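(* (a) For a group $G$ of order $2^7$, $\operatorname{K}(G) \neq \gamma_2(G)$ if and only if $G$ has nilpotency class $3$, $\gamma_2(G)$ is an abelian subgroup of order $2^4$ with $d(\gamma_2(G)) = 3$, and $|\operatorname{Z}(G)| = 2^3$. (b) Let $G$ be a group of order $3^7$. Then $\operatorname{K}(G) \neq \gamma_2(G)$ if and only if one of the following holds: (i) the nilpotency class of $G$ is $5$, $\gamma_2(G)$ is non-abelian with $d(\gamma_2(G)) = 3$, $|\gamma_5(G)| = 3$ and $|\operatorname{Z}_2(G)| = 3^3$; (ii) the nilpotency class of $G$ is $5$, $\gamma_2(G)$ is abelian of order $3^5$ and exponent $3^2$ with $d(\gamma_2(G)) = 3$, and $|\operatorname{Z}(G)| \leq 3^2$; (iii) the nilpotency class of $G$ is $4$, $\gamma_2(G)$ is abelian of order $3^4$ with $d(\gamma_2(G)) = 3$, and $|\operatorname{Z}(G)| = 3^3$; (iv) the nilpotency class of $G$ is $4$ and $\gamma_2(G)$ is abelian of exponent $3^2$ with $d(\gamma_2(G)) = 4$; (v) the nilpotency class of $G$ is $3$, $\gamma_2(G)$ is elementary abelian with $d(\gamma_2(G)) = 4$, and $|\operatorname{Z}(G)| = 3^3$. Moreover, every group of order $3^7$ has commutator length at most $2$.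
   Context: For a group $G$, $[x,y] = x^{-1}y^{-1}xy$, and $\operatorname{K}(G) = \{[a,b] \mid a,b \in G\}$; $\gamma_i(G)$ is the $i$-th term of the lower central series ($\gamma_2(G)$ the commutator subgroup), $\operatorname{Z}(G)$ the center and $\operatorname{Z}_i(G)$ the $i$-th term of the upper central series. $d(X)$ is the minimal number of generators of a finite group $X$ (''$k$-generated'' means $d = k$). The commutator length of $G$ is the smallest positive integer $m$ such that every element of $\gamma_2(G)$ is a product of at most $m$ commutators in $G$. *)

(* Defs.v *)
From mathcomp Require Import all_boot all_fingroup all_solvable.
Set Implicit Arguments. Unset Strict Implicit. Unset Printing Implicit Defensive.
Local Open Scope group_scope.

(* K(G) = { [a,b] | a, b in G }  (mathcomp: [~ a, b] = a^-1 * b^-1 * a * b) *)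
Definition commutators (gT : finGroupType) (G : {set gT}) : {set gT} :=
  [set [~ a, b] | a in G, b in G].

Definition mingen (gT : finGroupType) (X : {set gT}) (k : nat) : Prop :=
  (exists s : seq gT, size s = k /\ <<[set x in s]>> = X) /\
  (forall s : seq gT, <<[set x in s]>> = X -> (k <= size s)%N).

Definition commlen_le (gT : finGroupType) (G : {set gT}) (m : nat) : Prop :=
  forall x, x \in [~: G, G] ->
    exists s : seq gT, (size s <= m)%N /\ {subset s <= commutators G} /\
                       x = \prod_(y <- s) y.

(* Main.v *)
(* Write L_i for the terms of the lower central series.  If g is a commutator [x, y] modulo L_{k+1},
   then [n x, y] and [x, n y], for n in L_k, run through products of [x, y] with elements of the
   subgroups [L_k, x] and [L_k, y] of L_{k+1} / L_{k+2}; so g is a commutator modulo L_{k+2} as soon as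
   these subgroups, over all pairs (x, y) with [x, y] = g modulo L_{k+1}, cover the relevant coset.  For
   |G| = p^7 the orders of the factors L_i / L_{i+1} leave only a few types with |L_2| > p^3.  In each of
   them either the lifting always succeeds, or it fails exactly for one rigid configuration, which is
   recognised by the order of a term of the upper central series and which determines the Frattini
   subgroup of L_2.  The elements of L_2 that are not commutators then lie in Z(G) or in L_3, hence
   form less than half of L_2; so for g in L_2 the sets K(G) and g K(G) meet, and g is a product of
   two commutators, K(G) being closed under inversion. *)
Require Import Defs.
From mathcomp Require Import all_boot all_fingroup all_solvable zify.
Set Implicit Arguments. Unset Strict Implicit. Unset Printing Implicit Defensive.
Local Open Scope group_scope.

(** Nine tuples a2 a3 a4 a5 a6, with p^(a_i) the order of L_i, cover the cases |L_2| > p^3. Lifting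
    can fail for 41000, 42000, 43100, 54200 and 54210; the last is decided in G/L_5, where it
    becomes a two-generator version of 43100. Lifting succeeds when an entry can be chosen outside
    several proper subgroups: two can always be avoided, three only for odd p. The shortage at p = 2
    is paid for by a direct computation, and by the fact that a 2-group with abelianization of order
    4 has cyclic derived subgroup. The Frattini subgroup comes from power relations: x^p falls into
    a subgroup acting almost trivially, and expanding [x^p, y] ties p-th powers in L_2 to repeated
    commutators; the different binomial coefficients for p = 2 and p = 3 are the origin of d = 3
    against d = 4 in class 3. The converse directions need exclusions, since several types share a
    nilpotency class: 42100 has no center of order p^3, 43210 with p = 3 no nonabelian L_2 with
    Frattini subgroup of order 3 and |Z_2| = 27, and 54320 no abelian L_2. *)

Section Basics.
Variables (gT : finGroupType) (G : {group gT}).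
Implicit Types (A B C M T : {group gT}) (x y g n m : gT) (k i j : nat).

Lemma commutatorsP g :
  reflect (exists x y, [/\ x \in G, y \in G & [~ x, y] = g]) (g \in commutators G).
Proof.
apply: (iffP imset2P) => [[x y Gx Gy ->]|[x [y [Gx Gy <-]]]]; first by exists x, y.
by exists x y.
Qed.

Lemma mem_commutators x y : x \in G -> y \in G -> [~ x, y] \in commutators G.
Proof. by move=> Gx Gy; apply/commutatorsP; exists x, y. Qed.

Lemma commutatorsV g : g \in commutators G -> g^-1 \in commutators G.
Proof. by case/commutatorsP=> x [y [Gx Gy <-]]; rewrite invgR mem_commutators. Qed.

Lemma commutators_sub : commutators G \subset 'L_2(G).
Proof. by apply/subsetP=> g /commutatorsP[x [y [Gx Gy <-]]]; apply: mem_commg. Qed.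

Lemma commutators_full : {subset 'L_2(G) <= commutators G} -> commutators G = 'L_2(G).
Proof. by move=> h; apply/eqP; rewrite eqEsubset commutators_sub; apply/subsetP. Qed.

Lemma mem_lcn k n : n \in 'L_k(G) -> n \in G.
Proof. exact: subsetP (lcn_sub _ _) n. Qed.

Lemma mem_lcnR k n x : n \in 'L_k.+1(G) -> x \in G -> [~ n, x] \in 'L_k.+2(G).
Proof. by move=> Ln Gx; rewrite lcnSn mem_commg. Qed.

Lemma mem_lcnRl k n x : n \in 'L_k.+1(G) -> x \in G -> [~ x, n] \in 'L_k.+2(G).
Proof. by move=> Ln Gx; rewrite -groupV invgR mem_lcnR. Qed.

Lemma mem_lcn2 x y : x \in G -> y \in G -> [~ x, y] \in 'L_2(G).
Proof. exact: mem_commg. Qed.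

Lemma mem_lcn_leq k j n : k <= j -> n \in 'L_j(G) -> n \in 'L_k(G).
Proof. by move=> le; apply/subsetP/lcn_sub_leq. Qed.

Lemma mem_lcnJ k n x : x \in G -> (n ^ x \in 'L_k(G)) = (n \in 'L_k(G)).
Proof. by move=> Gx; rewrite memJ_norm // (subsetP (lcn_norm k G)). Qed.

(** The three subgroups lemma read in the quotient by M: it suffices that A, B and C normalize M,
    which lets every lower central term play the role of M. *)
Lemma three_subgroup_mod A B C M :
    A \subset 'N(M) -> B \subset 'N(M) -> C \subset 'N(M) ->
  [~: A, B, C] \subset M -> [~: B, C, A] \subset M -> [~: C, A, B] \subset M.
Proof.
move=> nA nB nC.
have nR (X Y : {group gT}) : X \subset 'N(M) -> Y \subset 'N(M) -> [~: X, Y] \subset 'N(M).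
  by move=> nX nY; rewrite comm_subG.
have nRR (X Y Z : {group gT}) : X \subset 'N(M) -> Y \subset 'N(M) -> Z \subset 'N(M) ->
    ([~: X, Y, Z] \subset M) = ([~: X / M, Y / M, Z / M] == 1).
  move=> nX nY nZ; have nXY := nR _ _ nX nY.
  by rewrite -quotientR // -[[~: [~: X, Y] / M, _]]quotientR // -subG1 quotient_sub1 ?nR.
rewrite !nRR // => /eqP hABC /eqP hBCA.
by rewrite (three_subgroup hABC hBCA).
Qed.

(** Induction on j with L_{j+2} = [L_{j+1}, G] and three subgroups: [G, L_{i+1}, L_{j+1}] and
    [L_{i+1}, L_{j+1}, G] already lie in the target. *)
Lemma lcn_comm i j : [~: 'L_i.+1(G), 'L_j.+1(G)] \subset 'L_(i + j).+2(G).
Proof.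
elim: j i => [|j IHj] i; first by rewrite addn0.
rewrite [in X in X \subset _]lcnSn commGC.
have nL k l : 'L_k(G) \subset 'N('L_l(G)) := subset_trans (lcn_sub k G) (lcn_norm l G).
apply: three_subgroup_mod => //; rewrite ?lcn_norm // ?nL //.
  have -> : [~: G, 'L_i.+1(G)] = 'L_i.+2(G) by rewrite commGC.
  by rewrite addnS -addSn; apply: IHj.
by rewrite addnS; apply: (commSg G (IHj i)).
Qed.

Lemma lcn_quo M k : M <| G -> 'L_k.+1(G / M) = 'L_k.+1(G) / M.
Proof. by case/andP=> _ nMG; rewrite -[G / M]/(coset M @* G) -morphim_lcn. Qed.

Lemma coset_comm M x y : G \subset 'N(M) -> x \in G -> y \in G ->
  coset M [~ x, y] = [~ coset M x, coset M y].
Proof. by move=> /subsetP nM Gx Gy; rewrite morphR ?nM. Qed.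

Lemma cosetMG M x y : G \subset 'N(M) -> x \in G -> y \in G ->
  coset M (x * y) = coset M x * coset M y.
Proof. by move=> /subsetP nM Gx Gy; rewrite morphM ?nM. Qed.

Lemma coset1P M x : G \subset 'N(M) -> x \in G -> reflect (coset M x = 1) (x \in M).
Proof.
move=> /subsetP nM Gx; apply: (iffP idP) => [/coset_id //|].
by apply: coset_idr; apply: nM.
Qed.

Lemma coset_eqP M x y : G \subset 'N(M) -> x \in G -> y \in G ->
  reflect (coset M x = coset M y) (x^-1 * y \in M).
Proof.
move=> nM Gx Gy; apply: (iffP (coset1P nM _)); rewrite ?groupM ?groupV //.
  rewrite cosetMG ?groupV // morphV ?(subsetP nM) //.
  by move/(canRL (mulKVg _)); rewrite mulg1 => ->.
by move=> e; rewrite cosetMG ?groupV // morphV ?(subsetP nM) // -e mulVg.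
Qed.

Lemma commutators_quo M g : M <| G -> g \in G ->
  reflect (exists x y, [/\ x \in G, y \in G & g^-1 * [~ x, y] \in M])
          (coset M g \in commutators (G / M)).
Proof.
case/andP=> sMG nMG Gg; apply: (iffP idP).
  case/imset2P=> X Y /morphimP[x _ Gx ->] /morphimP[y _ Gy ->] e.
  by exists x, y; split=> //; apply/(coset_eqP nMG); rewrite ?groupR // e coset_comm.
case=> x [y [Gx Gy /(coset_eqP nMG) e]]; apply/imset2P; exists (coset M x) (coset M y).
- by rewrite mem_quotient.
- by rewrite mem_quotient.
by rewrite e ?groupR // coset_comm.
Qed.

Lemma lcn_nilp k : nilpotent G -> 'L_k.+1(G) != 1 -> 'L_k.+2(G) \proper 'L_k.+1(G).
Proof.
move=> nG nt; rewrite lcnSn (nil_comm_properl nG) ?lcn_sub // subsetI subxx /=.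
exact: lcn_norm.
Qed.

(** Taking commutators with G turns the hypothesis into L_{k+i+1} <= M L_{k+i+2} for every i;
    chaining these inclusions reaches the trivial term of the series. *)
Lemma lcn_sub_nil k M : nilpotent G -> G \subset 'N(M) ->
  'L_k.+1(G) \subset M * 'L_k.+2(G) -> 'L_k.+1(G) \subset M.
Proof.
move=> nilG nM sL.
have step i : 'L_(k + i).+1(G) \subset M * 'L_(k + i).+2(G).
  elim: i => [|i IHi]; first by rewrite addn0.
  rewrite addnS; apply: subset_trans (commSg G IHi) _; rewrite commMG; last first.
    by apply: subset_trans (lcn_sub _ _) _; rewrite normsRr // (subset_trans (subxx G)).
  by apply: mulgSS; rewrite // commg_subl.
have h i : 'L_k.+1(G) \subset M * 'L_(k + i).+1(G).
  elim: i => [|i IHi]; first by rewrite addn0 mulG_subr.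
  apply: subset_trans IHi _; rewrite addnS -{2}(mulGid M) -mulgA mulgS //.
have [c Lc] := lcnP G nilG.
apply: subset_trans (h c) _; rewrite -{2}(mulg1 M) mulgS // -Lc.
by rewrite lcn_sub_leq // ltnS leq_addl.
Qed.

End Basics.

(** * Sets of commutators with a fixed right entry *)

Section CommSet.
Variables (gT : finGroupType).
Implicit Types (A B C M T G : {group gT}) (x y g n m : gT) (k i j : nat).

Definition cset (A : {set gT}) x := [set [~ n, x] | n in A].

Lemma csetP A x g : reflect (exists2 n, n \in A & [~ n, x] = g) (g \in cset A x).
Proof. by apply: (iffP imsetP) => [[n An ->]|[n An <-]]; exists n. Qed.

(** The identity [n m, x] = [n, x]^m [m, x] makes n -> [n, x] a homomorphism on A under this
    hypothesis. *)
Lemma cset_group_set A x :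
  {in A &, forall n m, [~ n, x] ^ m = [~ n, x]} -> group_set (cset A x).
Proof.
move=> cA; apply/group_setP; split; first by apply/csetP; exists 1; rewrite ?group1 ?comm1g.
move=> _ _ /csetP[n An <-] /csetP[m Am <-]; apply/csetP; exists (n * m); rewrite ?groupM //.
by rewrite commMgJ cA.
Qed.

(** Since [n, x] = (x^-1)^n x, the set is a translate of a class of x^-1, so its size becomes a
    centralizer index. *)
Lemma cset_class A x : cset A x = (x^-1 ^: A) :* x.
Proof.
rewrite /cset /class; apply/setP=> g; apply/csetP/rcosetP => [[n An <-]|[_ /imsetP[n An ->] ->]].
  by exists (x^-1 ^ n); rewrite ?imset_f // commgEr.
by exists n; rewrite // commgEr.
Qed.

Lemma card_cset A x : #|cset A x| = #|A : 'C_A[x]|.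
Proof. by rewrite cset_class card_rcoset -index_cent1 -cent_cycle cycleV cent_cycle. Qed.

End CommSet.

Section Avoid.
Variables (gT : finGroupType) (G : {group gT}).
Implicit Types (A B C : {group gT}).

Lemma avoid1 A : ~~ (G \subset A) -> exists2 w, w \in G & w \notin A.
Proof. by case/subsetPn=> w; exists w. Qed.

Lemma avoid2 A B : ~~ (G \subset A) -> ~~ (G \subset B) ->
  exists w, [/\ w \in G, w \notin A & w \notin B].
Proof.
case/subsetPn=> a Ga nAa /subsetPn[b Gb nBb].
have [Ba|nBa] := boolP (a \in B); last by exists a.
have [Ab|nAb] := boolP (b \in A); last by exists b.
by exists (a * b); rewrite groupM // groupMr // groupMl.
Qed.

(** With w outside A and B but in C, and v outside C, the elements v, v w, v w^2 all avoid C, and A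
    and B contain at most one of them each. Odd order enters through w^2, which generates the same
    cyclic group as w. *)
Lemma avoid3 (p : nat) A B C : p.-group G -> odd p ->
  ~~ (G \subset A) -> ~~ (G \subset B) -> ~~ (G \subset C) ->
  exists w, [/\ w \in G, w \notin A, w \notin B & w \notin C].
Proof.
move=> pG oddp nGA nGB nGC.
have [w [Gw nAw nBw]] := avoid2 nGA nGB.
have [Cw|nCw] := boolP (w \in C); last by exists w.
have [v Gv nCv] := avoid1 nGC.
have sq (D : {group gT}) : w \notin D -> w ^+ 2 \notin D.
  apply: contraNN => D2; suff -> : w = (w ^+ 2) ^+ (#[w].+1./2) by rewrite groupX.
  have ow : odd #[w] by apply: dvdn_odd (order_dvdG Gw) (odd_pgroup_odd oddp pG).
  rewrite -expgM mul2n -[X in X.*2]/(uphalf #[w]) uphalfK ow add1n.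
  by rewrite expgS expg_order mulg1.
have one (D : {group gT}) i j : w \notin D -> i < j -> j < 3 -> v * w ^+ i \in D -> v * w ^+ j \notin D.
  move=> nD lij lj Di; apply/negP=> Dj.
  have : (v * w ^+ i)^-1 * (v * w ^+ j) \in D by rewrite groupM ?groupV.
  rewrite invMg mulgA mulgKV -(subnKC (ltnW lij)) expgD mulKg.
  case: i j lij lj {Di Dj} => [|[|i]] [|[|[|j]]] //= _ _; rewrite ?subn0 ?expg1; apply/negP=> //.
  exact: sq.
have Gz i : v * w ^+ i \in G by rewrite groupM ?groupX.
have Cz i : v * w ^+ i \notin C by rewrite groupMr ?groupX.
have [A0|nA0] := boolP (v * w ^+ 0 \in A).
  have nA1 : v * w ^+ 1 \notin A by apply: one A0.
  have nA2 : v * w ^+ 2 \notin A by apply: one A0.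
  have [B1|nB1] := boolP (v * w ^+ 1 \in B); last by exists (v * w ^+ 1).
  by exists (v * w ^+ 2); rewrite (one B 1%N 2%N).
have [B0|nB0] := boolP (v * w ^+ 0 \in B); last by exists (v * w ^+ 0).
have nB1 : v * w ^+ 1 \notin B by apply: one B0.
have nB2 : v * w ^+ 2 \notin B by apply: one B0.
have [A1|nA1] := boolP (v * w ^+ 1 \in A); last by exists (v * w ^+ 1).
by exists (v * w ^+ 2); rewrite (one A 1%N 2%N).
Qed.

End Avoid.

(** * Derived subgroups of order at most p^2 *)

Section Breadth.
Variables (gT : finGroupType) (p : nat) (G : {group gT}).
Hypotheses (p_pr : prime p) (pG : p.-group G).

Lemma card_cset_p (A : {group gT}) x : A \subset G ->
  [\/ #|cset A x| = 1%N, #|cset A x| = p | p ^ 2 <= #|cset A x|].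
Proof.
move=> sAG; rewrite card_cset.
have /p_natP[[|[|k]] ->] : p.-nat #|A : 'C_A[x]| := pnat_dvd (dvdn_indexg _ _) (pgroupS sAG pG).
- by constructor 1.
- by constructor 2.
by constructor 3; rewrite leq_pexp2l // prime_gt0.
Qed.

Lemma prime_index_normal (M : {group gT}) : M \subset G -> #|G : M| = p ->
  M <| G /\ 'L_2(G) \subset M.
Proof.
move=> sMG iM; have nM : M <| G.
  by apply: p_maximal_normal pG _; apply: p_index_maximal; rewrite ?iM.
split=> //; apply: der1_min; first exact: normal_norm.
by apply/cyclic_abelian/prime_cyclic; rewrite card_quotient ?iM // normal_norm.
Qed.

(** If no set [G, x] has p^2 elements, every centralizer has index 1 or p, hence contains L_2, and
    all sets [G, x] are subgroups of order 1 or p. For noncentral x and y, an element w outside both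
    centralizers gives [G, x] = [G, w] = [G, y], so one of these subgroups contains all
    commutators. *)
Lemma cset_full_p2 : #|'L_2(G)| <= p ^ 2 -> exists2 x, x \in G & 'L_2(G) = cset G x.
Proof.
move=> oL2.
have sub x : x \in G -> cset G x \subset 'L_2(G).
  by move=> Gx; apply/subsetP=> _ /csetP[n Gn <-]; apply: mem_lcn2.
have [x /andP[Gx ge]|all] := pickP [pred x | (x \in G) && (p ^ 2 <= #|cset G x|)].
  by exists x => //; apply/eqP; rewrite eq_sym eqEcard sub //= (leq_trans oL2).
have small x : x \in G -> #|cset G x| = 1%N \/ #|cset G x| = p.
  move=> Gx; have := all x; rewrite /= Gx /= => /negbT h.
  by have [//||] := card_cset_p x (subxx G); [left|right|rewrite (negPf h)].
have cL2 x : x \in G -> 'L_2(G) \subset 'C_G[x].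
  move=> Gx; case: (small x Gx); rewrite card_cset => i.
    by rewrite (index1g (subsetIl _ _) i) lcn_sub.
  by have [] := prime_index_normal (subsetIl _ _) i.
have gr x : x \in G -> group_set (cset G x).
  move=> Gx; apply: cset_group_set => n m Gn Gm.
  have /setIP[_ /cent1P cm] := subsetP (cL2 m Gm) _ (mem_lcn2 Gn Gx).
  by rewrite conjgE cm mulKg.
have [abG|nabG] := boolP (abelian G).
  exists 1 => //; apply/eqP; rewrite eqEsubset sub // andbT.
  have -> : 'L_2(G) = 1 by apply/commG1P.
  by rewrite sub1set; apply/csetP; exists 1; rewrite ?comm1g.
have [x Gx ncx] : exists2 x, x \in G & ~~ (G \subset 'C[x]).
  by move: nabG; rewrite /abelian => /subsetPn[x Gx]; exists x; rewrite // sub_cent1.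
exists x => //; apply/eqP; rewrite eqEsubset sub // andbT.
have nt y w : y \in G -> w \in G -> w \notin 'C[y] ->
    cset G y = <[ [~ w, y] ]> /\ #[ [~ w, y] ] = p.
  move=> Gy Gw nc.
  have nt1 : [~ w, y] != 1 by apply: contra nc => /commgP/cent1P.
  have wy : [~ w, y] \in Group (gr y Gy) by apply/csetP; exists w.
  have oy : #|cset G y| = p.
    case: (small y Gy) => // /eq_leq/card_le1_eqP o1; case/eqP: nt1.
    by apply: o1 => //; apply/csetP; exists 1; rewrite ?comm1g.
  have op : #[ [~ w, y] ] = p.
    have o1 : #[ [~ w, y] ] != 1%N by rewrite order_eq1.
    by have := order_dvdG wy; rewrite /= oy => /(prime_nt_dvdP p_pr o1).
  split=> //; apply/eqP; rewrite eq_sym eqEcard oy -[#|<[_]>|]/#[_] op leqnn andbT.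
  by rewrite -[cset G y]/(gval (Group (gr y Gy))) cycle_subG.
have main y : y \in G -> cset G y \subset cset G x.
  move=> Gy; have [cy|ncy] := boolP (G \subset 'C[y]).
    apply/subsetP=> _ /csetP[n Gn <-].
    have /cent1P/commgP/eqP -> := subsetP cy n Gn.
    by apply/csetP; exists 1; rewrite ?comm1g.
  have [w [Gw nwx nwy]] := avoid2 ncx ncy.
  have [-> _] := nt y w Gy Gw nwy; have [-> _] := nt x w Gx Gw nwx.
  have nx : x \notin 'C[w] by rewrite cent1C.
  have ny : y \notin 'C[w] by rewrite cent1C.
  have [e1 _] := nt w x Gw Gx nx; have [e2 _] := nt w y Gw Gy ny.
  by rewrite -[[~ w, y]]invgK invgR cycleV -e2 e1 -cycleV invgR.
have -> : 'L_2(G) = <<commg_set G G>> by [].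
rewrite -[cset G x]/(gval (Group (gr x Gx))) gen_subG /=.
apply/subsetP=> _ /imset2P[a b Ga Gb ->].
by apply: (subsetP (main b Gb)); apply/csetP; exists a.
Qed.

End Breadth.

(** The centralizer of A modulo M. Intersecting with ['N(M)] makes it a subgroup for an arbitrary
    set A, so that inclusions can be tested on generators. *)
Definition cmod (gT : finGroupType) (A M : {set gT}) : {set gT} :=
  [set x in 'N(M) | [forall n in A, [~ n, x] \in M]].

Lemma cmodP (gT : finGroupType) (A M : {set gT}) x :
  reflect (x \in 'N(M) /\ {in A, forall n, [~ n, x] \in M}) (x \in cmod A M).
Proof. by rewrite /cmod in_set; apply: (iffP andP) => [[-> /forall_inP]|[-> /forall_inP]]. Qed.

Lemma cmod_group_set (gT : finGroupType) (A : {set gT}) (M : {group gT}) : group_set (cmod A M).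
Proof.
apply/group_setP; split; first by apply/cmodP; split=> [|n _]; rewrite ?group1 ?commg1.
move=> x y /cmodP[Nx cx] /cmodP[Ny cy]; apply/cmodP; split=> [|n An]; first by rewrite groupM.
by rewrite commgMJ groupM ?cy // memJ_norm ?cx.
Qed.

Canonical cmod_group (gT : finGroupType) (A : {set gT}) (M : {group gT}) := Group (cmod_group_set A M).

(** * Covering cosets by commutators *)

Section Cover.
Variables (gT : finGroupType) (G : {group gT}).
Implicit Types (A B C D M T Q : {group gT}) (x y g n m t : gT) (k i j p : nat).

Lemma cmod_nP (A : {set gT}) M x : G \subset 'N(M) -> x \in G -> x \notin cmod A M ->
  exists2 n, n \in A & [~ n, x] \notin M.
Proof.
move=> nM Gx; rewrite /cmod in_set (subsetP nM) //= negb_forall => /existsP[n].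
by rewrite negb_imply => /andP[]; exists n.
Qed.

Lemma cmod_in (A : {set gT}) M x : G \subset 'N(M) -> x \in G -> {in A, forall n, [~ n, x] \in M} -> x \in cmod A M.
Proof. by move=> nM Gx h; apply/cmodP; rewrite (subsetP nM). Qed.

Lemma coset_RMl M x y z : G \subset 'N(M) -> x \in G -> y \in G -> z \in G -> [~ x, z, y] \in M ->
  coset M [~ x * y, z] = coset M [~ x, z] * coset M [~ y, z].
Proof.
move=> nM Gx Gy Gz h; rewrite commMgR (cosetMG nM (groupM (groupR Gx Gz) _) (groupR Gy Gz)) ?groupR //.
by rewrite (cosetMG nM (groupR Gx Gz) (groupR (groupR Gx Gz) Gy)) (coset_id h) mulg1.
Qed.

Lemma coset_RMr M x y z : G \subset 'N(M) -> x \in G -> y \in G -> z \in G -> [~ x, y, z] \in M ->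
  coset M [~ x, y * z] = coset M [~ x, z] * coset M [~ x, y].
Proof.
move=> nM Gx Gy Gz h; rewrite commgMR (cosetMG nM (groupM (groupR Gx Gz) _)) ?groupR //.
by rewrite (coset_id h) mulg1 (cosetMG nM) ?groupR.
Qed.

Lemma cosetXG M x i : G \subset 'N(M) -> x \in G -> coset M (x ^+ i) = coset M x ^+ i.
Proof. by move=> nM Gx; rewrite morphX ?(subsetP nM). Qed.

Lemma coset_RXl M x z i : G \subset 'N(M) -> x \in G -> z \in G -> [~ x, z, x] \in M ->
  coset M [~ x ^+ i, z] = coset M [~ x, z] ^+ i.
Proof.
move=> nM Gx Gz h; rewrite !(coset_comm nM) ?groupX // (cosetXG i nM) //; apply: commXg.
by apply: commute_sym; apply/commgP; rewrite -!(coset_comm nM) ?groupR // coset_id.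
Qed.

Lemma coset_RXr M x z i : G \subset 'N(M) -> x \in G -> z \in G -> [~ x, z, z] \in M ->
  coset M [~ x, z ^+ i] = coset M [~ x, z] ^+ i.
Proof.
move=> nM Gx Gz h; rewrite !(coset_comm nM) ?groupX // (cosetXG i nM) //; apply: commgX.
by apply: commute_sym; apply/commgP; rewrite -!(coset_comm nM) ?groupR // coset_id.
Qed.

Lemma prime_index_cover p M T t0 t : prime p -> M <| T -> #|T : M| = p ->
  t0 \in T -> t0 \notin M -> t \in T -> exists i, (t0 ^+ i)^-1 * t \in M.
Proof.
move=> p_pr /andP[sMT nMT] iM Tt0 nMt0 Tt.
have Nt0 := subsetP nMT _ Tt0; have Nt := subsetP nMT _ Tt.
have oq : #|T / M| = p by rewrite card_quotient.
have : coset M t \in <[coset M t0]>.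
  suff -> : <[coset M t0]> = T / M by rewrite mem_quotient.
  apply/eqP; rewrite eqEcard cycle_subG mem_quotient //= oq -[#|<[_]>|]/#[_].
  have o1 : #[coset M t0] != 1%N by rewrite order_eq1; apply: contraNneq nMt0 => /(coset_idr Nt0).
  have d1 : #[coset M t0] %| p by rewrite -oq order_dvdG ?mem_quotient.
  by rewrite (prime_nt_dvdP p_pr o1 d1).
case/cycleP=> i e; exists i; apply/(coset_eqP nMT); rewrite ?groupX //.
by rewrite morphX.
Qed.

Lemma prime_card_cover p T t0 t : prime p -> #|T| = p -> t0 \in T -> t0 != 1 -> t \in T ->
  exists i, t = t0 ^+ i.
Proof.
move=> p_pr oT Tt0 nt Tt; have n1 : 1%G <| T := normal1 T.
have [||i] := prime_index_cover p_pr n1 _ Tt0 _ Tt; rewrite ?indexg1 ?inE //.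
by rewrite -eq_mulVg1 => /eqP; exists i.
Qed.

(** Modulo M the element [n^i, x] is the i-th power of [n, x], because [n, x, n] lies in M, and T/M
    has prime order: one value outside M yields every class. *)
Lemma hit p A M T x : prime p -> G \subset 'N(M) -> M <| T -> #|T : M| = p ->
    A \subset G -> x \in G -> {in A, forall n, [~ n, x] \in T} ->
    {in A, forall n, [~ n, x, n] \in M} -> (exists2 n, n \in A & [~ n, x] \notin M) ->
  {in T, forall t, exists2 n, n \in A & [~ n, x]^-1 * t \in M}.
Proof.
move=> p_pr nM nMT iM sAG Gx hT hM [n An nMn] t Tt.
have Gn := subsetP sAG n An; have Gnx : [~ n, x] \in G by rewrite groupR.
have [i hi] := prime_index_cover p_pr nMT iM (hT n An) nMn Tt.
exists (n ^+ i); rewrite ?groupX //.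
have Tr : [~ n ^+ i, x] \in T by rewrite hT ?groupX.
have nMT' := normal_norm nMT; apply/(coset_eqP nMT') => //.
move/(coset_eqP nMT'): hi => <- //; rewrite ?groupX ?hT //.
by rewrite (coset_RXl i nM) ?hM // (cosetXG i nM).
Qed.

(** The commutator is bilinear modulo Q. If [x, y] and all [x, t], [s, y], [s, t] with s, t in D
    were in Q, the generators would commute modulo Q and Q would contain L_2; the first of these
    outside Q shows which factors from D to insert. *)
Lemma pair_outside D Q x y : G \subset 'N(Q) -> 'L_3(G) \subset Q -> ~~ ('L_2(G) \subset Q) ->
    x \in G -> y \in G -> D \subset G -> G \subset <<[set x; y] :|: D>> ->
  exists s t, [/\ s \in D, t \in D & [~ x * s, y * t] \notin Q].
Proof.
move=> nQ L3Q nL2Q Gx Gy sDG defG.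
have [xyQ|] := boolP ([~ x, y] \in Q); last first.
  by exists 1, 1; rewrite !mulg1.
have G3 a b c : a \in G -> b \in G -> c \in G -> [~ a, b, c] \in Q.
  by move=> Ga Gb Gc; rewrite (subsetP L3Q) // (mem_lcnR (k := 1)) // mem_lcn2.
have Rl a b c : a \in G -> b \in G -> c \in G ->
    coset Q [~ a * b, c] = coset Q [~ a, c] * coset Q [~ b, c].
  by move=> Ga Gb Gc; apply: coset_RMl; rewrite ?G3.
have Rr a b c : a \in G -> b \in G -> c \in G ->
    coset Q [~ a, b * c] = coset Q [~ a, c] * coset Q [~ a, b].
  by move=> Ga Gb Gc; apply: coset_RMr; rewrite ?G3.
have inQ a b : a \in G -> b \in G -> ([~ a, b] \in Q) = (coset Q [~ a, b] == 1).
  by move=> Ga Gb; apply/(coset1P nQ _)/eqP; rewrite ?groupR.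
have [t /andP[Dt nt]|xD] := pickP [pred t | (t \in D) && ([~ x, t] \notin Q)].
  have Gt := subsetP sDG t Dt; exists 1, t; split; rewrite ?group1 ?mulg1 //.
  by rewrite inQ ?groupM // Rr // (eqP (_ : coset Q [~ x, y] == 1)) -?inQ // mulg1 -inQ.
have [s /andP[Ds ns]|yD] := pickP [pred s | (s \in D) && ([~ s, y] \notin Q)].
  have Gs := subsetP sDG s Ds; exists s, 1; split; rewrite ?group1 ?mulg1 //.
  by rewrite inQ ?groupM // Rl // (eqP (_ : coset Q [~ x, y] == 1)) -?inQ // mul1g -inQ.
have {}xD t : t \in D -> [~ x, t] \in Q.
  by move=> Dt; have := xD t; rewrite /= Dt /= => /negbFE.
have {}yD s : s \in D -> [~ s, y] \in Q.
  by move=> Ds; have := yD s; rewrite /= Ds /= => /negbFE.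
have [[s t] /and3P[/= Ds Dt nst]|DD] :=
    pickP [pred u : gT * gT | [&& u.1 \in D, u.2 \in D & [~ u.1, u.2] \notin Q]].
  have Gs := subsetP sDG s Ds; have Gt := subsetP sDG t Dt; exists s, t; split=> //.
  have q1 a b : a \in G -> b \in G -> [~ a, b] \in Q -> coset Q [~ a, b] = 1.
    by move=> Ga Gb; rewrite inQ // => /eqP.
  rewrite inQ ?groupM // Rl ?groupM // !Rr // (q1 x y) // (q1 x t) ?xD // (q1 s y) ?yD //.
  by rewrite !mulg1 mul1g -inQ.
have {}DD s t : s \in D -> t \in D -> [~ s, t] \in Q.
  by move=> Ds Dt; have := DD (s, t); rewrite /= Ds Dt /= => /negbFE.
pose S := [set x; y] :|: D.
have SS : {in S &, forall a b, [~ a, b] \in Q}.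
  have h a b : [~ a, b] \in Q -> [~ b, a] \in Q by rewrite -invgR groupV.
  move=> a b /setUP[/set2P[]->|Da] /setUP[/set2P[]->|Db]; rewrite ?commgg ?group1 //.
  - exact: xD.
  - exact: h.
  - by apply: h; apply: yD.
  - by apply: h; apply: xD.
  - exact: yD.
  - exact: DD.
have sSG : S \subset G by rewrite subUset sDG andbT; apply/subsetP=> z /set2P[]->.
have Gc : G \subset cmod S Q.
  apply: subset_trans defG _; rewrite gen_subG; apply/subsetP=> a Sa; apply: cmod_in => //.
    exact: subsetP sSG a Sa.
  by move=> n Sn; apply: SS.
have Gc2 : G \subset cmod G Q.
  apply: subset_trans (defG) _; rewrite gen_subG; apply/subsetP=> a Sa; apply: cmod_in => //.
    exact: subsetP sSG a Sa.
  by move=> n Gn; rewrite -groupV invgR; have /cmodP[_] := subsetP Gc n Gn; apply.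
case/negP: nL2Q; have -> : 'L_2(G) = <<commg_set G G>> by [].
rewrite gen_subG; apply/subsetP=> _ /imset2P[a b Ga Gb ->].
by have /cmodP[_] := subsetP Gc2 b Gb; apply.
Qed.

(** With a, b in L_{k+2} and [a, x][b, y] = t, the pair (x b, y a^-1) has commutator [x, y] t, since
    all cross terms lie in L_{k+4} = 1. *)
Lemma lift_last k x y : 'L_k.+4(G) = 1 -> x \in G -> y \in G ->
    'L_k.+3(G) \subset cset 'L_k.+2(G) x * cset 'L_k.+2(G) y ->
  {in 'L_k.+3(G), forall t, [~ x, y] * t \in commutators G}.
Proof.
move=> L1 Gx Gy cov t /(subsetP cov)/mulsgP[_ _ /csetP[a Ra <-] /csetP[b Rb <-] ->].
have Ga := mem_lcn Ra; have Gb := mem_lcn Rb.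
have c1 i j u v : (k.+4 <= (i + j).+2)%N -> u \in 'L_i.+1(G) -> v \in 'L_j.+1(G) -> [~ u, v] = 1.
  move=> le Lu Lv; apply/set1P; rewrite -[[set 1]]/(1%G : {set gT}) /= -L1.
  exact: mem_lcn_leq le (subsetP (lcn_comm G i j) _ (mem_commg Lu Lv)).
have cj i j u v : (k.+4 <= (i + j).+2)%N -> u \in 'L_i.+1(G) -> v \in 'L_j.+1(G) -> u ^ v = u.
  by move=> le Lu Lv; apply/conjg_fixP; rewrite (c1 i j).
have Lxy := mem_lcn2 Gx Gy.
have Ta : [~ a, x] \in 'L_k.+3(G) by rewrite mem_lcnR.
have Tb : [~ b, y] \in 'L_k.+3(G) by rewrite mem_lcnR.
apply/commutatorsP; exists (x * b), (y * a^-1); rewrite !groupM ?groupV //; split=> //.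
have Lz : [~ x, y * a^-1] \in 'L_2(G) by rewrite mem_lcn2 ?groupM ?groupV.
have GV : a^-1 \in G by rewrite groupV.
rewrite commMgJ (cj 1%N k.+1 _ b) ?add1n //.
rewrite (commgMJ x) (commgMJ b) (cj 1%N k.+1 [~ x, y]) ?groupV ?add1n //.
rewrite (c1 k.+1 k.+1 b) ?groupV // ?addSn ?addnS ?ltnS ?leq_addr //.
rewrite mul1g (cj k.+2 k.+1 [~ b, y]) ?groupV // ?addSn ?addnS ?ltnS ?leqW ?leq_addr //.
have cax : [~ a, x, a] = 1 by rewrite (c1 k.+2 k.+1) // ?addSn ?addnS ?ltnS ?leqW ?leq_addr.
have -> : [~ x, a^-1] = [~ a, x].
  have cax' : commute a [~ a, x] by apply: commute_sym; apply/commgP; rewrite cax.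
  by rewrite -[LHS]invgK invgR commVg // invgK.
have cc : commute [~ a, x] [~ x, y] by apply/commgP/eqP/(c1 k.+2 1%N); rewrite // addn1.
by rewrite [RHS]mulgA -cc.
Qed.

End Cover.

Lemma prime_index_gen (gT : finGroupType) p (M T A : {group gT}) t :
  prime p -> M <| T -> #|T : M| = p -> t \in T -> t \notin M ->
  M \subset A -> t \in A -> T \subset A.
Proof.
move=> p_pr nMT iM Tt nMt sMA At; apply/subsetP=> u Tu.
have [i hi] := prime_index_cover p_pr nMT iM Tt nMt Tu.
by rewrite -(mulKVg (t ^+ i) u) groupM ?groupX // (subsetP sMA).
Qed.

(** * Centralizers modulo lower central terms *)

Section Lcn.
Variables (gT : finGroupType) (G : {group gT}).
Implicit Types (A B C D M T Q : {group gT}) (x y z g n m t c : gT) (k i j p : nat).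

Lemma lcn_eq1 i j k u v : 'L_k.+2(G) = 1 -> (k <= i + j)%N ->
  u \in 'L_i.+1(G) -> v \in 'L_j.+1(G) -> [~ u, v] = 1.
Proof.
move=> L1 le Lu Lv; apply/set1P; rewrite -[[set 1]]/(1%G : {set gT}) /= -L1.
by apply: mem_lcn_leq (subsetP (lcn_comm G i j) _ (mem_commg Lu Lv)); rewrite !ltnS.
Qed.

(** In class 3 all conjugations and inner inverses in the Hall-Witt identity disappear. *)
Lemma jacobi3 x y z : 'L_4(G) = 1 -> x \in G -> y \in G -> z \in G ->
  [~ x, y, z] * [~ z, x, y] * [~ y, z, x] = 1.
Proof.
move=> L4 Gx Gy Gz; rewrite -[RHS](Hall_Witt_identity y x z).
have h a b c : a \in G -> b \in G -> c \in G -> [~ a, b^-1, c] ^ b = [~ b, a, c].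
  move=> Ga Gb Gc; have L2 : [~ b, a] \in 'L_2(G) := mem_lcn2 Gb Ga.
  have -> : [~ a, b^-1] = [~ b, a] * [~ b, a, b^-1].
    by rewrite -conjg_mulR [LHS]commgEr [[~ b, a]]commgEl !invgK [RHS]conjgE invgK -(mulgA b^-1) mulKVg.
  have L3 : [~ b, a, b^-1] \in 'L_3(G) by rewrite (mem_lcnR (k := 1)) ?groupV.
  have L3' : [~ b, a, c] \in 'L_3(G) by rewrite (mem_lcnR (k := 1)).
  have e1 : [~ b, a, b^-1, c] = 1 by apply: (lcn_eq1 L4 (i := 2) (j := 0)).
  have e2 : [~ b, a, c, [~ b, a, b^-1]] = 1 by apply: (lcn_eq1 L4 (i := 2) (j := 2)).
  have e3 : [~ b, a, c, b] = 1 by apply: (lcn_eq1 L4 (i := 2) (j := 0)).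
  by rewrite commMgR e1 e2 !mulg1; apply/conjg_fixP/eqP.
by rewrite !h.
Qed.

(** Three subgroups: an element pairing G into L_3 satisfies [G, x, G] <= L_4, hence [G, G, x] <=
    L_4. *)
Lemma lcn_F_C2 : cmod G 'L_3(G) :&: G \subset cmod 'L_2(G) 'L_4(G).
Proof.
pose F := (cmod_group G 'L_3(G) :&: G)%G; rewrite -[_ :&: _]/(gval F); have sFG : F \subset G := subsetIr _ _.
have nL k : G \subset 'N('L_k(G)) := lcn_norm k G.
have F3 : [~: G, F] \subset 'L_3(G).
  rewrite gen_subG; apply/subsetP=> _ /imset2P[a b Ga /setIP[/cmodP[_ Fb] Gb] ->]; exact: Fb.
have : [~: G, G, F] \subset 'L_4(G).
  apply: three_subgroup_mod; rewrite ?(subset_trans sFG) ?nL //.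
    by apply: (commSg G F3).
  by rewrite [[~: F, G]]commGC; apply: (commSg G F3).
move=> h; apply/subsetP=> x Fx; apply: (cmod_in (nL 4)); first exact: subsetP sFG x Fx.
by move=> n Ln; apply: subsetP h _ _; apply: mem_commg.
Qed.

(** L_2/L_3 is cyclic, generated by some c with [c, c] = 1, so every commutator of L_2 comes from
    [L_2, L_3], one term deeper than the general bound L_4. *)
Lemma lcn_der2 p : prime p -> #|'L_2(G) : 'L_3(G)| = p -> [~: 'L_2(G), 'L_2(G)] \subset 'L_5(G).
Proof.
move=> p_pr i3; have n3 := lcn_normalS 2 G.
have [c Lc nc] : exists2 c, c \in 'L_2(G) & c \notin 'L_3(G).
  by apply/subsetPn; rewrite -indexg_gt1 i3 prime_gt1.
have nL5 : G \subset 'N('L_5(G)) := lcn_norm 5 G.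
have Gc := mem_lcn Lc.
have L5 u v : u \in 'L_2(G) -> v \in 'L_3(G) -> [~ u, v] \in 'L_5(G).
  by move=> Lu Lv; apply: (subsetP (lcn_comm G 1 2)); apply: mem_commg.
have gen (A : {group gT}) : 'L_3(G) \subset A -> c \in A -> 'L_2(G) \subset A.
  exact: (prime_index_gen p_pr n3 i3 Lc nc).
have h1 : 'L_2(G) \subset cmod [set c] 'L_5(G).
  apply: gen; last by apply: (cmod_in nL5) => // n /set1P->; rewrite commgg.
  by apply/subsetP=> v Lv; apply: (cmod_in nL5); [exact: mem_lcn Lv|move=> n /set1P->; apply: L5].
have h2 : 'L_2(G) \subset cmod 'L_2(G) 'L_5(G).
  apply: gen.
    by apply/subsetP=> v Lv; apply: (cmod_in nL5); [exact: mem_lcn Lv|move=> n Ln; apply: L5].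
  apply: (cmod_in nL5) => // n Ln; rewrite -groupV invgR.
  by have /cmodP[_] := subsetP h1 n Ln; apply; rewrite inE.
rewrite gen_subG; apply/subsetP=> _ /imset2P[a b La Lb ->].
by have /cmodP[_] := subsetP h2 b Lb; apply.
Qed.

(** Three subgroups applied to [L_2, G, x]: one of the other two terms lies in [L_2, L_2], which
    [lcn_der2] puts into L_5. *)
Lemma lcn_C2_C3 p : prime p -> #|'L_2(G) : 'L_3(G)| = p ->
  cmod 'L_2(G) 'L_4(G) :&: G \subset cmod 'L_3(G) 'L_5(G).
Proof.
move=> p_pr i3; pose C := (cmod_group 'L_2(G) 'L_4(G) :&: G)%G; rewrite -[_ :&: _]/(gval C); have sCG : C \subset G := subsetIr _ _.
have nL k : G \subset 'N('L_k(G)) := lcn_norm k G.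
have sL k : 'L_k(G) \subset G := lcn_sub k G.
have C4 : [~: 'L_2(G), C] \subset 'L_4(G).
  rewrite gen_subG; apply/subsetP=> _ /imset2P[a b La /setIP[/cmodP[_ Cb] Gb] ->]; exact: Cb.
have : [~: 'L_2(G), G, C] \subset 'L_5(G).
  apply: three_subgroup_mod; rewrite ?(subset_trans sCG) ?(subset_trans (sL _)) ?nL //.
    apply: subset_trans (lcn_der2 p_pr i3); apply: commSg; exact: commgS sCG.
  by rewrite [[~: C, _]]commGC; apply: (commSg G C4).
move=> h; apply/subsetP=> x Cx; apply: (cmod_in (nL 5)); first exact: subsetP sCG x Cx.
by move=> n Ln; apply: subsetP h _ _; apply: mem_commg.
Qed.

Lemma cset_sub_lcn k x : x \in G -> cset 'L_k.+1(G) x \subset 'L_k.+2(G).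
Proof. by move=> Gx; apply/subsetP=> _ /csetP[n Ln <-]; apply: mem_lcnR. Qed.

(** The elements n with [n, x] in L_{k+4} form a subgroup between L_{k+3} and L_{k+2}; the index is
    prime, so it is one of the two. *)
Lemma cmod_prime p k x n : prime p -> #|'L_k.+2(G) : 'L_k.+3(G)| = p -> x \in G ->
    x \notin cmod 'L_k.+2(G) 'L_k.+4(G) ->
  n \in 'L_k.+2(G) -> [~ n, x] \in 'L_k.+4(G) -> n \in 'L_k.+3(G).
Proof.
move=> p_pr ik Gx nCx Ln hn; apply: contraR nCx => nLn.
have nL : G \subset 'N('L_k.+4(G)) := lcn_norm _ G.
have gr : group_set [set m in 'L_k.+2(G) | [~ m, x] \in 'L_k.+4(G)].
  apply/group_setP; split; first by rewrite inE group1 comm1g group1.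
  move=> a b /setIdP[La ha] /setIdP[Lb hb]; rewrite inE groupM //= commMgJ groupM //.
  by rewrite mem_lcnJ // (mem_lcn Lb).
have sub : 'L_k.+2(G) \subset Group gr.
  apply: (prime_index_gen p_pr (lcn_normalS _ G) ik Ln nLn); last by rewrite inE Ln.
  apply/subsetP=> m Lm; rewrite inE mem_lcnR // andbT.
  exact: mem_lcn_leq (leqnSn _) Lm.
apply: (cmod_in nL) => // m /(subsetP sub); by case/setIdP.
Qed.

Lemma uniserial_cent p (r : nat) x : prime p -> x \in G ->
    (forall k, (k.+2 < r)%N -> #|'L_k.+2(G) : 'L_k.+3(G)| = p) ->
    (forall k, (k.+2 < r)%N -> x \notin cmod 'L_k.+2(G) 'L_k.+4(G)) ->
  'C_('L_2(G))[x] \subset 'L_r(G).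
Proof.
move=> p_pr Gx ik nC; case: r ik nC => [|[|r]] ik nC.
- by rewrite (subset_trans (subsetIl _ _)) ?lcn_sub.
- by rewrite (subset_trans (subsetIl _ _)) ?lcn_sub.
apply/subsetP=> n /setIP[L2n /cent1P/commgP/eqP cx].
have: forall k, k <= r -> n \in 'L_k.+2(G).
  elim=> [//|k IHk] lt; apply: (cmod_prime p_pr (ik k _) Gx (nC k _)) => //.
    exact: IHk (ltnW lt).
  by rewrite cx group1.
by apply.
Qed.

(** An element n settles g modulo L_3; the error is supplied by m in L_2 through [m n, x] = [m, x]^n
    [n, x], which is why it is first conjugated by n^-1. *)
Lemma commutators_of_cset p x : prime p -> #|'L_2(G) : 'L_3(G)| = p -> x \in G ->
  x \notin cmod G 'L_3(G) -> 'L_3(G) \subset cset 'L_2(G) x ->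
  'L_2(G) \subset cset G x.
Proof.
move=> p_pr i3 Gx nFx cov; apply/subsetP=> g Lg.
have nL : G \subset 'N('L_3(G)) := lcn_norm _ G.
have h1 : {in G, forall n, [~ n, x] \in 'L_2(G)} by move=> n Gn; apply: mem_lcn2.
have h2 : {in G, forall n, [~ n, x, n] \in 'L_3(G)} by move=> n Gn; rewrite (mem_lcnR (k := 1)) ?h1.
have [n Gn hn] := hit p_pr nL (lcn_normalS 2 G) i3 (subxx G) Gx h1 h2 (cmod_nP nL Gx nFx) Lg.
have L3 : (g * [~ n, x]^-1) ^ n^-1 \in 'L_3(G).
  by rewrite mem_lcnJ ?groupV // -(mem_lcnJ 3 _ (groupR Gn Gx)) conjgE mulgKV.
have [m Lm hm] := csetP _ _ _ (subsetP cov _ L3).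
apply/csetP; exists (m * n); first by rewrite groupM ?(mem_lcn Lm).
by rewrite commMgJ hm conjgKV mulgKV.
Qed.

End Lcn.

Section Uniserial.
Variables (gT : finGroupType) (p : nat) (G : {group gT}).
Hypotheses (p_pr : prime p) (pG : p.-group G).

(** Counting: the centralizer of x in L_2 lies in the last term L_{c+3}, of order p, so [L_2, x] has
    at least |L_2|/p = |L_3| elements and fills L_3. *)
Lemma uniserial_cset c x : 'L_c.+4(G) = 1 -> x \in G ->
    (forall k, (k <= c.+1)%N -> #|'L_k.+2(G) : 'L_k.+3(G)| = p) ->
    (forall k, (k <= c)%N -> x \notin cmod 'L_k.+2(G) 'L_k.+4(G)) ->
  'L_2(G) \subset cset G x.
Proof.
move=> L1 Gx ik nC.
have cN : 'C_('L_2(G))[x] \subset 'L_c.+3(G).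
  by apply: uniserial_cent p_pr Gx _ _ => k lt; [apply: ik; apply: ltnW | apply: nC].
have oL : #|'L_c.+3(G)| = p by rewrite -(ik c.+1) // L1 indexg1.
apply: (commutators_of_cset p_pr (ik 0 isT)) => //.
  by apply: contra (nC 0 isT) => Fx; apply: (subsetP (lcn_F_C2 G)); rewrite inE Fx.
have sC := cset_sub_lcn 1 Gx; suff <- : cset 'L_2(G) x = 'L_3(G) by [].
apply/eqP; rewrite eqEcard sC /= card_cset -(leq_pmul2r (cardG_gt0 'L_c.+3(G))) {1}oL -(ik 0 isT).
rewrite Lagrange ?lcn_subS // -(Lagrange (lcn_sub_leq G (isT : 2 <= c.+3))) mulnC leq_pmul2r ?cardG_gt0 //.
by apply: dvdn_leq; rewrite ?indexgS ?indexg_gt0.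
Qed.

End Uniserial.

Lemma coprime_modinv n k : 0 < k -> coprime n k -> exists m, (k * m = 1 %[mod n])%N.
Proof.
move=> k0 co; have [u v e _] := egcdnP n k0; exists u; rewrite mulnC e.
by rewrite gcdnC (eqP co) modnMDl.
Qed.

Lemma prime_modinv p k r : prime p -> ~~ (p %| k) -> exists m, (k * m = 1 %[mod p ^ r])%N.
Proof.
move=> p_pr nk; apply: coprime_modinv; first by case: k nk => //; rewrite dvdn0.
by rewrite coprimeXl // prime_coprime.
Qed.

Lemma expg_modinv (gT : finGroupType) p k m (h : gT) :
  (k * m = 1 %[mod p])%N -> h ^+ p = 1 -> h ^+ k ^+ m = h.
Proof. by move=> e hp; rewrite -expgM -(expg_mod _ hp) e (expg_mod _ hp). Qed.

(** * Derived subgroups of order p^3 *)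

Section Class2.
Variables (gT : finGroupType) (p : nat) (G : {group gT}).
Hypotheses (p_pr : prime p) (pG : p.-group G).
Implicit Types (x y z g h : gT).

Lemma cmod_proper k : ~~ ('L_k.+2(G) \subset 'L_k.+3(G)) ->
  ~~ (G \subset cmod 'L_k.+1(G) 'L_k.+3(G)).
Proof.
apply: contra => sG; rewrite [in X in X \subset _]lcnSn gen_subG.
apply/subsetP=> _ /imset2P[a b La Gb ->].
by have /cmodP[_] := subsetP sG b Gb; apply.
Qed.

Lemma comm2l x y z : 'L_3(G) = 1 -> x \in G -> y \in G -> z \in G ->
  [~ x * y, z] = [~ x, z] * [~ y, z].
Proof.
move=> L3 Gx Gy Gz; rewrite commMgR (lcn_eq1 (u := [~ x, z]) L3 (i := 1%N) (j := 0%N)) ?mulg1 //.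
exact: mem_lcn2.
Qed.

Lemma comm2r x y z : 'L_3(G) = 1 -> x \in G -> y \in G -> z \in G ->
  [~ x, y * z] = [~ x, z] * [~ x, y].
Proof.
move=> L3 Gx Gy Gz; rewrite commgMR (lcn_eq1 (u := [~ x, y]) L3 (i := 1%N) (j := 0%N)) ?mulg1 //.
exact: mem_lcn2.
Qed.

Lemma comm2Xl x y i : 'L_3(G) = 1 -> x \in G -> y \in G -> [~ x ^+ i, y] = [~ x, y] ^+ i.
Proof.
move=> L3 Gx Gy; apply: commXg; apply: commute_sym; apply/commgP/eqP.
by apply: (lcn_eq1 L3 (i := 1%N) (j := 0%N)) => //; apply: mem_lcn2.
Qed.

Lemma comm2Xr x y i : 'L_3(G) = 1 -> x \in G -> y \in G -> [~ x, y ^+ i] = [~ x, y] ^+ i.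
Proof.
move=> L3 Gx Gy; apply: commgX; apply: commute_sym; apply/commgP/eqP.
by apply: (lcn_eq1 L3 (i := 1%N) (j := 0%N)) => //; apply: mem_lcn2.
Qed.

Lemma cset2_group_set x : 'L_3(G) = 1 -> x \in G -> group_set (cset G x).
Proof.
move=> L3 Gx; apply: cset_group_set => n m Gn Gm; apply/conjg_fixP/eqP.
by apply: (lcn_eq1 L3 (i := 1%N) (j := 0%N)) => //; apply: mem_lcn2.
Qed.

Lemma lcn2_central : 'L_3(G) = 1 -> 'L_2(G) \subset 'Z(G).
Proof.
move=> L3; rewrite subsetI lcn_sub; apply/commG1P; exact: L3.
Qed.

Lemma central_normal (T : {group gT}) : T \subset 'Z(G) -> T <| G.
Proof. exact: sub_center_normal. Qed.

Lemma quotient_full (T : {group gT}) : T <| G -> #|'L_2(G) / T| <= p ^ 2 ->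
  exists2 x, x \in G & {in 'L_2(G), forall g, exists2 h, h \in G & [~ h, x]^-1 * g \in T}.
Proof.
move=> nT o2; have nTG := normal_norm nT.
have [|X /morphimP[x _ Gx ->] full] := cset_full_p2 p_pr (quotient_pgroup T pG).
  by rewrite lcn_quo.
exists x => // g Lg; have : coset T g \in 'L_2(G / T) by rewrite lcn_quo ?mem_quotient.
rewrite full => /csetP[_ /morphimP[h _ Gh ->] e]; exists h => //.
by apply/(coset_eqP nTG); rewrite ?groupR ?(mem_lcn Lg) // (coset_comm nTG).
Qed.

Lemma commutators_class2 : 'L_3(G) = 1 -> #|'L_2(G)| = (p ^ 3)%N -> commutators G = 'L_2(G).
Proof.
move=> L3 o3; apply: commutators_full => g Lg.
have sZ := lcn2_central L3; have pL : p.-group 'L_2(G) := pgroupS (lcn_sub _ _) pG.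
have abL : abelian 'L_2(G) by apply: abelianS sZ (center_abelian G).
pose H x (Gx : x \in G) := Group (cset2_group_set L3 Gx).
have HP x (Gx : x \in G) h : h \in G -> [~ h, x] \in H x Gx by move=> Gh; apply/csetP; exists h.
have HK x (Gx : x \in G) h : h \in H x Gx -> h \in commutators G.
  by case/csetP=> n Gn <-; apply: mem_commutators.
have step (T : {group gT}) : T \subset 'L_2(G) -> #|T| = p ->
    exists x (Gx : x \in G), 'L_2(G) = H x Gx * T.
  move=> sTL oT; have nT : T <| G by apply: central_normal; apply: subset_trans sZ.
  have nTL : T <| 'L_2(G) by apply: normalS nT; rewrite ?lcn_sub.
  have [|x Gx full] := quotient_full nT.
    rewrite card_quotient ?normal_norm // -(leq_pmul2r (cardG_gt0 T)) mulnC Lagrange //.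
    by rewrite o3 oT -expnSr.
  exists x, Gx; apply/eqP; rewrite eqEsubset; apply/andP; split; last first.
    by rewrite mul_subG //; apply/subsetP=> _ /csetP[h Gh <-]; apply: mem_lcn2.
  apply/subsetP=> u Lu; have [h Gh hT] := full u Lu.
  by rewrite -(mulKVg [~ h, x] u) mem_mulg // HP.
have [Phi1|ntPhi] := eqVneq 'Phi('L_2(G)) 1; last first.
  have [_ pP _] := pgroup_pdiv (pgroupS (Phi_sub _) pL) ntPhi.
  have [t Pt ot] := Cauchy p_pr pP.
  have sTL : <[t]> \subset 'L_2(G) by rewrite cycle_subG (subsetP (Phi_sub _)).
  have [x [Gx def]] := step _ sTL ot.
  have sH : H x Gx \subset 'L_2(G) by rewrite def mulG_subl.
  suff e : <<H x Gx>> = 'L_2(G) by apply: (HK x Gx); rewrite -(genGid (H x Gx)) e.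
  apply: Phi_nongen; apply/eqP; rewrite eqEsubset join_subG Phi_sub sH /= {1}def.
  apply: mul_subG; first exact: joing_subr.
  by rewrite cycle_subG (subsetP (joing_subl _ _)).
have abel : p.-abelem 'L_2(G) by rewrite -(trivg_Phi pL) Phi1.
have expL u : u \in 'L_2(G) -> u ^+ p = 1 by move=> Lu; have /abelemP[//|_] := abel; apply.
have [->|nt_g] := eqVneq g 1; first by rewrite -(comm1g 1) mem_commutators.
have og : #|<[g]>| = p by apply: nt_prime_order => //; apply: expL.
have sgL : <[g]> \subset 'L_2(G) by rewrite cycle_subG.
have [x [Gx def]] := step <[g]>%G sgL og.
have [/HK //|nHg] := boolP (g \in H x Gx).
have sHL : H x Gx \subset 'L_2(G) by rewrite def mulG_subl.
have nHL : H x Gx <| 'L_2(G) by rewrite -sub_abelian_normal.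
have TI : H x Gx :&: <[g]> = 1.
  have pg : prime #|<[g]>| by rewrite og.
  by have [/subsetP/(_ g (cycle_id g))|//] := prime_subgroupVti (H x Gx) pg; rewrite (negPf nHg).
have oH : #|H x Gx| = (p ^ 2)%N.
  apply/eqP; rewrite -(eqn_pmul2r (prime_gt0 p_pr)) -expnSr -o3 def TI_cardMg //= og //.
have iH : #|'L_2(G) : H x Gx| = p.
  apply/eqP; rewrite -(eqn_pmul2l (cardG_gt0 (H x Gx))) Lagrange // oH o3 expnSr //.
have nQ : G \subset 'N(H x Gx).
  by apply/normal_norm/central_normal/(subset_trans _ sZ).
have expH h : h \in H x Gx -> h ^+ p = 1 by move/(subsetP sHL); apply: expL.
have [h1 Hh1 nt1] : exists2 h1, h1 \in H x Gx & h1 != 1.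
  apply/trivgPn; rewrite -cardG_gt1 oH (ltn_exp2l 0) ?prime_gt1 //.
have o1 : #|<[h1]>| = p by apply: nt_prime_order => //; apply: expH.
have [h2 Hh2 n2] : exists2 h2, h2 \in H x Gx & h2 \notin <[h1]>.
  apply/subsetPn; apply/negP=> /subset_leq_card; rewrite oH o1 leqNgt -{1}(expn1 p).
  by rewrite ltn_exp2l ?prime_gt1.
have s1H : <[h1]> \subset H x Gx by rewrite cycle_subG.
have genH : forall h, h \in H x Gx -> exists i j, h = h2 ^+ j * h1 ^+ i.
  move=> h Hh; have n1 : <[h1]> <| H x Gx by rewrite -sub_abelian_normal // (abelianS sHL).
  have i1 : #|H x Gx : <[h1]>| = p.
    by apply/eqP; rewrite -(eqn_pmul2l (cardG_gt0 <[h1]>)) Lagrange // o1 oH.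
  have [j hj] := prime_index_cover p_pr n1 i1 Hh2 n2 Hh.
  by have [i e] := cycleP _ _ hj; exists i, j; rewrite -e mulKVg.
have [y1 Gy1 e1] := csetP _ _ _ Hh1; have [y2 Gy2 e2] := csetP _ _ _ Hh2.
(* Multiplying y1, y2 by elements of C_G(x) does not change [y1, x] and [y2, x], which leaves room
   to move [y1, y2] out of [G, x]. *)
pose D := 'C_G[x]%G; have sDG : D \subset G := subsetIl _ _.
have Dx s : s \in D -> [~ s, x] = 1 by case/setIP=> _ /cent1P/commgP/eqP.
have gen : G \subset <<[set y1; y2] :|: D>>.
  apply/subsetP=> z Gz; have [i [j e]] := genH _ (HP x Gx z Gz).
  have Gy : y2 ^+ j * y1 ^+ i \in G by rewrite groupM ?groupX.
  rewrite -(mulKVg (y2 ^+ j * y1 ^+ i) z); apply: groupM.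
    by rewrite groupM // groupX // mem_gen // !inE eqxx ?orbT.
  rewrite mem_gen // inE; apply/orP; right; apply/setIP; split; first by rewrite groupM ?groupV.
  have ew : [~ y2 ^+ j * y1 ^+ i, x] = [~ z, x].
    by rewrite comm2l ?groupX // !comm2Xl // e1 e2 e.
  by apply/cent1P/commgP; rewrite comm2l ?groupV // -ew -comm2l ?groupV // mulVg comm1g.
have nL2H : ~~ ('L_2(G) \subset H x Gx) by apply: contra nHg => /subsetP; apply.
have L3H : 'L_3(G) \subset H x Gx by rewrite L3 sub1G.
have [s [t [Ds Dt nst]]] := pair_outside nQ L3H nL2H Gy1 Gy2 sDG gen.
have Gs := subsetP sDG s Ds; have Gt := subsetP sDG t Dt.
set u := y1 * s in nst; set v := y2 * t in nst.
have Gu : u \in G by rewrite groupM. have Gv : v \in G by rewrite groupM.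
have ux : [~ u, x] = h1 by rewrite comm2l // (Dx s) // mulg1.
have vx : [~ v, x] = h2 by rewrite comm2l // (Dx t) // mulg1.
have [k hk] := prime_index_cover p_pr nHL iH (mem_lcn2 Gu Gv) nst Lg.
have nk : ~~ (p %| k).
  apply/negP=> /dvdnP[q e]; case/negP: nHg; move: hk.
  by rewrite e mulnC expgM expL ?mem_lcn2 // expg1n invg1 mul1g.
have [m hm] := prime_modinv 1 p_pr nk; rewrite expn1 in hm.
have [i [j e]] := genH _ hk.
have Gxi r : x ^+ r \in G by rewrite groupX.
have GV : x^-1 \in G by rewrite groupV.
have xv : [~ x^-1, v] = h2.
  by apply: (mulIg [~ x, v]); rewrite -comm2l // mulVg comm1g -vx -(invgR v x) mulgV.
(* Expanding gives h1^i [u, v]^k h2^(m j k), and m k = 1 modulo p. *)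
apply/commutatorsP; exists (u * x^-1 ^+ (m * j)), (v ^+ k * x ^+ i).
rewrite !groupM ?groupX //; split=> //.
rewrite comm2l ?groupM ?groupX // !comm2r ?groupX // !comm2Xr ?groupX // !comm2Xl // ux xv.
have -> : [~ x^-1, x] = 1 by apply/eqP/commgP; apply: commute_sym; exact: commuteV.
have -> : h2 ^+ (m * j) ^+ k = h2 ^+ j.
  by rewrite -expgM [(_ * k)%N]mulnC mulnA !expgM (expg_modinv hm) ?expH.
have -> : g = [~ u, v] ^+ k * (h2 ^+ j * h1 ^+ i) by rewrite -e mulKVg.
have cL a b : a \in 'L_2(G) -> b \in 'L_2(G) -> a * b = b * a by move=> La Lb; apply: (centsP abL).
have Lh a r : a \in H x Gx -> a ^+ r \in 'L_2(G) by move=> Ha; rewrite groupX // (subsetP sHL).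
rewrite !expg1n mul1g (cL _ _ (Lh h1 i Hh1) (groupX _ (mem_lcn2 Gu Gv))) -mulgA.
by rewrite (cL _ _ (Lh h1 i Hh1) (Lh h2 j Hh2)).
Qed.

Lemma commutators_p2 : #|'L_2(G)| <= p ^ 2 -> commutators G = 'L_2(G).
Proof.
move=> o2; have [x Gx full] := cset_full_p2 p_pr pG o2.
apply: commutators_full => g; rewrite full => /csetP[n Gn <-]; exact: mem_commutators.
Qed.

Lemma commutators_cset x : x \in G -> 'L_2(G) \subset cset G x -> commutators G = 'L_2(G).
Proof.
move=> Gx full; apply: commutators_full => g /(subsetP full)/csetP[n Gn <-].
exact: mem_commutators.
Qed.

(** With c generating L_2 modulo L_3, y -> [c, y] is a homomorphism of G onto L_3, so L_3 consists
    of commutators. Elements u, v hitting two generators of L_3 can be altered by C_G(c) until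
    [u, v] is outside L_3; then every other coset of L_3 is that of some [u, v^k], and
    [L_2, u][L_2, v^k] = L_3 allows the lifting. *)
Lemma commutators_12 : 'L_4(G) = 1 -> #|'L_3(G)| = (p ^ 2)%N -> #|'L_2(G) : 'L_3(G)| = p ->
  commutators G = 'L_2(G).
Proof.
move=> L4 o3 i3; have nL3 := lcn_normalS 2 G; have nG3 := lcn_norm 3 G.
have [c Lc nc] : exists2 c, c \in 'L_2(G) & c \notin 'L_3(G).
  by apply/subsetPn; rewrite -indexg_gt1 i3 prime_gt1.
have Gc := mem_lcn Lc.
have c3 u v : u \in 'L_3(G) -> v \in G -> [~ u, v] = 1.
  by move=> Lu Gv; apply: (lcn_eq1 L4 (i := 2) (j := 0)).
have cMr y z : y \in G -> z \in G -> [~ c, y * z] = [~ c, y] * [~ c, z].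
  move=> Gy Gz; rewrite commgMR (c3 [~ c, y]) ?mulg1 //; last exact: (mem_lcnR (k := 1)).
  have cc: commute [~ c, z] [~ c, y].
    by apply/commgP/eqP/c3; [apply: (mem_lcnR (k := 1))|rewrite groupR].
  by rewrite cc.
have cML n m x : n \in 'L_2(G) -> m \in 'L_2(G) -> x \in G -> [~ n * m, x] = [~ n, x] * [~ m, x].
  move=> Ln Lm Gx; rewrite commMgR (c3 [~ n, x]) ?mulg1 //; first exact: (mem_lcnR (k := 1)).
  exact: mem_lcn Lm.
have genL (A : {group gT}) : 'L_3(G) \subset A -> c \in A -> 'L_2(G) \subset A.
  exact: (prime_index_gen p_pr nL3 i3 Lc nc).
pose R := [set [~ c, x] | x in G].
have gR : group_set R.
  apply/group_setP; split; first by apply/imsetP; exists 1; rewrite ?commg1.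
  by move=> _ _ /imsetP[y Gy ->] /imsetP[z Gz ->]; rewrite -cMr // imset_f ?groupM.
have R3 : R = 'L_3(G).
  apply/eqP; rewrite eqEsubset; apply/andP; split.
    by apply/subsetP=> _ /imsetP[y Gy ->]; rewrite (mem_lcnR (k := 1)).
  rewrite -[R]/(gval (Group gR)) [in X in X \subset _]lcnSn gen_subG.
  apply/subsetP=> _ /imset2P[n x Ln Gx ->].
  have [i hi] := prime_index_cover p_pr nL3 i3 Lc nc Ln.
  have cx3 : [~ c, x] \in 'L_3(G) by apply: (mem_lcnR (k := 1)).
  rewrite -(mulKVg (c ^+ i) n) cML ?groupX //; last by apply: mem_lcn_leq hi.
  rewrite (c3 _ x hi Gx) mulg1 commXg; last by apply/commute_sym/commgP/eqP/c3.
  by rewrite groupX //; apply/imsetP; exists x.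
have F_C x : x \in G -> c ^ x != c -> exists2 y, y \in G & [~ x, y] \notin 'L_3(G).
  move=> Gx nx; have nF : x \notin cmod G 'L_3(G).
    apply: contra nx => Fx; apply/eqP/conjg_fixP.
    have /(subsetP (lcn_F_C2 G))/cmodP[_ /(_ c Lc)] : x \in cmod G 'L_3(G) :&: G by rewrite inE Fx.
    by rewrite L4 => /set1P->.
  have [y Gy nxy] := cmod_nP nG3 Gx nF; exists y; by rewrite // -invgR groupV.
pose D := 'C_G[c]%G; have sDG : D \subset G := subsetIl _ _.
have iD : #|G : D| = (p ^ 2)%N.
  rewrite index_cent1 -o3 -R3; rewrite -(card_lcoset (c ^: G) c^-1); apply: eq_card => u.
  apply/lcosetP/imsetP => [[_ /imsetP[x Gx ->] ->]|[x Gx ->]]; first by exists x; rewrite // commgEl.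
  by exists (c ^ x); rewrite ?imset_f // commgEl.
have [|h1 Lh1 o1] := Cauchy (G := 'L_3(G)%G) p_pr; first by rewrite o3 dvdn_exp.
have [h2 Lh2 n2] : exists2 h2, h2 \in 'L_3(G) & h2 \notin <[h1]>.
  apply/subsetPn; apply/negP=> /subset_leq_card; rewrite o3 -[#|<[h1]>|]/#[h1] o1 leqNgt -{1}(expn1 p).
  by rewrite ltn_exp2l ?prime_gt1.
have ab3 : abelian 'L_3(G) by apply/centsP=> a La b Lb; apply/commgP/eqP/c3 => //; apply: mem_lcn Lb.
have gen3 h : h \in 'L_3(G) -> exists i j, h = h2 ^+ j * h1 ^+ i.
  move=> Lh; have sh1 : <[h1]> \subset 'L_3(G) by rewrite cycle_subG.
  have n1 : <[h1]> <| 'L_3(G) by rewrite -sub_abelian_normal.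
  have i1 : #|'L_3(G) : <[h1]>| = p.
    by apply/eqP; rewrite -(eqn_pmul2l (cardG_gt0 <[h1]>)) Lagrange // -[#|<[h1]>|]/#[h1] o1 o3.
  have [j hj] := prime_index_cover p_pr n1 i1 Lh2 n2 Lh.
  by have [i e] := cycleP _ _ hj; exists i, j; rewrite -e mulKVg.
have [y1 Gy1 e1] : exists2 y1, y1 \in G & [~ c, y1] = h1.
  by have /imsetP[y Gy ->] : h1 \in R; [by rewrite R3|exists y].
have [y2 Gy2 e2] : exists2 y2, y2 \in G & [~ c, y2] = h2.
  by have /imsetP[y Gy ->] : h2 \in R; [by rewrite R3|exists y].
have cX y i : y \in G -> [~ c, y ^+ i] = [~ c, y] ^+ i.
  move=> Gy; rewrite commgX //; apply/commute_sym/commgP/eqP/c3 => //; exact: (mem_lcnR (k := 1)).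
have Xc y i : y \in G -> [~ c ^+ i, y] = [~ c, y] ^+ i.
  move=> Gy; rewrite commXg //; apply/commute_sym/commgP/eqP/c3 => //; exact: (mem_lcnR (k := 1)).
have gen : G \subset <<[set y1; y2] :|: D>>.
  apply/subsetP=> z Gz; have [|i [j e]] := gen3 [~ c, z]; first exact: (mem_lcnR (k := 1)).
  have Gy : y2 ^+ j * y1 ^+ i \in G by rewrite groupM ?groupX.
  rewrite -(mulKVg (y2 ^+ j * y1 ^+ i) z); apply: groupM.
    by rewrite groupM // groupX // mem_gen // !inE eqxx ?orbT.
  rewrite mem_gen // inE; apply/orP; right; apply/setIP; split; first by rewrite groupM ?groupV.
  have ew : [~ c, y2 ^+ j * y1 ^+ i] = [~ c, z] by rewrite cMr ?groupX // !cX // e1 e2 e.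
  by apply/cent1P/commute_sym/commgP; rewrite cMr ?groupV // -ew -cMr ?groupV // mulVg commg1.
have nL23 : ~~ ('L_2(G) \subset 'L_3(G)) by apply: contra nc => /subsetP; apply.
have [s [t [Ds Dt nst]]] := pair_outside nG3 (subxx _) nL23 Gy1 Gy2 sDG gen.
have Gs := subsetP sDG s Ds; have Gt := subsetP sDG t Dt.
have Dc z : z \in D -> [~ c, z] = 1 by case/setIP=> _ /cent1P/commute_sym/commgP/eqP.
set u := y1 * s in nst; set v := y2 * t in nst.
have Gu : u \in G by rewrite groupM. have Gv : v \in G by rewrite groupM.
have cu : [~ c, u] = h1 by rewrite cMr // (Dc s) // mulg1.
have cv : [~ c, v] = h2 by rewrite cMr // (Dc t) // mulg1.
apply: commutators_full => g Lg; have [Lg3|nLg3] := boolP (g \in 'L_3(G)).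
  by move: Lg3; rewrite -R3 => /imsetP[y Gy ->]; rewrite mem_commutators.
have [k hk] := prime_index_cover p_pr nL3 i3 (mem_lcn2 Gu Gv) nst Lg.
have expL w : w \in 'L_2(G) -> w ^+ p \in 'L_3(G).
  move=> Lw; apply: (coset_idr (H := 'L_3(G)%G)); first by rewrite groupX // (subsetP (normal_norm nL3)).
  have Nw := subsetP (normal_norm nL3) w Lw.
  by rewrite morphX //= -i3 -card_quotient ?normal_norm // expg_cardG ?mem_quotient.
have nk : ~~ (p %| k).
  apply/negP=> /dvdnP[q e]; case/negP: nLg3; move: hk; rewrite groupMl // groupV e mulnC expgM.
  by rewrite groupX // expL // mem_lcn2.
(* The inverse of k is taken modulo p^2 since L_3 is not known to be elementary abelian. *)
have [m hm] := prime_modinv 2 p_pr nk.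
have hp h : h \in 'L_3(G) -> h ^+ (p ^ 2) = 1 by move=> Lh; rewrite -o3 expg_cardG.
have cov : 'L_3(G) \subset cset 'L_2(G) u * cset 'L_2(G) (v ^+ k).
  apply/subsetP=> h /gen3[i [j ->]]; rewrite (centsP ab3 _ (groupX _ Lh2) _ (groupX _ Lh1)).
  apply: mem_mulg; apply/csetP.
    by exists (c ^+ i); rewrite ?groupX // Xc // cu.
  exists (c ^+ (m * j)); rewrite ?groupX // Xc ?groupX // cX // cv.
  by rewrite -expgM mulnA expgM expgM (expg_modinv hm) ?hp.
have key := lift_last L4 Gu (groupX k Gv) cov.
have Gvk : v ^+ k \in G by rewrite groupX.
have Guv : [~ u, v] \in G by rewrite groupR.
have e : [~ u, v ^+ k]^-1 * g \in 'L_3(G).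
  apply/(coset_eqP nG3); rewrite ?groupR ?(mem_lcn Lg) // (coset_RXr k nG3) //; last first.
    by apply: (mem_lcnR (k := 1)) => //; apply: mem_lcn2.
  by rewrite -(cosetXG k nG3) //; apply/(coset_eqP nG3); rewrite ?groupX // (mem_lcn Lg).
by have := key _ e; rewrite mulKVg.
Qed.

End Class2.

Section Small.
Variables (gT : finGroupType) (p : nat) (G : {group gT}).
Hypotheses (p_pr : prime p) (pG : p.-group G).
Implicit Types (x y z g h : gT).

(** It is enough to find x outside C(L_2) with [G, x] covering L_2 modulo L_3, because [L_2, x] =
    L_3 supplies the rest. A covering y exists by the order p^2 case; if no such x exists, y
    centralizes L_2 and every element outside C(L_2) has at most p values modulo L_3. Comparing x
    with x y then forces x to centralize L_2. *)
Lemma cset_21 : 'L_4(G) = 1 -> #|'L_3(G)| = p -> #|'L_2(G) : 'L_3(G)| = (p ^ 2)%N ->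
  exists2 x, x \in G & 'L_2(G) \subset cset G x.
Proof.
move=> L4 o3 i3; have nG3 := lcn_norm 3 G; have nL3 := lcn_normalS 2 G.
set T := 'L_3(G)%G in nG3 nL3 *.
have nTG : T <| G := lcn_normal 3 G.
have sTL : T \subset 'L_2(G) := lcn_subS 2 G.
have oQ : #|'L_2(G) / T| = (p ^ 2)%N by rewrite card_quotient ?normal_norm.
have c3 u v : u \in T -> v \in G -> [~ u, v] = 1.
  by move=> Lu Gv; apply: (lcn_eq1 L4 (i := 2) (j := 0)).
have R3 n x : n \in 'L_2(G) -> x \in G -> [~ n, x] \in T by move=> Ln Gx; apply: (mem_lcnR (k := 1)).
have G3 a b c : a \in G -> b \in G -> c \in G -> [~ a, b, c] \in T.
  by move=> Ga Gb Gc; rewrite R3 // mem_lcn2.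
pose full x := [forall g in 'L_2(G), exists h in G, [~ h, x]^-1 * g \in T].
have fullP x : reflect {in 'L_2(G), forall g, exists2 h, h \in G & [~ h, x]^-1 * g \in T} (full x).
  apply: (iffP forall_inP) => H g Lg; first by have /exists_inP[h] := H g Lg; exists h.
  by apply/exists_inP; have [h] := H g Lg; exists h.
have nC : ~~ (G \subset 'C('L_2(G))).
  apply/negP=> cG; have o1 : 'L_3(G) = 1 by rewrite lcnSn commGC; apply/commG1P.
  by move: o3 (prime_gt1 p_pr); rewrite o1 cards1 => <-.
suff [x /and3P[Gx nCx /fullP fx]] : exists x, [&& x \in G, x \notin 'C('L_2(G)) & full x].
  exists x => //; apply/subsetP=> g Lg; have [h Gh hg] := fx g Lg.
  have [n Ln nn] : exists2 n, n \in 'L_2(G) & [~ n, x] != 1.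
    apply/exists_inP; rewrite -negb_forall_in; apply: contra nCx => /forall_inP H.
    by apply/centP=> n Ln; apply/commute_sym/commgP/H.
  have Gn := mem_lcn Ln.
  have [i e] := prime_card_cover p_pr o3 (R3 n x Ln Gx) nn hg.
  apply/csetP; exists (h * n ^+ i); first by rewrite groupM ?groupX.
  have cn : commute n [~ n, x] by apply/commute_sym/commgP/eqP/c3; rewrite ?R3.
  rewrite commMgR (commXg _ cn) // -e.
  have -> : [~ h, x, n ^+ i] = 1.
    by apply: (lcn_eq1 L4 (i := 1) (j := 1)); rewrite ?groupX // mem_lcn2.
  by rewrite mulg1 mulKVg.
have [y Gy fy] := quotient_full p_pr pG nTG (eq_leq oQ).
have [/exists_inP[x Gx /andP[nCx fx]]|/exists_inPn none] :=
    boolP [exists x in G, (x \notin 'C('L_2(G))) && full x]; first by exists x; rewrite Gx nCx.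
have {}none x : x \in G -> x \notin 'C('L_2(G)) -> ~~ full x.
  by move=> Gx nCx; have := none x Gx; rewrite nCx.
have Cy : y \in 'C('L_2(G)) by apply: contraT => /(none y Gy) /fullP[].
have [x Gx nCx] := avoid1 nC; have Gxy : x * y \in G by rewrite groupM.
have nCxy : x * y \notin 'C('L_2(G)) by rewrite groupMr.
have inT a : a \in G -> (a \in T) = (coset T a == 1).
  by move=> Ga; apply/(coset1P nG3 Ga)/eqP.
have inTR a b : a \in G -> b \in G -> ([~ a, b] \in T) = (coset T [~ a, b] == 1).
  by move=> Ga Gb; rewrite inT ?groupR.
have qM a b : a \in G -> b \in G -> coset T (a * b) = coset T a * coset T b by apply: cosetMG.
have qR a b c : a \in G -> b \in G -> c \in G -> coset T [~ a, b * c] = coset T [~ a, c] * coset T [~ a, b].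
  by move=> Ga Gb Gc; apply: (coset_RMr nG3) => //; apply: G3.
have L3Q : 'L_3(G / T) = 1 by rewrite lcn_quo // trivg_quotient.
have full_q z : z \in G -> z \notin 'C('L_2(G)) -> #|cset (G / T) (coset T z)| = p \/ #|cset (G / T) (coset T z)| = 1%N.
  move=> Gz nCz; have [->|->|o2] := card_cset_p p_pr (quotient_pgroup T pG) (coset T z) (subxx _); [by right|by left|].
  case/negP: (none z Gz nCz); apply/fullP => g Lg.
  have sR : cset (G / T) (coset T z) \subset 'L_2(G / T).
    by apply/subsetP=> _ /csetP[n Qn <-]; apply: mem_lcn2 => //; exact: mem_quotient.
  have eR : cset (G / T) (coset T z) = 'L_2(G / T) by apply/eqP; rewrite eqEcard sR lcn_quo // oQ.
  have : coset T g \in 'L_2(G / T) by rewrite lcn_quo ?mem_quotient.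
  rewrite -eR => /csetP[_ /morphimP[h _ Gh ->] e]; exists h => //.
  by apply/(coset_eqP nG3); rewrite ?groupR ?(mem_lcn Lg) // (coset_comm nG3).
have small z : z \in G -> z \notin 'C('L_2(G)) -> forall k l, k \in G -> l \in G -> [~ k, z] \notin T ->
    exists i, coset T [~ l, z] = coset T [~ k, z] ^+ i.
  move=> Gz nCz k l Gk Gl nk; have nk1 : coset T [~ k, z] != 1 by rewrite -inTR.
  have Qz : coset T z \in G / T by rewrite mem_quotient.
  pose R := Group (cset2_group_set L3Q Qz).
  have Rk a : a \in G -> coset T [~ a, z] \in R.
    by move=> Ga; apply/csetP; exists (coset T a); rewrite ?mem_quotient // (coset_comm nG3).
  have [o1|o1] := full_q z Gz nCz.
    exact: prime_card_cover p_pr (o1 : #|R| = p) (Rk k Gk) nk1 (Rk l Gl).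
  have /card_le1_eqP le1 := eq_leq (o1 : #|R| = 1%N).
  by case/eqP: nk1; rewrite (le1 _ _ (group1 R) (Rk k Gk)).
have oY : #|cset (G / T) (coset T y)| = (p ^ 2)%N.
  rewrite -oQ -lcn_quo //; apply: eq_card; apply: subset_eqP; apply/andP; split; apply/subsetP.
    by move=> _ /csetP[n Qn <-]; apply: mem_lcn2 => //; exact: mem_quotient.
  move=> w; rewrite lcn_quo // => /morphimP[g Ng Lg ->]; have [h Gh hg] := fy g Lg.
  apply/csetP; exists (coset T h); first exact: mem_quotient.
  by rewrite -(coset_comm nG3) //; apply/(coset_eqP nG3); rewrite ?groupR ?(mem_lcn Lg).
(* Modulo L_3 the centralizer of z has index at most p, while that of y has index p^2. *)
have wit z : z \in G -> z \notin 'C('L_2(G)) -> exists h, [/\ h \in G, [~ h, z] \in T & [~ h, y] \notin T].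
  move=> Gz nCz; have : ~~ ('C_(G / T)[coset T z] \subset 'C_(G / T)[coset T y]).
    apply/negP=> /(indexgS (G / T)); rewrite -!card_cset oY.
    have lt : p < p ^ 2 by rewrite -{1}(expn1 p) ltn_exp2l ?prime_gt1.
    have lt1 := ltn_trans (prime_gt1 p_pr) lt.
    by have [->|->] := full_q z Gz nCz; rewrite gtnNdvd // prime_gt0.
  case/subsetPn=> _ /setIP[/morphimP[h _ Gh ->] /cent1P/commgP cz] ncy; exists h; split=> //.
    by rewrite inTR // (coset_comm nG3).
  by apply: contra ncy; rewrite inTR // (coset_comm nG3) // inE mem_quotient // => /commgP/cent1P.
have [b [Gb bx by_]] := wit x Gx nCx; have [a [Ga axy ay]] := wit (x * y) Gxy nCxy.
have q1 u : u \in T -> coset T u = 1 by exact: coset_id.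
have qV u : u \in G -> coset T u^-1 = (coset T u)^-1 by move=> Gu; rewrite morphV ?(subsetP nG3).
have ax : [~ a, x] \notin T.
  apply: contra ay => ax; rewrite inTR //; move: axy; rewrite inTR // qR // (q1 _ ax) mulg1.
  by [].
have bxy : [~ b, x * y] \notin T by rewrite inTR // qR // (q1 _ bx) mulg1 -inTR.
(* Otherwise every [l, y] = [l, x y][l, x]^-1 would be a power of [y, x] modulo L_3, leaving y at
   most p values. *)
have yx : [~ y, x] \in T.
  apply: contraT => nyx.
  have nyxy : [~ y, x * y] \notin T by rewrite inTR // qR // commgg morph1 mul1g -inTR.
  have cyc l : l \in G -> coset T [~ l, y] \in <[coset T [~ y, x]]>.
    move=> Gl; have [i ei] := small x Gx nCx y l Gy Gl nyx; have [j ej] := small _ Gxy nCxy y l Gy Gl nyxy.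
    have e : coset T [~ l, y] = coset T [~ l, x * y] * (coset T [~ l, x])^-1 by rewrite qR // mulgK.
    rewrite e ei ej qR // commgg morph1 mul1g groupM ?groupV ?mem_cycle //.
  have oc : #|<[coset T [~ y, x]]>| = p.
    have Qx : coset T x \in G / T by rewrite mem_quotient.
    pose R := Group (cset2_group_set L3Q Qx).
    have Ry : coset T [~ y, x] \in R.
      by apply/csetP; exists (coset T y); rewrite ?mem_quotient // (coset_comm nG3).
    have [o1|o1] := full_q x Gx nCx.
      rewrite -[LHS]/#[_]; apply: nt_prime_order => //; first by rewrite -(o1 : #|R| = p) expg_cardG.
      by rewrite -inTR.
    have /card_le1_eqP le1 := eq_leq (o1 : #|R| = 1%N).
    by case/negP: nyx; rewrite inTR // (le1 _ _ (group1 R) Ry).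
  have : cset (G / T) (coset T y) \subset <[coset T [~ y, x]]>.
    apply/subsetP=> _ /csetP[_ /morphimP[l _ Gl ->] <-]; rewrite -(coset_comm nG3) //; exact: cyc.
  by move/subset_leq_card; rewrite oY oc leqNgt -{1}(expn1 p) ltn_exp2l ?prime_gt1.
have cT u v : u \in T -> v \in G -> v * u = u * v.
  by move=> Tu Gv; apply/commute_sym/commgP/eqP/c3.
(* x commutes with [a, x] and [b, x y], which generate L_2(G) modulo L_3(G) *)
have xy3 : [~ x, y] \in T by rewrite -groupV invgR.
have cya : [~ y, a, x] = 1.
  have := jacobi3 L4 Gx Gy Ga; rewrite (c3 _ _ xy3 Ga) mul1g.
  have -> : [~ a, x, y] = 1 by apply/eqP/commgP/commute_sym; apply: (centP Cy); rewrite mem_lcn2.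
  by rewrite mul1g.
have cyb : [~ y, b, x] = 1.
  have := jacobi3 L4 Gx Gy Gb; rewrite (c3 _ _ xy3 Gb) mul1g (c3 _ _ bx Gy) mul1g.
  by [].
have com1 (u v : gT) : [~ u, v] = 1 -> commute u v by move=> e; apply/commgP; rewrite e.
have comV (u v : gT) : commute u v -> commute u^-1 v.
  by move=> uv; apply/commute_sym/commuteV/commute_sym.
have cb : commute [~ b, y] x by rewrite -invgR; apply: comV; apply: com1.
have ca : commute [~ a, y] x by rewrite -invgR; apply: comV; apply: com1.
case: (negP nCx); apply/centP=> g Lg; apply: commute_sym.
have [h Gh hg] := fy g Lg.
have [i ei] := small _ Gxy nCxy b h Gb Gh bxy; have [j ej] := small x Gx nCx a h Ga Gh ax.
have eb : coset T [~ b, x * y] = coset T [~ b, y] by rewrite qR // (q1 _ bx) mulg1.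
have ea : (coset T [~ a, x])^-1 = coset T [~ a, y].
  by apply: (mulIg (coset T [~ a, x])); rewrite mulVg -qR // (q1 _ axy).
have Tt : ([~ b, y] ^+ i * [~ a, y] ^+ j)^-1 * g \in T.
  apply/(coset_eqP nG3); rewrite ?groupM ?groupX ?groupR ?(mem_lcn Lg) //.
  move/(coset_eqP nG3): hg => <- //; rewrite ?groupR ?(mem_lcn Lg) //.
  rewrite qM ?groupX ?groupR // !(cosetXG _ nG3) ?groupR // -eb -ea expgVn -ei -ej qR //.
  by rewrite mulgK.
rewrite -(mulKVg ([~ b, y] ^+ i * [~ a, y] ^+ j) g).
apply: commute_sym; apply: commuteM; first by apply: commuteM; apply/commuteX/commute_sym.
by apply: commute_sym; apply: com1; apply: c3.
Qed.

Lemma uniserial_111 : 'L_5(G) = 1 -> #|'L_4(G)| = p -> #|'L_3(G) : 'L_4(G)| = p ->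
  #|'L_2(G) : 'L_3(G)| = p -> exists2 x, x \in G & 'L_2(G) \subset cset G x.
Proof.
move=> L5 o4 i34 i23.
have n k : #|'L_k.+2(G) : 'L_k.+3(G)| = p -> ~~ ('L_k.+2(G) \subset 'L_k.+3(G)).
  by move=> i; rewrite -indexg_gt1 i prime_gt1.
have i45 : #|'L_4(G) : 'L_5(G)| = p by rewrite L5 indexg1.
have [x [Gx nx2 nx3]] := avoid2 (cmod_proper (n 1%N i34)) (cmod_proper (n 2 i45)).
exists x => //; apply: (uniserial_cset (c := 1) p_pr L5 Gx); first by case=> [|[|[|]]].
by case=> [|[|]].
Qed.

Lemma lcn_card k : #|'L_k(G)| = (p ^ logn p #|'L_k(G)|)%N.
Proof. exact: card_pgroup (pgroupS (lcn_sub k G) pG). Qed.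

Lemma lcn_log_eq1 k : (logn p #|'L_k(G)| == 0) = ('L_k(G) == 1).
Proof. by rewrite trivg_card1 {2}lcn_card -(expn0 p) eqn_exp2l ?prime_gt1. Qed.

Lemma lcn_index k : #|'L_k(G) : 'L_k.+1(G)| = (p ^ (logn p #|'L_k(G)| - logn p #|'L_k.+1(G)|))%N.
Proof.
have sL := lcn_subS k G.
have le : logn p #|'L_k.+1(G)| <= logn p #|'L_k(G)| by apply: dvdn_leq_log; rewrite ?cardSg.
apply/eqP; rewrite -(eqn_pmul2l (cardG_gt0 'L_k.+1(G))) Lagrange // {1}lcn_card [X in (X * _)%N]lcn_card.
by rewrite -expnD subnKC.
Qed.

Lemma lcn_log_lt k : 'L_k.+1(G) != 1 -> logn p #|'L_k.+2(G)| < logn p #|'L_k.+1(G)|.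
Proof.
move=> nt; rewrite -(ltn_exp2l _ _ (prime_gt1 p_pr)) -!lcn_card.
exact: proper_card (lcn_nilp (pgroup_nil pG) nt).
Qed.

(** For |L_2| = p^3 the factors from L_2 downwards have orders p^3; or p^2, p; or p, p^2; or p, p,
    p, and each pattern is settled separately. *)
Lemma commutators_p3 : #|'L_2(G)| <= p ^ 3 -> commutators G = 'L_2(G).
Proof.
have p1 := prime_gt1 p_pr; rewrite lcn_card leq_exp2l // leq_eqVlt ltnS => /predU1P[l2|le]; last first.
  by apply: (commutators_p2 p_pr pG); rewrite lcn_card leq_exp2l.
have i2 := lcn_index 2; have i3 := lcn_index 3; have o3 := lcn_card 3; have o4 := lcn_card 4.
have [L3|nt3] := eqVneq 'L_3(G) 1.
  by apply: (commutators_class2 p_pr pG L3); rewrite lcn_card l2.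
have lt3 : logn p #|'L_3(G)| < 3.
  have [|lt] := boolP ('L_2(G) == 1); last by have := lcn_log_lt lt; rewrite l2.
  by rewrite -lcn_log_eq1 l2.
have [L4|nt4] := eqVneq 'L_4(G) 1.
  move: lt3 i2 i3 o3; rewrite l2; have := lcn_log_eq1 3; rewrite (negPf nt3).
  case: (logn p #|'L_3(G)|) => [//|[|[|//]]] _ _ i2 _ o3.
    by have [x Gx] := cset_21 L4 o3 i2; apply: commutators_cset.
  exact: commutators_12 p_pr L4 o3 i2.
have lt4 := lcn_log_lt nt3; have lt5 := lcn_log_lt nt4; have := lcn_log_eq1 4.
rewrite (negPf nt4) => /negbT; rewrite -lt0n => l4.
have l3 : logn p #|'L_3(G)| = 2 by lia.
have {}l4 : logn p #|'L_4(G)| = 1%N by lia.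
have l5 : logn p #|'L_5(G)| = 0 by lia.
have /eqP L5 : 'L_5(G) == 1 by rewrite -lcn_log_eq1 l5.
rewrite l2 l3 l4 in i2 i3 o4.
by have [x Gx] := uniserial_111 L5 o4 i3 i2; apply: commutators_cset.
Qed.

End Small.

(** * Generation of the derived subgroup and power formulas *)

Section Gen.
Variables (gT : finGroupType) (G : {group gT}).
Implicit Types (A B C D M N T Q : {group gT}) (x y z g n m t c d w : gT) (k i j p : nat).

Lemma der_gen (S : {set gT}) B : G \subset 'N(B) -> S \subset G -> G \subset <<S>> ->
  {in S &, forall s t, [~ s, t] \in B} -> 'L_2(G) \subset B.
Proof.
move=> nB sSG defG SS.
have G1 : G \subset cmod S B.
  apply: subset_trans defG _; rewrite gen_subG; apply/subsetP=> a Sa.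
  by apply: (cmod_in nB); [exact: subsetP sSG a Sa | move=> n Sn; apply: SS].
have G2 : G \subset cmod G B.
  apply: subset_trans (defG) _; rewrite gen_subG; apply/subsetP=> a Sa.
  apply: (cmod_in nB); first exact: subsetP sSG a Sa.
  by move=> n Gn; rewrite -groupV invgR; have /cmodP[_] := subsetP G1 n Gn; apply.
have -> : 'L_2(G) = <<commg_set G G>> by [].
rewrite gen_subG; apply/subsetP=> _ /imset2P[a b Ga Gb ->].
by have /cmodP[_] := subsetP G2 b Gb; apply.
Qed.

Lemma norm_between k B : 'L_k.+2(G) \subset B -> B \subset 'L_k.+1(G) -> G \subset 'N(B).
Proof.
move=> sLB sBL; rewrite -commg_subl; apply: subset_trans sLB.
by rewrite lcnSn commSg.
Qed.

Lemma comm1 (x y : gT) : [~ x, y] = 1 -> commute x y.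
Proof. by move=> e; apply/commgP; rewrite e. Qed.

Lemma commuteVl (x y : gT) : commute x y -> commute x^-1 y.
Proof. by move=> xy; apply: commute_sym; apply: commuteV; apply: commute_sym. Qed.

Lemma commM_abelian N x n m : abelian N -> x \in 'N(N) -> n \in N -> m \in N ->
  [~ n * m, x] = [~ n, x] * [~ m, x].
Proof.
move=> abN Nx Nn Nm; rewrite commMgJ; congr (_ * _); apply/conjg_fixP/eqP; apply/eqP.
apply/commgP; apply: (centsP abN) => //; rewrite commgEl groupM ?groupV // memJ_norm //.
Qed.

Lemma commX_abelian N x n i : abelian N -> x \in 'N(N) -> n \in N -> [~ n ^+ i, x] = [~ n, x] ^+ i.
Proof.
move=> abN Nx Nn; apply: commXg; apply: (centsP abN) => //.
by rewrite commgEl groupM ?groupV // memJ_norm.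
Qed.

Lemma expg_sq (x : gT) : x ^+ 2 = x * x. Proof. by []. Qed.
Lemma expg_cube (x : gT) : x ^+ 3 = x * (x * x). Proof. by []. Qed.

Lemma comm_sq x z : [~ z ^+ 2, x] = [~ z, x] ^ z * [~ z, x].
Proof. by rewrite expg_sq commMgJ. Qed.

Lemma comm_sq_abelian N x z : abelian N -> z \in 'N(N) -> [~ z, x] \in N ->
  [~ z ^+ 2, x] = [~ z, x] ^+ 2 * [~ z, x, z].
Proof.
move=> abN Nz Nw; rewrite comm_sq conjg_mulR -mulgA.
have Nd : [~ z, x, z] \in N by rewrite commgEl groupM ?groupV // memJ_norm.
by rewrite ((centsP abN) _ Nd _ Nw) mulgA.
Qed.

(** With w = [z, x] one has [z^3, x] = w^(z^2) w^z w; additively, for d(w) = [w, z], this is (1 +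
    d)^2 + (1 + d) + 1 = 3 + 3 d + d^2 applied to w. *)
Lemma comm_cube_abelian N x z : abelian N -> z \in 'N(N) -> [~ z, x] \in N ->
  [~ z ^+ 3, x] = [~ z, x] ^+ 3 * [~ z, x, z] ^+ 3 * [~ z, x, z, z].
Proof.
move=> abN Nz; rewrite expg_cube commMgJ commMgJ; set w := [~ z, x] => Nw.
have Nd : [~ w, z] \in N by rewrite commgEl groupM ?groupV // memJ_norm.
have Ne : [~ w, z, z] \in N by rewrite commgEl groupM ?groupV // memJ_norm.
set d := [~ w, z] in Nd Ne *; set e := [~ d, z] in Ne *.
rewrite conjgM !(conjg_mulR w) -/d conjMg (conjg_mulR w) -/d (conjg_mulR d) -/e.
have cdw : commute d w by apply: (centsP abN).
have cew : commute e w by apply: (centsP abN).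
have ced : commute e d by apply: (centsP abN).
clearbody w d e; rewrite !expg_cube.
have dw : d * w = w * d := cdw. have ew : e * w = w * e := cew. have ed : e * d = d * e := ced.
have dwk (u : gT) : d * (w * u) = w * (d * u) by rewrite mulgA dw -mulgA.
have ewk (u : gT) : e * (w * u) = w * (e * u) by rewrite mulgA ew -mulgA.
have edk (u : gT) : e * (d * u) = d * (e * u) by rewrite mulgA ed -mulgA.
by rewrite -!mulgA !(dwk, ewk, edk, dw, ew, ed).
Qed.

End Gen.

(** * Bilinearity of the commutator modulo L_3 *)

Section ModL3.
Variables (gT : finGroupType) (G : {group gT}).
Implicit Types (x y z g n m t c d w : gT) (k i j p : nat).
Local Notation q := (coset 'L_3(G)).

Lemma lcn3_comm x y z : x \in G -> y \in G -> z \in G -> [~ x, y, z] \in 'L_3(G).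
Proof. by move=> Gx Gy Gz; rewrite (mem_lcnR (k := 1)) // mem_lcn2. Qed.

Lemma cos3M x y : x \in G -> y \in G -> q (x * y) = q x * q y.
Proof. exact: (cosetMG (lcn_norm 3 G)). Qed.

Lemma cos3V x : x \in G -> q x^-1 = (q x)^-1.
Proof. by move=> Gx; rewrite morphV ?(subsetP (lcn_norm 3 G)). Qed.

Lemma cos3X x i : x \in G -> q (x ^+ i) = q x ^+ i.
Proof. exact: (cosetXG i (lcn_norm 3 G)). Qed.

Lemma cos3Rl x y z : x \in G -> y \in G -> z \in G -> q [~ x * y, z] = q [~ x, z] * q [~ y, z].
Proof. by move=> Gx Gy Gz; apply: (coset_RMl (lcn_norm 3 G)) => //; apply: lcn3_comm. Qed.

Lemma cos3Rr x y z : x \in G -> y \in G -> z \in G -> q [~ x, y * z] = q [~ x, z] * q [~ x, y].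
Proof. by move=> Gx Gy Gz; apply: (coset_RMr (lcn_norm 3 G)) => //; apply: lcn3_comm. Qed.

Lemma cos3Xl x z i : x \in G -> z \in G -> q [~ x ^+ i, z] = q [~ x, z] ^+ i.
Proof. by move=> Gx Gz; apply: (coset_RXl i (lcn_norm 3 G)) => //; apply: lcn3_comm. Qed.

Lemma cos3Xr x z i : x \in G -> z \in G -> q [~ x, z ^+ i] = q [~ x, z] ^+ i.
Proof. by move=> Gx Gz; apply: (coset_RXr i (lcn_norm 3 G)) => //; apply: lcn3_comm. Qed.

Lemma cos3_1 x : x \in G -> (x \in 'L_3(G)) = (q x == 1).
Proof. by move=> Gx; apply/(coset1P (lcn_norm 3 G) Gx)/eqP. Qed.

Lemma cos3_R x y : x \in G -> y \in G -> ([~ x, y] \in 'L_3(G)) = (q [~ x, y] == 1).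
Proof. by move=> Gx Gy; apply: cos3_1; rewrite groupR. Qed.

Lemma cos3_eq x y : x \in G -> y \in G -> (x^-1 * y \in 'L_3(G)) = (q x == q y).
Proof. by move=> Gx Gy; apply/(coset_eqP (lcn_norm 3 G) Gx Gy)/eqP. Qed.

Lemma cos3C x y : x \in 'L_2(G) -> y \in G -> q x * q y = q y * q x.
Proof.
move=> Lx Gy; have L3 : [~ x, y] \in 'L_3(G) by apply: (mem_lcnR (k := 1)).
by apply: comm1; rewrite -(coset_comm (lcn_norm 3 G)) ?(mem_lcn Lx) // (coset_id L3).
Qed.

End ModL3.

(** * Generators when G/L_2 has order p^3 *)

Section Index.
Variables (gT : finGroupType) (p : nat) (G : {group gT}).
Hypotheses (p_pr : prime p) (pG : p.-group G).
Implicit Types (x y z g n m t c d w r s a b : gT) (k i j : nat) (M T B : {group gT}).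

Lemma index_cycle_le T w : w \in 'N(T) -> w ^+ p \in T -> #|T <*> <[w]> : T| <= p.
Proof.
move=> Nw wp; have sN : T <*> <[w]> \subset 'N(T) by rewrite join_subG normG cycle_subG.
rewrite -card_quotient // -[T <*> _]/(gval (T <*> <[w]>)%G) /= quotientYidl ?cycle_subG // quotient_cycle //.
rewrite -[#|<[_]>|]/#[_] dvdn_leq ?prime_gt0 // order_dvdn -morphX //=.
by rewrite coset_id.
Qed.

Lemma index_join_le T M w : T \subset M -> w \in 'N(M) -> w ^+ p \in M ->
  #|M <*> <[w]> : T| <= p * #|M : T|.
Proof.
move=> sTM Nw wp; rewrite -(Lagrange_index (joing_subl M <[w]>) sTM) leq_pmul2r ?indexg_gt0 //.
exact: index_cycle_le.
Qed.

(** An element outside M enlarges it by a factor of at least p; repeated use proves that given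
    elements generate G. *)
Lemma index_step M r k : M \subset G -> r \in G -> r \notin M -> #|G : M| <= p ^ k.+1 ->
  #|G : M <*> <[r]>| <= p ^ k.
Proof.
move=> sMG Gr nMr le; have sM' : M <*> <[r]> \subset G by rewrite join_subG sMG cycle_subG.
have : #|M <*> <[r]> : M| != 1%N.
  rewrite indexg_eq1; apply: contra nMr => /subsetP; apply.
  by rewrite (subsetP (joing_subr _ _)) ?cycle_id.
have /p_natP[[|e] i] : p.-nat #|M <*> <[r]> : M|.
- exact: pnat_dvd (dvdn_indexg _ _) (pgroupS sM' pG).
- by rewrite i.
move=> _; move: le; rewrite -(Lagrange_index sM' (joing_subl M <[r]>)) i expnS [in X in _ <= X -> _]expnS.
rewrite mulnC -mulnA leq_pmul2l ?prime_gt0 //; apply: leq_trans.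
by rewrite leq_pmull // expn_gt0 prime_gt0.
Qed.

Lemma index_le1 M : #|G : M| <= p ^ 0 -> G \subset M.
Proof. by rewrite expn0 -indexg_eq1 eqn_leq indexg_gt0 andbT. Qed.

Lemma triple_gen w r s (T : {group gT}) :
  T <*> <[w]> <*> <[r]> <*> <[s]> \subset <<[set w; r; s] :|: T>>.
Proof.
have m u : u \in [set w; r; s] -> u \in <<[set w; r; s] :|: T>>.
  by move=> Su; rewrite mem_gen // inE Su.
by rewrite !join_subG !cycle_subG !m ?inE ?eqxx ?orbT //= sub_gen // subsetUr.
Qed.

Lemma complete_triple w : #|G : 'L_2(G)| = (p ^ 3)%N -> w \in G -> w \notin 'L_2(G) ->
  exists r s, [/\ r \in G, s \in G & G \subset <<[set w; r; s] :|: 'L_2(G)>>].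
Proof.
move=> o Gw nw; pose M1 := ('L_2(G) <*> <[w]>)%G.
have sM1 : M1 \subset G by rewrite join_subG lcn_sub cycle_subG.
have i1 : #|G : M1| <= p ^ 2 by apply: index_step nw _; rewrite ?lcn_sub ?o.
have ext M k : M \subset G -> #|G : M| <= p ^ k.+1 ->
    exists2 r, r \in G & #|G : M <*> <[r]>| <= p ^ k.
  move=> sMG i; have [sGM|/avoid1[r Gr nr]] := boolP (G \subset M).
    exists 1 => //; rewrite cycle1 joingG1.
    by rewrite (eqP (_ : #|G : M| == 1%N)) ?indexg_eq1 // expn_gt0 prime_gt0.
  by exists r => //; apply: index_step.
have [r Gr i2] := ext M1 1%N sM1 i1.
have [|s Gs i3] := ext (M1 <*> <[r]>)%G 0 _ i2; first by rewrite join_subG sM1 cycle_subG.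
exists r, s; split=> //; apply: subset_trans (triple_gen w r s 'L_2(G)%G).
exact: index_le1 i3.
Qed.

(** If a^p were outside L_2, then <a> L_2 would have index at most p and G = <a, b> L_2, so L_2 =
    L_3 <[b, a]>. Since b^p lies in <a> L_2, the p-th power of [b, a] lies in L_3, against |L_2 :
    L_3| > p. *)
Lemma elementary_quo a : #|G : 'L_2(G)| = (p ^ 3)%N -> p < #|'L_2(G) : 'L_3(G)| -> a \in G -> a ^+ p \in 'L_2(G).
Proof.
move=> o lt Ga; apply: contraT => nap; pose M1 := ('L_2(G) <*> <[a ^+ p]>)%G.
have i1 : #|G : M1| <= p ^ 2 by apply: index_step nap _; rewrite ?lcn_sub ?o ?groupX.
have sM1 : M1 \subset G by rewrite join_subG lcn_sub cycle_subG groupX.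
(* Modulo L_2 the order of a is a nontrivial power of p, so <a^p> is strictly smaller than <a>. *)
have na1 : a \notin M1.
  apply: contra nap => a1; apply: groupX.
  have : coset 'L_2(G) a \in M1 / 'L_2(G) by rewrite mem_quotient.
  have nL := subsetP (lcn_norm 2 G); have NL := nL a Ga.
  rewrite quotientYidl ?quotient_cycle ?cycle_subG ?groupX // morphX //= -cycle_subG => /subset_leq_card.
  rewrite -!/(#[_]) orderXgcd leqNgt => lt1; apply: (coset_idr NL); apply/eqP; rewrite -order_eq1.
  have /p_natP[[|r] hr] : p.-nat #[coset 'L_2(G) a].
  - by apply: (mem_p_elt (quotient_pgroup 'L_2(G)%G pG)); rewrite mem_quotient.
  - by rewrite hr.
  case/negP: lt1; rewrite hr expnS gcdnC (gcdn_idPl _) ?dvdn_mulr // ltn_Pdiv ?prime_gt1 //.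
  by rewrite muln_gt0 expn_gt0 prime_gt0.
have i2 : #|G : M1 <*> <[a]>| <= p ^ 1 by apply: index_step na1 i1.
pose M := (M1 <*> <[a]>)%G; have sMG : M \subset G by rewrite join_subG sM1 cycle_subG.
have sLM : 'L_2(G) \subset M by rewrite !(subset_trans _ (joing_subl _ _)).
have nMG : M <| G by apply: sub_der1_normal.
have sMa : M \subset cmod [set a] 'L_3(G).
  have nL3 := lcn_norm 3 G.
  have aC : a \in cmod [set a] 'L_3(G) by apply: (cmod_in nL3) => // n /set1P->; rewrite commgg.
  rewrite !join_subG !cycle_subG aC groupX // !andbT; apply/subsetP=> n Ln.
  by apply: (cmod_in nL3); [exact: mem_lcn Ln|move=> m /set1P->; apply: (mem_lcnRl (k := 1))].
have genM (S : {set gT}) : a \in S -> M \subset <<S :|: 'L_2(G)>>.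
  move=> Sa; have aS : a \in <<S :|: 'L_2(G)>> by rewrite mem_gen // inE Sa.
  by rewrite !join_subG !cycle_subG groupX // aS sub_gen // subsetUr.
have L3R u v : u \in 'L_2(G) -> v \in G -> [~ u, v] \in 'L_3(G) by apply: mem_lcnR.
have L3R' u v : u \in 'L_2(G) -> v \in G -> [~ v, u] \in 'L_3(G) by apply: mem_lcnRl.
have [sGM|/avoid1[b Gb nb]] := boolP (G \subset M).
  have : 'L_2(G) \subset 'L_3(G).
    apply: (der_gen (S := [set a] :|: 'L_2(G))); rewrite ?lcn_norm //.
    - by rewrite subUset sub1set Ga lcn_sub.
    - by apply: subset_trans sGM _; apply: genM; rewrite inE.
    move=> s t /setUP[/set1P->|Ls] /setUP[/set1P->|Lt]; first by rewrite commgg group1.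
    - exact: L3R'.
    - exact: L3R.
    - by apply: L3R => //; apply: mem_lcn Lt.
  by rewrite -indexg_eq1 => /eqP e; move: lt; rewrite e ltnNge prime_gt0.
have bM : b ^+ p \in M.
  have nM := normal_norm nMG; have Nb := subsetP nM b Gb.
  have iM : #|G : M| = p.
    have : #|G : M| != 1%N by rewrite indexg_eq1; apply: contra nb => /subsetP; apply.
    have /p_natP[[|[|e]] i] : p.-nat #|G : M| by apply: pnat_dvd (dvdn_indexg _ _) pG.
    - by rewrite i.
    - by rewrite i.
    by move: i2; rewrite i leq_exp2l ?prime_gt1.
  have : coset M b ^+ #|(G / M)%G| = 1 by rewrite expg_cardG ?mem_quotient.
  by rewrite card_quotient // iM -morphX //; apply: coset_idr; apply: groupX.
pose w := [~ b, a]; pose B := ('L_3(G) <*> <[w]>)%G.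
have Lw : w \in 'L_2(G) by apply: mem_lcn2.
have wp : w ^+ p \in 'L_3(G).
  have Gw : w \in G := mem_lcn Lw.
  rewrite cos3_1 ?groupX // cos3X // -cos3Xl // -cos3_R ?groupX // -groupV invgR.
  by have /cmodP[_] := subsetP sMa _ bM; apply; rewrite inE.
have sBL : B \subset 'L_2(G) by rewrite join_subG (lcn_subS 2) cycle_subG.
have wB : w \in B by rewrite (subsetP (joing_subr _ _)) ?cycle_id.
have L3B : {subset 'L_3(G) <= B} by apply/subsetP; apply: joing_subl.
have : 'L_2(G) \subset B.
  apply: (der_gen (S := [set a; b] :|: 'L_2(G))).
  - by apply: (norm_between (k := 1)); rewrite ?joing_subl.
  - by rewrite subUset lcn_sub andbT; apply/subsetP=> u /set2P[]->.
  - have sM' : M \subset <<[set a; b] :|: 'L_2(G)>> by apply: genM; rewrite !inE eqxx.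
    have bS : b \in <<[set a; b] :|: 'L_2(G)>> by rewrite mem_gen // !inE eqxx orbT.
    have i3 : #|G : M <*> <[b]>| <= p ^ 0 by apply: index_step nb i2.
    by apply: subset_trans (index_le1 i3) _; rewrite join_subG sM' cycle_subG.
  move=> s t /setUP[/set2P[]->|Ls] /setUP[/set2P[]->|Lt]; rewrite ?commgg ?group1 ?wB //.
  - by rewrite -groupV invgR.
  - by apply: L3B; apply: L3R'.
  - by apply: L3B; apply: L3R'.
  - by apply: L3B; apply: L3R.
  - by apply: L3B; apply: L3R.
  - by apply: L3B; apply: L3R => //; apply: mem_lcn Lt.
move=> sLB; have le : #|B : 'L_3(G)| <= p.
  by apply: index_cycle_le => //; rewrite (subsetP (lcn_norm 3 G)) // (mem_lcn Lw).
move: lt; rewrite ltnNge (leq_trans _ le) // dvdn_leq ?indexg_gt0 //.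
by rewrite indexSg ?(lcn_subS 2).
Qed.

(** The commutator maps the exterior square of G/L_2, of dimension 3 over F_p, onto L_2/L_3, of
    dimension 2. Its kernel is a line, and in dimension 3 every bivector is decomposable, whence x
    and y. They are found explicitly from a z with [G, z] = L_2 modulo L_3. *)
Lemma coords2 : #|G : 'L_2(G)| = (p ^ 3)%N -> #|'L_2(G) : 'L_3(G)| = (p ^ 2)%N ->
  exists x y z, [/\ x \in G, y \in G, z \in G, [~ x, y] \in 'L_3(G) & G \subset <<[set x; y; z] :|: 'L_2(G)>>].
Proof.
move=> o i2; have lt : p < #|'L_2(G) : 'L_3(G)| by rewrite i2 -{1}(expn1 p) ltn_exp2l ?prime_gt1.
have elem := elementary_quo o lt.
have [|z Gz full] := quotient_full p_pr pG (lcn_normal 3 G).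
  by rewrite card_quotient ?(subset_trans (lcn_sub 2 G) (lcn_norm 3 G)) // i2.
have expL w : w \in 'L_2(G) -> w ^+ p \in 'L_3(G).
  move=> Lw; have [h Gh hw] := full w Lw; have Gw := mem_lcn Lw.
  rewrite cos3_1 ?groupX // cos3X //; move: hw; rewrite cos3_eq ?groupR // => /eqP <-.
  rewrite -cos3Xl // -cos3_R ?groupX //.
  by apply: (mem_lcnR (k := 1)) => //; apply: elem.
have nw3 w : w \in G -> w \in 'N('L_3(G)) by apply/subsetP/lcn_norm.
have [h1 Lh1 nh1] : exists2 h, h \in 'L_2(G) & h \notin 'L_3(G).
  by apply/subsetPn; rewrite -indexg_gt1 (leq_ltn_trans (prime_gt0 p_pr)).
pose B := ('L_3(G) <*> <[h1]>)%G.
have sBL : B \subset 'L_2(G) by rewrite join_subG (lcn_subS 2) cycle_subG.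
have iB : #|B : 'L_3(G)| <= p by apply: index_cycle_le; rewrite ?expL ?nw3 ?(mem_lcn Lh1).
have [h2 Lh2 nh2] : exists2 h, h \in 'L_2(G) & h \notin B.
  apply/subsetPn; apply/negP=> sLB; move: lt; rewrite ltnNge (leq_trans _ iB) //.
  by rewrite dvdn_leq ?indexg_gt0 // indexSg ?(lcn_subS 2).
have nB : G \subset 'N(B) by apply: (norm_between (k := 1)); rewrite ?joing_subl.
have [y1 Gy1 e1] := full _ Lh1; have [y2 Gy2 e2] := full _ Lh2.
have n1 : [~ y1, z] \notin 'L_3(G) by apply: contra nh1 => n1; rewrite -(groupMl _ (groupVr n1)).
have n2 : [~ y2, z] \notin B.
  apply: contra nh2 => n2; rewrite -(groupMl _ (groupVr n2)).
  by rewrite (subsetP (joing_subl _ _)).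
have Lz : z \notin 'L_2(G) by apply: contra n1 => Lz; apply: (mem_lcnRl (k := 1)).
pose M1 := ('L_2(G) <*> <[z]>)%G; pose M2 := (M1 <*> <[y1]>)%G; pose M3 := (M2 <*> <[y2]>)%G.
have cB y : y \in G -> (y \in cmod [set z] B) = ([~ y, z] \in B).
  move=> Gy; apply/idP/idP => [/cmodP[_ /(_ z (set11 z))]|h]; first by rewrite -invgR groupV.
  by apply: (cmod_in nB) => // n /set1P->; rewrite -invgR groupV.
have c3 y : y \in G -> (y \in cmod [set z] 'L_3(G)) = ([~ y, z] \in 'L_3(G)).
  move=> Gy; apply/idP/idP => [/cmodP[_ /(_ z (set11 z))]|h]; first by rewrite -invgR groupV.
  by apply: (cmod_in (lcn_norm 3 G)) => // n /set1P->; rewrite -invgR groupV.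
have sM1 : M1 \subset cmod [set z] 'L_3(G).
  rewrite join_subG cycle_subG c3 // commgg group1 andbT; apply/subsetP=> n Ln.
  by rewrite c3 ?(mem_lcn Ln) // (mem_lcnR (k := 1)).
have s3B : 'L_3(G) \subset B := joing_subl _ _.
have sM2 : M2 \subset cmod [set z] B.
  have hB : h1 \in B by rewrite (subsetP (joing_subr _ _)) ?cycle_id.
  have y1B : [~ y1, z] \in B by rewrite -groupV -(groupMr _ hB) (subsetP s3B).
  rewrite !join_subG !cycle_subG !cB // commgg group1 y1B !andbT; apply/subsetP=> n Ln.
  by rewrite cB ?(mem_lcn Ln) // (subsetP s3B) // (mem_lcnR (k := 1)).
have nM1 : y1 \notin M1 by apply: contra n1 => /(subsetP sM1); rewrite c3.
have nM2 : y2 \notin M2 by apply: contra n2 => /(subsetP sM2); rewrite cB.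
have sG1 : M1 \subset G by rewrite join_subG lcn_sub cycle_subG.
have sG2 : M2 \subset G by rewrite join_subG sG1 cycle_subG.
have i1 : #|G : M1| <= p ^ 2 by apply: index_step Lz _; rewrite ?lcn_sub ?o.
have i3 : #|G : M3| <= p ^ 0 by apply: index_step nM2 _ => //; apply: index_step nM1 i1.
have sGM := index_le1 i3.
have iLB : #|'L_2(G) : B| = p.
  have /p_natP[e ie] : p.-nat #|'L_2(G) : B|.
    by apply: pnat_dvd (dvdn_indexg _ _) (pgroupS (lcn_sub 2 G) pG).
  have /p_natP[f if_] : p.-nat #|B : 'L_3(G)|.
    by apply: pnat_dvd (dvdn_indexg _ _) (pgroupS (subset_trans sBL (lcn_sub 2 G)) pG).
  have := Lagrange_index sBL s3B; rewrite ie if_ i2 -expnD => /eqP; rewrite eqn_exp2l ?prime_gt1 // => /eqP ef.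
  have : f <= 1 by rewrite -(leq_exp2l _ _ (prime_gt1 p_pr)) -if_ expn1.
  have : f != 0.
    have hB : h1 \in B by rewrite (subsetP (joing_subr _ _)) ?cycle_id.
    apply: contra nh1 => /eqP f0; move: if_; rewrite f0 => /eqP; rewrite indexg_eq1 => /subsetP; exact.
  move=> e0 f1; have e1' : e = 1%N.
    by move: e0 f1 ef; clear; lia.
  by rewrite e1' expn1.
have nBL : B <| 'L_2(G) by rewrite /normal sBL (subset_trans (lcn_sub 2 G) nB).
have Ly := mem_lcn2 Gy1 Gy2.
have [j hj] := prime_index_cover p_pr nBL iLB Lh2 nh2 Ly.
have [i hi] : exists i, (h1 ^+ i)^-1 * ((h2 ^+ j)^-1 * [~ y1, y2]) \in 'L_3(G).
  have nn : B \subset 'N('L_3(G)) by apply: subset_trans sBL (subset_trans (lcn_sub 2 G) (lcn_norm 3 G)).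
  have : coset 'L_3(G) ((h2 ^+ j)^-1 * [~ y1, y2]) \in B / 'L_3(G) by rewrite mem_quotient.
  rewrite quotientYidl ?cycle_subG ?nw3 ?(mem_lcn Lh1) // quotient_cycle ?nw3 ?(mem_lcn Lh1) // => /cycleP[i e].
  have GB := subsetP (subset_trans sBL (lcn_sub 2 G)) _ hj.
  by exists i; rewrite cos3_eq ?groupX ?(mem_lcn Lh1) // e cos3X ?(mem_lcn Lh1).
have Gh1 := mem_lcn Lh1; have Gh2 := mem_lcn Lh2.
move: e1 e2; rewrite !cos3_eq ?groupR // => /eqP e1 /eqP e2.
move: hi; rewrite cos3_eq ?groupM ?groupV ?groupX ?groupR // => /eqP hi.
(* Modulo L_3, [y1, y2] = h2^j h1^i with h1 = [y1, z] and h2 = [y2, z]; the factors z^j and z^-i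
   contribute exactly the inverse of this element. *)
exists (y1 * z ^+ j), (y2 * z^-1 ^+ i), z.
have Gz' : z^-1 \in G by rewrite groupV.
have GzX k : z ^+ k \in G by rewrite groupX. have GzX' k : z^-1 ^+ k \in G by rewrite groupX.
have GyM1 : y1 * z ^+ j \in G by rewrite groupM.
have GyM2 : y2 * z^-1 ^+ i \in G by rewrite groupM.
have zz k : [~ z ^+ j, z^-1 ^+ k] = 1.
  by apply/eqP/commgP; apply: commuteX; apply: commute_sym; apply: commuteX; apply: commuteVl.
split=> //.
  rewrite cos3_R // cos3Rl // !cos3Rr // !(cos3Xl, cos3Xr) //.
  have -> : [~ z, z^-1] = 1 by apply/eqP/commgP; apply: commuteV.
  have -> : coset 'L_3(G) [~ y1, z^-1] = (coset 'L_3(G) h1)^-1.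
    by apply: (mulIg (coset 'L_3(G) [~ y1, z])); rewrite -cos3Rr // mulgV commg1 morph1 e1 mulVg.
  have -> : coset 'L_3(G) [~ z, y2] = (coset 'L_3(G) h2)^-1 by rewrite -e2 -cos3V ?groupR // invgR.
  have -> : coset 'L_3(G) [~ y1, y2] = coset 'L_3(G) h2 ^+ j * coset 'L_3(G) h1 ^+ i.
    rewrite -(cos3X i) // hi (cos3M (x := h2 ^- j)) ?groupV ?groupX ?groupR // cos3V ?groupX // (cos3X j) //.
    by rewrite mulKVg.
  have cc : commute (coset 'L_3(G) h1 ^+ i) (coset 'L_3(G) h2 ^+ j).
    by apply: commuteX2; apply: cos3C.
  by rewrite morph1 !expg1n mul1g !expgVn -[X in _ * X * _]cc mulKg mulgV.
have mS u : u \in [set y1 * z ^+ j; y2 * z^-1 ^+ i; z] -> u \in <<[set y1 * z ^+ j; y2 * z^-1 ^+ i; z] :|: 'L_2(G)>>.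
  by move=> Su; rewrite mem_gen // inE Su.
have mz : z \in <<[set y1 * z ^+ j; y2 * z^-1 ^+ i; z] :|: 'L_2(G)>> by rewrite mS // !inE eqxx ?orbT.
have m1 : y1 * z ^+ j \in <<[set y1 * z ^+ j; y2 * z^-1 ^+ i; z] :|: 'L_2(G)>> by rewrite mS // !inE eqxx ?orbT.
have m2 : y2 * z^-1 ^+ i \in <<[set y1 * z ^+ j; y2 * z^-1 ^+ i; z] :|: 'L_2(G)>> by rewrite mS // !inE eqxx ?orbT.
have := groupM m2 (groupVr (groupX i (groupVr mz))); have := groupM m1 (groupVr (groupX j mz)); rewrite !mulgK => m1' m2'.
by apply: subset_trans sGM _; rewrite !join_subG !cycle_subG mz m1' m2' sub_gen ?subsetUr.
Qed.

End Index.

(** * Generating triples and lifting over a last term of order p *)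

Section Triple.
Variables (gT : finGroupType) (G : {group gT}).
Implicit Types (x y z g n m t c d w r s a b u v : gT) (k i j p : nat) (M T B P : {group gT}).

Lemma der_triple x y z B : x \in G -> y \in G -> z \in G -> G \subset <<[set x; y; z] :|: 'L_2(G)>> ->
    'L_3(G) \subset B -> B \subset 'L_2(G) ->
    [~ x, y] \in B -> [~ x, z] \in B -> [~ y, z] \in B -> 'L_2(G) \subset B.
Proof.
move=> Gx Gy Gz defG s3B sB2 xy xz yz.
have inv u v : [~ u, v] \in B -> [~ v, u] \in B by rewrite -invgR groupV.
have sSG : [set x; y; z] \subset G by apply/subsetP=> u /setUP[/set2P[]->|/set1P->].
have R3 u v : u \in 'L_2(G) -> v \in G -> [~ u, v] \in B.
  by move=> Lu Gv; apply: (subsetP s3B); apply: mem_lcnR.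
apply: (der_gen (S := [set x; y; z] :|: 'L_2(G))) => //.
- exact: (norm_between (k := 1)).
- by rewrite subUset sSG lcn_sub.
move=> s t /setUP[Ss|Ls] /setUP[St|Lt].
- by move: Ss St => /setUP[/set2P[]->|/set1P->] /setUP[/set2P[]->|/set1P->];
    rewrite ?commgg ?group1 //; apply: inv.
- by apply: inv; apply: R3; rewrite ?(subsetP sSG).
- by apply: R3; rewrite ?(subsetP sSG).
- by apply: R3 => //; apply: mem_lcn Lt.
Qed.

Lemma lcn3_triple u v x y z P : 'L_4(G) = 1 ->
    'L_2(G) \subset <<[set u; v] :|: 'L_3(G)>> -> G \subset <<[set x; y; z] :|: 'L_2(G)>> ->
    u \in 'L_2(G) -> v \in 'L_2(G) -> x \in G -> y \in G -> z \in G -> P \subset 'L_3(G) ->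
    [~ u, x] \in P -> [~ u, y] \in P -> [~ u, z] \in P ->
    [~ v, x] \in P -> [~ v, y] \in P -> [~ v, z] \in P -> 'L_3(G) \subset P.
Proof.
move=> L4 defL defG Lu Lv Gx Gy Gz sP3 ux uy uz vx vy vz.
have nP : G \subset 'N(P) by apply: (norm_between (k := 2)); rewrite // L4 sub1G.
have abL : abelian 'L_2(G).
  by apply/centsP=> a La b Lb; apply: comm1; apply: (lcn_eq1 L4 (i := 1) (j := 1)).
have GG w : w \in 'L_2(G) -> [~ w, x] \in P -> [~ w, y] \in P -> [~ w, z] \in P -> G \subset cmod [set w] P.
  move=> Lw wx wy wz; apply: subset_trans defG _; rewrite gen_subG subUset; apply/andP; split.
    apply/subsetP=> t /setUP[/set2P[]->|/set1P->]; apply: (cmod_in nP) => // n /set1P-> //.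
  apply/subsetP=> t Lt; apply: (cmod_in nP); first exact: mem_lcn Lt.
  by move=> n /set1P->; rewrite (_ : [~ w, t] = 1) //; apply/eqP/commgP; apply: (centsP abL).
have GL : 'L_2(G) \subset cmod G P.
  apply: subset_trans (defL) _; rewrite gen_subG subUset; apply/andP; split.
    apply/subsetP=> t /set2P[]->; apply: (cmod_in nP); rewrite ?(mem_lcn Lu) ?(mem_lcn Lv) // => n Gn;
      rewrite -groupV invgR.
      by have /cmodP[_] := subsetP (GG u Lu ux uy uz) n Gn; apply; rewrite inE.
    by have /cmodP[_] := subsetP (GG v Lv vx vy vz) n Gn; apply; rewrite inE.
  apply/subsetP=> t Lt; apply: (cmod_in nP); first exact: mem_lcn Lt.
  move=> n Gn; rewrite (_ : [~ n, t] = 1) //; apply/eqP/commgP/commute_sym.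
  by apply: comm1; apply: (lcn_eq1 L4 (i := 2) (j := 0)).
rewrite [in X in X \subset _]lcnSn gen_subG; apply/subsetP=> _ /imset2P[n g Ln Gg ->].
by rewrite -groupV invgR; have /cmodP[_] := subsetP GL n Ln; apply.
Qed.

Lemma cset_last k p x : prime p -> 'L_k.+4(G) = 1 -> #|'L_k.+3(G)| = p -> x \in G ->
  x \notin 'C('L_k.+2(G)) -> 'L_k.+3(G) \subset cset 'L_k.+2(G) x.
Proof.
move=> p_pr L1 o Gx nCx; have [n Ln nn] : exists2 n, n \in 'L_k.+2(G) & [~ n, x] != 1.
  apply/exists_inP; rewrite -negb_forall_in; apply: contra nCx => /forall_inP H.
  by apply/centP=> n Ln; apply/commute_sym/commgP/H.
have Lnx : [~ n, x] \in 'L_k.+3(G) by apply: mem_lcnR.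
apply/subsetP=> t Lt; have [i ->] := prime_card_cover p_pr o Lnx nn Lt.
apply/csetP; exists (n ^+ i); rewrite ?groupX // commXg //; apply: commute_sym; apply: comm1.
by apply: (lcn_eq1 L1 (i := k.+2) (j := 0)); rewrite ?addn0 ?(mem_lcn Ln).
Qed.

Lemma lift_prime k p g x y : prime p -> 'L_k.+4(G) = 1 -> #|'L_k.+3(G)| = p -> x \in G -> y \in G ->
    [~ x, y]^-1 * g \in 'L_k.+3(G) -> x \notin 'C('L_k.+2(G)) \/ y \notin 'C('L_k.+2(G)) ->
  g \in commutators G.
Proof.
move=> p_pr L1 o Gx Gy hg nC.
have id1 z : 1 \in cset 'L_k.+2(G) z by apply/csetP; exists 1; rewrite ?group1 ?comm1g.
suff cov : 'L_k.+3(G) \subset cset 'L_k.+2(G) x * cset 'L_k.+2(G) y.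
  by have := lift_last L1 Gx Gy cov hg; rewrite mulKVg.
case: nC => nC; apply/subsetP=> t Lt; [rewrite -[t]mulg1 | rewrite -[t]mul1g]; apply: mem_mulg => //.
  exact: subsetP (cset_last p_pr L1 o Gx nC) t Lt.
exact: subsetP (cset_last p_pr L1 o Gy nC) t Lt.
Qed.

Lemma last_commutators k p : prime p -> 'L_k.+4(G) = 1 -> #|'L_k.+3(G)| = p ->
  {subset 'L_k.+3(G) <= commutators G}.
Proof.
move=> p_pr L1 o g Lg; have nC : ~~ (G \subset 'C('L_k.+2(G))).
  apply/negP=> cG; have o1 : 'L_k.+3(G) = 1 by rewrite lcnSn commGC; apply/commG1P.
  by move: o (prime_gt1 p_pr); rewrite o1 cards1 => <-.
have [x Gx nCx] := avoid1 nC.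
have /csetP[n Ln <-] := subsetP (cset_last p_pr L1 o Gx nCx) g Lg.
by apply: mem_commutators => //; apply: mem_lcn Ln.
Qed.

End Triple.

Section Class3.
Variables (gT : finGroupType) (p : nat) (G : {group gT}).
Hypotheses (p_pr : prime p) (pG : p.-group G) (oG2 : #|G : 'L_2(G)| = (p ^ 3)%N).
Implicit Types (x y z g n m t c d w r s a b u v : gT) (k i j : nat) (M T B P : {group gT}).

Lemma join_commR_le a b x y B : p < #|'L_2(G) : 'L_3(G)| -> a \in G -> b \in G ->
  'L_3(G) \subset B -> B \subset 'L_2(G) ->
  #|B <*> <[ [~ a, b] ]> : 'L_3(G)| <= p * #|B : 'L_3(G)|.
Proof.
move=> lt Ga Gb s3B sB2; have nB : G \subset 'N(B) by apply: (norm_between (k := 1)).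
apply: index_join_le => //; first by rewrite (subsetP nB) ?groupR.
apply: (subsetP s3B); rewrite cos3_1 ?groupX ?groupR // cos3X ?groupR // -cos3Xl // -cos3_R ?groupX //.
by apply: (mem_lcnR (k := 1)) => //; apply: elementary_quo.
Qed.

(** A central w outside L_2 could be completed to a generating triple w, r, s; only [r, s] would
    survive, and L_3 <[r, s]> has index at most p over L_3. *)
Lemma center_sub_lcn2 : p < #|'L_2(G) : 'L_3(G)| -> 'Z(G) \subset 'L_2(G).
Proof.
move=> lt; apply/subsetP=> w /setIP[Gw /centP cw]; apply: contraT => nw.
have [r [s [Gr Gs defG]]] := complete_triple p_pr pG oG2 Gw nw.
have w1 t : t \in G -> [~ w, t] = 1 by move=> Gt; apply/eqP/commgP/cw.
pose B := ('L_3(G) <*> <[ [~ r, s] ]>)%G.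
have sB : B \subset 'L_2(G) by rewrite join_subG (lcn_subS 2) cycle_subG; apply: mem_lcn2.
have rsB : [~ r, s] \in B by rewrite (subsetP (joing_subr _ _)) ?cycle_id.
have sLB : 'L_2(G) \subset B by apply: (der_triple Gw Gr Gs defG); rewrite ?joing_subl ?w1.
have := join_commR_le w w lt Gr Gs (subxx 'L_3(G)) (lcn_subS 2 G); rewrite indexgg muln1.
rewrite -/(gval B) leqNgt => /negP[]; apply: leq_trans lt _.
by rewrite dvdn_leq ?indexg_gt0 // indexSg ?(lcn_subS 2).
Qed.

End Class3.

Section PowerGen.
Variables (gT : finGroupType) (A : {group gT}).
Hypothesis abA : abelian A.

Lemma expg_gen k (S : {set gT}) (T : {group gT}) : S \subset A -> A \subset <<S>> ->
  {in S, forall s, s ^+ k \in T} -> {in A, forall a, a ^+ k \in T}.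
Proof.
move=> sSA defA hS; have gr : group_set [set a in A | a ^+ k \in T].
  apply/group_setP; split; first by rewrite inE group1 expg1n group1.
  move=> a b /setIdP[Aa ha] /setIdP[Ab hb]; rewrite inE groupM // expgMn ?groupM //.
  exact: (centsP abA).
have sA : A \subset Group gr.
  apply: subset_trans defA _; rewrite gen_subG; apply/subsetP=> s Ss.
  by rewrite inE (subsetP sSA) //= hS.
by move=> a Aa; have /setIdP[] := subsetP sA a Aa.
Qed.

End PowerGen.

(** * Class 3 with L_2/L_3 of order p^3 *)

Section Type31.
Variables (gT : finGroupType) (p : nat) (G : {group gT}).
Hypotheses (p_pr : prime p) (pG : p.-group G) (oG2 : #|G : 'L_2(G)| = (p ^ 3)%N).
Hypotheses (L4 : 'L_4(G) = 1) (o3 : #|'L_3(G)| = p) (i2 : #|'L_2(G) : 'L_3(G)| = (p ^ 3)%N).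
Implicit Types (x y z g n m t c d w r s a b u v : gT) (k i j : nat) (M T B P : {group gT}).

Let lt : p < #|'L_2(G) : 'L_3(G)|.
Proof. by rewrite i2 -{1}(expn1 p) ltn_exp2l ?prime_gt1. Qed.

Lemma abelian_lcn2 : abelian 'L_2(G).
Proof. by apply/centsP=> a La b Lb; apply: comm1; apply: (lcn_eq1 L4 (i := 1) (j := 1)). Qed.

Lemma cent_lcn2_proper : ~~ (G \subset 'C('L_2(G))).
Proof.
apply/negP=> cG; have o1 : 'L_3(G) = 1 by rewrite lcnSn commGC; apply/commG1P.
by move: o3 (prime_gt1 p_pr); rewrite o1 cards1 => <-.
Qed.

(* the obstructing configuration: x, y and L_2(G) generate a maximal subgroup, which centralizes L_2(G) *)
Definition obstruct31 x y z :=
  [/\ [/\ x \in G, y \in G & z \in G], x \in 'C('L_2(G)), y \in 'C('L_2(G)), [~ x, y] \notin 'L_3(G)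
    & G \subset <<[set x; y; z] :|: 'L_2(G)>>].

Lemma cent_gen x y : x \in G -> y \in G -> x \in 'C('L_2(G)) -> y \in 'C('L_2(G)) ->
   x \notin 'L_2(G) -> y \notin 'L_2(G) <*> <[x]> -> #|G : 'L_2(G) <*> <[x]> <*> <[y]>| <= p ^ 1.
Proof.
move=> Gx Gy Cx Cy nx ny; have i1 : #|G : 'L_2(G) <*> <[x]>| <= p ^ 2.
  by apply: (index_step p_pr pG _ Gx nx); rewrite ?lcn_sub ?oG2.
by apply: (index_step p_pr pG _ Gy ny i1); rewrite join_subG lcn_sub cycle_subG.
Qed.

Lemma obstruct31_z x y : x \in G -> y \in G -> x \in 'C('L_2(G)) -> y \in 'C('L_2(G)) ->
  x \notin 'L_2(G) -> y \notin 'L_2(G) <*> <[x]> -> exists2 z, z \in G & G \subset <<[set x; y; z] :|: 'L_2(G)>>.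
Proof.
move=> Gx Gy Cx Cy nx ny; have i2' := cent_gen Gx Gy Cx Cy nx ny.
have [z Gz nCz] := avoid1 cent_lcn2_proper; exists z => //.
apply: subset_trans (triple_gen x y z 'L_2(G)%G); apply: (index_le1 (p := p)).
apply: (index_step p_pr pG _ Gz _ i2'); first by rewrite !join_subG !cycle_subG lcn_sub Gx.
apply: contra nCz; apply: subsetP; rewrite !join_subG !cycle_subG Cx Cy !andbT; exact: abelian_lcn2.
Qed.

(** Elements of L_3 are commutators by [last_commutators], and G/L_3 falls under the order p^3 case.
    A pair representing g modulo L_3 lifts as soon as one entry does not centralize L_2, so a
    failure produces two centralizing entries with [x, y] outside L_3. *)
Lemma commutators_31 : commutators G <> 'L_2(G) -> exists x y z, obstruct31 x y z.
Proof.
move=> neq; have [ex|none] := boolP [exists x in G, [exists y in G,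
   [&& x \in 'C('L_2(G)), y \in 'C('L_2(G)) & [~ x, y] \notin 'L_3(G)]]].
  have /exists_inP[x Gx /exists_inP[y Gy /and3P[Cx Cy nxy]]] := ex.
  have [||z Gz defG] := obstruct31_z Gx Gy Cx Cy; last by exists x, y, z.
    by apply: contra nxy => Lx; apply: (mem_lcnR (k := 1)).
  apply: contra nxy => My; have : 'L_2(G) <*> <[x]> \subset cmod [set x] 'L_3(G).
    rewrite join_subG cycle_subG; apply/andP; split.
      apply/subsetP=> n Ln; apply: (cmod_in (lcn_norm 3 G)); first exact: mem_lcn Ln.
      by move=> m /set1P->; apply: (mem_lcnRl (k := 1)).
    by apply: (cmod_in (lcn_norm 3 G)) => // m /set1P->; rewrite commgg.
  by move/subsetP/(_ y My)/cmodP=> [_]; apply; rewrite inE.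
case: neq; apply: commutators_full => g Lg; have Gg := mem_lcn Lg.
have [Lg3|nLg3] := boolP (g \in 'L_3(G)); first exact: (last_commutators p_pr L4 o3).
have nL3 := lcn_normal 3 G; have K3 : commutators (G / 'L_3(G)) = 'L_2(G / 'L_3(G)).
  apply: (commutators_p3 p_pr (quotient_pgroup _ pG)).
  by rewrite lcn_quo // card_quotient ?(subset_trans (lcn_sub 2 G) (lcn_norm 3 G)) // i2.
have : coset 'L_3(G) g \in commutators (G / 'L_3(G)) by rewrite K3 lcn_quo ?mem_quotient.
case/(commutators_quo nL3 Gg)=> x [y [Gx Gy e]].
have e' : [~ x, y]^-1 * g \in 'L_3(G) by rewrite -groupV invMg invgK.
apply: (lift_prime p_pr L4 o3 Gx Gy e'); apply/orP; rewrite -negb_and; apply: contra none => /andP[Cx Cy].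
apply/exists_inP; exists x => //; apply/exists_inP; exists y => //; rewrite Cx Cy /=.
by apply: contra nLg3 => Lxy; rewrite -(groupMl _ (groupVr Lxy)).
Qed.

(** Z(G) has index p in L_2, so the centralizer of L_2 is that of a single n and has index at most
    p; it contains x, y independent modulo L_2. If they commuted modulo L_3, L_2/L_3 would be
    generated by two elements of order dividing p. *)
Lemma obstruct31_center : #|'Z(G)| = (p ^ 3)%N -> exists x y z, obstruct31 x y z.
Proof.
move=> oZ; have sZL := center_sub_lcn2 p_pr pG oG2 lt; have abL := abelian_lcn2.
have o2 : #|'L_2(G)| = (p ^ 4)%N by rewrite -(Lagrange (lcn_subS 2 G)) o3 i2 -expnS.
have iZ : #|'L_2(G) : 'Z(G)| = p.
  by apply/eqP; rewrite -(eqn_pmul2l (cardG_gt0 'Z(G))) Lagrange // oZ o2 -expnSr.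
have [n Ln nZn] : exists2 n, n \in 'L_2(G) & n \notin 'Z(G).
  by apply/subsetPn; rewrite -indexg_gt1 iZ prime_gt1.
have nZL : 'Z(G) <| 'L_2(G) by rewrite -sub_abelian_normal.
pose C := 'C_G[n]%G; have sCG : C \subset G := subsetIl _ _.
have sCC : C \subset 'C('L_2(G)).
  rewrite centsC; apply: (prime_index_gen p_pr nZL iZ Ln nZn).
    by rewrite centsC; apply: subset_trans sCG _; rewrite centsC subsetIr.
  by apply/centP=> c /setIP[_ /cent1P cn]; apply: commute_sym.
have iC : #|G : C| <= p.
  rewrite -card_cset -o3; apply: subset_leq_card; apply/subsetP=> _ /csetP[m Gm <-].
  exact: (mem_lcnRl (k := 1)).
have sLC : 'L_2(G) \subset C.
  by rewrite subsetI lcn_sub /=; apply: subset_trans abL _; rewrite -cent_set1 centS // sub1set.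
have iCL : p < #|C : 'L_2(G)|.
  rewrite ltnNge; apply/negP=> le; have := Lagrange_index sCG sLC; rewrite oG2 => e.
  have : p ^ 3 <= p * p by rewrite -e leq_mul.
  by rewrite mulnn leq_exp2l ?prime_gt1.
have [x Cx nx] : exists2 x, x \in C & x \notin 'L_2(G).
  by apply/subsetPn; rewrite -indexg_gt1 (leq_ltn_trans (prime_gt0 p_pr)).
have Gx := subsetP sCG x Cx.
have [y Cy ny] : exists2 y, y \in C & y \notin 'L_2(G) <*> <[x]>.
  apply/subsetPn; apply/negP=> sC; move: iCL; rewrite ltnNge => /negP[].
  apply: leq_trans (index_cycle_le p_pr (subsetP (lcn_norm 2 G) x Gx) (elementary_quo p_pr pG oG2 lt Gx)).
  by rewrite dvdn_leq ?indexg_gt0 // indexSg.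
have Gy := subsetP sCG y Cy; have cx := subsetP sCC x Cx; have cy := subsetP sCC y Cy.
have [z Gz defG] := obstruct31_z Gx Gy cx cy nx ny.
exists x, y, z; split=> //; apply/negP=> Lxy.
pose B1 := ('L_3(G) <*> <[ [~ x, z] ]>)%G; pose B := (B1 <*> <[ [~ y, z] ]>)%G.
have s1 : B1 \subset 'L_2(G) by rewrite join_subG (lcn_subS 2) cycle_subG; apply: mem_lcn2.
have s2 : B \subset 'L_2(G) by rewrite join_subG s1 cycle_subG; apply: mem_lcn2.
have t1 : 'L_3(G) \subset B1 := joing_subl _ _.
have t2 : B1 \subset B := joing_subl _ _.
have sLB : 'L_2(G) \subset B.
  apply: (der_triple Gx Gy Gz defG); rewrite ?(subset_trans t1) //.
  - by apply: (subsetP t2); apply: (subsetP t1).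
  - by apply: (subsetP t2); rewrite (subsetP (joing_subr _ _)) ?cycle_id.
  - by rewrite (subsetP (joing_subr _ _)) ?cycle_id.
have j1 := join_commR_le p_pr pG oG2 x x lt Gx Gz (subxx 'L_3(G)) (lcn_subS 2 G).
have j2 := join_commR_le p_pr pG oG2 x x lt Gy Gz t1 s1.
have : #|'L_2(G) : 'L_3(G)| <= p ^ 2.
  apply: (@leq_trans #|B : 'L_3(G)|); first by rewrite dvdn_leq ?indexg_gt0 // indexSg ?(lcn_subS 2).
  by apply: leq_trans j2 _; rewrite -mulnn leq_mul2l orbC; move: j1; rewrite indexgg muln1 => ->.
by rewrite i2 leq_exp2l ?prime_gt1.
Qed.

Section Obstruct31.
Variables (x y z : gT).
Hypothesis obs : obstruct31 x y z.

Let C := ('L_2(G) <*> <[x]> <*> <[y]>)%G.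

Let Gx : x \in G. Proof. by case: obs => -[]. Qed.
Let Gy : y \in G. Proof. by case: obs => -[]. Qed.
Let Gz : z \in G. Proof. by case: obs => -[]. Qed.

Lemma ob_cent : C \subset 'C('L_2(G)).
Proof. by case: obs => _ Cx Cy _ _; rewrite !join_subG !cycle_subG Cx Cy !andbT; apply: abelian_lcn2. Qed.

Lemma ob_sub : C \subset G.
Proof. by rewrite !join_subG !cycle_subG lcn_sub Gx Gy. Qed.

Lemma ob_nz : z \notin 'C('L_2(G)).
Proof.
case: obs => _ Cx Cy _ defG; apply: contra cent_lcn2_proper => Cz.
apply: subset_trans defG _; rewrite gen_subG subUset; apply/andP; split; last exact: abelian_lcn2.
by apply/subsetP=> u /setUP[/set2P[]->|/set1P->].
Qed.

(** The center is the centralizer of z in L_2, whose index in L_2 is |[L_2, z]| = |L_3| = p. *)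
Lemma card_center_31 : #|'Z(G)| = (p ^ 3)%N.
Proof.
have sZL := center_sub_lcn2 p_pr pG oG2 lt; case: obs => _ Cx Cy _ defG.
have o2 : #|'L_2(G)| = (p ^ 4)%N by rewrite -(Lagrange (lcn_subS 2 G)) o3 i2 -expnS.
have eC : cset 'L_2(G) z = 'L_3(G).
  by apply/eqP; rewrite eqEsubset (cset_sub_lcn 1 Gz) (cset_last p_pr L4 o3 Gz ob_nz).
have eZ : 'Z(G) = 'C_('L_2(G))[z].
  apply/eqP; rewrite eqEsubset; apply/andP; split; apply/subsetP=> w.
    by move=> Zw; rewrite inE (subsetP sZL) //=; move/setIP: Zw => [_ /centP/(_ z Gz) cw]; apply/cent1P.
  case/setIP=> Lw /cent1P cw; apply/setIP; split; first exact: mem_lcn Lw.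
  suff : G \subset 'C[w] by rewrite -cent_set1 centsC sub1set.
  apply: subset_trans defG _; rewrite gen_subG subUset; apply/andP; split.
    apply/subsetP=> u /setUP[/set2P[]->|/set1P->]; apply/cent1P; [exact: (centP Cx)|exact: (centP Cy)|].
    exact: commute_sym.
  by apply/subsetP=> m Lm; apply/cent1P; apply: (centsP abelian_lcn2).
have := card_cset 'L_2(G) z; rewrite eC o3 -eZ => iZ.
have := Lagrange sZL; rewrite -iZ o2 => e.
by apply/eqP; rewrite -(eqn_pmul2r (prime_gt0 p_pr)) e -expnSr.
Qed.

Lemma ob_comm_exp : [~ x, y] ^+ p = 1.
Proof.
case: obs => _ Cx Cy _ _; have Lxy := mem_lcn2 Gx Gy.
rewrite -commXg; last by apply: (centP Cx).
by apply/eqP/commgP/commute_sym; apply: (centP Cy); apply: elementary_quo.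
Qed.

Lemma ob_comm : [~: C, C] \subset <[ [~ x, y] ]>.
Proof.
case: obs => _ Cx Cy _ _; have Lxy := mem_lcn2 Gx Gy.
have inv u v : u \in 'L_2(G) -> v \in 'C('L_2(G)) -> [~ u, v] = 1 /\ [~ v, u] = 1.
  by move=> Lu /centP/(_ u Lu) cv; split; apply/eqP/commgP => //; apply: commute_sym.
have sLC : 'L_2(G) \subset 'C('L_2(G)) := abelian_lcn2.
apply: (@der_gen _ C ([set x; y] :|: 'L_2(G)) <[ [~ x, y] ]>%G).
- by apply/cents_norm/(subset_trans ob_cent); rewrite centS // cycle_subG.
- have s1 := joing_subl 'L_2(G) <[x]>; have s2 := joing_subl ('L_2(G) <*> <[x]>) <[y]>.
  rewrite subUset (subset_trans s1 s2) andbT; apply/subsetP=> u /set2P[]->.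
    by rewrite (subsetP s2) // (subsetP (joing_subr _ _)) ?cycle_id.
  by rewrite (subsetP (joing_subr _ _)) ?cycle_id.
- by rewrite !join_subG !cycle_subG sub_gen ?subsetUr ?mem_gen // !inE eqxx ?orbT.
move=> s t /setUP[/set2P[]->|Ls] /setUP[/set2P[]->|Lt]; rewrite ?commgg ?group1 ?cycle_id //.
- by have [_ ->] := inv t x Lt Cx; rewrite group1.
- by rewrite -groupV invgR cycle_id.
- by have [_ ->] := inv t y Lt Cy; rewrite group1.
- by have [-> _] := inv s x Ls Cx; rewrite group1.
- by have [-> _] := inv s y Ls Cy; rewrite group1.
by have [-> _] := inv s t Ls (subsetP sLC t Lt); rewrite group1.
Qed.

(** Otherwise Y, completed by some Y' of [C] and by X, generates G modulo L_2; as [Y, Y'] is a power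
    of [x, y], the factor L_2/L_3 would be generated by [X, Y] and [Y', X] alone. *)
Lemma ob_not_comm X Y : X \in G -> X \notin C -> Y \in C ->
  [~ x, y] \notin 'L_3(G) <*> <[ [~ X, Y] ]>.
Proof.
case: obs => _ Cx Cy nxy _ GX nX CY; apply/negP=> h.
have GY := subsetP ob_sub Y CY.
pose B0 := ('L_3(G) <*> <[ [~ X, Y] ]>)%G.
have nY : Y \notin 'L_2(G).
  apply: contra nxy => LY; apply: subsetP h; rewrite join_subG subxx cycle_subG /=.
  exact: (mem_lcnRl (k := 1)).
have i1 : #|G : 'L_2(G) <*> <[Y]>| <= p ^ 2.
  by apply: (index_step p_pr pG _ GY nY); rewrite ?lcn_sub ?oG2.
have nx : x \notin 'L_2(G) by apply: contra nxy => Lx; apply: (mem_lcnR (k := 1)).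
have ny : y \notin 'L_2(G) <*> <[x]>.
  apply: contra nxy => My; have : 'L_2(G) <*> <[x]> \subset cmod [set x] 'L_3(G).
    rewrite join_subG cycle_subG; apply/andP; split.
      apply/subsetP=> n Ln; apply: (cmod_in (lcn_norm 3 G)); first exact: mem_lcn Ln.
      by move=> m /set1P->; apply: (mem_lcnRl (k := 1)).
    by apply: (cmod_in (lcn_norm 3 G)) => // m /set1P->; rewrite commgg.
  by move/subsetP/(_ y My)/cmodP=> [_]; apply; rewrite inE.
have iC : #|G : C| <= p ^ 1 by apply: cent_gen.
have sLC : 'L_2(G) \subset C by rewrite !(subset_trans _ (joing_subl _ _)).
have iCL : p < #|C : 'L_2(G)|.
  rewrite ltnNge; apply/negP=> le; have := Lagrange_index ob_sub sLC; rewrite oG2 => e.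
  have : p ^ 3 <= p * p by rewrite -e leq_mul // -{2}(expn1 p).
  by rewrite mulnn leq_exp2l ?prime_gt1.
have [Y' CY' nY'] : exists2 Y', Y' \in C & Y' \notin 'L_2(G) <*> <[Y]>.
  apply/subsetPn; apply/negP=> sC; move: iCL; rewrite ltnNge => /negP[].
  apply: leq_trans (index_cycle_le p_pr (subsetP (lcn_norm 2 G) Y GY) (elementary_quo p_pr pG oG2 lt GY)).
  by rewrite dvdn_leq ?indexg_gt0 // indexSg.
have GY' := subsetP ob_sub Y' CY'.
have i3 : #|G : 'L_2(G) <*> <[Y]> <*> <[Y']>| <= p ^ 1.
  by apply: (index_step p_pr pG _ GY' nY' i1); rewrite join_subG lcn_sub cycle_subG.
have sYC : 'L_2(G) <*> <[Y]> <*> <[Y']> \subset C by rewrite !join_subG sLC !cycle_subG CY.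
have i4 : #|G : 'L_2(G) <*> <[Y]> <*> <[Y']> <*> <[X]>| <= p ^ 0.
  apply: (index_step p_pr pG _ GX _ i3); first exact: subset_trans sYC ob_sub.
  by apply: contra nX; apply: subsetP.
have defG : G \subset <<[set Y; Y'; X] :|: 'L_2(G)>>.
  exact: subset_trans (index_le1 i4) (triple_gen Y Y' X 'L_2(G)%G).
pose B := (B0 <*> <[ [~ Y', X] ]>)%G.
have sB0 : B0 \subset 'L_2(G) by rewrite join_subG (lcn_subS 2) cycle_subG; apply: mem_lcn2.
have sB : B \subset 'L_2(G) by rewrite join_subG sB0 cycle_subG; apply: mem_lcn2.
have t0 : 'L_3(G) \subset B0 := joing_subl _ _.
have t1 : B0 \subset B := joing_subl _ _.
have sLB : 'L_2(G) \subset B.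
  apply: (der_triple GY GY' GX defG); rewrite ?(subset_trans t0) //.
  - apply: (subsetP t1); have : [~ Y, Y'] \in <[ [~ x, y] ]> by apply: (subsetP ob_comm); apply: mem_commg.
    by apply: subsetP; rewrite cycle_subG.
  - by apply: (subsetP t1); rewrite -groupV invgR (subsetP (joing_subr _ _)) ?cycle_id.
  - by rewrite (subsetP (joing_subr _ _)) ?cycle_id.
have j1 := join_commR_le p_pr pG oG2 x x lt GX GY (subxx 'L_3(G)) (lcn_subS 2 G).
have j2 := join_commR_le p_pr pG oG2 x x lt GY' GX t0 sB0.
have : #|'L_2(G) : 'L_3(G)| <= p ^ 2.
  apply: (@leq_trans #|B : 'L_3(G)|); first by rewrite dvdn_leq ?indexg_gt0 // indexSg ?(lcn_subS 2).
  by apply: leq_trans j2 _; rewrite -mulnn leq_mul2l orbC; move: j1; rewrite indexgg muln1 => ->.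
by rewrite i2 leq_exp2l ?prime_gt1.
Qed.

(** The element [x, y] t with t nontrivial in L_3 is missed. Of two entries outside [C], one is
    brought into [C] by dividing by a power of the other; exactly one entry outside contradicts
    [ob_not_comm]; two entries inside give a power of [x, y], and <[x, y]>, of order p, meets L_3
    trivially. *)
Lemma ob_not_full : commutators G <> 'L_2(G).
Proof.
have nxy : [~ x, y] \notin 'L_3(G) by case: obs.
have [t Lt nt] : exists2 t, t \in 'L_3(G) & t != 1.
  by apply/trivgPn; rewrite -cardG_gt1 o3 prime_gt1.
move=> eK; have : [~ x, y] * t \in commutators G.
  by rewrite eK groupM ?mem_lcn2 // (mem_lcn_leq (isT : 2 <= 3)).
case/commutatorsP=> X [Y [GX GY e]].
have bad U V : U \in G -> U \notin C -> V \in C ->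
    [~ U, V] = [~ x, y] * t \/ [~ U, V] = ([~ x, y] * t)^-1 -> False.
  move=> GU nU CV eUV; case/negP: (ob_not_comm GU nU CV).
  have tB : t \in 'L_3(G) <*> <[ [~ U, V] ]> by apply: (subsetP (joing_subl _ _)).
  rewrite -(groupMr _ tB); have : [~ U, V] \in 'L_3(G) <*> <[ [~ U, V] ]>.
    by rewrite (subsetP (joing_subr _ _)) ?cycle_id.
  by case: eUV => {1}->; rewrite ?groupV.
have [CX|nX] := boolP (X \in C); last first.
  have [CY|nY] := boolP (Y \in C); first by apply: (bad X Y) => //; left.
  have iC : #|G : C| = p.
    have : #|G : C| != 1%N by rewrite indexg_eq1; apply: contra nX => /subsetP; apply.
    have nx : x \notin 'L_2(G) by apply: contra nxy => Lx; apply: (mem_lcnR (k := 1)).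
    have ny : y \notin 'L_2(G) <*> <[x]>.
      apply: contra nxy => My; have : 'L_2(G) <*> <[x]> \subset cmod [set x] 'L_3(G).
        rewrite join_subG cycle_subG; apply/andP; split.
          apply/subsetP=> n Ln; apply: (cmod_in (lcn_norm 3 G)); first exact: mem_lcn Ln.
          by move=> m /set1P->; apply: (mem_lcnRl (k := 1)).
        by apply: (cmod_in (lcn_norm 3 G)) => // m /set1P->; rewrite commgg.
      by move/subsetP/(_ y My)/cmodP=> [_]; apply; rewrite inE.
    have : #|G : C| <= p ^ 1 by case: obs => _ Cx Cy _ _; apply: cent_gen.
    have /p_natP[[|[|k]] ->] : p.-nat #|G : C| by apply: pnat_dvd (dvdn_indexg _ _) pG.
    - by [].
    - by [].
    by rewrite leq_exp2l ?prime_gt1.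
  have nC : C <| G.
    by apply: sub_der1_normal ob_sub; rewrite !(subset_trans _ (joing_subl _ _)).
  have [i hi] := prime_index_cover p_pr nC iC GX nX GY.
  apply: (bad X ((X ^+ i)^-1 * Y) GX nX hi); left; rewrite -e.
  rewrite -{2}(mulKVg (X ^+ i) Y) [RHS]commgMJ.
  have -> : [~ X, X ^+ i] = 1 by apply/eqP/commgP; apply: commuteX.
  by rewrite conj1g mulg1.
have [CY|nY] := boolP (Y \in C); last first.
  by apply: (bad Y X GY nY CX); right; rewrite -e invgR.
have : [~ X, Y] \in <[ [~ x, y] ]> by apply: (subsetP ob_comm); apply: mem_commg.
rewrite e groupMl ?cycle_id // => tc; case: (negP nxy).
have o1 : #|<[ [~ x, y] ]>| = p.
  apply: nt_prime_order => //; first exact: ob_comm_exp.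
  by apply: contra nxy => /eqP->; apply: group1.
have [i ->] := prime_card_cover p_pr o1 tc nt (cycle_id _).
by rewrite groupX.
Qed.

Lemma ob_gen : 'L_2(G) \subset <<[set [~ x, y]; [~ z, x]; [~ z, y]] :|: 'L_3(G)>>.
Proof.
case: obs => _ _ _ _ defG; set S := (_ :|: _); have mS s : s \in S -> s \in <<S>> by apply: mem_gen.
have sS : S \subset 'L_2(G).
  rewrite subUset (lcn_subS 2) andbT.
  by apply/subsetP=> u /setUP[/set2P[]->|/set1P->]; apply: mem_lcn2.
apply: (der_triple Gx Gy Gz defG).
- by rewrite sub_gen // subsetUr.
- by rewrite gen_subG.
- by apply: mS; rewrite !inE eqxx.
- by rewrite -groupV invgR; apply: mS; rewrite !inE eqxx ?orbT.
- by rewrite -groupV invgR; apply: mS; rewrite !inE eqxx ?orbT.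
Qed.

Lemma ob_gen_sub : [set [~ x, y]; [~ z, x]; [~ z, y]] :|: 'L_3(G) \subset 'L_2(G).
Proof.
rewrite subUset (lcn_subS 2) andbT.
by apply/subsetP=> u /setUP[/set2P[]->|/set1P->]; apply: mem_lcn2.
Qed.

(** For w = x and w = y, the cube z^3 lies in L_2 and commutes with w. In the cube formula the
    middle term is a cube in L_3, of order 3, and the last one vanishes in class 3, leaving [z, w]^3
    = 1. *)
Lemma ob_abelem : p = 3 -> p.-abelem 'L_2(G).
Proof.
move=> p3; apply/abelemP=> //; split; first exact: abelian_lcn2.
have L3p t : t \in 'L_3(G) -> t ^+ p = 1 by move=> Lt; rewrite -o3 expg_cardG.
have cube w : w \in G -> w \in 'C('L_2(G)) -> [~ z, w] ^+ 3 = 1.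
  move=> Gw Cw; have Lzw := mem_lcn2 Gz Gw; have Ld : [~ z, w, z] \in 'L_3(G) by apply: (mem_lcnR (k := 1)).
  have := comm_cube_abelian abelian_lcn2 (subsetP (lcn_norm 2 G) z Gz) Lzw.
  have -> : [~ z ^+ 3, w] = 1.
    by apply/eqP/commgP/commute_sym; apply: (centP Cw); rewrite -p3; apply: elementary_quo.
  rewrite (_ : [~ z, w, z] ^+ 3 = 1) ?mulg1; last by rewrite -p3 L3p.
  by rewrite (lcn_eq1 L4 (i := 2) (j := 0) isT Ld Gz) mulg1 => <-.
have Cx : x \in 'C('L_2(G)) by case: obs. have Cy : y \in 'C('L_2(G)) by case: obs.
have := @expg_gen _ _ abelian_lcn2 p _ 1%G ob_gen_sub ob_gen.
move=> H u Lu; apply/set1P; apply: H => // s /setUP[/setUP[/set2P[]->|/set1P->]|Ls]; apply/set1P.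
- exact: ob_comm_exp.
- by rewrite p3 cube.
- by rewrite p3 cube.
- exact: L3p.
Qed.

Lemma Phi_sub_lcn3 : {in 'L_2(G), forall n, n ^+ p \in 'L_3(G)} -> 'Phi('L_2(G)) \subset 'L_3(G).
Proof.
move=> h; have nn : 'L_2(G) \subset 'N('L_3(G)) := subset_trans (lcn_sub 2 G) (lcn_norm 3 G).
apply: (Phi_min (pgroupS (lcn_sub 2 G) pG) nn).
apply/abelemP => //; split; first by rewrite quotient_abelian ?abelian_lcn2.
by move=> _ /morphimP[n Nn Ln ->]; rewrite -morphX //= coset_id ?h.
Qed.

(** For w = x and w = y, [z^2, w] = 1 reads [z, w]^2 = [z, w, z]^-1, so the squares of L_2 lie in
    L_3, of order 2. They are not all trivial, or z would centralize [z, x], [z, y] and, by Jacobi,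
    [x, y]. *)
Lemma ob_Phi2 : p = 2 -> #|'Phi('L_2(G))| = 2.
Proof.
move=> p2; have Cx : x \in 'C('L_2(G)) by case: obs. have Cy : y \in 'C('L_2(G)) by case: obs.
have sq w : w \in G -> w \in 'C('L_2(G)) -> [~ z, w] ^+ 2 * [~ z, w, z] = 1.
  move=> Gw Cw; rewrite -(comm_sq_abelian abelian_lcn2 (subsetP (lcn_norm 2 G) z Gz) (mem_lcn2 Gz Gw)).
  by apply/eqP/commgP/commute_sym; apply: (centP Cw); have := elementary_quo p_pr pG oG2 lt Gz; rewrite p2.
have R3 w : w \in G -> [~ z, w, z] \in 'L_3(G) by move=> Gw; apply: (mem_lcnR (k := 1)) => //; apply: mem_lcn2.
have sqV w : w \in G -> w \in 'C('L_2(G)) -> [~ z, w] ^+ 2 = [~ z, w, z]^-1.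
  by move=> Gw Cw; apply/eqP; rewrite eq_mulgV1 invgK sq.
have sub : 'Phi('L_2(G)) \subset 'L_3(G).
  apply: Phi_sub_lcn3; apply: (expg_gen abelian_lcn2 ob_gen_sub ob_gen).
  move=> s /setUP[/setUP[/set2P[]->|/set1P->]|Ls]; last exact: groupX.
  - by rewrite ob_comm_exp group1.
  - by rewrite p2 sqV // groupV R3.
  - by rewrite p2 sqV // groupV R3.
have nt : 'Phi('L_2(G)) != 1.
  rewrite (trivg_Phi (pgroupS (lcn_sub 2 G) pG)); apply/negP=> /(abelemP p_pr)[_ exp1].
  have c1 w : w \in G -> w \in 'C('L_2(G)) -> [~ z, w, z] = 1.
    by move=> Gw Cw; apply/eqP; rewrite -eq_invg1 -sqV // -p2 exp1 // mem_lcn2.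
  case/negP: (ob_nz); apply/centP=> n Ln; apply: commute_sym.
  suff : 'L_2(G) \subset 'C[z] by move/subsetP/(_ n Ln)/cent1P.
  apply: subset_trans ob_gen _; rewrite gen_subG; apply/subsetP=> s Ss; apply/cent1P; apply: comm1.
  move: Ss => /setUP[/setUP[/set2P[]->|/set1P->]|Ls]; rewrite ?c1 //.
    have := jacobi3 L4 Gx Gy Gz; have -> : [~ z, x, y] = 1.
      by apply/eqP/commgP/commute_sym; apply: (centP Cy); apply: mem_lcn2.
    have -> : [~ y, z, x] = 1.
      by apply/eqP/commgP/commute_sym; apply: (centP Cx); apply: mem_lcn2.
    by rewrite !mulg1.
  exact: (lcn_eq1 L4 (i := 2) (j := 0)).
have [_ _ [k e]] := pgroup_pdiv (pgroupS (subset_trans sub (lcn_sub 3 G)) pG) nt.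
apply/eqP; rewrite eqn_leq; apply/andP; split.
  by rewrite (leq_trans (subset_leq_card sub)) // o3 p2.
by rewrite e p2 -{1}(expn1 2) leq_exp2l.
Qed.

End Obstruct31.
End Type31.

Lemma mem_expg_coprime (gT : finGroupType) (A : {group gT}) p i (x : gT) :
  prime p -> ~~ (p %| i) -> x ^+ p \in A -> x ^+ i \in A -> x \in A.
Proof.
move=> p_pr ni xp xi; have [m hm] := prime_modinv 1 p_pr ni; move: hm; rewrite expn1 => hm.
have : x ^+ (i * m) \in A by rewrite expgM groupX.
rewrite (divn_eq (i * m) p) hm modn_small ?prime_gt1 // expgD [(_ * p)%N]mulnC expgM. by rewrite groupMl; [ | apply: groupX].
Qed.

Lemma proper_p2_cycle (gT : finGroupType) p (P L : {group gT}) a : prime p -> P \subset L -> #|L| = (p ^ 2)%N ->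
  ~~ (L \subset P) -> a \in P -> a != 1 -> P \subset <[a]>.
Proof.
move=> p_pr sPL oL nLP Pa na; have pL : p.-group L by rewrite /pgroup oL pnatX pnat_id.
have ltP : #|P| < p ^ 2 by rewrite -oL proper_card // properE sPL.
have pP := pgroupS sPL pL; have sa : <[a]> \subset P by rewrite cycle_subG.
have [k e] := p_natP pP; have [j e'] := p_natP (pgroupS sa pP).
have j0 : 0 < j by move: na; rewrite -cycle_eq1 -cardG_gt1 e'; case: (j).
suff : <[a]>%G == P by move/eqP=> <-.
rewrite -val_eqE eqEcard sa /= e e' leq_exp2l ?prime_gt1 //.
by apply: leq_trans j0; rewrite -ltnS -(ltn_exp2l k 2 (prime_gt1 p_pr)) -e.
Qed.

(** * Class 3 with L_2/L_3 of order p^2 *)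

Section Frame22.
Variables (gT : finGroupType) (p : nat) (G : {group gT}).
Hypotheses (p_pr : prime p) (pG : p.-group G) (oG2 : #|G : 'L_2(G)| = (p ^ 3)%N).
Hypotheses (i2 : #|'L_2(G) : 'L_3(G)| = (p ^ 2)%N).
Implicit Types (x y z g n m t c d w r s a b u v : gT) (k i j : nat) (M T B P : {group gT}).

Let lt : p < #|'L_2(G) : 'L_3(G)|.
Proof. by rewrite i2 -{1}(expn1 p) ltn_exp2l ?prime_gt1. Qed.

Definition frame22 x y z :=
  [/\ x \in G, y \in G, z \in G, [~ x, y] \in 'L_3(G) & G \subset <<[set x; y; z] :|: 'L_2(G)>>].

Lemma frame22_gen x y z : frame22 x y z -> 'L_2(G) \subset <<[set [~ x, z]; [~ y, z]] :|: 'L_3(G)>>.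
Proof.
case=> Gx Gy Gz xy defG; set S := _ :|: _; have mS s : s \in S -> s \in <<S>> by apply: mem_gen.
apply: (der_triple Gx Gy Gz defG).
- by rewrite sub_gen // subsetUr.
- rewrite gen_subG subUset (lcn_subS 2) andbT; apply/subsetP=> u /set2P[]->; exact: mem_lcn2.
- by apply: mS; rewrite inE xy orbT.
- by apply: mS; rewrite !inE eqxx.
- by apply: mS; rewrite !inE eqxx orbT.
Qed.

Lemma frame22_coord0 x y z n : frame22 x y z -> n \in 'L_2(G) ->
  exists i j, ([~ x, z] ^+ i * [~ y, z] ^+ j)^-1 * n \in 'L_3(G).
Proof.
move=> fr Ln; have [Gx Gy Gz _ _] := fr; have u2 := mem_lcn2 Gx Gz; have v2 := mem_lcn2 Gy Gz.
pose Q1 := ('L_3(G) <*> <[ [~ x, z] ]>)%G.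
have s1 : Q1 \subset 'L_2(G) by rewrite join_subG (lcn_subS 2) cycle_subG.
have n1 : G \subset 'N(Q1) by apply: (norm_between (k := 1)); rewrite ?joing_subl.
have nu : <[ [~ x, z] ]> \subset 'N('L_3(G)) by rewrite cycle_subG (subsetP (lcn_norm 3 G)) // (mem_lcn u2).
have nv : <[ [~ y, z] ]> \subset 'N(Q1) by rewrite cycle_subG (subsetP n1) // (mem_lcn v2).
have : n \in Q1 <*> <[ [~ y, z] ]>.
  have : 'L_2(G) \subset Q1 <*> <[ [~ y, z] ]>.
    apply: subset_trans (frame22_gen fr) _; rewrite gen_subG; apply/subsetP=> a /setUP[/set2P[]->|La].
    - by apply: (subsetP (joing_subl _ _)); rewrite (subsetP (joing_subr _ _)) ?cycle_id.
    - by rewrite (subsetP (joing_subr _ _)) ?cycle_id.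
    - by do 2!apply: (subsetP (joing_subl _ _)).
  by move/subsetP; apply.
rewrite (norm_joinEr nv) => /mulsgP[a _ + /cycleP[j ->] en].
rewrite /Q1 /= (norm_joinEr nu) => /mulsgP[l _ Ll /cycleP[i ->] ea]; exists i, j.
rewrite en ea -mulgA -conjgE mem_lcnJ // groupM // ?groupX //; [exact: mem_lcn u2 | exact: mem_lcn v2].
Qed.

Lemma frame22_expp a b : a \in G -> b \in G -> [~ a, b] ^+ p \in 'L_3(G).
Proof.
move=> Ga Gb; rewrite cos3_1 ?groupX ?groupR // cos3X ?groupR // -cos3Xl // -cos3_R ?groupX //.
by apply: (mem_lcnR (k := 1)) => //; apply: (elementary_quo p_pr pG oG2 lt).
Qed.

(** Modulo L_3 the element g is [x^i y^j, z], so x^i y^j is the new first entry. It completes to a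
    frame with y if p does not divide i and with x otherwise, since p cannot divide both
    exponents. *)
Lemma frame22_change x y z g : frame22 x y z -> g \in 'L_2(G) -> g \notin 'L_3(G) ->
  exists x' y', frame22 x' y' z /\ [~ x', z]^-1 * g \in 'L_3(G).
Proof.
move=> fr Lg ng; have [Gx Gy Gz xy defG] := fr; have u2 := mem_lcn2 Gx Gz; have v2 := mem_lcn2 Gy Gz.
have [i [j hl]] := frame22_coord0 fr Lg.
set l := _ * g in hl; have Ll := hl; have eg : g = [~ x, z] ^+ i * [~ y, z] ^+ j * l by rewrite mulKVg.
have hx : x ^+ p \in 'L_2(G) := elementary_quo p_pr pG oG2 lt Gx.
have hy : y ^+ p \in 'L_2(G) := elementary_quo p_pr pG oG2 lt Gy.
have GW : x ^+ i * y ^+ j \in G by rewrite groupM ?groupX.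
have qxy : coset 'L_3(G) [~ x, y] = 1 by apply/eqP; rewrite -cos3_R.
have el : [~ x ^+ i * y ^+ j, z]^-1 * g \in 'L_3(G).
  rewrite cos3_eq ?groupR ?(mem_lcn Lg) // cos3Rl ?groupX // !cos3Xl // eg.
  have Gu := groupX i (groupR Gx Gz); have Gv := groupX j (groupR Gy Gz).
  rewrite (cos3M (groupM Gu Gv) (mem_lcn Ll)) (cos3M Gu Gv) !cos3X ?groupR //.
  have /eqP-> : coset 'L_3(G) l == 1 by rewrite -cos3_1 ?(mem_lcn Ll).
  by rewrite mulg1.
have [pi|ni] := boolP (p %| i); last first.
  exists (x ^+ i * y ^+ j), y; split=> //; split=> //.
    rewrite cos3_R // cos3Rl ?groupX // !cos3Xl // qxy expg1n mul1g.
    by rewrite commgg morph1 expg1n.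
  set S := <<_>>; apply: subset_trans defG _.
  have SL : 'L_2(G) \subset S by rewrite sub_gen ?subsetUr.
  have Sz : z \in S by rewrite mem_gen // !inE eqxx ?orbT.
  have Sy : y \in S by rewrite mem_gen // !inE eqxx ?orbT.
  have Sx : x ^+ i \in S.
    have : x ^+ i * y ^+ j \in S by rewrite mem_gen // !inE eqxx ?orbT.
    by rewrite groupMr // groupX.
  rewrite gen_subG subUset SL andbT; apply/subsetP=> t /setUP[/set2P[]->|/set1P->] //.
  exact: (mem_expg_coprime p_pr ni (subsetP SL _ hx) Sx).
have nj : ~~ (p %| j).
  apply: contra ng => pj; rewrite eg groupMr // groupM //.
    by case/dvdnP: pi => k ->; rewrite mulnC expgM groupX // frame22_expp.
  by case/dvdnP: pj => k ->; rewrite mulnC expgM groupX // frame22_expp.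
exists (x ^+ i * y ^+ j), x; split=> //; split=> //.
  rewrite cos3_R // cos3Rl ?groupX // !cos3Xl //.
  by rewrite commgg morph1 expg1n mul1g -(invgR x y) cos3V ?groupR // qxy invg1 expg1n.
set S := <<_>>; apply: subset_trans defG _.
have SL : 'L_2(G) \subset S by rewrite sub_gen ?subsetUr.
have Sz : z \in S by rewrite mem_gen // !inE eqxx ?orbT.
have Sx : x \in S by rewrite mem_gen // !inE eqxx ?orbT.
have Sy : y ^+ j \in S.
  have : x ^+ i * y ^+ j \in S by rewrite mem_gen // !inE eqxx ?orbT.
  by rewrite groupMl // groupX.
rewrite gen_subG subUset SL andbT; apply/subsetP=> t /setUP[/set2P[]->|/set1P->] //.
exact: (mem_expg_coprime p_pr nj (subsetP SL _ hy) Sy).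
Qed.

End Frame22.

Section Type22.
Variables (gT : finGroupType) (p : nat) (G : {group gT}).
Hypotheses (p_pr : prime p) (pG : p.-group G) (oG2 : #|G : 'L_2(G)| = (p ^ 3)%N).
Hypotheses (L4 : 'L_4(G) = 1) (o3 : #|'L_3(G)| = (p ^ 2)%N) (i2 : #|'L_2(G) : 'L_3(G)| = (p ^ 2)%N).
Implicit Types (x y z g n m t c d w r s a b u v : gT) (k i j : nat) (M T B P : {group gT}).

Let lt : p < #|'L_2(G) : 'L_3(G)|.
Proof. by rewrite i2 -{1}(expn1 p) ltn_exp2l ?prime_gt1. Qed.

Let abL : abelian 'L_2(G) := abelian_lcn2 L4.

Let c3 u v : u \in 'L_3(G) -> v \in G -> [~ u, v] = 1.
Proof. exact: (lcn_eq1 L4 (i := 2) (j := 0) isT). Qed.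

Let R3 n x : n \in 'L_2(G) -> x \in G -> [~ n, x] \in 'L_3(G).
Proof. exact: mem_lcnR. Qed.

Let RMl n m x : n \in 'L_2(G) -> m \in G -> x \in G -> [~ n * m, x] = [~ n, x] * [~ m, x].
Proof. by move=> Ln Gm Gx; rewrite commMgR (c3 (R3 Ln Gx) Gm) mulg1. Qed.

Let RMr n x y : n \in 'L_2(G) -> x \in G -> y \in G -> [~ n, x * y] = [~ n, y] * [~ n, x].
Proof. by move=> Ln Gx Gy; rewrite commgMR (c3 (R3 Ln Gx) Gy) mulg1. Qed.

Let RXl n x i : n \in 'L_2(G) -> x \in G -> [~ n ^+ i, x] = [~ n, x] ^+ i.
Proof.
move=> Ln Gx; apply: commXg; apply: commute_sym; apply: comm1.
by apply: c3; [apply: R3 | apply: mem_lcn Ln].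
Qed.

Let RXr n x i : n \in 'L_2(G) -> x \in G -> [~ n, x ^+ i] = [~ n, x] ^+ i.
Proof.
move=> Ln Gx; apply: commgX; apply: commute_sym; apply: comm1.
by apply: c3; [apply: R3 | ].
Qed.

Lemma cset3_group_set x : x \in G -> group_set (cset 'L_2(G) x).
Proof.
move=> Gx; apply: cset_group_set => n m Ln Lm; apply/conjg_fixP/eqP.
by apply: c3; [apply: R3 | apply: mem_lcn Lm].
Qed.

Lemma ab3 : abelian 'L_3(G). Proof. exact: abelianS (lcn_subS 2 G) abL. Qed.

Lemma frame22_jacobi x y z : frame22 G x y z -> [~ y, z, x] = [~ x, z, y].
Proof.
case=> Gx Gy Gz xy _; have := jacobi3 L4 Gx Gy Gz; rewrite (c3 xy Gz) mul1g.
have -> : [~ z, x, y] = [~ x, z, y]^-1.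
  rewrite -(invgR x z) commVg //; apply: commute_sym; apply: comm1; apply: c3; last exact: groupR.
  by apply: R3 => //; apply: mem_lcn2.
by move/(canRL (mulKVg _)); rewrite mulg1.
Qed.

Lemma frame22_coord x y z n : frame22 G x y z -> n \in 'L_2(G) ->
  exists i j l, l \in 'L_3(G) /\ n = [~ x, z] ^+ i * [~ y, z] ^+ j * l.
Proof.
move=> fr Ln; have [i [j h]] := frame22_coord0 fr Ln.
by exists i, j, (([~ x, z] ^+ i * [~ y, z] ^+ j)^-1 * n); rewrite mulKVg.
Qed.

Lemma lcn2_expp n : n \in 'L_2(G) -> n ^+ p \in 'L_3(G).
Proof.
apply: (expg_gen abL (S := commutators G) (commutators_sub G)).
  by rewrite gen_subG; apply/subsetP=> _ /imset2P[a b Ga Gb ->]; rewrite mem_gen // mem_commutators.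
move=> _ /commutatorsP[a [b [Ga Gb <-]]].
rewrite cos3_1 ?groupX ?groupR // cos3X ?groupR // -cos3Xl // -cos3_R ?groupX //.
by apply: (mem_lcnR (k := 1)) => //; apply: (elementary_quo p_pr pG oG2 lt).
Qed.

(** [n, g]^p = [n^p, g], where n^p lies in the central subgroup L_3. *)
Lemma lcn3_expp t : t \in 'L_3(G) -> t ^+ p = 1.
Proof.
move=> Lt; apply/set1P; move: t Lt.
apply: (expg_gen ab3 (T := 1%G) (S := [set [~ n, g] | n in 'L_2(G), g in G])).
- by apply/subsetP=> _ /imset2P[n g Ln Gg ->]; apply: R3.
- exact: subxx.
- move=> _ /imset2P[n g Ln Gg ->]; apply/set1P; rewrite -RXl //; apply: c3 => //; exact: lcn2_expp.
Qed.

Lemma cset_prod w1 w2 : w1 \in G -> w2 \in G ->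
  exists P : {group gT}, [/\ P \subset 'L_3(G), P = cset 'L_2(G) w1 * cset 'L_2(G) w2 :> {set gT},
    {in 'L_2(G), forall n, [~ n, w1] \in P} & {in 'L_2(G), forall n, [~ n, w2] \in P}].
Proof.
move=> G1 G2; pose A := Group (cset3_group_set G1); pose B := Group (cset3_group_set G2).
have sA : A \subset 'L_3(G) := cset_sub_lcn 1 G1; have sB : B \subset 'L_3(G) := cset_sub_lcn 1 G2.
have e : A <*> B = A * B by apply: cent_joinEl; apply: subset_trans sA (subset_trans ab3 (centS sB)).
exists (A <*> B)%G; split; first by rewrite join_subG sA.
- by rewrite /= e.
- by move=> n Ln; apply: (subsetP (joing_subl _ _)); apply/csetP; exists n.
- by move=> n Ln; apply: (subsetP (joing_subr _ _)); apply/csetP; exists n.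
Qed.

(** Both (x, z) and (x, z y) represent the missed element modulo L_3, so neither [L_2, x][L_2, z]
    nor [L_2, x][L_2, z y] is all of L_3. By Jacobi both contain [u, x], [u, y], [u, z] for u =
    [x, z]. If one of these were nontrivial, the two subgroups of order p would coincide and contain
    all generators of L_3. *)
Lemma pair22 x y z l : frame22 G x y z -> l \in 'L_3(G) -> [~ x, z] * l \notin commutators G ->
  [~ x, z] \in 'Z(G).
Proof.
move=> fr Ll nK; have [Gx Gy Gz xy defG] := fr; have u2 := mem_lcn2 Gx Gz; have v2 := mem_lcn2 Gy Gz.
have jac := frame22_jacobi fr.
have [P0 [s0 e0 in0x in0z]] := cset_prod Gx Gz; have [P1 [s1 e1 in1x in1z]] := cset_prod Gx (groupM Gz Gy).
have n0 : ~~ ('L_3(G) \subset P0).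
  by apply: contra nK; rewrite e0 => h; apply: (lift_last L4 Gx Gz h).
have n1 : ~~ ('L_3(G) \subset P1).
  apply: contra nK; rewrite e1 => h; have := lift_last L4 Gx (groupM Gz Gy) h.
  move=> H; have : [~ x, z * y]^-1 * ([~ x, z] * l) \in 'L_3(G).
    have Gl := mem_lcn Ll; have Gzy := groupM Gz Gy; have Gxz := groupR Gx Gz; have Gxz' := groupR Gx Gzy.
    have Gul := groupM Gxz Gl; rewrite cos3_eq //.
    rewrite cos3Rr // (cos3M Gxz Gl).
    have /eqP-> : coset 'L_3(G) [~ x, y] == 1 by rewrite -cos3_R.
    have /eqP-> : coset 'L_3(G) l == 1 by rewrite -cos3_1 ?(mem_lcn Ll).
    by rewrite mulg1 mul1g.
  by move/H; rewrite mulKVg.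
pose u := [~ x, z]; pose v := [~ y, z].
have uzy := RMr u2 Gz Gy; have vzy := RMr v2 Gz Gy.
have ux0 : [~ u, x] \in P0 := in0x u u2. have vx0 : [~ v, x] \in P0 := in0x v v2.
have ux1 : [~ u, x] \in P1 := in1x u u2. have vx1 : [~ v, x] \in P1 := in1x v v2.
have uz0 : [~ u, z] \in P0 := in0z u u2. have vz0 : [~ v, z] \in P0 := in0z v v2.
have uy0 : [~ u, y] \in P0 by rewrite /u -jac.
have uy1 : [~ u, y] \in P1 by rewrite /u -jac.
have uz1 : [~ u, z] \in P1 by have := in1z u u2; rewrite uzy groupMl.
have key a : a \in P0 -> a \in P1 -> a = 1.
  move=> a0 a1; apply/eqP; apply: contraT => na; case: (negP n0).
  have sP : P1 \subset P0.
    by apply: subset_trans (proper_p2_cycle p_pr s1 o3 n1 a1 na) _; rewrite cycle_subG.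
  apply: (lcn3_triple (u := u) (v := v) L4 (frame22_gen fr) defG) => //.
  by have := subsetP sP _ (in1z v v2); rewrite vzy groupMr.
apply/setIP; split; first exact: mem_lcn u2.
have : G \subset 'C[u].
  apply: subset_trans defG _; rewrite gen_subG subUset; apply/andP; split.
    apply/subsetP=> t /setUP[/set2P[]->|/set1P->]; apply/cent1P/commute_sym/comm1; exact: key.
  by apply/subsetP=> n Ln; apply/cent1P; apply: (centsP abL).
by rewrite -cent_set1 centsC sub1set.
Qed.

(** With u, v generating L_2 modulo L_3, the sets [G, u] and [G, v] are subgroups that together
    generate L_3. If both are proper, an X centralizing neither u nor v makes [L_2, X] meet both
    nontrivially, hence contain both. *)
Lemma lcn3_commutators : {subset 'L_3(G) <= commutators G}.
Proof.
have [x [y [z [Gx Gy Gz xy defG]]]] := coords2 p_pr pG oG2 i2.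
have fr : frame22 G x y z by [].
pose u := [~ x, z]; pose v := [~ y, z].
have u2 : u \in 'L_2(G) := mem_lcn2 Gx Gz; have v2 : v \in 'L_2(G) := mem_lcn2 Gy Gz.
have gr w : w \in 'L_2(G) -> group_set (cset G w).
  move=> Lw; apply: cset_group_set => n m Gn Gm; apply/conjg_fixP/eqP.
  by apply: c3 => //; rewrite -groupV invgR; apply: R3.
pose P := Group (gr u u2); pose Q := Group (gr v v2).
have inK w : w \in G -> {subset cset G w <= commutators G}.
  by move=> Gw _ /csetP[n Gn <-]; apply: mem_commutators.
have sub w : w \in 'L_2(G) -> cset G w \subset 'L_3(G).
  by move=> Lw; apply/subsetP=> _ /csetP[n Gn <-]; rewrite -groupV invgR; apply: R3.
have [sP|nP] := boolP ('L_3(G) \subset P); first by move=> t /(subsetP sP)/inK; apply; apply: mem_lcn u2.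
have [sQ|nQ] := boolP ('L_3(G) \subset Q); first by move=> t /(subsetP sQ)/inK; apply; apply: mem_lcn v2.
have inP t : t \in G -> [~ u, t] \in P.
  by move=> Gt; rewrite -groupV invgR; apply/csetP; exists t.
have inQ t : t \in G -> [~ v, t] \in Q.
  by move=> Gt; rewrite -groupV invgR; apply/csetP; exists t.
have s3 : 'L_3(G) \subset P <*> Q.
  have tr : P <*> Q \subset 'L_3(G) by rewrite join_subG !sub.
  apply: (lcn3_triple (u := u) (v := v) L4 (frame22_gen fr) defG) => //;
    by [apply: (subsetP (joing_subl _ _)); apply: inP | apply: (subsetP (joing_subr _ _)); apply: inQ].
have nC w (A B : {group gT}) : 'L_3(G) \subset A <*> B -> ~~ ('L_3(G) \subset A) -> {in G, forall t, [~ w, t] \in B} -> w \in 'L_2(G) ->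
    (forall b, b \in B -> exists2 t, t \in G & b = [~ w, t]) -> ~~ (G \subset 'C[w]).
  move=> sAB nA inB Lw memB; apply: contra nA => cG; apply: subset_trans sAB _.
  rewrite join_subG subxx; apply/subsetP=> b /memB[t Gt ->].
  by rewrite (_ : [~ w, t] = 1) //; apply/eqP/commgP; apply/cent1P; rewrite -cent1C; apply: (subsetP cG).
have mem w b : w \in 'L_2(G) -> b \in cset G w -> exists2 t, t \in G & b = [~ w, t].
  move=> Lw /csetP[t Gt <-]; exists t^-1; first by rewrite groupV.
  have -> : [~ t, w] = [~ w, t]^-1 by rewrite invgR.
  rewrite commgV //; apply: commute_sym; apply: comm1; apply: c3 => //; exact: R3.
have nCv : ~~ (G \subset 'C[v]).
  by apply: (nC v P Q) => // b; apply: mem.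
have nCu : ~~ (G \subset 'C[u]).
  by apply: (nC u Q P) => //; [rewrite joingC | move=> b; apply: mem].
have [X [GX nuX nvX]] := avoid2 nCu nCv.
pose R := Group (cset3_group_set GX).
have sR : 'L_3(G) \subset R.
  apply: subset_trans s3 _; rewrite join_subG; apply/andP; split.
    apply: subset_trans (proper_p2_cycle (P := P) (a := [~ u, X]) p_pr (sub u u2) o3 nP (inP X GX) _) _.
      by apply: contra nuX => /commgP/cent1P; rewrite cent1C.
    by rewrite cycle_subG; apply/csetP; exists u.
  apply: subset_trans (proper_p2_cycle (P := Q) (a := [~ v, X]) p_pr (sub v v2) o3 nQ (inQ X GX) _) _.
    by apply: contra nvX => /commgP/cent1P; rewrite cent1C.
  by rewrite cycle_subG; apply/csetP; exists v.
move=> t /(subsetP sR)/csetP[n Ln <-]; apply: mem_commutators => //; exact: mem_lcn Ln.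
Qed.

Definition obstruct22 x y z := [/\ frame22 G x y z, [~ x, z] \in 'Z(G) & [~ x, z] \notin 'L_3(G)].

Lemma commutators_22 : commutators G <> 'L_2(G) -> exists x y z, obstruct22 x y z.
Proof.
move=> neq; have [sK|] := boolP ('L_2(G) \subset commutators G).
  by case: neq; apply: commutators_full; apply/subsetP.
case/subsetPn=> g Lg nK; have ng : g \notin 'L_3(G) by apply: contra nK; apply: lcn3_commutators.
have [x [y [z fr0]]] := coords2 p_pr pG oG2 i2.
have [x' [y' [fr hg]]] := frame22_change p_pr pG oG2 i2 fr0 Lg ng; exists x', y', z; split=> //.
  by apply: (pair22 fr hg); rewrite mulKVg.
by apply: contra ng => h; rewrite -(groupMl _ (groupVr h)).
Qed.

Lemma obstruct22_center : #|'Z(G)| = (p ^ 3)%N -> exists x y z, obstruct22 x y z.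
Proof.
move=> oZ; have sZL := center_sub_lcn2 p_pr pG oG2 lt.
have [w Zw nw] : exists2 w, w \in 'Z(G) & w \notin 'L_3(G).
  apply/subsetPn; apply/negP=> /subset_leq_card.
  by rewrite oZ o3 leq_exp2l ?prime_gt1.
have Lw := subsetP sZL w Zw; have [x [y [z fr0]]] := coords2 p_pr pG oG2 i2.
have [x' [y' [fr hg]]] := frame22_change p_pr pG oG2 i2 fr0 Lw nw; exists x', y', z; split=> //.
  have : [~ x', z]^-1 * w \in 'Z(G).
    apply/setIP; split; first exact: mem_lcn hg.
    by apply/centP=> t Gt; apply: comm1; apply: c3.
  by rewrite groupMr // groupV.
by apply: contra nw => h; rewrite -(groupMl _ (groupVr h)).
Qed.

Section Obstruct22.
Variables (x y z : gT).
Hypothesis obs : obstruct22 x y z.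
Let u := [~ x, z].
Let v := [~ y, z].

Let fr : frame22 G x y z. Proof. by case: obs. Qed.
Let Gx : x \in G. Proof. by case: fr. Qed.
Let Gy : y \in G. Proof. by case: fr. Qed.
Let Gz : z \in G. Proof. by case: fr. Qed.
Let xy : [~ x, y] \in 'L_3(G). Proof. by case: fr. Qed.
Let u2 : u \in 'L_2(G) := mem_lcn2 Gx Gz.
Let v2 : v \in 'L_2(G) := mem_lcn2 Gy Gz.

Let cu w : w \in G -> [~ u, w] = 1.
Proof. by case: obs => _ /setIP[_ /centP cu] _ Gw; apply/eqP/commgP/cu. Qed.

Let vx : [~ v, x] = 1.
Proof. by rewrite (frame22_jacobi fr) cu. Qed.

Let comL n m : n \in 'L_2(G) -> m \in 'L_2(G) -> commute n m.
Proof. by move=> Ln Lm; apply: (centsP abL). Qed.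

Lemma obs22_coord n w : n \in 'L_2(G) -> w \in G -> exists j, [~ n, w] = [~ v, w] ^+ j.
Proof.
move=> Ln Gw; have [i [j [l [Ll ->]]]] := frame22_coord fr Ln; exists j.
have Li : u ^+ i \in 'L_2(G) by rewrite groupX.
have Lj : v ^+ j \in 'L_2(G) by rewrite groupX.
rewrite (RMl (groupM Li Lj) (mem_lcn Ll) Gw) (RMl Li (mem_lcn Lj) Gw) !RXl // cu // (c3 Ll) //.
by rewrite expg1n mul1g mulg1.
Qed.

Lemma obs22_lcn3 t : t \in 'L_3(G) -> exists i j, t = [~ v, z] ^+ i * [~ v, y] ^+ j.
Proof.
have L3F : [~ v, z] \in 'L_3(G) := R3 v2 Gz. have L3C : [~ v, y] \in 'L_3(G) := R3 v2 Gy.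
have cFC : <[ [~ v, z] ]> <*> <[ [~ v, y] ]> = <[ [~ v, z] ]> * <[ [~ v, y] ]>.
  apply: cent_joinEl; apply: (@subset_trans _ _ 'L_3(G)); first by rewrite cycle_subG.
  by apply: subset_trans ab3 (centS _); rewrite cycle_subG.
have sub : 'L_3(G) \subset <[ [~ v, z] ]> <*> <[ [~ v, y] ]>.
  case: fr => _ _ _ _ defG; apply: (lcn3_triple (u := u) (v := v) L4 (frame22_gen fr) defG) => //;
    rewrite ?cu ?vx ?group1 //.
  - by rewrite join_subG !cycle_subG L3F.
  - by rewrite (subsetP (joing_subr _ _)) ?cycle_id.
  - by rewrite (subsetP (joing_subl _ _)) ?cycle_id.
move/(subsetP sub); rewrite cFC => /mulsgP[a b /cycleP[i ->] /cycleP[j ->] ->].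
by exists i, j.
Qed.

(** L_3 has exponent p and order p^2, so [v, z] alone cannot generate it, while [v, z] and [v, y]
    do. *)
Lemma obs22_C : [~ v, y] != 1.
Proof.
apply/eqP=> C1; have : 'L_3(G) \subset <[ [~ v, z] ]>.
  by apply/subsetP=> t /obs22_lcn3[i [j ->]]; rewrite C1 expg1n mulg1 mem_cycle.
move/subset_leq_card; rewrite o3; have : #|<[ [~ v, z] ]>| <= p.
  by rewrite -orderE dvdn_leq ?prime_gt0 // order_dvdn lcn3_expp // R3.
by move=> le1 /leq_trans/(_ le1); rewrite leqNgt -[X in X < _]expn1 ltn_exp2l ?prime_gt1.
Qed.

(** Each [n, w] is a power of [v, w] with an exponent that depends only on n, and [v, y] has order
    p. *)
Lemma obs22_y n : n \in 'L_2(G) -> [~ n, y] = 1 -> [~ n, z] = 1.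
Proof.
move=> Ln ny; have [i [j [l [Ll en]]]] := frame22_coord fr Ln; move: ny; rewrite en.
have Li : u ^+ i \in 'L_2(G) by rewrite groupX.
have Lj : v ^+ j \in 'L_2(G) by rewrite groupX.
have ex w : w \in G -> [~ u ^+ i * v ^+ j * l, w] = [~ v, w] ^+ j.
  move=> Gw; rewrite (RMl (groupM Li Lj) (mem_lcn Ll) Gw) (RMl Li (mem_lcn Lj) Gw) !RXl // cu // (c3 Ll) //.
  by rewrite expg1n mul1g mulg1.
rewrite !ex // => /eqP; rewrite -order_dvdn.
have -> : #[ [~ v, y] ] = p.
  by apply: nt_prime_order; rewrite ?obs22_C // lcn3_expp // R3.
by case/dvdnP=> k ->; rewrite mulnC expgM lcn3_expp ?expg1n // R3.
Qed.

(** u^p = [x^p, z] with x^p in L_2, and [x^p, y] = [x, y]^p = 1; [obs22_y] transfers this from y to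
    z. *)
Lemma obs22_up : u ^+ p = 1.
Proof.
have cxu : commute x u by apply: commute_sym; apply: comm1; apply: cu.
rewrite /u -commXg //; apply: obs22_y; first exact: (elementary_quo p_pr pG oG2 lt).
rewrite commXg; first exact: lcn3_expp.
by apply: commute_sym; apply: comm1; apply: c3.
Qed.

Lemma card_center_22 : #|'Z(G)| = (p ^ 3)%N.
Proof.
have sZL := center_sub_lcn2 p_pr pG oG2 lt; case: obs => _ Zu nu.
have s3Z : 'L_3(G) \subset 'Z(G).
  apply/subsetP=> t Lt; apply/setIP; split; first exact: mem_lcn Lt.
  by apply/centP=> w Gw; apply: comm1; apply: c3.
have pZ := pgroupS (center_sub G) pG; have [k ok] := p_natP pZ.
have lo : p ^ 2 < #|'Z(G)|.
  rewrite -o3 proper_card // properE s3Z; apply: contra nu => /subsetP; exact.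
have hi : #|'Z(G)| < p ^ 4.
  have <- : #|'L_2(G)| = (p ^ 4)%N by rewrite -(Lagrange (lcn_subS 2 G)) o3 i2 -expnD.
  apply: proper_card; rewrite properE sZL; apply: contra obs22_C => /subsetP/(_ v v2)/setIP[_ /centP cv].
  by apply/commgP/cv.
move: lo hi; rewrite ok !ltn_exp2l ?prime_gt1 //; case: (k) => [|[|[|[|k']]]] //.
Qed.

(* the values on <x>L_2 x G are p lines of the plane L_3, two of which meet *)
Lemma obs22_lines t : t \in 'L_3(G) -> u * t \in commutators G ->
  exists (b k : nat), t = [~ x, y] ^+ b * ([~ v, z] * [~ v, y] ^+ b) ^+ k.
Proof.
move=> Lt /commutatorsP[X [Y [GX GY e]]]; case: obs => _ Zu nu.
set s := u * t in e; have Ls : s \in 'L_2(G) by rewrite groupM // (subsetP (lcn_subS 2 G)).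
have cs w : w \in G -> commute s w.
  move=> Gw; apply: comm1; rewrite /s RMl ?(mem_lcn Lt) // cu // (c3 Lt) ?mulg1 //.
have ns : s \notin 'L_3(G) by rewrite groupMr.
have sp : s ^+ p = 1.
  by rewrite expgMn ?obs22_up ?lcn3_expp ?mulg1 //; apply: comL => //; apply: (subsetP (lcn_subS 2 G)).
pose M := ('L_2(G) <*> <[x]>)%G.
have sMG : M \subset G by rewrite join_subG lcn_sub cycle_subG.
have nM : M <| G by apply: sub_der1_normal sMG; apply: joing_subl.
(* The first entry is x a with a in L_2. The other one reduces to y^b z^c, and comparison modulo L_3
   forces c = 1 modulo p; this confines t to one line for each b. *)
have core a W : a \in 'L_2(G) -> W \in G -> [~ x * a, W] = s ->
    exists (b k : nat), t = [~ x, y] ^+ b * ([~ v, z] * [~ v, y] ^+ b) ^+ k.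
  move=> La GW eW; have Gxa : x * a \in G by rewrite groupM // (mem_lcn La).
  have [i [n [b [c [Ln eWc]]]]] : exists (i : nat) n (b c : nat), n \in 'L_2(G) /\ W = x ^+ i * n * y ^+ b * z ^+ c.
    have nLx : <[x]> \subset 'N('L_2(G)) by rewrite cycle_subG; apply: (subsetP (lcn_norm 2 G)).
    have nMy : <[y]> \subset 'N(M) by rewrite cycle_subG; apply: (subsetP (normal_norm nM)).
    have sMy : M <*> <[y]> \subset G by rewrite join_subG sMG cycle_subG.
    have nN : M <*> <[y]> <| G.
      by apply: sub_der1_normal sMy; apply: subset_trans (joing_subl _ _); apply: joing_subl.
    have nNz : <[z]> \subset 'N(M <*> <[y]>) by rewrite cycle_subG; apply: (subsetP (normal_norm nN)).
    have : W \in M <*> <[y]> <*> <[z]>.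
      have dG : G \subset M <*> <[y]> <*> <[z]>.
        case: fr => _ _ _ _ defG; apply: subset_trans defG _; rewrite gen_subG subUset; apply/andP; split.
          apply/subsetP=> w /setUP[/set2P[]->|/set1P->].
          - by do 2!apply: (subsetP (joing_subl _ _)); rewrite (subsetP (joing_subr _ _)) ?cycle_id.
          - by apply: (subsetP (joing_subl _ _)); rewrite (subsetP (joing_subr _ _)) ?cycle_id.
          - by rewrite (subsetP (joing_subr _ _)) ?cycle_id.
        by apply: subset_trans (joing_subl _ _); apply: subset_trans (joing_subl _ _); apply: joing_subl.
      exact: (subsetP dG).
    rewrite (norm_joinEr nNz) => /mulsgP[A _ + /cycleP[c ->] ->].
    rewrite /= (norm_joinEr nMy) => /mulsgP[A' _ + /cycleP[b ->] ->].
    by rewrite /M /= (norm_joinEr nLx) -normC // => /mulsgP[_ n /cycleP[i ->] Ln ->]; exists i, n, b, c.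
  pose D := y ^+ b * z ^+ c; have GD : D \in G by rewrite groupM ?groupX.
  have Gn := mem_lcn Ln.
  pose n' := (x * a) ^- i * (x ^+ i * n).
  have Ln' : n' \in 'L_2(G).
    have Ga := mem_lcn La.
    apply/(coset_eqP (lcn_norm 2 G)); rewrite ?groupM ?groupX //.
    rewrite (cosetMG (lcn_norm 2 G) (groupX i Gx) Gn) !(cosetXG _ (lcn_norm 2 G)) // (cosetMG (lcn_norm 2 G) Gx Ga).
    have -> : coset 'L_2(G) n = 1 by apply/(coset1P (lcn_norm 2 G) Gn).
    have -> : coset 'L_2(G) a = 1 by apply/(coset1P (lcn_norm 2 G) Ga).
    by rewrite !mulg1.
  have Gn' := mem_lcn Ln'.
  have eW1 : [~ x * a, n' * D] = s.
    have eD : W = (x * a) ^+ i * (n' * D) by rewrite /n' /D eWc !mulgA mulgV mul1g.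
    rewrite -eW eD [RHS]commgMJ.
    have -> : [~ x * a, (x * a) ^+ i] = 1 by apply/eqP/commgP; apply: commuteX.
    by rewrite conj1g mulg1.
  have nx1 : [~ n', x] = 1 by have [j ->] := obs22_coord Ln' Gx; rewrite vx expg1n.
  have na1 : [~ n', a] = 1 by apply/eqP/commgP; apply: comL.
  have eW2 : [~ x * a, D] = s.
    have e1 : [~ x * a, n'] = 1.
      by apply/eqP; rewrite -invg_eq1 invgR (RMr Ln' Gx (mem_lcn La)) na1 nx1 mulg1.
    by rewrite -eW1 [RHS]commgMJ e1 conj1g mulg1.
  have Lxd : [~ x, D] \in 'L_2(G) by apply: mem_lcn2.
  have eW3 : s = [~ x, D] * [~ a, D].
    by rewrite -eW2 commMgJ conjgE (comL Lxd La) mulKg.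
  have ue : [~ x, z ^+ c] = u ^+ c.
    by apply: commgX; apply: commute_sym; apply: comm1; apply: cu.
  have exy : [~ x, y ^+ b] = [~ x, y] ^+ b.
    by apply: commgX; apply: commute_sym; apply: comm1; apply: c3.
  have exD : [~ x, D] = u ^+ c * [~ x, y] ^+ b.
    have fx : ([~ x, y] ^+ b) ^ (z ^+ c) = [~ x, y] ^+ b.
      by apply/conjg_fixP/eqP; apply: c3; apply: groupX.
    by rewrite /D commgMJ ue exy fx.
  have [k eaD] := obs22_coord La GD.
  have evD : [~ v, D] = [~ v, z] ^+ c * [~ v, y] ^+ b by rewrite /D RMr ?groupX // !RXr.
  have qu : #[coset 'L_3(G) u] = p.
    apply: nt_prime_order => //; last by rewrite -cos3_1 // (mem_lcn u2).
    by rewrite -cos3X ?(mem_lcn u2) // obs22_up morph1.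
  have L3t : [~ x, y] ^+ b * [~ a, D] \in 'L_3(G) by apply: groupM; [apply: groupX | apply: R3].
  have uc : (c = 1 %[mod p])%N.
    have Gu := mem_lcn u2; apply/eqP; have := eq_expg_mod_order (coset 'L_3(G) u) c 1; rewrite qu => <-.
    rewrite expg1 -cos3X // eq_sym -cos3_eq ?groupX //.
    have -> : u^-1 * u ^+ c = t * ([~ x, y] ^+ b * [~ a, D])^-1.
      by apply: (canRL (mulgK _)); apply: (mulgI u); rewrite (mulgA u) mulKVg mulgA -exD -eW3.
    by rewrite groupM // groupV.
  have red (h : gT) : h ^+ p = 1 -> h ^+ c = h.
    by move=> hp; rewrite -(expg_mod c hp) uc expg_mod // expg1.
  exists b, k; apply: (mulgI u); rewrite -/s eW3 exD eaD evD (red u obs22_up) red ?lcn3_expp ?R3 //.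
  by rewrite mulgA.
(* An entry x^i n with p not dividing i is brought to the form x a by [Y0^m, W^i] = s^(m i) = s,
   valid because s is central with s^p = 1. *)
have core' Y0 W : Y0 \in M -> W \in G -> [~ Y0, W] = s ->
    exists (b k : nat), t = [~ x, y] ^+ b * ([~ v, z] * [~ v, y] ^+ b) ^+ k.
  move=> MY GW eW; have GY0 := subsetP sMG _ MY.
  have : Y0 \in 'L_2(G) * <[x]>.
    by rewrite -norm_joinEr // cycle_subG; apply: (subsetP (lcn_norm 2 G)).
  rewrite -normC; last by rewrite cycle_subG; apply: (subsetP (lcn_norm 2 G)).
  case/mulsgP=> _ n /cycleP[i ->] Ln eY.
  have ni : ~~ (p %| i).
    apply: contra ns => /dvdnP[k ei]; rewrite -eW; apply: R3 => //; rewrite eY groupM //.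
    by rewrite ei mulnC expgM groupX //; apply: (elementary_quo p_pr pG oG2 lt).
  have [m hm] := prime_modinv 1 p_pr ni; rewrite expn1 in hm.
  have hm1 : (i * m %% p)%N = 1%N by rewrite hm modn_small ?prime_gt1.
  have e1 : [~ Y0 ^+ m, W ^+ i] = s.
    have cY : commute Y0 [~ Y0, W] by rewrite eW; apply/commute_sym/cs.
    have eYm : [~ Y0 ^+ m, W] = s ^+ m by rewrite commXg ?eW // -eW.
    have cW : commute W [~ Y0 ^+ m, W] by rewrite eYm; apply: commuteX; apply/commute_sym/cs.
    rewrite commgX // eYm.
    by rewrite -expgM mulnC (divn_eq (i * m) p) hm1 expgD mulnC expgM sp expg1n mul1g.
  have Lx : x^-1 * Y0 ^+ m \in 'L_2(G).
    have [Gi Gn] := (groupX i Gx, mem_lcn Ln).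
    have GYm := groupX m GY0.
    apply/(coset_eqP (lcn_norm 2 G) Gx GYm); rewrite (cosetXG _ (lcn_norm 2 G)) // eY.
    rewrite (cosetMG (lcn_norm 2 G) Gi Gn).
    have -> : coset 'L_2(G) n = 1 by apply/(coset1P (lcn_norm 2 G) Gn).
    rewrite mulg1 -(cosetXG _ (lcn_norm 2 G)) // -expgM (divn_eq (i * m) p) hm1 expgD mulnC expgM.
    apply: esym; have Lxp := groupX (i * m %/ p) (elementary_quo p_pr pG oG2 lt Gx).
    rewrite (cosetMG (lcn_norm 2 G) (mem_lcn Lxp) Gx).
    by have -> : coset 'L_2(G) (x ^+ p ^+ (i * m %/ p)) = 1; [apply/(coset1P (lcn_norm 2 G) (mem_lcn Lxp)) | rewrite mul1g].
  by apply: (core _ (W ^+ i) Lx); rewrite ?groupX // mulKVg.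
have [MX|nX] := boolP (X \in M); first exact: (core' X Y).
have [MY|nY] := boolP (Y \in M).
  apply: (core' Y X^-1 MY); rewrite ?groupV // commgV.
    by rewrite -invgR e invgK.
  apply: commute_sym; rewrite -invgR e; apply: commuteVl; exact: cs.
have [nx|] := boolP (x \in 'L_2(G)); first by case: (negP nu); apply: (mem_lcnR (k := 1)).
move=> nx; have iM : #|G : M| <= p ^ 2 by apply: (index_step p_pr pG _ Gx nx); rewrite ?lcn_sub ?oG2.
have iMX : #|G : M <*> <[X]>| <= p ^ 1 by apply: (index_step p_pr pG sMG GX nX iM).
have nMX : <[X]> \subset 'N(M) by rewrite cycle_subG; apply: (subsetP (normal_norm nM)).
have sMX : M <*> <[X]> \subset G by rewrite join_subG sMG cycle_subG.
(* Both entries are now outside [M]. If Y is in [M] <X>, dividing by a power of X gives an entry in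
   [M]. If not, X, Y and [M] generate G, all commutators fall into L_3 <u>, and v in L_3 <u> would
   commute with y. *)
have [|nMXY] := boolP (Y \in M <*> <[X]>).
  rewrite (norm_joinEr nMX) => /mulsgP[m _ Mm /cycleP[k ->] eY].
  have Gm := subsetP sMG m Mm; have Gk := groupX k GX.
  have emX : [~ X, m] = s.
    have : [~ X, m] ^ (X ^+ k) = s.
      rewrite -e eY [RHS]commgMJ; have -> : [~ X, X ^+ k] = 1 by apply/eqP/commgP; apply: commuteX.
      by rewrite mul1g.
    move/(canRL (conjgK _)) => ->; apply/conjg_fixP/commgP/cs; by rewrite groupV.
  apply: (core' m X^-1 Mm); rewrite ?groupV // commgV.
    by rewrite -invgR emX invgK.
  by apply: commute_sym; rewrite -invgR emX; apply: commuteVl; exact: cs.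
have iMXY : #|G : M <*> <[X]> <*> <[Y]>| <= p ^ 0 by apply: (index_step p_pr pG sMX GY nMXY iMX).
have dG := index_le1 iMXY.
pose B := ('L_3(G) <*> <[u]>)%G.
have sB2 : B \subset 'L_2(G) by rewrite join_subG (lcn_subS 2) cycle_subG.
have s3B : 'L_3(G) \subset B := joing_subl _ _.
have uB : u \in B by rewrite (subsetP (joing_subr _ _)) ?cycle_id.
have nB : G \subset 'N(B) by apply: (norm_between (k := 1)).
have xB : G \subset cmod [set x] B.
  case: fr => _ _ _ _ defG; apply: subset_trans defG _; rewrite gen_subG subUset; apply/andP; split.
    apply/subsetP=> w /setUP[/set2P[]->|/set1P->]; apply: (cmod_in nB) => // _ /set1P-> //.
      by rewrite commgg.
    exact: (subsetP s3B).
  apply/subsetP=> w Lw; apply: (cmod_in nB); first exact: mem_lcn Lw.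
  by move=> _ /set1P->; apply: (subsetP s3B); rewrite -groupV invgR; apply: R3.
have MB : M \subset cmod G B.
  rewrite join_subG cycle_subG; apply/andP; split.
    apply/subsetP=> n Ln; apply: (cmod_in nB); first exact: mem_lcn Ln.
    by move=> w Gw; apply: (subsetP s3B); rewrite -groupV invgR; apply: R3.
  apply: (cmod_in nB) => // w Gw; rewrite -groupV invgR.
  by have /cmodP[_] := subsetP xB w Gw; apply; rewrite inE.
have mB m w : m \in M -> w \in G -> [~ w, m] \in B.
  by move=> Mm Gw; have /cmodP[_] := subsetP MB m Mm; apply.
have mB' m w : m \in M -> w \in G -> [~ m, w] \in B.
  by move=> Mm Gw; rewrite -groupV invgR mB.
have sB : s \in B by rewrite groupM // (subsetP s3B).
have LB : 'L_2(G) \subset B.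
  apply: (@der_gen _ G ([set X; Y] :|: M) B) => //.
  - by rewrite subUset sMG andbT; apply/subsetP=> w /set2P[]->.
  - apply: subset_trans dG _; rewrite (join_subG (M <*> <[X]>)%G <[Y]>) (join_subG M <[X]>) !cycle_subG.
    by rewrite sub_gen ?subsetUr // !mem_gen // !inE eqxx ?orbT.
  move=> a b /setUP[/set2P[]->|Ma] /setUP[/set2P[]->|Mb]; rewrite ?commgg ?group1 ?e //; try exact: mB; try exact: mB'.
  - by rewrite -groupV invgR e.
  - by apply: mB'; rewrite // (subsetP sMG).
case: (negP obs22_C); have : v \in B by apply: (subsetP LB).
rewrite /B /= norm_joinEr; last by rewrite cycle_subG (subsetP (lcn_norm 3 G)) // (mem_lcn u2).
case/mulsgP=> l _ Ll /cycleP[k ->] ->.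
have Luk : u ^+ k \in 'L_2(G) by rewrite groupX.
by rewrite RMl ?(mem_lcn Luk) ?(subsetP (lcn_subS 2 G)) // RXl // cu // (c3 Ll) // expg1n mulg1.
Qed.

(** Covering L_3, of order p^2, would make the p^2 parameters (b, k) inject. But the lines b = 0 and
    b = 1 meet: if [x, y] = [v, z]^i [v, y]^j, the exponent -j on the second line gives the point
    with exponent i - j on the first. *)
Lemma obs22_not_full : commutators G <> 'L_2(G).
Proof.
move=> eK; pose f (bk : 'I_p * 'I_p) := [~ x, y] ^+ bk.1 * ([~ v, z] * [~ v, y] ^+ bk.1) ^+ bk.2.
have Fp : [~ v, z] ^+ p = 1 by rewrite lcn3_expp // R3.
have Cp : [~ v, y] ^+ p = 1 by rewrite lcn3_expp // R3.
have p0 := prime_gt0 p_pr.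
have cov : 'L_3(G) \subset f @: setT.
  apply/subsetP=> t Lt; have [|b [k ->]] := obs22_lines Lt.
    by rewrite eK groupM // (subsetP (lcn_subS 2 G)).
  apply/imsetP; exists (Ordinal (ltn_pmod b p0), Ordinal (ltn_pmod k p0)); rewrite ?inE // /f /=.
  have mp h (c : nat) : h \in 'L_3(G) -> h ^+ (c %% p) = h ^+ c by move=> Lh; apply: expg_mod; apply: lcn3_expp.
  have Lb (d : nat) : [~ v, z] * [~ v, y] ^+ d \in 'L_3(G) by apply: groupM; [|apply: groupX]; apply: R3.
  by rewrite (mp _ b xy) (mp _ _ (R3 v2 Gy)) (mp _ k (Lb b)).
have inj : injective f.
  have /imset_injP inj : #|f @: setT| == #|[set: 'I_p * 'I_p]|.
    rewrite eqn_leq leq_imset_card /=; apply: leq_trans (subset_leq_card cov).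
    by rewrite o3 cardsT card_prod card_ord mulnn.
  by move=> a b eab; apply: inj.
have [i [j eij]] := obs22_lcn3 xy.
have p1 := prime_gt1 p_pr.
pose k' := (p - j %% p)%N.
have := inj (Ordinal p0, Ordinal (ltn_pmod (i + k') p0)) (Ordinal p1, Ordinal (ltn_pmod k' p0)).
rewrite /f /= => H; have /H[] // : [~ x, y] ^+ 0 * ([~ v, z] * [~ v, y] ^+ 0) ^+ ((i + k') %% p) =
   [~ x, y] ^+ 1 * ([~ v, z] * [~ v, y] ^+ 1) ^+ (k' %% p).
rewrite mul1g !expg1 mulg1.
have cFC : commute [~ v, z] [~ v, y] by apply: (centsP ab3); apply: R3.
have FCp : ([~ v, z] * [~ v, y]) ^+ p = 1 by rewrite expgMn // Fp Cp mulg1.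
rewrite (expg_mod _ Fp) (expg_mod _ FCp) (expgMn _ cFC) eij expgD -!mulgA; congr (_ * _).
rewrite !mulgA -(commuteX2 k' j cFC) -mulgA -expgD.
have -> : [~ v, y] ^+ (j + k') = 1.
  rewrite /k' {1}(divn_eq j p) -addnA subnKC; last by rewrite ltnW // ltn_pmod.
  by rewrite expgD mulnC expgM Cp expg1n mulg1.
by rewrite mulg1.
Qed.

Lemma obs22_yp w : w \in 'L_2(G) -> w = y ^+ p -> [~ w, z] = 1.
Proof.
move=> Lw ew; apply: obs22_y Lw _; rewrite ew; apply/eqP/commgP/commute_sym; exact: commuteX.
Qed.

Lemma obs22_gen_sub : [set u; v] :|: 'L_3(G) \subset 'L_2(G).
Proof. by rewrite subUset (lcn_subS 2) andbT; apply/subsetP=> w /set2P[]->. Qed.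

(** y^3 lies in L_2 and commutes with y, hence with z by [obs22_y], and the cube formula reduces
    [y^3, z] = 1 to v^3 = 1. *)
Lemma obs22_abelem : p = 3 -> p.-abelem 'L_2(G).
Proof.
move=> p3; apply/abelemP=> //; split; first exact: abL.
have yp : y ^+ p \in 'L_2(G) := elementary_quo p_pr pG oG2 lt Gy.
have := obs22_yp yp erefl.
rewrite {1}p3 (comm_cube_abelian abL (subsetP (lcn_norm 2 G) y Gy) v2) -/v.
rewrite (c3 (R3 v2 Gy) Gy) mulg1 -{2}p3 lcn3_expp ?R3 // mulg1 => v3.
move=> a La; apply/set1P; move: a La.
apply: (expg_gen abL (T := 1%G) obs22_gen_sub (frame22_gen fr)).
move=> s /setUP[/set2P[]->|Ls]; apply/set1P; [exact: obs22_up | by rewrite p3 | exact: lcn3_expp].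
Qed.

(** Here [y^2, z] = 1 becomes v^2 = [v, y]^-1, which has order 2; u and L_3 contribute no
    squares. *)
Lemma obs22_Phi2 : p = 2 -> #|'Phi('L_2(G))| = 2.
Proof.
move=> p2; have yp : y ^+ p \in 'L_2(G) := elementary_quo p_pr pG oG2 lt Gy.
have := obs22_yp yp erefl.
rewrite {1}p2 (comm_sq_abelian abL (subsetP (lcn_norm 2 G) y Gy) v2) -/v => v2C.
have vv : v ^+ 2 = [~ v, y]^-1 by apply/eqP; rewrite eq_mulgV1 invgK v2C.
have oC : #|<[ [~ v, y] ]>| = 2.
  by rewrite -orderE; apply: nt_prime_order => //; [rewrite -p2 lcn3_expp // R3 | apply: obs22_C].
suff -> : 'Phi('L_2(G)) = <[ [~ v, y] ]> by [].
have nC : 'L_2(G) \subset 'N(<[ [~ v, y] ]>).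
  by apply/cents_norm/(subset_trans abL)/centS; rewrite cycle_subG (subsetP (lcn_subS 2 G)) ?R3.
apply/eqP; rewrite eqEsubset; apply/andP; split.
  apply: (Phi_min (p := 2) _ nC); first by rewrite -p2; apply: pgroupS pG; apply: lcn_sub.
  apply/abelemP => //; split; first by rewrite quotient_abelian ?abL.
  move=> _ /morphimP[n Nn Ln ->]; rewrite -morphX //= coset_id //.
  apply: (expg_gen abL (T := <[ [~ v, y] ]>%G) obs22_gen_sub (frame22_gen fr)) Ln.
  move=> s /setUP[/set2P[]->|Ls].
  - by rewrite -p2 obs22_up group1.
  - by rewrite vv groupV cycle_id.
  - by rewrite -p2 lcn3_expp // group1.
have p2L : 2.-group 'L_2(G) by rewrite -p2; apply: pgroupS pG; apply: lcn_sub.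
rewrite cycle_subG -groupV -vv /=; have <- : 'Mho^1('L_2(G)) = 'Phi('L_2(G)) by rewrite (Phi_Mho p2L abL).
exact: (Mho_p_elt 1 v2 (mem_p_elt p2L v2)).
Qed.

End Obstruct22.
End Type22.

(** * Class 4 with L_2/L_3 of order p^2 *)

Section Type211.
Variables (gT : finGroupType) (p : nat) (G : {group gT}).
Hypotheses (p_pr : prime p) (pG : p.-group G) (oG2 : #|G : 'L_2(G)| = (p ^ 3)%N).
Hypotheses (L5 : 'L_5(G) = 1) (o4 : #|'L_4(G)| = p) (i3 : #|'L_3(G) : 'L_4(G)| = p)
  (i2 : #|'L_2(G) : 'L_3(G)| = (p ^ 2)%N).
Implicit Types (x y z g n m t c d w r s a b u v l X Y : gT) (k i j : nat) (M T B P : {group gT}).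

Let lt : p < #|'L_2(G) : 'L_3(G)|.
Proof. by rewrite i2 -{1}(expn1 p) ltn_exp2l ?prime_gt1. Qed.

Let N4 : G \subset 'N('L_4(G)) := lcn_norm 4 G.
Let E := cmod_group 'L_2(G) 'L_4(G).
Let q x := coset 'L_4(G) x.

Let comm_lcn23 n t : n \in 'L_2(G) -> t \in 'L_3(G) -> [~ n, t] = 1.
Proof. by move=> Ln Lt; apply: (lcn_eq1 L5 (i := 1) (j := 2)). Qed.

Let c4 u v : u \in 'L_4(G) -> v \in G -> [~ u, v] = 1.
Proof. exact: (lcn_eq1 L5 (i := 3) (j := 0) isT). Qed.

Let R3 n X : n \in 'L_2(G) -> X \in G -> [~ n, X] \in 'L_3(G). Proof. exact: mem_lcnR. Qed.
Let R4 n X : n \in 'L_3(G) -> X \in G -> [~ n, X] \in 'L_4(G). Proof. exact: mem_lcnR. Qed.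

Let qRl n m X : n \in 'L_2(G) -> m \in 'L_2(G) -> X \in G -> q [~ n * m, X] = q [~ n, X] * q [~ m, X].
Proof.
move=> Ln Lm GX; apply: (coset_RMl N4); rewrite ?(mem_lcn Ln) ?(mem_lcn Lm) //.
by apply: R4; [apply: R3 | apply: mem_lcn Lm].
Qed.

Let qRr n X Y : n \in 'L_2(G) -> X \in G -> Y \in G -> q [~ n, X * Y] = q [~ n, Y] * q [~ n, X].
Proof.
by move=> Ln GX GY; apply: (coset_RMr N4); rewrite ?(mem_lcn Ln) //; apply: R4 => //; apply: R3.
Qed.

Let qXl n X i : n \in 'L_2(G) -> X \in G -> q [~ n ^+ i, X] = q [~ n, X] ^+ i.
Proof.
move=> Ln GX; apply: (coset_RXl _ N4); rewrite ?(mem_lcn Ln) //.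
by apply: R4; [apply: R3 | apply: mem_lcn Ln].
Qed.

Let q1 X : X \in G -> (X \in 'L_4(G)) = (q X == 1).
Proof. by move=> GX; apply/idP/eqP => /(coset1P N4 GX). Qed.

Let sL2E : 'L_2(G) \subset E.
Proof.
apply/subsetP=> n Ln; apply: (cmod_in N4); first exact: mem_lcn Ln.
move=> m Lm; have : [~ m, n] \in [~: 'L_2(G), 'L_2(G)] by apply: mem_commg.
exact: subsetP (lcn_comm G 1 1) _.
Qed.

Let sL2C : 'L_2(G) \subset 'C('L_3(G)).
Proof. by apply/centsP=> n Ln t Lt; apply: comm1; apply: comm_lcn23. Qed.

Let nE : ~~ (G \subset E).
Proof.
apply: (cmod_proper (k := 1)); apply/negP=> s34.
by move: i3 (prime_gt1 p_pr) => <-; rewrite -indexg_eq1 in s34; rewrite (eqP s34).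
Qed.

Let nC : ~~ (G \subset 'C('L_3(G))).
Proof.
apply/negP=> cG; have o1 : 'L_4(G) = 1 by rewrite lcnSn commGC; apply/commG1P.
by move: o4 (prime_gt1 p_pr); rewrite o1 cards1 => <-.
Qed.

Let nL43 : 'L_4(G) <| 'L_3(G).
Proof. by rewrite /normal (lcn_subS 3) (subset_trans (lcn_sub 3 G) N4). Qed.

Let hitE X : X \in G -> X \notin E -> {in 'L_3(G), forall t, exists2 n, n \in 'L_2(G) & [~ n, X]^-1 * t \in 'L_4(G)}.
Proof.
move=> GX nX; apply: (hit p_pr N4 nL43 i3 (lcn_sub 2 G) GX).
- by move=> n Ln; apply: R3.
- by move=> n Ln; apply: R4; [apply: R3 | apply: mem_lcn Ln].
exact: cmod_nP N4 GX nX.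
Qed.

(** If one entry is outside [E], a factor from L_2 corrects the pair modulo L_4. The factor does not
    affect whether an entry centralizes L_3, so the second condition still lifts the pair over L_4,
    of order p. *)
Let good X Y l : X \in G -> Y \in G -> X \notin E \/ Y \notin E ->
  X \notin 'C('L_3(G)) \/ Y \notin 'C('L_3(G)) -> l \in 'L_3(G) -> [~ X, Y] * l \in commutators G.
Proof.
move=> GX GY nEE nCC Ll; have Gl := mem_lcn Ll; have LXY := mem_lcn2 GX GY.
have nCm Z n : n \in 'L_2(G) -> Z \notin 'C('L_3(G)) -> Z * n \notin 'C('L_3(G)).
  by move=> Ln; rewrite groupMr // (subsetP sL2C).
have cXY n : n \in 'L_2(G) -> [~ X, Y, n] \in 'L_4(G).
  move=> Ln; have : [~ X, Y, n] \in [~: 'L_2(G), 'L_2(G)] by apply: mem_commg.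
  exact: subsetP (lcn_comm G 1 1) _.
have fin n1 n2 : n1 \in 'L_2(G) -> n2 \in 'L_2(G) ->
    [~ X * n1, Y * n2]^-1 * ([~ X, Y] * l) \in 'L_4(G) -> [~ X, Y] * l \in commutators G.
  move=> L1 L2 h; apply: (lift_prime (k := 1) p_pr L5 o4 _ _ h); first exact: groupM GX (mem_lcn L1).
    exact: groupM GY (mem_lcn L2).
  by case: nCC => nCC; [left | right]; apply: nCm.
case: nEE => nEE.
  have [n Ln hn] := hitE GX nEE (groupVr Ll); have Gn := mem_lcn Ln; have GYn := groupM GY Gn.
  apply: (fin 1 n); rewrite ?group1 // mulg1.
  apply/(coset_eqP N4); [exact: groupR | exact: groupM (groupR GX GY) Gl |].
  rewrite (coset_RMr N4 GX GY Gn (cXY n Ln)) (cosetMG N4 (groupR GX GY) Gl).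
  have e : coset 'L_4(G) [~ X, n] = coset 'L_4(G) l.
    apply/(coset_eqP N4 (groupR GX Gn) Gl); rewrite invgR.
    by rewrite -(mulKg l ([~ n, X] * l)) (mulgA l) -conjgE mem_lcnJ // -groupV invMg.
  rewrite e -(cosetMG N4 Gl (groupR GX GY)) -(cosetMG N4 (groupR GX GY) Gl).
  have c : commute l [~ X, Y] by apply/commute_sym/comm1/comm_lcn23.
  by rewrite c.
have [n Ln hn] := hitE GY nEE Ll; have Gn := mem_lcn Ln; have GXn := groupM GX Gn.
apply: (fin n 1); rewrite ?group1 // mulg1.
apply/(coset_eqP N4); [exact: groupR | exact: groupM (groupR GX GY) Gl |].
rewrite (coset_RMl N4 GX Gn GY (cXY n Ln)) (cosetMG N4 (groupR GX GY) Gl).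
by congr (_ * _); apply/(coset_eqP N4 (groupR Gn GY) Gl).
Qed.

Let lcn3K : {subset 'L_3(G) <= commutators G}.
Proof.
have [X [GX nXE nXC]] := avoid2 nE nC; move=> t Lt.
by have := good GX (group1 G) (or_introl nXE) (or_introl nXC) Lt; rewrite commg1 mul1g.
Qed.

Let gen_sub x y z B : frame22 G x y z -> 'L_2(G) \subset B -> x \in B -> y \in B -> z \in B -> G \subset B.
Proof.
case=> _ _ _ _ defG sB xB yB zB; apply: subset_trans defG _; rewrite gen_subG subUset sB andbT.
by apply/subsetP=> w /setUP[/set2P[]->|/set1P->].
Qed.

Let cover_notin x y z l (t : nat) : frame22 G x y z -> l \in 'L_3(G) ->
  x \notin E \/ z * y ^+ t \notin E -> x \notin 'C('L_3(G)) \/ z * y ^+ t \notin 'C('L_3(G)) ->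
  [~ x, z] * l \in commutators G.
Proof.
move=> [Gx Gy Gz xy _] Ll nEE nCC; have Gw : z * y ^+ t \in G by rewrite groupM ?groupX.
have h : [~ x, z * y ^+ t]^-1 * ([~ x, z] * l) \in 'L_3(G).
  have Gxz := groupR Gx Gz; have Gl := mem_lcn Ll.
  rewrite cos3_eq; [|exact: groupR|exact: groupM].
  rewrite cos3Rr ?groupX // cos3Xr // (cosetMG (lcn_norm 3 G) Gxz Gl).
  have /eqP-> : coset 'L_3(G) [~ x, y] == 1 by rewrite -cos3_R.
  have -> : coset 'L_3(G) l = 1 by apply/(coset1P (lcn_norm 3 G) Gl).
  by rewrite expg1n mulg1 mul1g.
by have := good Gx Gw nEE nCC h; rewrite mulKVg.
Qed.

(* p = 2, and z, z y lie each in exactly one of the two maximal subgroups *)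
Let leftover x y z l : p = 2 -> frame22 G x y z -> l \in 'L_3(G) -> x \in E -> x \in 'C('L_3(G)) ->
  z \in 'C('L_3(G)) -> z \notin E -> z * y \in E -> z * y \notin 'C('L_3(G)) -> [~ x, z] * l \in commutators G.
Proof.
move=> p2 fr Ll xE xC zC zE zyE zyC; have [Gx Gy Gz xy defG] := fr.
set u := [~ x, z]; set v := [~ y, z]; have u2 : u \in 'L_2(G) := mem_lcn2 Gx Gz.
have v2 : v \in 'L_2(G) := mem_lcn2 Gy Gz.
have Gu := mem_lcn u2; have Gv := mem_lcn v2.
have inE n X : n \in 'L_2(G) -> X \in E -> q [~ n, X] = 1.
  move=> Ln /cmodP[_ /(_ n Ln) h]; apply/eqP; rewrite -q1 //; exact: mem_lcn h.
have ezy n : n \in 'L_2(G) -> q [~ n, y] * q [~ n, z] = 1 by move=> Ln; rewrite -qRr ?inE.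
have vx : q [~ v, x] = 1 by apply: inE.
have sq t : t \in 'L_3(G) -> q t ^+ 2 = 1.
  move=> Lt; have : q t \in 'L_3(G) / 'L_4(G) by apply: mem_quotient.
  by move/expg_cardG; rewrite card_quotient ?(subset_trans (lcn_sub 3 G) N4) // i3 p2.
have N4' : G \subset 'N('L_4(G)) := lcn_norm 4 G; have sN := subsetP N4'.
have qV n w : n \in 'L_2(G) -> w \in G -> q [~ n^-1, w] = (q [~ n, w])^-1.
  move=> Ln Gw; apply: (mulIg (q [~ n, w])); rewrite mulVg -qRl ?groupV // mulVg comm1g.
  exact: morph1.
(* Jacobi modulo L_4, where [x, y, z] vanishes and x centralizes L_2. *)
have uy : q [~ u, y] = 1.
  have L4q : 'L_4(G / 'L_4(G)) = 1 by rewrite lcn_quo ?lcn_normal // trivg_quotient.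
  have mq w : w \in G -> coset 'L_4(G) w \in G / 'L_4(G) by move=> Gw; apply: mem_quotient.
  have := jacobi3 L4q (mq x Gx) (mq y Gy) (mq z Gz).
  rewrite -!(coset_comm N4') ?groupR // -/(q _) -/(q _) -/(q _).
  have -> : q [~ x, y, z] = 1 by apply/eqP; rewrite -q1; [apply: R4 | rewrite !groupR].
  by rewrite -/v vx mulg1 mul1g -(invgR x z) qV // => /eqP; rewrite invg_eq1 => /eqP.
have uz : q [~ u, z] = 1 by have := ezy u u2; rewrite uy mul1g.
have qM X Y : X \in G -> Y \in G -> q (X * Y) = q X * q Y by apply: cosetMG.
have hq n : n \in 'L_2(G) -> exists i j : nat, forall w, w \in G -> q [~ n, w] = q [~ u, w] ^+ i * q [~ v, w] ^+ j.
  move=> Ln; have [i [j hl]] := frame22_coord0 fr Ln; exists i, j => w Gw.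
  have Li : u ^+ i \in 'L_2(G) by apply: groupX.
  have Lj : v ^+ j \in 'L_2(G) by apply: groupX.
  have Ll' := subsetP (lcn_subS 2 G) _ hl.
  rewrite -(mulKVg (u ^+ i * v ^+ j) n) (qRl (groupM Li Lj) Ll' Gw) (qRl Li Lj Gw) !qXl //.
  have /eqP-> : q [~ (u ^+ i * v ^+ j)^-1 * n, w] == 1 by rewrite -q1; [apply: R4 | apply: groupR; rewrite ?(mem_lcn Ll')].
  by rewrite mulg1.
have nvy : q [~ v, y] != 1.
  apply: contra zE => /eqP vy1; have yE : y \in E.
    apply: (cmod_in N4') => // n Ln; have [i [j hn]] := hq n Ln.
    rewrite q1; last by apply: groupR; rewrite ?(mem_lcn Ln).
    by rewrite hn // uy vy1 !expg1n mulg1.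
  by rewrite -(groupMr z yE).
set e := [~ v, y] in nvy *; have Le : e \in 'L_3(G) := R3 v2 Gy; have Ge := mem_lcn Le.
have vz : q [~ v, z] = (q e)^-1 by apply: (mulgI (q e)); rewrite mulgV; apply: ezy.
have y2 : y ^+ 2 \in 'L_2(G) by have := elementary_quo p_pr pG oG2 lt Gy; rewrite p2.
have y2z : q [~ y ^+ 2, z] = 1.
  have [i [j hn]] := hq _ y2; rewrite hn // uz expg1n mul1g vz expgVn.
  have : q [~ y ^+ 2, y] = 1.
    have -> : [~ y ^+ 2, y] = 1 by apply/eqP/commgP/commute_sym/commuteX.
    exact: morph1.
  by rewrite hn // uy expg1n mul1g => ->; rewrite invg1.
have cve : commute v e by apply: comm1; apply: comm_lcn23.
have l4 : v ^+ 2 * e \in 'L_4(G).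
  have -> : v ^+ 2 * e = [~ y ^+ 2, z].
    by rewrite comm_sq -/v conjg_mulR -/e expg_sq -(mulgA v v e) -(mulgA v e v) cve.
  by rewrite q1 ?y2z //; apply: groupR => //; apply: groupX.
(* If e^2 = 1, comparing [v^2, y] = e^2 with v^2 = e^-1 modulo L_4 shows that y commutes with e, so
   y and with it z y would centralize L_3. *)
have e2 : e ^+ 2 != 1.
  apply: contra zyC => /eqP e21; rewrite groupMl //.
  have eV : v ^+ 2 = (v ^+ 2 * e) * e^-1 by rewrite mulgK.
  have : [~ v ^+ 2, y] = e ^+ 2.
    by rewrite commMgR -/e (_ : [~ e, v] = 1) ?mulg1 //; apply/eqP/commgP/commute_sym.
  rewrite e21 eV commMgJ (c4 l4 Gy) conj1g mul1g => ey.
  have eC : e \in 'C[y] by rewrite -groupV; apply/cent1P; rewrite -/(commute _ _); first [exact: comm1 ey | exact: commute_sym (comm1 ey)].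
  have : 'L_3(G) \subset 'C[y].
    apply: (prime_index_gen p_pr nL43 i3 Le _ _ eC); first by rewrite q1.
    by apply/subsetP=> t Lt; apply/cent1P; first [exact: comm1 (c4 Lt Gy) | exact: commute_sym (comm1 (c4 Lt Gy))].
  move=> sC; apply/centP=> t Lt; apply/cent1P; rewrite cent1C; exact: subsetP sC t Lt.
(* In this configuration L_3 is cyclic of order 4, generated by f, because f^2 = e^-2 is nontrivial
   in L_4; and [x v^k, z] = u f^k runs through the whole coset of u. *)
set f := [~ u, v] * [~ v, z].
have uv4 : [~ u, v] \in 'L_4(G).
  have : [~ u, v] \in [~: 'L_2(G), 'L_2(G)] by apply: mem_commg.
  exact: subsetP (lcn_comm G 1 1) _.
have Lf : f \in 'L_3(G) by rewrite groupM ?R3 // (subsetP (lcn_subS 3 G)).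
have Gf := mem_lcn Lf.
have qf : q f = (q e)^-1.
  rewrite /f (qM _ _ (mem_lcn uv4) (groupR Gv Gz)) vz.
  by have /eqP-> : q [~ u, v] == 1; rewrite ?mul1g // -q1 ?(mem_lcn uv4).
have fe : f * e \in 'L_4(G).
  by rewrite (q1 (groupM Gf Ge)) (qM _ _ Gf Ge) qf mulVg.
have f2 : f ^+ 2 = (e ^+ 2)^-1.
  have ef : f = (f * e) * e^-1 by rewrite mulgK.
  have c : commute (f * e) e^-1 by apply: comm1; apply: c4; rewrite ?groupV.
  have fe2 : (f * e) ^+ 2 = 1 by have := expg_cardG fe; rewrite /= o4 p2.
  by rewrite {1}ef (expgMn _ c) expgVn fe2 mul1g.
have f24 : f ^+ 2 \in 'L_4(G) by rewrite (q1 (groupX 2 Gf)) /q (cosetXG 2 N4' Gf) (sq f Lf).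
have s4f : 'L_4(G) \subset <[f]>.
  apply/subsetP=> t Lt; have [|k ->] := prime_card_cover p_pr o4 f24 _ Lt; last by rewrite -expgM mem_cycle.
  by rewrite f2 invg_eq1.
have s3f : 'L_3(G) \subset <[f]>.
  apply: (prime_index_gen p_pr nL43 i3 Lf _ s4f (cycle_id f)).
  by rewrite q1 // qf invg_eq1.
have /cycleP[k ->] := subsetP s3f l Ll.
apply/commutatorsP; exists (x * v ^+ k), z; split=> //; first by rewrite groupM ?groupX.
have Luz := R3 v2 Gz.
rewrite commMgJ -/u conjg_mulR commXg; last by apply: comm1; apply: comm_lcn23.
rewrite (commgX k (_ : commute v [~ u, v])); last by apply/commute_sym/comm1/c4.
rewrite -mulgA -expgMn //; apply: comm1; apply: c4 => //; exact: mem_lcn Luz.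
Qed.

(** All entries z y^t give [x, z] modulo L_3, so a z y^t outside both [E] and the centralizer of L_3
    suffices. When x lies in both of these, each contains at most one z y^t with t modulo p; for odd
    p one of t = 0, 1, 2 remains, and for p = 2 only the configurations of [leftover] escape. *)
Let cover x y z l : frame22 G x y z -> l \in 'L_3(G) -> [~ x, z] * l \in commutators G.
Proof.
move=> fr Ll; have [Gx Gy Gz xy defG] := fr.
have E2 := subsetP sL2E; have C2 := subsetP sL2C.
have gE : x \in E -> y \in E -> z \in E -> False by move=> *; case/negP: nE; apply: gen_sub fr _ _ _ _.
have gC : x \in 'C('L_3(G)) -> y \in 'C('L_3(G)) -> z \in 'C('L_3(G)) -> False.
  by move=> *; case/negP: nC; apply: gen_sub fr _ _ _ _.
have yp : y ^+ p \in 'L_2(G) := elementary_quo p_pr pG oG2 lt Gy.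
have [xE|nxE] := boolP (x \in E); have [xC|nxC] := boolP (x \in 'C('L_3(G))); last first.
- by apply: (cover_notin (t := 0) fr Ll); left.
- have [zC|nzC] := boolP (z \in 'C('L_3(G))); last first.
    by apply: (cover_notin (t := 0) fr Ll); [left | right; rewrite mulg1].
  apply: (cover_notin (t := 1) fr Ll); [by left | right; rewrite groupMl //].
  by apply/negP=> yC; apply: gC.
- have [zE|nzE] := boolP (z \in E); last first.
    by apply: (cover_notin (t := 0) fr Ll); [right; rewrite mulg1 | left].
  apply: (cover_notin (t := 1) fr Ll); [right; rewrite groupMl // | by left].
  by apply/negP=> yE; apply: gE.
have bad (t : nat) : (z * y ^+ t \in E) || (z * y ^+ t \in 'C('L_3(G))) \/ [~ x, z] * l \in commutators G.
  have [h|] := boolP (_ || _); first by left.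
  by rewrite negb_or => /andP[h1 h2]; right; apply: (cover_notin (t := t) fr Ll); right.
case: (bad 0%N) => // b0; case: (bad 1%N) => // b1; case: (bad 2%N) => // b2.
have two (A : {group gT}) (i j : nat) : 'L_2(G) \subset A -> i < j -> ~~ (p %| j - i) -> z * y ^+ i \in A -> z * y ^+ j \in A ->
    y \in A /\ z \in A.
  move=> sA lij nd zi zj; have yA : y \in A.
    apply: (mem_expg_coprime p_pr nd (subsetP sA _ yp)).
    have : (z * y ^+ i)^-1 * (z * y ^+ j) \in A by rewrite groupM ?groupV.
    by rewrite invMg -mulgA mulKg -expgVn -{1}(subnKC (ltnW lij)) expgD mulgA -expgMn ?mulVg ?expg1n ?mul1g //; apply: commuteVl.
  by split=> //; move: zi; rewrite groupMr ?groupX.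
have noE (i j : nat) : i < j -> ~~ (p %| j - i) -> z * y ^+ i \in E -> z * y ^+ j \in E -> False.
  by move=> lij nd zi zj; have [yE zE] := two E i j sL2E lij nd zi zj; apply: gE.
have noC (i j : nat) : i < j -> ~~ (p %| j - i) -> z * y ^+ i \in 'C('L_3(G)) -> z * y ^+ j \in 'C('L_3(G)) -> False.
  by move=> lij nd zi zj; have [yE zE] := two _ i j sL2C lij nd zi zj; apply: gC.
have p1 : ~~ (p %| 1) by rewrite dvdn1 neq_ltn prime_gt1 ?orbT.
have [p2|np2] := eqVneq p 2; last first.
  have np : ~~ (p %| 2) by rewrite dvdn_prime2.
  have := noE 0%N 1%N isT p1; have := noE 1%N 2%N isT p1; have := noE 0%N 2%N isT np.
  have := noC 0%N 1%N isT p1; have := noC 1%N 2%N isT p1; have := noC 0%N 2%N isT np.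
  by move: b0 b1 b2; case: (z * y ^+ 0 \in E); case: (z * y ^+ 1 \in E); case: (z * y ^+ 2 \in E);
   case: (z * y ^+ 0 \in 'C(_)); case: (z * y ^+ 1 \in 'C(_)); case: (z * y ^+ 2 \in 'C(_)) => //= _ _ _;
   intuition.
have := noE 0%N 1%N isT p1; have := noC 0%N 1%N isT p1; move: b0 b1; rewrite expg0 expg1 mulg1.
have [zE|nzE] := boolP (z \in E); have [zC|nzC] := boolP (z \in 'C('L_3(G))) => //= _.
- move=> + h1 h2; have [zyE|_] := boolP (z * y \in E); first by case: (h2 isT zyE).
  by have [zyC|//] := boolP (z * y \in 'C(_)); case: (h1 isT zyC).
- move=> + h1 h2; have [zyE|nzyE] := boolP (z * y \in E); first by case: (h2 isT zyE).
  move=> zyC; have Gzy : z * y \in G by rewrite groupM.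
  have fr' : frame22 G x y (z * y).
    split=> //; set S := <<_>>; apply: subset_trans defG _.
    have SL : 'L_2(G) \subset S by rewrite sub_gen ?subsetUr.
    have Sy : y \in S by rewrite mem_gen // !inE eqxx ?orbT.
    have Sz : z \in S.
      have : z * y \in S by rewrite mem_gen // !inE eqxx ?orbT.
      by rewrite groupMr.
    rewrite gen_subG subUset SL andbT; apply/subsetP=> w /setUP[/set2P[]->|/set1P->] //.
    by rewrite mem_gen // !inE eqxx.
  have h : [~ x, z * y]^-1 * ([~ x, z] * l) \in 'L_3(G).
    have Gxz := groupR Gx Gz; have Gl := mem_lcn Ll.
    rewrite cos3_eq; [|exact: groupR|exact: groupM].
    rewrite cos3Rr // (cosetMG (lcn_norm 3 G) Gxz Gl).
    have /eqP-> : coset 'L_3(G) [~ x, y] == 1 by rewrite -cos3_R.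
    have -> : coset 'L_3(G) l = 1 by apply/(coset1P (lcn_norm 3 G) Gl).
    by rewrite mulg1 mul1g.
  have nny : y \notin 'C('L_3(G)) by apply: contra nzC => yC; rewrite -(groupMr _ yC).
  have yp' : y ^+ 2 \in 'L_2(G) by rewrite -[in X in _ ^+ X]p2.
  have := leftover p2 fr' h xE xC zyC nzyE; rewrite -mulgA -expg_sq mulKVg; apply.
    by rewrite groupMr // E2.
  by rewrite groupMr // C2.
- move=> + h1 h2; have [zyC|nzyC] := boolP (z * y \in 'C(_)); first by case: (h1 isT zyC).
  rewrite orbF => zyE; exact: (leftover p2 fr Ll).
Qed.

Lemma commutators_211 : commutators G = 'L_2(G).
Proof.
apply: commutators_full => g Lg; have [Lg3|ng] := boolP (g \in 'L_3(G)); first exact: lcn3K.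
have [x [y [z fr0]]] := coords2 p_pr pG oG2 i2.
have [x' [y' [fr hg]]] := frame22_change p_pr pG oG2 i2 fr0 Lg ng.
by have := cover fr hg; rewrite mulKVg.
Qed.

(** A center of order p^3 would have index p in L_2 and miss some t of L_3, so L_2 = Z(G) <t> and
    [L_2, G] would fall into L_4. Hence this type cannot meet the center condition in class 4. *)
Lemma center_211 : #|'Z(G)| != (p ^ 3)%N.
Proof.
apply/eqP=> oZ; have sZL := center_sub_lcn2 p_pr pG oG2 lt.
have o3 : #|'L_3(G)| = (p ^ 2)%N by rewrite -(Lagrange (lcn_subS 3 G)) o4 i3.
have o2 : #|'L_2(G)| = (p ^ 4)%N by rewrite -(Lagrange (lcn_subS 2 G)) o3 i2 -expnD.
have nZ : 'Z(G) <| 'L_2(G) by apply: normalS sZL (lcn_sub 2 G) (center_normal G).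
have iZ : #|'L_2(G) : 'Z(G)| = p.
  by apply/eqP; rewrite -(eqn_pmul2l (cardG_gt0 'Z(G))) Lagrange // oZ o2 -expnSr.
have [t Lt nt] : exists2 t, t \in 'L_3(G) & t \notin 'Z(G).
  apply/subsetPn; apply: contra nC => /subsetP sZ; apply/subsetP=> w Gw; apply/centP=> t Lt.
  by have /setIP[_ /centP/(_ w Gw) h] := sZ t Lt; apply: commute_sym.
pose W := cmod_group G 'L_4(G).
have sLW : 'L_2(G) \subset W.
  apply: (prime_index_gen p_pr nZ iZ (subsetP (lcn_subS 2 G) t Lt) nt).
    apply/subsetP=> w /setIP[Gw /centP cw]; apply: (cmod_in N4) => // g Gg.
    by rewrite (_ : [~ g, w] = 1) //; apply/eqP/commgP/commute_sym/cw.
  apply: (cmod_in N4); first exact: mem_lcn Lt.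
  by move=> g Gg; rewrite -groupV invgR; apply: R4.
case/negP: nE; apply/subsetP=> g Gg; apply: (cmod_in N4) => // n Ln.
by rewrite -groupV invgR; have /cmodP[_] := subsetP sLW n Ln; apply.
Qed.

End Type211.

(** [x, y] lies in the abelian L_2 and so fixes conjugates of n, whence n^(x y) = n^(y x). *)
Lemma comm_sym_abelian (gT : finGroupType) (G : {group gT}) n x y : abelian 'L_2(G) ->
  n \in 'L_2(G) -> x \in G -> y \in G -> [~ n, x, y] = [~ n, y, x].
Proof.
move=> abL Ln Gx Gy; have Lnyx : n ^ (y * x) \in 'L_2(G) by rewrite mem_lcnJ ?groupM.
have cm u v : u \in 'L_2(G) -> v \in 'L_2(G) -> commute u v by move=> *; apply: (centsP abL).
have nxy : n ^ (x * y) = n ^ (y * x).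
  by rewrite (commgC x y) (conjgM n (y * x)); apply/conjg_fixP/commgP/cm => //; apply: mem_lcn2.
have R2 u : u \in G -> [~ n, u] \in 'L_2(G) by move=> Gu; apply: mem_lcn2 => //; apply: mem_lcn Ln.
have e u v : u \in G -> v \in G -> n ^ (u * v) = n * ([~ n, u] * [~ n, v]) * [~ n, u, v].
  move=> Gu Gv; rewrite conjgM (conjg_mulR n u) conjMg (conjg_mulR n v) (conjg_mulR [~ n, u] v).
  by rewrite (mulgA (n * [~ n, v])) -(mulgA n [~ n, v]) (cm _ _ (R2 v Gv) (R2 u Gu)).
by move: nxy; rewrite !e // (cm _ _ (R2 y Gy) (R2 x Gx)); move/mulgI.
Qed.

(** * Covering the last term when all but two generators act trivially *)

Section CoverLast.
Variables (gT : finGroupType) (G : {group gT}).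
Implicit Types (x y z g n m t c d w r s a b u v l X Y : gT) (k i j : nat) (M T B P D : {group gT}).

(** Modulo [L_{k+2}, X][L_{k+2}, Y] every generator of G centralizes L_{k+2}, so this product
    contains [L_{k+2}, G]. *)
Lemma cover_last k X Y (D : {set gT}) : 'L_k.+4(G) = 1 -> X \in G -> Y \in G -> D \subset G ->
  G \subset <<[set X; Y] :|: D>> -> (forall n d, n \in 'L_k.+2(G) -> d \in D -> [~ n, d] = 1) ->
  'L_k.+3(G) \subset cset 'L_k.+2(G) X * cset 'L_k.+2(G) Y.
Proof.
move=> L4 GX GY sDG defG cD.
have c3 u w : u \in 'L_k.+3(G) -> w \in G -> [~ u, w] = 1.
  by apply: (lcn_eq1 L4 (i := k.+2) (j := 0)); rewrite addn0.
have gr x : x \in G -> group_set (cset 'L_k.+2(G) x).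
  move=> Gx; apply: cset_group_set => n m Ln Lm; apply/conjg_fixP/eqP.
  by apply: c3; [apply: mem_lcnR | apply: mem_lcn Lm].
pose A := Group (gr X GX); pose B := Group (gr Y GY).
have sA : A \subset 'L_k.+3(G) := cset_sub_lcn k.+1 GX; have sB : B \subset 'L_k.+3(G) := cset_sub_lcn k.+1 GY.
have ab : 'L_k.+3(G) \subset 'C('L_k.+3(G)).
  by apply/centsP=> u Lu w Lw; apply: comm1; apply: c3 => //; apply: mem_lcn Lw.
have e : A <*> B = A * B by apply: cent_joinEl; apply: subset_trans sA (subset_trans ab (centS sB)).
rewrite -[cset _ X]/(gval A) -[cset _ Y]/(gval B) -e.
have sAB : A <*> B \subset 'L_k.+3(G) by rewrite join_subG sA.
have nAB : G \subset 'N(A <*> B).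
  apply/subsetP=> g Gg; rewrite inE; apply/subsetP=> _ /imsetP[u ABu ->].
  by rewrite (conjg_fixP _) //; apply/eqP; apply: c3 => //; apply: (subsetP sAB).
have cn n : n \in 'L_k.+2(G) -> G \subset cmod [set n] (A <*> B).
  move=> Ln; apply: subset_trans defG _; rewrite gen_subG; apply/subsetP=> g.
  case/setUP=> [/set2P[]->|Dg].
  - by apply: (cmod_in nAB) => // _ /set1P->; apply: (subsetP (joing_subl _ _)); apply/csetP; exists n.
  - by apply: (cmod_in nAB) => // _ /set1P->; apply: (subsetP (joing_subr _ _)); apply/csetP; exists n.
  - by apply: (cmod_in nAB) => [|_ /set1P->]; [apply: (subsetP sDG) | rewrite cD].
rewrite lcnSn gen_subG; apply/subsetP=> _ /imset2P[n g Ln Gg ->].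
by have /cmodP[_] := subsetP (cn n Ln) g Gg; apply; rewrite inE.
Qed.

End CoverLast.

(** * Groups with L_2/L_3 of order p *)

Section Rank1.
Variables (gT : finGroupType) (p : nat) (G : {group gT}).
Hypotheses (p_pr : prime p) (pG : p.-group G) (i2 : #|'L_2(G) : 'L_3(G)| = p).
Implicit Types (x y z g n m t c d w r s a b u v l X Y : gT) (k i j : nat) (M T B P D : {group gT}).

(* the radical of the commutator pairing G x G -> L_2(G)/L_3(G) *)
Definition rad3 := (cmod_group G 'L_3(G) :&: G)%G.
Local Notation F := rad3.

Let N3 : G \subset 'N('L_3(G)) := lcn_norm 3 G.
Let N4 : G \subset 'N('L_4(G)) := lcn_norm 4 G.

Lemma rad3_sub : F \subset G. Proof. exact: subsetIr. Qed.

Lemma rad3P x : reflect (x \in G /\ {in G, forall g, [~ g, x] \in 'L_3(G)}) (x \in F).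
Proof.
apply: (iffP setIP) => [[/cmodP[_ h] Gx] // | [Gx h]]; split=> //.
exact: (cmod_in N3).
Qed.

Lemma rad3R x g : x \in F -> g \in G -> [~ x, g] \in 'L_3(G).
Proof. by case/rad3P=> _ h Gg; rewrite -groupV invgR h. Qed.

Lemma lcn2_rad3 : 'L_2(G) \subset F.
Proof.
apply/subsetP=> n Ln; apply/rad3P; split; first exact: mem_lcn Ln.
by move=> g Gg; apply: (mem_lcnRl (k := 1)).
Qed.

Lemma rad3_C2 : F \subset cmod 'L_2(G) 'L_4(G).
Proof. exact: lcn_F_C2. Qed.

Lemma rad3_C2R n x : n \in 'L_2(G) -> x \in F -> [~ n, x] \in 'L_4(G).
Proof. by move=> Ln /(subsetP rad3_C2)/cmodP[_]; apply. Qed.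

Lemma rad3_C3 : F \subset cmod 'L_3(G) 'L_5(G).
Proof.
apply: subset_trans (lcn_C2_C3 p_pr i2); apply/subsetP=> x Fx; rewrite inE (subsetP rad3_C2) //.
exact: (subsetP rad3_sub).
Qed.

Lemma nrad3P X : X \in G -> X \notin F -> exists2 Y, Y \in G & [~ Y, X] \notin 'L_3(G).
Proof.
move=> GX nX; apply: (cmod_nP N3 GX); apply: contra nX => h; exact/setIP.
Qed.

Lemma nrad3 X Y : X \in G -> Y \in G -> [~ X, Y] \notin 'L_3(G) -> X \notin F /\ Y \notin F.
Proof.
move=> GX GY nXY; split; apply: contra nXY => h; first exact: rad3R.
by case/rad3P: h => _ h; apply: h.
Qed.

Lemma rad3_normal : F <| G.
Proof. by apply: sub_der1_normal rad3_sub; apply: lcn2_rad3. Qed.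

Lemma rad3_pow x : x \in G -> x ^+ p \in F.
Proof.
move=> Gx; apply/rad3P; split; first exact: groupX.
move=> g Gg; rewrite cos3_R ?groupX // cos3Xr //; have Lgx := mem_lcn2 Gg Gx.
have : coset 'L_3(G) [~ g, x] \in 'L_2(G) / 'L_3(G) by apply: mem_quotient.
by move/expg_cardG; rewrite card_quotient ?(subset_trans (lcn_sub 2 G) N3) // i2 => ->.
Qed.

Lemma lcn2_pow n : n \in 'L_2(G) -> n ^+ p \in 'L_3(G).
Proof.
move=> Ln; have Gn := mem_lcn Ln; rewrite cos3_1 ?groupX // cos3X //.
have : coset 'L_3(G) n \in 'L_2(G) / 'L_3(G) by apply: mem_quotient.
by move/expg_cardG; rewrite card_quotient ?(subset_trans (lcn_sub 2 G) N3) // i2 => ->.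
Qed.

Lemma lcn3_pow n x : n \in 'L_2(G) -> x \in G -> [~ n, x] ^+ p \in 'L_4(G).
Proof.
move=> Ln Gx; have Gn := mem_lcn Ln; have L3 := mem_lcnR Ln Gx.
apply/(coset1P N4); first by rewrite groupX // groupR.
rewrite (cosetXG _ N4) ?groupR // -(coset_RXl _ N4) //; last by apply: mem_lcnR.
apply/(coset1P N4); first by rewrite groupR // groupX.
by apply: mem_lcnR => //; apply: lcn2_pow.
Qed.

Lemma not_cycle_rad3 X Y : X \in G -> Y \in G -> [~ X, Y] \notin 'L_3(G) -> Y \notin F <*> <[X]>.
Proof.
move=> GX GY; apply: contra => h; have : F <*> <[X]> \subset cmod [set X] 'L_3(G).
  rewrite join_subG cycle_subG; apply/andP; split.
    by apply/subsetP=> x Fx; apply: (cmod_in N3); [apply: (subsetP rad3_sub) | move=> _ /set1P->; case/rad3P: Fx => _; apply].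
  by apply: (cmod_in N3) => // _ /set1P->; rewrite commgg.
by move/subsetP/(_ Y h)/cmodP=> [_]; apply; rewrite inE.
Qed.

Lemma nlcn23 : ~~ ('L_2(G) \subset 'L_3(G)).
Proof. by rewrite -indexg_eq1 i2 neq_ltn prime_gt1 ?orbT. Qed.

Lemma exists_pair : exists a b, [/\ a \in G, b \in G & [~ a, b] \notin 'L_3(G)].
Proof.
have [nF] : ~~ (G \subset F).
  apply: contra nlcn23 => sF; rewrite (lcnSn 1) gen_subG; apply/subsetP=> _ /imset2P[x y Gx Gy ->].
  by apply: rad3R => //; apply: (subsetP sF).
have [b Gb nb] := avoid1 nF; have [a Ga nab] := nrad3P Gb nb; by exists a, b.
Qed.

Lemma gen_rad3 x a b : x \in G -> a \in G -> b \in G -> G \subset 'L_2(G) <*> <[a]> <*> <[b]> <*> <[x]> ->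
  [~ a, x] \in 'L_3(G) -> [~ b, x] \in 'L_3(G) -> x \in F.
Proof.
move=> Gx Ga Gb defG ax bx; apply/rad3P; split=> // g Gg.
have : G \subset cmod [set x] 'L_3(G).
  apply: subset_trans defG _; rewrite !join_subG !cycle_subG -!andbA; apply/and4P; split.
  - apply/subsetP=> n Ln; apply: (cmod_in N3); first exact: mem_lcn Ln.
    by move=> _ /set1P->; apply: (mem_lcnRl (k := 1)).
  - by apply: (cmod_in N3) => // _ /set1P->; rewrite -groupV invgR.
  - by apply: (cmod_in N3) => // _ /set1P->; rewrite -groupV invgR.
  - by apply: (cmod_in N3) => // _ /set1P->; rewrite commgg.
move/subsetP/(_ g Gg)/cmodP=> [_ h]; by rewrite -groupV invgR h ?inE.
Qed.

(** A form that is alternating with values in a group of order p has even rank, so in dimension 3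
    its radical has index at most p^2. As G/L_2 need not be elementary, a radical element outside
    L_2 is sought among a^p, b^p and a corrected third generator. *)
Lemma index_rad3 : #|G : 'L_2(G)| <= p ^ 3 -> #|G : F| <= p ^ 2.
Proof.
move=> oG; suff [|[t Ft nt]] : #|G : 'L_2(G)| <= p ^ 2 \/ exists2 t, t \in F & t \notin 'L_2(G).
- by apply: leq_trans; rewrite dvdn_leq // indexgS // lcn2_rad3.
- have st : 'L_2(G) <*> <[t]> \subset F by rewrite join_subG lcn2_rad3 cycle_subG.
  have Gt := subsetP rad3_sub t Ft.
  apply: leq_trans (index_step p_pr pG (lcn_sub 2 G) Gt nt oG).
  by rewrite dvdn_leq // indexgS.
have [a [b [Ga Gb nab]]] := exists_pair.
have na : a \notin 'L_2(G) by apply: contra nab => La; apply: (mem_lcnR (k := 1)).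
have nb : b \notin 'L_2(G) <*> <[a]>.
  apply: contra (not_cycle_rad3 Ga Gb nab); apply: subsetP; apply: genS; apply: setSU; exact: lcn2_rad3.
pose H := ('L_2(G) <*> <[a]> <*> <[b]>)%G.
have GcL x : [~ x, x] \in 'L_3(G) by rewrite commgg.
have [sGH|nGH] := boolP (G \subset H).
  have inF x : x \in G -> [~ a, x] \in 'L_3(G) -> [~ b, x] \in 'L_3(G) -> x \in F.
    by move=> Gx; apply: (gen_rad3 Gx Ga Gb); apply: subset_trans sGH (joing_subl _ _).
  have [ap|nap] := boolP (a ^+ p \in 'L_2(G)); last by right; exists (a ^+ p); rewrite // rad3_pow.
  have [bp|nbp] := boolP (b ^+ p \in 'L_2(G)); last by right; exists (b ^+ p); rewrite // rad3_pow.
  left; have nL := lcn_norm 2 G.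
  have ia := index_cycle_le p_pr (subsetP nL a Ga) ap.
  have nM : G \subset 'N('L_2(G) <*> <[a]>).
    apply: normal_norm; apply: sub_der1_normal; first exact: joing_subl.
    by rewrite join_subG lcn_sub cycle_subG.
  have ib := index_join_le p_pr (joing_subl 'L_2(G) <[a]>) (subsetP nM b Gb) (subsetP (joing_subl _ _) _ bp).
  apply: (@leq_trans #|H : 'L_2(G)|).
    have <- : G = H by apply/eqP; rewrite -val_eqE eqEsubset sGH /= !join_subG !cycle_subG lcn_sub Ga.
    by [].
  by apply: leq_trans ib _; rewrite -mulnn leq_mul2l ia orbT.
right; have [t0 Gt0 nt0] := avoid1 nGH.
have nL32 : 'L_3(G) <| 'L_2(G) by rewrite /normal (lcn_subS 2) (subset_trans (lcn_sub 2 G) N3).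
have cov := prime_index_cover p_pr nL32 i2 (mem_lcn2 Ga Gb) nab.
have [i hi] := cov _ (mem_lcn2 Gt0 Gb); have [j hj] := cov _ (mem_lcn2 Gt0 Ga).
(* Orthogonalization against the hyperbolic pair a, b: i and j are read off from [t0, b] and
   [t0, a]. *)
pose t := t0 * a ^- i * b ^+ j.
have Gai : a ^- i \in G by rewrite groupV groupX.
have Gbj : b ^+ j \in G by rewrite groupX.
have Gt : t \in G by rewrite !groupM.
have tH : t \notin H.
  have aH : a \in H by apply: (subsetP (joing_subl _ _)); rewrite (subsetP (joing_subr _ _)) ?cycle_id.
  have bH : b \in H by rewrite (subsetP (joing_subr _ _)) ?cycle_id.
  by rewrite /t groupMr ?groupX // groupMr // groupV groupX.
exists t; last by apply: contra tH; apply: subsetP; do 2!apply: subset_trans (joing_subl _ _).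
have eqc x y (k : nat) : x \in G -> y \in G -> ([~ a, b] ^+ k)^-1 * [~ x, y] \in 'L_3(G) ->
   coset 'L_3(G) [~ x, y] = coset 'L_3(G) [~ a, b] ^+ k.
  move=> Gx Gy h; rewrite -cos3X ?groupR //; apply: esym; apply/(coset_eqP N3) => //; by rewrite ?groupX ?groupR.
have e1 := eqc _ _ _ Gt0 Gb hi; have e2 := eqc _ _ _ Gt0 Ga hj.
have Gta : t0 * a ^- i \in G by rewrite groupM.
have invq x y : x \in G -> y \in G -> coset 'L_3(G) [~ x^-1, y] = (coset 'L_3(G) [~ x, y])^-1.
  move=> Gx Gy; apply: (mulIg (coset 'L_3(G) [~ x, y])); rewrite mulVg -cos3Rl ?groupV // mulVg comm1g.
  exact: morph1.
have ta : [~ t, a] \in 'L_3(G).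
  rewrite cos3_R // cos3Rl // cos3Rl // e2 cos3Xl // -(invgR a b) cos3V ?groupR //.
  rewrite invq ?groupX // cos3Xl // commgg morph1 expg1n invg1 mulg1.
  by rewrite expgVn mulgV.
have tb : [~ t, b] \in 'L_3(G).
  rewrite cos3_R // cos3Rl // cos3Rl // e1 cos3Xl // commgg morph1 expg1n mulg1.
  by rewrite invq ?groupX // cos3Xl // mulgV.
apply: (gen_rad3 Gt Ga Gb); rewrite -?[[~ a, t]]invgR -?[[~ b, t]]invgR ?groupV //.
have iH : #|G : 'L_2(G) <*> <[a]>| <= p ^ 2 by apply: (index_step p_pr pG (lcn_sub 2 G) Ga na).
have sH1 : 'L_2(G) <*> <[a]> \subset G by rewrite join_subG lcn_sub cycle_subG.
have iH2 : #|G : H| <= p ^ 1 by apply: (index_step p_pr pG sH1 Gb nb).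
have sH2 : H \subset G by rewrite join_subG sH1 cycle_subG.
exact: index_le1 (index_step p_pr pG sH2 Gt tH iH2).
Qed.

Section Small.
Hypothesis iF : #|G : F| <= p ^ 2.

Lemma pair_gen X Y : X \in G -> Y \in G -> [~ X, Y] \notin 'L_3(G) -> G \subset <<[set X; Y] :|: F>>.
Proof.
move=> GX GY nXY; have [nX _] := nrad3 GX GY nXY; have nY := not_cycle_rad3 GX GY nXY.
have i1 : #|G : F <*> <[X]>| <= p ^ 1 by apply: (index_step p_pr pG rad3_sub GX nX).
have s1 : F <*> <[X]> \subset G by rewrite join_subG rad3_sub cycle_subG.
have := index_le1 (index_step p_pr pG s1 GY nY i1) => sG; apply: subset_trans sG _.
rewrite (join_subG (F <*> <[X]>)%G <[Y]>) (join_subG F <[X]>) !cycle_subG.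
by rewrite sub_gen ?subsetUr // !mem_gen // !inE eqxx ?orbT.
Qed.

Lemma lcn3_gen X Y n B : X \in G -> Y \in G -> [~ X, Y] \notin 'L_3(G) -> n \in 'L_2(G) -> n \notin 'L_3(G) ->
  'L_4(G) \subset B -> B \subset 'L_3(G) -> [~ n, X] \in B -> [~ n, Y] \in B -> 'L_3(G) \subset B.
Proof.
move=> GX GY nXY Ln nn s4B sB3 nX nY; have nB : G \subset 'N(B) by apply: (norm_between (k := 2)).
have nG : G \subset cmod [set n] B.
  apply: subset_trans (pair_gen GX GY nXY) _; rewrite gen_subG; apply/subsetP=> g.
  case/setUP=> [/set2P[]->|Fg]; [by apply: (cmod_in nB) => // _ /set1P-> | by apply: (cmod_in nB) => // _ /set1P-> | ].
  apply: (cmod_in nB) => [|_ /set1P->]; first exact: (subsetP rad3_sub).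
  by apply: (subsetP s4B); apply: rad3_C2R.
have nL32 : 'L_3(G) <| 'L_2(G) by rewrite /normal (lcn_subS 2) (subset_trans (lcn_sub 2 G) N3).
have : 'L_2(G) \subset cmod G B.
  apply: (prime_index_gen p_pr nL32 i2 Ln nn).
    apply/subsetP=> l Ll; apply: (cmod_in nB); first exact: mem_lcn Ll.
    by move=> g Gg; apply: (subsetP s4B); apply: (mem_lcnRl (k := 2)).
  apply: (cmod_in nB); first exact: mem_lcn Ln.
  by move=> g Gg; rewrite -groupV invgR; have /cmodP[_] := subsetP nG g Gg; apply; rewrite inE.
move=> sL; rewrite [in X in X \subset _](lcnSn 1) gen_subG; apply/subsetP=> _ /imset2P[m g Lm Gg ->].
by rewrite -groupV invgR; have /cmodP[_] := subsetP sL m Lm; apply.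
Qed.

Lemma lcn3_coord X Y n t : X \in G -> Y \in G -> [~ X, Y] \notin 'L_3(G) -> n \in 'L_2(G) -> n \notin 'L_3(G) ->
  t \in 'L_3(G) -> exists (i j : nat), ([~ n, X] ^+ i * [~ n, Y] ^+ j)^-1 * t \in 'L_4(G).
Proof.
move=> GX GY nXY Ln nn Lt; have LX := mem_lcnR Ln GX; have LY := mem_lcnR Ln GY.
pose Q1 := ('L_4(G) <*> <[ [~ n, X] ]>)%G.
have s1 : Q1 \subset 'L_3(G) by rewrite join_subG (lcn_subS 3) cycle_subG.
have n1 : G \subset 'N(Q1) by apply: (norm_between (k := 2)); rewrite ?joing_subl.
have nu : <[ [~ n, X] ]> \subset 'N('L_4(G)) by rewrite cycle_subG (subsetP N4) // (mem_lcn LX).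
have nv : <[ [~ n, Y] ]> \subset 'N(Q1) by rewrite cycle_subG (subsetP n1) // (mem_lcn LY).
have sQ : Q1 <*> <[ [~ n, Y] ]> \subset 'L_3(G) by rewrite join_subG s1 cycle_subG.
have : t \in Q1 <*> <[ [~ n, Y] ]>.
  apply: (subsetP _ t Lt); apply: (lcn3_gen GX GY nXY Ln nn _ sQ).
  - by apply: subset_trans (joing_subl _ _); apply: joing_subl.
  - by apply: (subsetP (joing_subl _ _)); rewrite (subsetP (joing_subr _ _)) ?cycle_id.
  - by rewrite (subsetP (joing_subr _ _)) ?cycle_id.
rewrite (norm_joinEr nv) => /mulsgP[a _ + /cycleP[j ->] en].
rewrite /Q1 /= (norm_joinEr nu) => /mulsgP[l _ Ll /cycleP[i ->] ea]; exists i, j.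
rewrite en ea -mulgA -conjgE mem_lcnJ //; apply: groupM; apply: groupX; [exact: mem_lcn LX | exact: mem_lcn LY].
Qed.

(** Modulo L_4 the map x -> [n, x] is a homomorphism, and its values at X and Y generate L_3. *)
Lemma lcn3_value n t : n \in 'L_2(G) -> n \notin 'L_3(G) -> t \in 'L_3(G) ->
  exists2 x, x \in G & [~ n, x]^-1 * t \in 'L_4(G).
Proof.
move=> Ln nn Lt; have [X [Y [GX GY nXY]]] := exists_pair.
have [i [j h]] := lcn3_coord GX GY nXY Ln nn Lt; have Gn := mem_lcn Ln.
exists (Y ^+ j * X ^+ i); first by rewrite groupM ?groupX.
have Li : [~ n, X ^+ i] \in 'L_3(G) by apply: mem_lcnR => //; apply: groupX.
have Gw : Y ^+ j * X ^+ i \in G by rewrite groupM ?groupX.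
have GRX := groupX i (groupR Gn GX); have GRY := groupX j (groupR Gn GY).
apply/(coset_eqP N4) => //; first exact: groupR.
  exact: mem_lcn Lt.
have <- : coset 'L_4(G) ([~ n, X] ^+ i * [~ n, Y] ^+ j) = coset 'L_4(G) t.
  by apply/(coset_eqP N4 _ (mem_lcn Lt)) => //; apply: groupM.
have R4 u v : u \in 'L_3(G) -> v \in G -> [~ u, v] \in 'L_4(G) by apply: mem_lcnR.
rewrite (coset_RMr N4) ?groupX //; last by apply: R4; [apply: (mem_lcnR (k := 1)) => //; apply: groupX | apply: groupX].
rewrite (cosetMG N4 GRX GRY) !(cosetXG _ N4) ?groupR //.
by rewrite !(coset_RXr _ N4) //; apply: R4 => //; apply: mem_lcnR.
Qed.

Lemma index34_le : #|'L_3(G) : 'L_4(G)| <= p ^ 2.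
Proof.
have [X [Y [GX GY nXY]]] := exists_pair; set n := [~ X, Y] in nXY; have Ln : n \in 'L_2(G) := mem_lcn2 GX GY.
have LX := mem_lcnR Ln GX; have LY := mem_lcnR Ln GY.
pose Q1 := ('L_4(G) <*> <[ [~ n, X] ]>)%G.
have s1 : Q1 \subset 'L_3(G) by rewrite join_subG (lcn_subS 3) cycle_subG.
have n1 : G \subset 'N(Q1) by apply: (norm_between (k := 2)); rewrite ?joing_subl.
have sQ : Q1 <*> <[ [~ n, Y] ]> \subset 'L_3(G) by rewrite join_subG s1 cycle_subG.
have s3 : 'L_3(G) \subset Q1 <*> <[ [~ n, Y] ]>.
  apply: (lcn3_gen GX GY nXY Ln nXY _ sQ).
  - by apply: subset_trans (joing_subl _ _); apply: joing_subl.
  - by apply: (subsetP (joing_subl _ _)); rewrite (subsetP (joing_subr _ _)) ?cycle_id.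
  - by rewrite (subsetP (joing_subr _ _)) ?cycle_id.
have ia := index_cycle_le p_pr (subsetP N4 _ (mem_lcn LX)) (lcn3_pow Ln GX).
have ib := index_join_le p_pr (joing_subl 'L_4(G) _) (subsetP n1 _ (mem_lcn LY)) (subsetP (joing_subl _ _) _ (lcn3_pow Ln GY)).
apply: (@leq_trans #|Q1 <*> <[ [~ n, Y] ]> : 'L_4(G)|); first by rewrite dvdn_leq // indexSg // (lcn_subS 3).
by apply: leq_trans ib _; rewrite -mulnn leq_mul2l ia orbT.
Qed.

(** If [n, x] were in L_4, the factor L_3/L_4 would be generated by a single [n, y] of order
    dividing p. *)
Lemma indep34 n x : #|'L_3(G) : 'L_4(G)| = (p ^ 2)%N -> n \in 'L_2(G) -> n \notin 'L_3(G) -> x \in G -> x \notin F ->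
  [~ n, x] \notin 'L_4(G).
Proof.
move=> i3 Ln nn Gx nx; apply/negP=> L4x; have [y Gy nyx] := nrad3P Gx nx.
have LY := mem_lcnR Ln Gy; pose Q1 := ('L_4(G) <*> <[ [~ n, y] ]>)%G.
have s1 : Q1 \subset 'L_3(G) by rewrite join_subG (lcn_subS 3) cycle_subG.
have s3 : 'L_3(G) \subset Q1.
  apply: (lcn3_gen Gy Gx nyx Ln nn (joing_subl _ _) s1); last by apply: (subsetP (joing_subl _ _)).
  by rewrite (subsetP (joing_subr _ _)) ?cycle_id.
have ia := index_cycle_le p_pr (subsetP N4 _ (mem_lcn LY)) (lcn3_pow Ln Gy).
have : #|'L_3(G) : 'L_4(G)| <= p by apply: leq_trans ia; rewrite dvdn_leq // indexSg // (lcn_subS 3).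
by rewrite i3 leqNgt -{1}(expn1 p) ltn_exp2l ?prime_gt1.
Qed.

End Small.
End Rank1.

(** * Lifting elements outside L_3 through the whole series *)

Section Rank1Lift.
Variables (gT : finGroupType) (p : nat) (G : {group gT}).
Hypotheses (p_pr : prime p) (pG : p.-group G) (i2 : #|'L_2(G) : 'L_3(G)| = p).
Implicit Types (x y z g n m t d w r s a b u v l X Y : gT) (k i j c : nat) (M T B P D : {group gT}).
Local Notation F := (rad3 G).
Let N3 : G \subset 'N('L_3(G)) := lcn_norm 3 G.
Let N4 : G \subset 'N('L_4(G)) := lcn_norm 4 G.
Let nL32 : 'L_3(G) <| 'L_2(G).
Proof. by rewrite /normal (lcn_subS 2) (subset_trans (lcn_sub 2 G) N3). Qed.

(** A pair with [X, Y] outside L_3 generates G together with [F], and [F] acts trivially on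
    L_{k+2}/L_{k+4}; [cover_last] in G/L_{k+4} therefore makes every lifting step succeed. *)
Lemma lift_all c g : #|G : F| <= p ^ 2 -> (forall k, k <= c -> F \subset cmod 'L_k.+2(G) 'L_k.+4(G)) ->
  g \in 'L_2(G) -> g \notin 'L_3(G) ->
  forall k, k <= c.+1 -> exists X Y, [/\ X \in G, Y \in G & [~ X, Y]^-1 * g \in 'L_k.+3(G)].
Proof.
move=> iF cF Lg ng; have Gg := mem_lcn Lg; elim=> [|k IH] lek.
  have [a [b [Ga Gb nab]]] := exists_pair p_pr i2.
  have [i hi] := prime_index_cover p_pr nL32 i2 (mem_lcn2 Ga Gb) nab Lg.
  exists (a ^+ i), b; split; rewrite ?groupX //.
  rewrite cos3_eq ?groupR ?groupX // cos3Xl // -cos3X ?groupR //.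
  by apply/eqP/(coset_eqP N3 _ Gg); rewrite // groupX // groupR.
have [X [Y [GX GY h]]] := IH (ltnW lek).
have nXY : [~ X, Y] \notin 'L_3(G).
  by apply: contra ng => L; rewrite -(groupMl _ (groupVr L)); apply: mem_lcn_leq h.
have GR := groupR GX GY; have nM := lcn_normal k.+4 G; have NM : G \subset 'N('L_k.+4(G)) := lcn_norm k.+4 G.
have Lq j : 'L_j.+1(G / 'L_k.+4(G)) = 'L_j.+1(G) / 'L_k.+4(G) by apply: lcn_quo.
have Lk : 'L_k.+4(G / 'L_k.+4(G)) = 1 by rewrite Lq trivg_quotient.
have cov := @cover_last _ (G / 'L_k.+4(G)) k (coset _ X) (coset _ Y) (F / 'L_k.+4(G)) Lk.
have lift := lift_last Lk (mem_quotient _ GX) (mem_quotient _ GY) (cov _ _ _ _ _).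
have : coset 'L_k.+4(G) g \in commutators (G / 'L_k.+4(G)).
  have := lift _ _ _ _ _ (coset 'L_k.+4(G) ([~ X, Y]^-1 * g)).
  have Gt : [~ X, Y]^-1 * g \in G by rewrite groupM ?groupV.
  rewrite -(coset_comm NM GX GY) -(cosetMG NM GR Gt) mulKVg.
  apply; rewrite ?mem_quotient ?quotientS ?(rad3_sub G) //.
  - have := quotientS 'L_k.+4(G) (pair_gen p_pr pG iF GX GY nXY).
    rewrite /quotient morphim_gen; last first.
      by apply: subset_trans NM; rewrite subUset rad3_sub andbT; apply/subsetP=> w /set2P[]->.
    move/subset_trans; apply; apply: genS; apply/subsetP=> _ /morphimP[w Nw + ->].
    case/setUP=> [/set2P[]->|Fw]; rewrite !inE ?eqxx ?orbT //.
    by rewrite mem_quotient ?orbT.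
  - move=> n d; rewrite Lq => /morphimP[n0 Nn0 Ln0 ->] /morphimP[d0 Nd0 Fd0 ->].
    have /cmodP[_ cd] := subsetP (cF k lek) d0 Fd0.
    have [Gn0 Gd0] := (mem_lcn Ln0, subsetP (rad3_sub G) _ Fd0).
    by rewrite -(coset_comm NM Gn0 Gd0); apply/(coset1P NM); [apply: groupR | apply: cd].
  - by rewrite Lq; apply: mem_quotient.
case/(commutators_quo nM Gg)=> x [y [Gx Gy e]]; exists x, y; split=> //.
by rewrite -groupV invMg invgK.
Qed.

(** Every g is a power of a times an element centralizing L_2/L_4, and by [lcn_C2_C3] such elements
    also centralize L_3/L_5. So L_4/L_5 is generated by one commutator [l, a], of order dividing
    p. *)
Lemma index45_le : #|'L_3(G) : 'L_4(G)| = p -> #|'L_4(G) : 'L_5(G)| <= p.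
Proof.
move=> i3; have N5 : G \subset 'N('L_5(G)) := lcn_norm 5 G.
have nE : ~~ (G \subset cmod 'L_2(G) 'L_4(G)).
  apply: (cmod_proper (k := 1)); apply/negP=> s34; rewrite -indexg_eq1 i3 in s34.
  by move: (prime_gt1 p_pr); rewrite (eqP s34).
have nL43 : 'L_4(G) <| 'L_3(G) by rewrite /normal (lcn_subS 3) (subset_trans (lcn_sub 3 G) N4).
have [a Ga na] := avoid1 nE; have [n Ln nn] := cmod_nP N4 Ga na.
have L3a := mem_lcnR Ln Ga; set l := [~ n, a] in nn L3a; have Gl := mem_lcn L3a; have Gn := mem_lcn Ln.
have L4a : [~ l, a] \in 'L_4(G) by apply: mem_lcnR.
pose B := ('L_5(G) <*> <[ [~ l, a] ]>)%G.
have sB : B \subset 'L_4(G) by rewrite join_subG (lcn_subS 4) cycle_subG.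
have nB : G \subset 'N(B) by apply: (norm_between (k := 3)); rewrite ?joing_subl.
have nn3 : n \notin 'L_3(G) by apply: contra nn => Ln3; apply: mem_lcnR.
have lG : G \subset cmod [set l] B.
  apply/subsetP=> g Gg; have [i hi] := prime_index_cover p_pr nL43 i3 L3a nn (mem_lcnR Ln Gg).
  pose e := (a ^+ i)^-1 * g; have Ge : e \in G by rewrite groupM ?groupV ?groupX.
  have Gai := groupX i Ga.
  have eC : e \in cmod 'L_2(G) 'L_4(G) :&: G.
    rewrite inE Ge andbT; apply: (cmod_in N4) => // m Lm; have Gm := mem_lcn Lm.
    have RR u v : u \in 'L_2(G) -> v \in G -> [~ u, v] \in 'L_3(G) by apply: mem_lcnR.
    have R4 u v : u \in 'L_3(G) -> v \in G -> [~ u, v] \in 'L_4(G) by apply: mem_lcnR.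
    have ne : n \in cmod [set e] 'L_4(G).
      apply: (cmod_in N4) => // _ /set1P->; rewrite -groupV invgR.
      have e1 : coset 'L_4(G) [~ n, g] = coset 'L_4(G) [~ n, e] * coset 'L_4(G) [~ n, a ^+ i].
        by rewrite -(coset_RMr N4) ?mulKVg //; apply: R4 => //; apply: RR.
      have e2 : coset 'L_4(G) [~ n, g] = coset 'L_4(G) [~ n, a ^+ i].
        apply: esym; rewrite (coset_RXr _ N4) //.
        by rewrite -(cosetXG _ N4) //; apply/(coset_eqP N4 (groupX i Gl) (groupR Gn Gg)).
      by apply/(coset1P N4); [apply: groupR | apply: (mulIg (coset 'L_4(G) [~ n, a ^+ i])); rewrite -e1 mul1g].
    have : 'L_2(G) \subset cmod [set e] 'L_4(G).
      apply: (prime_index_gen p_pr nL32 i2 Ln nn3 _ ne).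
      apply/subsetP=> w Lw; apply: (cmod_in N4); first exact: mem_lcn Lw.
      by move=> _ /set1P->; apply: (mem_lcnRl (k := 2)).
    by move/subsetP/(_ m Lm)/cmodP=> [_ h]; rewrite -groupV invgR h ?inE.
  have /cmodP[_ eC5] := subsetP (lcn_C2_C3 p_pr i2) e eC.
  have aB : a \in cmod [set l] B.
    by apply: (cmod_in nB) => // _ /set1P->; rewrite (subsetP (joing_subr _ _)) ?cycle_id.
  have eB : e \in cmod [set l] B.
    by apply: (cmod_in nB) => // _ /set1P->; apply: (subsetP (joing_subl _ _)); apply: eC5.
  by rewrite -(mulKVg (a ^+ i) g) groupM ?groupX.
have sL : 'L_3(G) \subset cmod G B.
  apply: (prime_index_gen p_pr nL43 i3 L3a nn).
    apply/subsetP=> w Lw; apply: (cmod_in nB); first exact: mem_lcn Lw.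
    by move=> g Gg; apply: (subsetP (joing_subl _ _)); apply: (mem_lcnRl (k := 3)).
  apply: (cmod_in nB) => // g Gg.
  by rewrite -groupV invgR; have /cmodP[_] := subsetP lG g Gg; apply; rewrite inE.
have s4 : 'L_4(G) \subset B.
  rewrite [in X in X \subset _](lcnSn 2) gen_subG; apply/subsetP=> _ /imset2P[m g Lm Gg ->].
  by rewrite -groupV invgR; have /cmodP[_] := subsetP sL m Lm; apply.
have lp : l ^+ p \in 'L_4(G) by apply: lcn3_pow.
have la5 : [~ l, a] ^+ p \in 'L_5(G).
  have R5 u v : u \in 'L_4(G) -> v \in G -> [~ u, v] \in 'L_5(G) by apply: mem_lcnR.
  apply/(coset1P N5); first by rewrite groupX // groupR.
  rewrite (cosetXG _ N5) ?groupR // -(coset_RXl _ N5) //; last by apply: R5.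
  apply/(coset1P N5); first by rewrite groupR // groupX.
  exact: R5.
apply: leq_trans (index_cycle_le p_pr (subsetP N5 _ (mem_lcn L4a)) la5).
by rewrite dvdn_leq // indexSg // (lcn_subS 4).
Qed.

End Rank1Lift.

(** * All factors of order p *)

Section Uniserial45.
Variables (gT : finGroupType) (p : nat) (G : {group gT}).
Hypotheses (p_pr : prime p) (pG : p.-group G).
Implicit Types (x y z g n m t c d w r s a b u v l X Y : gT) (k i j : nat) (M T B P D : {group gT}).

Let nsub k : #|'L_k.+2(G) : 'L_k.+3(G)| = p -> ~~ (G \subset cmod 'L_k.+1(G) 'L_k.+3(G)).
Proof.
move=> i; apply: cmod_proper; apply/negP=> s; rewrite -indexg_eq1 i in s.
by move: (prime_gt1 p_pr); rewrite (eqP s).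
Qed.

Lemma commutators_1111 : 'L_6(G) = 1 -> (forall k, k <= 3 -> #|'L_k.+2(G) : 'L_k.+3(G)| = p) ->
  commutators G = 'L_2(G).
Proof.
move=> L6 iL; have n3 : ~~ (G \subset cmod 'L_3(G) 'L_5(G)) by apply: nsub; apply: (iL 2%N).
have n4 : ~~ (G \subset cmod 'L_4(G) 'L_6(G)) by apply: nsub; apply: (iL 3%N).
have [x [Gx x3 x4]] := avoid2 n3 n4.
apply: (commutators_cset Gx); apply: (uniserial_cset (c := 2) p_pr L6 Gx iL).
case=> [|[|[|//]]] _ //; apply: contra x3 => x2; apply: (subsetP (lcn_C2_C3 p_pr (iL 0%N isT))).
by rewrite inE x2.
Qed.

(** Three centralizers have to be avoided, whence odd p; that of L_2/L_4 is contained in that of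
    L_3/L_5 by [lcn_C2_C3], so avoiding the latter takes care of it. *)
Lemma commutators_11111 : odd p -> 'L_7(G) = 1 -> (forall k, k <= 4 -> #|'L_k.+2(G) : 'L_k.+3(G)| = p) ->
  commutators G = 'L_2(G).
Proof.
move=> op L7 iL; have n3 : ~~ (G \subset cmod 'L_3(G) 'L_5(G)) by apply: nsub; apply: (iL 2%N).
have n4 : ~~ (G \subset cmod 'L_4(G) 'L_6(G)) by apply: nsub; apply: (iL 3%N).
have n5 : ~~ (G \subset cmod 'L_5(G) 'L_7(G)) by apply: nsub; apply: (iL 4%N).
have [x [Gx x3 x4 x5]] := avoid3 pG op n3 n4 n5.
apply: (commutators_cset Gx); apply: (uniserial_cset (c := 3) p_pr L7 Gx iL).
case=> [|[|[|[|//]]]] _ //; apply: contra x3 => x2; apply: (subsetP (lcn_C2_C3 p_pr (iL 0%N isT))).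
by rewrite inE x2.
Qed.

End Uniserial45.

(* a 2-group with |G : G'| = 4 has cyclic derived subgroup *)
(** * 2-groups with abelianization of order 4 *)

Section MaxClass2.
Variables (gT : finGroupType) (G : {group gT}).
Hypotheses (pG : 2.-group G) (i2 : #|'L_2(G) : 'L_3(G)| = 2) (iG : #|G : 'L_2(G)| = 4)
  (n34 : ~~ ('L_3(G) \subset 'L_4(G))).
Implicit Types (x y z g n m t c d w r s a b u v l X Y : gT) (k i j : nat) (M T B P D : {group gT}).
Local Notation F := (rad3 G).
Let p2 : prime 2 := isT.
Let N3 : G \subset 'N('L_3(G)) := lcn_norm 3 G.
Let N4 : G \subset 'N('L_4(G)) := lcn_norm 4 G.
Let Phi := [group of 'Phi('L_2(G))].
Let nL32 : 'L_3(G) <| 'L_2(G).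
Proof. by rewrite /normal (lcn_subS 2) (subset_trans (lcn_sub 2 G) N3). Qed.

Let R3 n X : n \in 'L_2(G) -> X \in G -> [~ n, X] \in 'L_3(G). Proof. exact: mem_lcnR. Qed.
Let R4 n X : n \in 'L_3(G) -> X \in G -> [~ n, X] \in 'L_4(G). Proof. exact: mem_lcnR. Qed.

Let iF : #|G : F| <= 2 ^ 2.
Proof. by apply: (index_rad3 p2 pG i2); rewrite iG. Qed.

Let square_in x y : x \in G -> y \in G -> [~ x, y] \notin 'L_3(G) -> x ^+ 2 \in 'L_2(G).
Proof.
move=> Gx Gy nxy; apply: contraT => nx2; have [nx _] := nrad3 Gx Gy nxy.
have nF : ~~ (#|G : F| <= 2 ^ 1).
  apply/negP=> i1; have i0 := index_step p2 pG (rad3_sub G) Gx nx i1.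
  by case/negP: (not_cycle_rad3 Gx Gy nxy); apply: subsetP (index_le1 i0) y Gy.
case/negP: nF; have x2G := groupX 2 Gx.
have : #|G : 'L_2(G) <*> <[x ^+ 2]>| <= 2 ^ 1 by apply: (index_step p2 pG (lcn_sub 2 G) x2G nx2); rewrite iG.
apply: leq_trans; rewrite dvdn_leq // indexgS // join_subG lcn2_rad3 cycle_subG.
exact: rad3_pow.
Qed.

(** Modulo L_4, [x^2, y] is [x, y]^2 [[x, y], x], so the claim follows once x^2 lies in L_3. Now x^2
    = n^i modulo L_3, and [x^2, x] = 1 together with [n, x] outside L_4 makes i even. *)
Let comm_square x y : x \in G -> y \in G -> [~ x, y] \notin 'L_3(G) -> [~ [~ x, y], x] \notin 'L_4(G) ->
  [~ x, y] ^+ 2 * [~ [~ x, y], x] \in 'L_4(G).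
Proof.
move=> Gx Gy nxy nc; have Ln := mem_lcn2 Gx Gy; set n := [~ x, y] in nxy nc Ln *; have Gn := mem_lcn Ln.
have Lx2 := square_in Gx Gy nxy.
have [i hi] := prime_index_cover p2 nL32 i2 Ln nxy Lx2.
set l := _ * _ in hi; have ex : x ^+ 2 = n ^+ i * l by rewrite mulKVg.
have Gl := mem_lcn hi; have Ll2 := subsetP (lcn_subS 2 G) l hi.
have x21 : [~ x ^+ 2, x] = 1 by apply/eqP/commgP/commute_sym/commuteX.
have q1 : coset 'L_4(G) [~ n, x] ^+ i = 1.
  rewrite -(coset_RXl _ N4) //; last by apply: R4; [apply: R3 | ].
  have e : coset 'L_4(G) [~ x ^+ 2, x] = coset 'L_4(G) [~ n ^+ i, x] * coset 'L_4(G) [~ l, x].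
    rewrite ex (coset_RMl N4) ?groupX //; apply: R4 => //; apply: R3 => //; exact: groupX.
  move: e; rewrite x21 morph1; have -> : coset 'L_4(G) [~ l, x] = 1 by apply/(coset1P N4 (groupR Gl Gx)); apply: R4.
  by rewrite mulg1 => <-.
have even : ~~ odd i.
  apply/negP=> oi; case/negP: nc; apply/(coset1P N4 (groupR Gn Gx)).
  have h2 : coset 'L_4(G) [~ n, x] ^+ 2 = 1.
    rewrite -(cosetXG _ N4) ?groupR //; apply/(coset1P N4); first by rewrite groupX // groupR.
    exact: (lcn3_pow i2).
  by move: q1; rewrite -(odd_double_half i) oi expgD -mul2n expgM h2 expg1n mulg1.
have Lx23 : x ^+ 2 \in 'L_3(G).
  rewrite ex groupMr // -(odd_double_half i) (negbTE even) add0n -mul2n expgM groupX //.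
  exact: lcn2_pow.
have := R4 Lx23 Gy; rewrite comm_sq -/n conjg_mulR -mulgA.
have Lc := R3 Ln Gx.
have -> : n * ([~ n, x] * n) = n ^+ 2 * [~ n, x] * [~ n, x, n].
  by rewrite (commgC [~ n, x] n) expg_sq (mulgA n (n * [~ n, x])) (mulgA n n).
by rewrite groupMr //; apply: R4.
Qed.

(** By the square relation [L_2, G] lies in L_4 Phi(L_2), so L_3 <= L_4 Phi(L_2) and, descending the
    series, L_3 <= Phi(L_2). Hence c generates L_2 modulo its Frattini subgroup. *)
Lemma maxclass2_cyclic c : c \in 'L_2(G) -> c \notin 'L_3(G) -> 'L_2(G) = <[c]>.
Proof.
move=> Lc nc; have [a [b [Ga Gb nab]]] := exists_pair p2 i2.
have p2L : 2.-group 'L_2(G) := pgroupS (lcn_sub 2 G) pG.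
have sq n : n \in 'L_2(G) -> n ^+ 2 \in Phi.
  move=> Ln; rewrite /= (Phi_joing p2L) (subsetP (joing_subr _ _)) //.
  by rewrite (MhoE 1 p2L) mem_gen //; apply: imset_f.
have nPhi : Phi <| G by apply: char_normal_trans (Phi_char _) (lcn_normal 2 G).
have sPhi3 : Phi \subset 'L_3(G).
  apply: (Phi_min p2L); first by rewrite (subset_trans (lcn_sub 2 G) N3).
  by apply: prime_abelem => //; rewrite card_quotient ?(subset_trans (lcn_sub 2 G) N3).
pose B := ('L_4(G) <*> Phi)%G.
have sB : B \subset 'L_3(G) by rewrite join_subG (lcn_subS 3).
have s4B : 'L_4(G) \subset B := joing_subl _ _.
have sPB : Phi \subset B := joing_subr _ _.
have nB : G \subset 'N(B) by apply: (norm_between (k := 2)).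
have cB n x : n \in 'L_2(G) -> x \in G -> [~ n, x] \in B.
  move=> Ln Gx; have [xC|nx] := boolP (x \in cmod 'L_2(G) 'L_4(G)).
    by apply: (subsetP s4B); case/cmodP: xC => _; apply.
  have nxF : x \notin F by apply: contra nx; apply: subsetP (rad3_C2 G) x.
  have [y Gy nyx] := nrad3P Gx nxF.
  have nxy : [~ x, y] \notin 'L_3(G) by rewrite -groupV invgR.
  set m := [~ x, y] in nxy; have Lm : m \in 'L_2(G) := mem_lcn2 Gx Gy.
  have mB : [~ m, x] \in B.
    have [L4|nL4] := boolP ([~ m, x] \in 'L_4(G)); first exact: (subsetP s4B).
    have := subsetP s4B _ (comm_square Gx Gy nxy nL4); rewrite groupMl //.
    by apply: (subsetP sPB); apply: sq.
  have : 'L_2(G) \subset cmod [set x] B.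
    apply: (prime_index_gen p2 nL32 i2 Lm nxy).
      apply/subsetP=> l Ll; apply: (cmod_in nB); first exact: mem_lcn Ll.
      by move=> _ /set1P->; apply: (subsetP s4B); apply: (mem_lcnRl (k := 2)).
    apply: (cmod_in nB); first exact: mem_lcn Lm.
    by move=> _ /set1P->; rewrite -groupV invgR.
  by move/subsetP/(_ n Ln)/cmodP=> [_ h]; rewrite -groupV invgR h ?inE.
have s3B : 'L_3(G) \subset B.
  by apply: (lcn3_gen p2 pG i2 iF Ga Gb nab Lc nc s4B sB); apply: cB.
have s3P : 'L_3(G) \subset Phi.
  apply: (lcn_sub_nil (k := 2) (pgroup_nil pG) (normal_norm nPhi)).
  have nL4 : 'L_4(G) \subset 'N(Phi) := subset_trans (lcn_sub 4 G) (normal_norm nPhi).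
  by apply: subset_trans s3B _; rewrite /= norm_joinEl // (normC nL4).
have defL : 'Phi('L_2(G)) <*> [set c] = 'L_2(G).
  apply/eqP; rewrite eqEsubset join_subG Phi_sub sub1set Lc /=.
  apply: (prime_index_gen p2 nL32 i2 Lc nc (A := ('Phi('L_2(G)) <*> [set c])%G)).
    exact: subset_trans s3P (joing_subl _ _).
  by apply: (subsetP (joing_subr _ _)); rewrite inE.
by rewrite -(Phi_nongen defL).
Qed.

(** L_2 = <c>, and x is chosen to act nontrivially on L_2/L_4. As c^2 [c, x] lies in L_4, L_3 <=
    <[c, x]> L_4, hence L_3 <= <[c, x]>, and [c, x]^j = [c^j, x]. *)
Lemma commutators_maxclass2 : commutators G = 'L_2(G).
Proof.
have nE : ~~ (G \subset cmod 'L_2(G) 'L_4(G)) by apply: (cmod_proper (k := 1)).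
have [x Gx nx] := avoid1 nE.
have nxF : x \notin F by apply: contra nx; apply: subsetP (rad3_C2 G) x.
have [y Gy nyx] := nrad3P Gx nxF.
have nxy : [~ x, y] \notin 'L_3(G) by rewrite -groupV invgR.
set c := [~ x, y] in nxy; have Lc : c \in 'L_2(G) := mem_lcn2 Gx Gy.
have eL := maxclass2_cyclic Lc nxy.
have abL : abelian 'L_2(G) by rewrite eL cycle_abelian.
have ncx : [~ c, x] \notin 'L_4(G).
  have [n Ln nn] := cmod_nP N4 Gx nx; apply: contra nn => h.
  have : 'L_2(G) \subset cmod [set x] 'L_4(G).
    rewrite eL cycle_subG; apply: (cmod_in N4); first exact: mem_lcn Lc.
    by move=> _ /set1P->; rewrite -groupV invgR.
  by move/subsetP/(_ n Ln)/cmodP=> [_ h']; rewrite -groupV invgR h' ?inE.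
have Lcx := R3 Lc Gx; pose M := <[ [~ c, x] ]>%G.
have sML : M \subset 'L_2(G) by rewrite cycle_subG (subsetP (lcn_subS 2 G)).
have nM : G \subset 'N(M).
  apply: normal_norm; apply: char_normal_trans (lcn_normal 2 G).
  have cL : cyclic 'L_2(G) by rewrite eL cycle_cyclic.
  by rewrite (sub_cyclic_char _ cL).
have sM : 'L_3(G) \subset M.
  apply: (lcn_sub_nil (k := 2) (pgroup_nil pG) nM).
  apply/subsetP=> t Lt; have := subsetP (lcn_subS 2 G) t Lt; rewrite eL => /cycleP[i ei].
  have even : ~~ odd i.
    apply/negP=> oi; case/negP: nxy; move: Lt; rewrite ei -(odd_double_half i) oi expgD expg1.
    by rewrite -mul2n expgM groupMr // groupX // (lcn2_pow i2).
  have h := comm_square Gx Gy nxy ncx; rewrite -/c in h.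
  have nL4 : 'L_4(G) \subset 'N(M) := subset_trans (lcn_sub 4 G) nM.
  rewrite -norm_joinEr // ei -(odd_double_half i) (negbTE even) add0n -mul2n expgM groupX //.
  have hB : c ^+ 2 * [~ c, x] \in M <*> 'L_4(G) by apply: (subsetP (joing_subr _ _)).
  by rewrite -(groupMr _ (subsetP (joing_subl M 'L_4(G)) _ (cycle_id _))).
apply: (commutators_cset Gx); apply: (commutators_of_cset p2 i2 Gx).
  by apply: contra nxF => h; apply/setIP.
apply/subsetP=> t /(subsetP sM)/cycleP[j ->]; apply/csetP; exists (c ^+ j); first exact: groupX.
by rewrite (commX_abelian _ abL) // (subsetP (lcn_norm 2 G)).
Qed.

End MaxClass2.

Lemma ucn2P (gT : finGroupType) (G : {group gT}) z : z \in 'Z_2(G) -> z \in G /\ {in G, forall g, [~ z, g] \in 'Z(G)}.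
Proof.
rewrite ucnSnR ucn1 => /setIdP[Gz sz]; split=> // g Gg; apply: (subsetP sz).
by apply: mem_commg => //; rewrite inE.
Qed.

(** Otherwise z generates L_{k+2} modulo L_{k+3}, and [L_{k+2}, G] would lie in L_{k+4}. *)
Lemma cmod_down (gT : finGroupType) p (G : {group gT}) k z : prime p -> #|'L_k.+2(G) : 'L_k.+3(G)| = p ->
  ~~ ('L_k.+3(G) \subset 'L_k.+4(G)) -> z \in 'L_k.+2(G) -> {in G, forall g, [~ z, g] \in 'L_k.+4(G)} ->
  z \in 'L_k.+3(G).
Proof.
move=> p_pr i n34 Lz hz; apply: contraT => nz; case/negP: n34.
have N4 : G \subset 'N('L_k.+4(G)) := lcn_norm k.+4 G.
have nL : 'L_k.+3(G) <| 'L_k.+2(G).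
  by rewrite /normal (lcn_subS k.+2) (subset_trans (lcn_sub k.+2 G) (lcn_norm k.+3 G)).
have sL : 'L_k.+2(G) \subset cmod G 'L_k.+4(G).
  apply: (prime_index_gen p_pr nL i Lz nz).
    apply/subsetP=> w Lw; apply: (cmod_in N4); first exact: mem_lcn Lw.
    by move=> g Gg; apply: (mem_lcnRl (k := k.+2)).
  apply: (cmod_in N4); first exact: mem_lcn Lz.
  by move=> g Gg; rewrite -groupV invgR hz.
rewrite [in X in X \subset _](lcnSn k.+1) gen_subG; apply/subsetP=> _ /imset2P[m g Lm Gg ->].
by rewrite -groupV invgR; have /cmodP[_] := subsetP sL m Lm; apply.
Qed.

(** * Factors of order 3 throughout do not meet the class 5 condition *)

Section Exclude1111.
Variables (gT : finGroupType) (G : {group gT}).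
Hypotheses (pG : 3.-group G) (L6 : 'L_6(G) = 1) (iL : forall k, k <= 3 -> #|'L_k.+2(G) : 'L_k.+3(G)| = 3)
  (oG : #|G : 'L_2(G)| = 27).
Implicit Types (x y z g n m t c d w r s a b u v l X Y : gT) (k i j : nat) (M T B P D : {group gT}).
Local Notation F := (rad3 G).
Let p3 : prime 3 := isT.
Let N5 : G \subset 'N('L_5(G)) := lcn_norm 5 G.

Let nS k : k <= 3 -> ~~ ('L_k.+2(G) \subset 'L_k.+3(G)).
Proof. by move=> le; rewrite -indexg_eq1 iL. Qed.

Let down5 z : z \in 'L_2(G) -> {in G, forall g, [~ z, g] \in 'L_5(G)} -> z \in 'L_4(G).
Proof.
move=> Lz hz; have L3 : z \in 'L_3(G).
  apply: (cmod_down (k := 0) p3 (iL (isT : 0 <= 3)) (nS (isT : 1 <= 3)) Lz) => g Gg.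
  exact: (mem_lcn_leq (isT : 4 <= 5)) (hz g Gg).
exact: (cmod_down (k := 1) p3 (iL (isT : 1 <= 3)) (nS (isT : 2 <= 3)) L3).
Qed.

Let center5 z : z \in 'L_2(G) -> z \in 'Z(G) -> z \in 'L_5(G).
Proof.
move=> Lz /setIP[Gz /centP cz]; have z1 g : g \in G -> [~ z, g] = 1 by move=> Gg; apply/eqP/commgP/cz.
have L4 : z \in 'L_4(G) by apply: down5 => // g Gg; rewrite z1.
apply: (cmod_down (k := 2) p3 (iL (isT : 2 <= 3)) (nS (isT : 3 <= 3)) L4) => g Gg.
by rewrite z1.
Qed.

(** Phi(L_2) = [L_2, L_2] = L_5, so cubes of L_2 lie in L_5, and |Z_2| = 27 yields t in Z_2 outside
    L_2 with [F] = L_2 <t>. Then a^3 acts modulo L_5 like an element of L_4, that is trivially, and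
    the cube formula puts [c, a, a] into L_5; but a is chosen to act nontrivially on L_3/L_5. *)
Lemma exclude_1111 : ~~ abelian 'L_2(G) -> #|'Phi('L_2(G))| = 3 -> #|'Z_2(G)| = 27 -> False.
Proof.
move=> nab oPhi oZ; have p3L : 3.-group 'L_2(G) := pgroupS (lcn_sub 2 G) pG.
have o5 : #|'L_5(G)| = 3 by have := iL (isT : 3 <= 3); rewrite L6 indexg1.
have i2 : #|'L_2(G) : 'L_3(G)| = 3 := iL (isT : 0 <= 3).
have o4 : #|'L_4(G)| = 9 by rewrite -(Lagrange (lcn_subS 4 G)) o5 (iL (isT : 2 <= 3)).
have sD5 : [~: 'L_2(G), 'L_2(G)] \subset 'L_5(G) := lcn_der2 p3 i2.
have ePhi : 'Phi('L_2(G)) = 'L_5(G).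
  have nt : [~: 'L_2(G), 'L_2(G)] != 1 by rewrite (sameP eqP commG1P).
  have sDP : [~: 'L_2(G), 'L_2(G)] \subset 'Phi('L_2(G)) by rewrite (Phi_joing p3L) joing_subl.
  have D5 : 'L_5(G) \subset [~: 'L_2(G), 'L_2(G)].
    by apply: prime_meetG; [rewrite o5 | rewrite (setIidPr sD5)].
  have DP : 'Phi('L_2(G)) \subset [~: 'L_2(G), 'L_2(G)].
    by apply: prime_meetG; [rewrite oPhi | rewrite (setIidPr sDP)].
  by apply/eqP; rewrite eqEsubset (subset_trans DP sD5) (subset_trans D5 sDP).
have cube n : n \in 'L_2(G) -> n ^+ 3 \in 'L_5(G).
  by move=> Ln; rewrite -ePhi (Phi_joing p3L) (subsetP (joing_subr _ _)) // (Mho_p_elt 1) // (mem_p_elt p3L).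
have nE : ~~ (G \subset cmod 'L_3(G) 'L_5(G)) by apply: cmod_proper; apply: (nS (isT : 2 <= 3)).
have [a Ga na3] := avoid1 nE.
have naF : a \notin F by apply: contra na3; apply: subsetP (rad3_C3 p3 i2) a.
have na2 : a \notin cmod 'L_2(G) 'L_4(G).
  by apply: contra na3 => h; apply: (subsetP (lcn_C2_C3 p3 i2)); rewrite inE h.
have [b Gb nba] := nrad3P Ga naF.
have nab' : [~ a, b] \notin 'L_3(G) by rewrite -groupV invgR.
have [t Zt nt4] : exists2 t, t \in 'Z_2(G) & t \notin 'L_4(G).
  by apply/subsetPn; apply/negP=> /subset_leq_card; rewrite oZ o4.
have [Gt Ztg] := ucn2P Zt.
have t5 g : g \in G -> [~ t, g] \in 'L_5(G).
  by move=> Gg; apply: center5 (Ztg g Gg); apply: mem_lcn2.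
have nt2 : t \notin 'L_2(G) by apply: contra nt4 => Lt; apply: down5.
have tF : t \in F.
  by apply/rad3P; split=> // g Gg; rewrite -groupV invgR; apply: (mem_lcn_leq (isT : 3 <= 5)); apply: t5.
have iF3 : #|F : 'L_2(G)| = 3.
  have iF9 : 9 %| #|G : F|.
    have sFa : F <*> <[a]> \subset G by rewrite join_subG rad3_sub cycle_subG.
    have iGF := Lagrange_index sFa (joing_subl F <[a]>).
    have d3 (A B : {group gT}) : A \subset G -> B \subset A -> ~~ (A \subset B) -> 3 %| #|A : B|.
      move=> sA sB nAB; have pA : 3.-nat #|A : B| by apply: pnat_dvd (dvdn_indexg _ _) (pgroupS sA pG).
      have [k e] := p_natP pA; move: nAB; rewrite -indexg_eq1 e; case: (k) => // k' _.
      by rewrite expnS dvdn_mulr.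
    rewrite -iGF (_ : 9 = 3 * 3)%N //; apply: dvdn_mul; apply: d3 => //.
    - by apply/negP=> /subsetP/(_ b Gb); apply/negP; apply: not_cycle_rad3.
    - exact: joing_subl.
    - by apply/negP=> /subsetP/(_ a); rewrite (subsetP (joing_subr _ _)) ?cycle_id //; move/(_ isT); apply/negP.
  have := Lagrange_index (rad3_sub G) (lcn2_rad3 G); rewrite oG => e.
  have ne1 : #|F : 'L_2(G)| != 1%N by rewrite indexg_eq1; apply/negP=> /subsetP/(_ t tF); apply/negP.
  by case/dvdnP: iF9 => r er; move: e ne1; rewrite er; clear; move: #|_ : _| => q; case: r => [|[|[|[|r]]]]; case: q => [|q]; nia.
have nLF : 'L_2(G) <| F by rewrite /normal lcn2_rad3 (subset_trans (rad3_sub G) (lcn_norm 2 G)).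
have [i hn] := prime_index_cover p3 nLF iF3 tF nt2 (rad3_pow i2 Ga).
set n := _ * _ in hn; have ea : a ^+ 3 = t ^+ i * n by rewrite mulKVg.
have Gn := mem_lcn hn; have Gti := groupX i Gt.
have ti5 g : g \in G -> [~ t ^+ i, g] \in 'L_5(G).
  have tC : t \in cmod G 'L_5(G) by apply: (cmod_in N5) => // w Gw; rewrite -groupV invgR t5.
  by move=> Gg; have /cmodP[_ h] := groupX i tC; rewrite -groupV invgR h.
have a3g g : g \in G -> coset 'L_5(G) [~ a ^+ 3, g] = coset 'L_5(G) [~ n, g].
  move=> Gg; have GA : [~ t ^+ i, g] ^ n \in G by apply: groupJ => //; apply: groupR.
  rewrite ea commMgJ (cosetMG N5 GA (groupR Gn Gg)).
  have -> : coset 'L_5(G) ([~ t ^+ i, g] ^ n) = 1.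
    by apply/(coset1P N5 GA); rewrite mem_lcnJ ?ti5.
  by rewrite mul1g.
have na : [~ n, a] \in 'L_5(G).
  apply/(coset1P N5 (groupR Gn Ga)); rewrite -a3g //.
  have -> : [~ a ^+ 3, a] = 1 by apply/eqP/commgP/commute_sym/commuteX.
  exact: morph1.
have n3 : n \in 'L_3(G).
  exact: (cmod_prime (k := 0) p3 i2 Ga na2 hn (mem_lcn_leq (isT : 4 <= 5) na)).
have n4 : n \in 'L_4(G) := cmod_prime (k := 1) p3 (iL (isT : 1 <= 3)) Ga na3 n3 na.
have n5 : [~ n, b] \in 'L_5(G) by apply: (mem_lcnR (k := 3)).
have ab5 : coset 'L_5(G) [~ a ^+ 3, b] = 1 by rewrite a3g //; apply/(coset1P N5 (groupR Gn Gb)).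
pose c := [~ a, b]; have Lc : c \in 'L_2(G) := mem_lcn2 Ga Gb; have Gc := mem_lcn Lc.
have Lca := mem_lcnR Lc Ga; have Gca := mem_lcn Lca.
have caa : [~ c, a, a] \in 'L_5(G).
  apply/(coset1P N5); first by rewrite !groupR.
  have abq : abelian ('L_2(G) / 'L_5(G)).
    by apply: sub_der1_abelian; apply: sD5.
  have nq : coset 'L_5(G) a \in 'N('L_2(G) / 'L_5(G)).
    by apply: (subsetP (quotient_norms 'L_5(G) (lcn_norm 2 G))); apply: mem_quotient.
  have := comm_cube_abelian (x := coset 'L_5(G) b) abq nq.
  rewrite -(coset_comm N5 Ga Gb) -(cosetXG _ N5 Ga) -(coset_comm N5 (groupX 3 Ga) Gb) -/c.
  rewrite -(coset_comm N5 Gc Ga) -(coset_comm N5 Gca Ga) -!(cosetXG _ N5) //.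
  have c1 m : m \in 'L_2(G) -> coset 'L_5(G) (m ^+ 3) = 1.
    by move=> Lm; apply/(coset1P N5); [apply: groupX; apply: mem_lcn Lm | apply: cube].
  rewrite ab5 (c1 c) // (c1 [~ c, a]) ?(subsetP (lcn_subS 2 G)) // !mul1g => <- //.
  exact: mem_quotient.
have c4 : [~ c, a] \in 'L_4(G) := cmod_prime (k := 1) p3 (iL (isT : 1 <= 3)) Ga na3 Lca caa.
by case/negP: nab'; apply: (cmod_prime (k := 0) p3 i2 Ga na2 Lc c4).
Qed.
End Exclude1111.

(** * Class 4 with L_2/L_3 and L_3/L_4 of orders p and p^2 *)

Section Rank12.
Variables (gT : finGroupType) (p : nat) (G : {group gT}).
Hypotheses (p_pr : prime p) (pG : p.-group G) (i2 : #|'L_2(G) : 'L_3(G)| = p)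
  (i3 : #|'L_3(G) : 'L_4(G)| = (p ^ 2)%N) (L5 : 'L_5(G) = 1).
Local Notation F := (rad3 G).
Hypothesis iF : #|G : F| <= p ^ 2.
Implicit Types (x y z g n m t c d w r s a b u v l X Y : gT) (k i j : nat) (M T B P D : {group gT}).

Let N4 : G \subset 'N('L_4(G)) := lcn_norm 4 G.
Let N3 : G \subset 'N('L_3(G)) := lcn_norm 3 G.
Let nL32 : 'L_3(G) <| 'L_2(G).
Proof. by rewrite /normal (lcn_subS 2) (subset_trans (lcn_sub 2 G) N3). Qed.

Lemma abelian_lcn2_12 : abelian 'L_2(G).
Proof. by apply/commG1P/eqP; rewrite -subG1 -L5; apply: lcn_der2 p_pr i2. Qed.
Let abL := abelian_lcn2_12.

Let inC a b : [~ a, b] = 1 -> a \in 'C[b].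
Proof. by move/comm1=> h; apply/cent1P; first [exact: h | exact: commute_sym h]. Qed.
Let inC' a b : [~ a, b] = 1 -> b \in 'C[a].
Proof. by move/comm1=> h; apply/cent1P; first [exact: h | exact: commute_sym h]. Qed.

Let s32 := subsetP (lcn_subS 2 G).
Let s43 := subsetP (lcn_subS 3 G).
Let R3 n X : n \in 'L_2(G) -> X \in G -> [~ n, X] \in 'L_3(G). Proof. exact: mem_lcnR. Qed.
Let R4 n X : n \in 'L_3(G) -> X \in G -> [~ n, X] \in 'L_4(G). Proof. exact: mem_lcnR. Qed.
Let c4 u v : u \in 'L_4(G) -> v \in G -> [~ u, v] = 1.
Proof. exact: (lcn_eq1 L5 (i := 3) (j := 0) isT). Qed.
Let cm n m : n \in 'L_2(G) -> m \in 'L_2(G) -> commute n m. Proof. by move=> *; apply: (centsP abL). Qed.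
Let cJ n m : n \in 'L_2(G) -> m \in 'L_2(G) -> n ^ m = n.
Proof. by move=> Ln Lm; apply/conjg_fixP/commgP/cm. Qed.
Let nL2 g : g \in G -> g \in 'N('L_2(G)). Proof. exact: (subsetP (lcn_norm 2 G)). Qed.
Let RM n m g : n \in 'L_2(G) -> m \in 'L_2(G) -> g \in G -> [~ n * m, g] = [~ n, g] * [~ m, g].
Proof. by move=> Ln Lm Gg; rewrite (commM_abelian abL (nL2 Gg)). Qed.
Let RX n g i : n \in 'L_2(G) -> g \in G -> [~ n ^+ i, g] = [~ n, g] ^+ i.
Proof. by move=> Ln Gg; rewrite (commX_abelian _ abL (nL2 Gg)). Qed.
Let RV n g : n \in 'L_2(G) -> g \in G -> [~ n^-1, g] = [~ n, g]^-1.
Proof.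
by move=> Ln Gg; apply: (mulIg [~ n, g]); rewrite mulVg -RM ?groupV // mulVg comm1g.
Qed.
Let R3r l g h : l \in 'L_3(G) -> g \in G -> h \in G -> [~ l, g * h] = [~ l, h] * [~ l, g].
Proof. by move=> Ll Gg Gh; rewrite commgMR (c4 (R4 Ll Gg) Gh) mulg1. Qed.
Let rF l f : l \in 'L_3(G) -> f \in F -> [~ l, f] = 1.
Proof.
move=> Ll /(subsetP (rad3_C3 p_pr i2))/cmodP[_ h]; apply/set1P.
by have := h l Ll; rewrite L5.
Qed.

Lemma comm_sym12 n x y : n \in 'L_2(G) -> x \in G -> y \in G -> [~ n, x, y] = [~ n, y, x].
Proof. exact: comm_sym_abelian. Qed.

(* F = Z(G) L_2 makes every commutator in L_3 of the form [n, g] with n in L_2 *)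
Lemma rad3_central_value X Y : F \subset 'Z(G) * 'L_2(G) -> X \in G -> Y \in G -> [~ X, Y] \in 'L_3(G) ->
  exists n g, [/\ n \in 'L_2(G), g \in G & [~ X, Y] = [~ n, g]].
Proof.
move=> sF GX GY L3.
have zn f g : f \in F -> g \in G -> exists2 n, n \in 'L_2(G) & [~ f, g] = [~ n, g].
  move=> /(subsetP sF)/mulsgP[z n /setIP[Gz /centP cz] Ln ->] Gg; exists n => //.
  by rewrite commMgJ (_ : [~ z, g] = 1) ?conj1g ?mul1g //; apply/eqP/commgP/cz.
have [FX|nX] := boolP (X \in F); first by have [n Ln e] := zn X Y FX GY; exists n, Y.
have YM : Y \in F <*> <[X]>.
  apply: contraT => nY; have i1 : #|G : F <*> <[X]>| <= p ^ 1 by apply: (index_step p_pr pG (rad3_sub G) GX nX).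
  have s1 : F <*> <[X]> \subset G by rewrite join_subG rad3_sub cycle_subG.
  have sG := index_le1 (index_step p_pr pG s1 GY nY i1).
  case/negP: nX; apply/rad3P; split=> // g Gg.
  have : G \subset cmod [set X] 'L_3(G).
    apply: subset_trans sG _; rewrite (join_subG (F <*> <[X]>)%G) (join_subG F) !cycle_subG -andbA.
    apply/and3P; split; last by apply: (cmod_in N3) => // _ /set1P->.
      apply/subsetP=> f Ff; apply: (cmod_in N3); first exact: (subsetP (rad3_sub G)).
      by move=> _ /set1P->; case/rad3P: Ff => _; apply.
    by apply: (cmod_in N3) => // _ /set1P->; rewrite commgg.
  by move/subsetP/(_ g Gg)/cmodP=> [_ h]; rewrite -groupV invgR h ?inE.
have nMX : <[X]> \subset 'N(F) by rewrite cycle_subG; apply: (subsetP (normal_norm (rad3_normal G))).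
move: YM; rewrite (norm_joinEr nMX) => /mulsgP[f _ Ff /cycleP[k ->] eY].
have [n Ln e] := zn f X Ff GX; have GXk := groupX k GX; have Gn := mem_lcn Ln.
have LnX := s32 (R3 Ln GX).
exists (n ^ (X ^+ k))^-1, X; split=> //; first by rewrite groupV mem_lcnJ.
rewrite eY commgMJ (_ : [~ X, X ^+ k] = 1) ?mul1g; last by apply/eqP/commgP/commuteX.
rewrite RV ?mem_lcnJ // -(invgR f X) e conjVg; congr (_^-1).
rewrite conjRg (_ : X ^ (X ^+ k) = X) //; apply/conjg_fixP/commgP; exact: commuteX.
Qed.

(** A commutator in L_3 equals some [n, g] with n in L_2. Nondegeneracy of the pairing of L_2/L_3
    and G/[F] into L_3/L_4 forces g = e b^k with e in [F] and c = n^k modulo L_3; expanding [n, b^k]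
    then shows s in [L_3, b]. *)
Lemma not_commutator_12 c b s : F \subset 'Z(G) * 'L_2(G) -> b \in G -> b \notin F ->
  c \in 'L_2(G) -> c \notin 'L_3(G) -> s \in 'L_4(G) -> s \notin cset 'L_3(G) b ->
  [~ c, b] * s \notin commutators G.
Proof.
move=> sF Gb nb Lc nc Ls ns; apply/negP=> /commutatorsP[X [Y [GX GY eXY]]].
have Lcb := R3 Lc Gb.
have LXY : [~ X, Y] \in 'L_3(G) by rewrite eXY groupM // s43.
have [n [g [Ln Gg eng]]] := rad3_central_value sF GX GY LXY; rewrite eXY in eng.
have Gn := mem_lcn Ln; have Gc := mem_lcn Lc; have Gs := mem_lcn Ls.
have ind m x := indep34 p_pr pG i2 iF i3 (n := m) (x := x).
have ncb : [~ c, b] \notin 'L_4(G) by apply: ind.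
have nn : n \notin 'L_3(G).
  apply: contra ncb => Ln3; have : [~ c, b] * s \in 'L_4(G) by rewrite eng; apply: R4.
  by rewrite groupMr.
have [k hk] := prime_index_cover p_pr nL32 i2 Ln nn Lc.
have Lnk : n ^+ k \in 'L_2(G) by rewrite groupX.
pose e := g * b ^- k; have Gbk := groupX k Gb; have Ge : e \in G by rewrite groupM ?groupV.
have eg : g = e * b ^+ k by rewrite mulgKV.
have eF : e \in F.
  apply: contraT => ne; case/negP: (ind n e Ln nn Ge ne).
  have q1 : coset 'L_4(G) [~ n, g] = coset 'L_4(G) [~ n, b] ^+ k.
    rewrite -eng (cosetMG N4 (groupR Gc Gb) Gs) (_ : coset _ s = 1) ?mulg1; last by apply/(coset1P N4 Gs).
    have ec : c = n ^+ k * ((n ^+ k)^-1 * c) by rewrite mulKVg.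
    have Gl := mem_lcn hk; have Gnk := mem_lcn Lnk.
    have e1 : [~ c, b] = [~ n, b] ^+ k * [~ (n ^+ k)^-1 * c, b] by rewrite {1}ec (RM Lnk (s32 hk) Gb) (RX k Ln Gb).
    rewrite e1 (cosetMG N4 (groupX k (groupR Gn Gb)) (groupR Gl Gb)) (cosetXG _ N4 (groupR Gn Gb)).
    have -> : coset 'L_4(G) [~ (n ^+ k)^-1 * c, b] = 1 by apply/(coset1P N4 (groupR Gl Gb)); apply: R4.
    by rewrite mulg1.
  have q2 : coset 'L_4(G) [~ n, g] = coset 'L_4(G) [~ n, b] ^+ k * coset 'L_4(G) [~ n, e].
    rewrite eg (coset_RMr N4 Gn Ge Gbk); last by apply: R4 => //; apply: R3.
    by rewrite (coset_RXr _ N4) //; apply: R4 => //; apply: R3.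
  apply/(coset1P N4 (groupR Gn Ge)); apply: (mulgI (coset 'L_4(G) [~ n, b] ^+ k)).
  by rewrite -q2 q1 mulg1.
have ne1 : [~ n, e] = 1.
  have /mulsgP[z m /setIP[Gz /centP cz] Lm ->] := subsetP sF e eF.
  rewrite commgMR (_ : [~ n, m] = 1) ?mul1g; last by apply/eqP/commgP/cm.
  have -> : [~ n, z] = 1 by apply/eqP/commgP/commute_sym/cz.
  by rewrite comm1g mulg1.
have enbk : [~ n, g] = [~ n, b ^+ k].
  by rewrite eg commgMJ ne1 conj1g mulg1.
have gD : group_set (cset 'L_3(G) b).
  by apply: cset_group_set => l m Ll Lm; apply: cJ; apply: s32 => //; apply: s43; apply: R4.
pose D := Group gD; have inD l : l \in 'L_3(G) -> [~ l, b] \in D by move=> Ll; apply/csetP; exists l.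
have hD j : exists2 d, d \in D & [~ n, b ^+ j] = [~ n ^+ j, b] * d.
  elim: j => [|j [d Dd IH]]; first by exists 1; rewrite ?group1 // !expg0 commg1 comm1g mulg1.
  have Gbj := groupX j Gb; have Lj : [~ n, b ^+ j] \in 'L_3(G) by apply: R3.
  exists (d * [~ [~ n, b ^+ j], b]); first by rewrite groupM // inD.
  rewrite expgSr commgMJ (conjg_mulR [~ n, b ^+ j]) {1}IH expgS (RM Ln (groupX j Ln) Gb).
  by rewrite -(mulgA [~ n ^+ j, b] d) (mulgA [~ n, b]).
have [d Dd ed] := hD k.
have Lm : c^-1 * n ^+ k \in 'L_2(G) by rewrite groupM ?groupV.
have em : [~ c^-1 * n ^+ k, b] * d = s.
  by rewrite RM ?groupV // RV // -mulgA -ed -enbk -eng mulKg.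
have Ld : d \in 'L_4(G) by case/csetP: Dd => l Ll <-; apply: R4.
have Lm3 : c^-1 * n ^+ k \in 'L_3(G).
  apply: contraT => nm; case/negP: (ind _ b Lm nm Gb nb).
  by rewrite -(groupMr _ Ld) em.
have : s \in D by rewrite -em; apply: groupM => //; apply: inD.
exact/negP.
Qed.
Lemma lcn23_commutators : {subset 'L_2(G) :\: 'L_3(G) <= commutators G}.
Proof.
move=> g /setDP[Lg ng]; have [||X [Y [GX GY h]]] := lift_all (c := 1) p_pr pG i2 iF _ Lg ng (k := 2) => //.
  by case=> [|[|//]] _; [apply: rad3_C2 | apply: (rad3_C3 p_pr i2)].
apply/commutatorsP; exists X, Y; split=> //; apply/eqP; rewrite eq_mulVg1.
by move: h; rewrite L5 => /set1P->.
Qed.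

(** L_2 is abelian, so [c, b, a] = [c, a, b] and three triple commutators suffice. *)
Lemma lcn4_gen a b c B : a \in G -> b \in G -> [~ a, b] \notin 'L_3(G) -> c \in 'L_2(G) -> c \notin 'L_3(G) ->
  [~ c, a, a] \in B -> [~ c, a, b] \in B -> [~ c, b, b] \in B -> 'L_4(G) \subset B.
Proof.
move=> Ga Gb nab Lc nc aa ab bb; have ba : [~ c, b, a] \in B by rewrite comm_sym12.
pose B4 := (B :&: 'L_4(G))%G; suff : 'L_4(G) \subset B4 by rewrite subsetI => /andP[].
have nB : G \subset 'N(B4) by apply: (norm_between (k := 3)); rewrite ?L5 ?sub1G // subsetIr.
have Lca := R3 Lc Ga; have Lcb := R3 Lc Gb.
have inB l g : l \in 'L_3(G) -> [~ l, g] \in B -> g \in G -> [~ l, g] \in B4.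
  by move=> Ll Bl Gg; apply/setIP; split=> //; apply: R4.
have hl l g : l \in 'L_3(G) -> g \in G -> [~ c, a, g] \in B -> [~ c, b, g] \in B -> [~ l, g] \in B4.
  move=> Ll Gg Ba Bb; apply: inB => //; have [i [j h]] := lcn3_coord p_pr pG i2 iF Ga Gb nab Lc nc Ll.
  have Li : [~ c, a] ^+ i \in 'L_3(G) by apply: groupX.
  have Lj : [~ c, b] ^+ j \in 'L_3(G) by apply: groupX.
  have Lij := groupM Li Lj.
  rewrite -(mulKVg ([~ c, a] ^+ i * [~ c, b] ^+ j) l) (RM (s32 Lij) (s32 (s43 h)) Gg) (c4 h Gg) mulg1.
  by rewrite (RM (s32 Li) (s32 Lj) Gg) (RX i (s32 Lca) Gg) (RX j (s32 Lcb) Gg) groupM ?groupX.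
have lG l : l \in 'L_3(G) -> G \subset cmod [set l] B4.
  move=> Ll; apply: subset_trans (pair_gen p_pr pG iF Ga Gb nab) _; rewrite gen_subG; apply/subsetP=> g.
  case/setUP=> [/set2P[]->|Ff].
  - by apply: (cmod_in nB) => // _ /set1P->; apply: hl.
  - by apply: (cmod_in nB) => // _ /set1P->; apply: hl.
  - by apply: (cmod_in nB) => [|_ /set1P->]; [apply: (subsetP (rad3_sub G)) | rewrite rF].
rewrite [in X in X \subset _](lcnSn 2) gen_subG; apply/subsetP=> _ /imset2P[l g Ll Gg ->].
by have /cmodP[_] := subsetP (lG l Ll) g Gg; apply; rewrite inE.
Qed.

Lemma center_lcn3 z : z \in 'Z(G) -> z \in 'L_2(G) -> z \in 'L_3(G).
Proof.
case/setIP=> Gz /centP cz Lz; apply: contraT => nz; have [X [Y [GX GY nXY]]] := exists_pair p_pr i2.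
have [nX _] := nrad3 GX GY nXY; case/negP: (indep34 p_pr pG i2 iF i3 Lz nz GX nX).
by rewrite (_ : [~ z, X] = 1) //; apply/eqP/commgP/cz.
Qed.

(** Modulo the central L_4 every element of L_3 is some [c, y], and [c, y, x] = [c, x, y] = 1. *)
Lemma cent_lcn3 c x : c \in 'L_2(G) -> c \notin 'L_3(G) -> x \in G -> [~ c, x] \in 'Z(G) -> x \in 'C('L_3(G)).
Proof.
move=> Lc nc Gx /setIP[_ /centP cz]; apply/centP=> l Ll; apply: commute_sym; apply: comm1.
have [y Gy h] := lcn3_value p_pr pG i2 iF Lc nc Ll; have Lcy := R3 Lc Gy.
rewrite -(mulKVg [~ c, y] l) (RM (s32 Lcy) (s32 (s43 h)) Gx) (c4 h Gx) mulg1 comm_sym12 //.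
by apply/eqP/commgP/cz.
Qed.

Section Last1.
Hypotheses (o4 : #|'L_4(G)| = p).

Lemma coset_value c x t : c \in 'L_2(G) -> x \in G -> x \notin 'C('L_3(G)) ->
  [~ c, x]^-1 * t \in 'L_4(G) -> t \in commutators G.
Proof.
move=> Lc Gx nx ht; have /csetP[l Ll el] := subsetP (cset_last (k := 1) p_pr L5 o4 Gx nx) _ ht.
apply/commutatorsP; exists (c * l), x; split=> //; first by rewrite groupM ?(mem_lcn Lc) ?(mem_lcn Ll).
by rewrite (RM Lc (s32 Ll) Gx) el mulKVg.
Qed.

Lemma lcn4_commutators : {subset 'L_4(G) <= commutators G}.
Proof. exact: (last_commutators (k := 1) p_pr L5 o4). Qed.

(** A central element of L_2 is [c, x] modulo L_4 for some x. Then [c, x] is central too, so x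
    centralizes L_3 and lies in [F], which puts [c, x] into L_4. *)
Lemma center_lcn4 : G :&: 'C('L_3(G)) \subset F -> 'Z(G) :&: 'L_2(G) \subset 'L_4(G).
Proof.
move=> sCF; apply/subsetP=> z /setIP[Zz Lz]; have Lz3 := center_lcn3 Zz Lz.
have [c Lc nc] : exists2 c, c \in 'L_2(G) & c \notin 'L_3(G) by apply/subsetPn; apply: (nlcn23 p_pr i2).
have [x Gx h] := lcn3_value p_pr pG i2 iF Lc nc Lz3; have Lcx := R3 Lc Gx.
have Zcx : [~ c, x] \in 'Z(G).
  apply/setIP; split; first exact: mem_lcn Lcx.
  apply/centP=> y Gy; apply: comm1; case/setIP: Zz => _ /centP/(_ y Gy) cz.
  have : [~ z, y] = 1 by apply/eqP/commgP.
  by rewrite -(mulKVg [~ c, x] z) (RM (s32 Lcx) (s32 (s43 h)) Gy) (c4 h Gy) mulg1.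
have Fx : x \in F by apply: (subsetP sCF); apply/setIP; split=> //; apply: cent_lcn3 Lc nc Gx Zcx.
by rewrite -(groupMl _ (groupVr (rad3_C2R Lc Fx))).
Qed.

Lemma center_rad3 : 'Z(G) \subset F.
Proof.
apply/subsetP=> z /setIP[Gz /centP cz]; apply/rad3P; split=> // g Gg.
by rewrite (_ : [~ g, z] = 1) //; apply/eqP/commgP/commute_sym/cz.
Qed.

Lemma center_lcn2_lt : #|'Z(G) :&: 'L_2(G)| < p ^ 3.
Proof.
have o3 : #|'L_3(G)| = (p ^ 3)%N by rewrite -(Lagrange (lcn_subS 3 G)) o4 i3 -expnS.
rewrite -o3; apply: proper_card; rewrite properE; apply/andP; split.
  by apply/subsetP=> z /setIP[Zz Lz]; apply: center_lcn3.
apply/negP=> s; have : 'L_4(G) = 1.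
  rewrite lcnSn; apply/commG1P; apply: subset_trans s _; apply: subset_trans (subsetIl _ _) _.
  exact: (subsetIr G 'C(G)).
by move=> e; move: o4 (prime_gt1 p_pr); rewrite e cards1 => <-.
Qed.

Section Index3.
Hypothesis iFL : #|F : 'L_2(G)| = p.

Let card_center : #|'Z(G)| <= #|'Z(G) :&: 'L_2(G)| * p.
Proof.
rewrite -(LagrangeI 'Z(G) 'L_2(G)) leq_mul2l -iFL; apply/orP; right.
have nL : G \subset 'N('L_2(G)) := lcn_norm 2 G.
rewrite -!card_quotient ?(subset_trans (rad3_sub G) nL) ?(subset_trans (center_sub G) nL) //.
by apply: subset_leq_card; apply: quotientS; apply: center_rad3.
Qed.

(** The first condition makes every commutator lying in L_3 a value [n, g] with n in L_2; the second
    gives [L_3, b] = 1. Together they leave [c, b] as the only commutator in the coset [c, b] L_4,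
    for c in L_2 outside L_3. *)
Definition obs121 := F \subset 'Z(G) * 'L_2(G) /\ exists2 b, b \in G :&: 'C('L_3(G)) & b \notin F.

Let nLF : 'L_2(G) <| F.
Proof. by rewrite /normal lcn2_rad3 (subset_trans (rad3_sub G) (lcn_norm 2 G)). Qed.

Lemma central_obs t : t \in 'Z(G) -> t \notin 'L_2(G) -> F \subset 'Z(G) * 'L_2(G).
Proof.
move=> Zt nt; have Ft := subsetP center_rad3 t Zt.
have nZ : 'L_2(G) \subset 'N('Z(G)).
  exact: subset_trans (lcn_sub 2 G) (normal_norm (center_normal G)).
rewrite -(norm_joinEr nZ).
apply: (prime_index_gen p_pr nLF iFL Ft nt); first exact: joing_subr.
exact: (subsetP (joing_subl _ _)).
Qed.

(** A center of order p^3 does not fit into L_2, which gives a central element outside L_2. As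
    |Z(G)| is at most p times its part in L_2, that part exceeds L_4, and [center_lcn4] yields an
    element outside [F] centralizing L_3. *)
Lemma obs121_center : #|'Z(G)| = (p ^ 3)%N -> obs121.
Proof.
move=> oZ; split.
  have [t Zt nt] : exists2 t, t \in 'Z(G) & t \notin 'L_2(G).
    apply/subsetPn; apply/negP=> s; have := center_lcn2_lt.
    by rewrite (setIidPl s) oZ ltnn.
  exact: central_obs Zt nt.
apply/subsetPn; apply/negP=> sCF; have := subset_leq_card (center_lcn4 sCF); rewrite o4 => le.
have := leq_trans card_center (leq_mul le (leqnn p)); rewrite oZ mulnn leq_exp2l ?prime_gt1 //.
Qed.

(** The part of Z(G) in L_2 is larger than L_4 because it contains [c, b], and Z(G) is larger than
    this part; on the other side |Z(G)| < p^4. *)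
Lemma card_center_121 : obs121 -> #|'Z(G)| = (p ^ 3)%N.
Proof.
case=> sF [b /setIP[Gb Cb] nb].
have [c Lc nc] : exists2 c, c \in 'L_2(G) & c \notin 'L_3(G) by apply/subsetPn; apply: (nlcn23 p_pr i2).
have pZ := pgroupS (center_sub G) pG; have [j ej] := p_natP pZ.
have pZL : p.-group ('Z(G) :&: 'L_2(G)) by apply: pgroupS pZ; apply: subsetIl.
have [i ei] := p_natP pZL.
have lt1 : p ^ 1 < #|'Z(G) :&: 'L_2(G)|.
  rewrite expn1 -o4; apply: proper_card; rewrite properE; apply/andP; split.
    apply/subsetP=> s Ls; apply/setIP; split; last by apply: s32; apply: s43.
    by apply/setIP; split; [apply: mem_lcn Ls | apply/centP=> g Gg; apply: comm1; apply: c4].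
  apply/negP=> s; have Lcb := R3 Lc Gb; have : [~ c, b] \in 'L_4(G).
    apply: (subsetP s); apply/setIP; split; last exact: s32.
    apply/setIP; split; first exact: mem_lcn Lcb.
    apply/centP=> g Gg; apply: comm1; rewrite comm_sym12 //; apply/eqP/commgP/commute_sym.
    by apply: (centP Cb); apply: R3.
  exact/negP/(indep34 p_pr pG i2 iF i3).
have lt2 : #|'Z(G) :&: 'L_2(G)| < #|'Z(G)|.
  apply: proper_card; rewrite properE subsetIl; apply/negP=> s.
  have sZL : 'Z(G) \subset 'L_2(G) by apply: subset_trans s (subsetIr _ _).
  have : F \subset 'L_2(G) by apply: subset_trans sF _; apply: mul_subG.
  by rewrite -indexg_eq1 iFL; move: (prime_gt1 p_pr) => /[swap] /eqP->.
have lt3 : #|'Z(G)| < p ^ 4.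
  apply: leq_ltn_trans card_center _; rewrite expnSr ltn_mul2r prime_gt0 //; exact: center_lcn2_lt.
move: lt1 lt2 lt3; rewrite ej ei !(ltn_exp2l _ _ (prime_gt1 p_pr)) => l1 l2 l3; congr (_ ^ _)%N.
by move: l1 l2 l3; clear; lia.
Qed.

End Index3.

Lemma obs121_not_full : obs121 -> commutators G <> 'L_2(G).
Proof.
case=> sF [b /setIP[Gb Cb] nb] eK.
have [c Lc nc] : exists2 c, c \in 'L_2(G) & c \notin 'L_3(G) by apply/subsetPn; apply: (nlcn23 p_pr i2).
have [s Ls ns] : exists2 s, s \in 'L_4(G) & s != 1 by apply/trivgPn; rewrite -cardG_gt1 o4 prime_gt1.
have : [~ c, b] * s \in commutators G.
  by rewrite eK groupM //; [apply: s32; apply: R3 | apply: s32; apply: s43].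
apply/negP; apply: not_commutator_12 => //; apply: contra ns => /csetP[l Ll <-].
by apply/commgP/commute_sym; apply: (centP Cb).
Qed.

(** A missed g lies in L_3 outside L_4, and writing g = [c, b] s forces b to centralize L_3. What
    remains is to find a central element of [F] outside L_2: any element of [F] outside L_2 is
    corrected step by step, and whenever a correction is impossible g turns out to be a
    commutator. *)
Lemma obs121_commutators : #|F : 'L_2(G)| = p -> commutators G <> 'L_2(G) -> obs121.
Proof.
move=> iFL neq; have nC : ~~ (G \subset 'C('L_3(G))).
  apply/negP=> cG; have o1 : 'L_4(G) = 1 by rewrite lcnSn commGC; apply/commG1P.
  by move: o4 (prime_gt1 p_pr); rewrite o1 cards1 => <-.
have [sK|] := boolP ('L_2(G) \subset commutators G); first by case: neq; apply: commutators_full; apply/subsetP.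
case/subsetPn=> g Lg nK.
have Lg3 : g \in 'L_3(G) by apply: contraR nK => ng; apply: lcn23_commutators; apply/setDP.
have ng4 : g \notin 'L_4(G) by apply: contra nK; apply: lcn4_commutators.
have [c Lc nc] : exists2 c, c \in 'L_2(G) & c \notin 'L_3(G) by apply/subsetPn; apply: (nlcn23 p_pr i2).
have [b Gb hb] := lcn3_value p_pr pG i2 iF Lc nc Lg3; set s := _ * g in hb.
have eg : g = [~ c, b] * s by rewrite mulKVg.
have Cb : b \in 'C('L_3(G)) by apply: contraR nK => nb; apply: coset_value hb.
have nb : b \notin F.
  by apply: contra ng4 => Fb; rewrite -(groupMl _ (groupVr (rad3_C2R Lc Fb))).
have [a Ga nab] := nrad3P Gb nb; have [na _] := nrad3 Ga Gb nab.
have Ca : a \notin 'C('L_3(G)).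
  apply: contra nC => Ca; apply: subset_trans (pair_gen p_pr pG iF Ga Gb nab) _.
  rewrite gen_subG; apply/subsetP=> f /setUP[/set2P[]->|Ff] //.
  by apply/centP=> l Ll; apply: commute_sym; apply: comm1; apply: rF.
have Cab : a * b \notin 'C('L_3(G)) by rewrite groupMr.
have covers x : x \in G -> x \notin 'C('L_3(G)) -> forall u, u \in 'L_4(G) -> exists2 l, l \in 'L_3(G) & [~ l, x] = u.
  by move=> Gx nx u Lu; apply/csetP; apply: (subsetP (cset_last (k := 1) p_pr L5 o4 Gx nx)).
have notK X Y : X \in G -> Y \in G -> [~ X, Y] = g -> False.
  by move=> GX GY e; case/negP: nK; rewrite -e mem_commutators.
have Lcb := R3 Lc Gb; have Lca := R3 Lc Ga; have Gc := mem_lcn Lc; have Gs := mem_lcn hb.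
have nc_cb : [~ c, b] \notin 'L_4(G) by apply: (indep34 p_pr pG i2 iF i3).
have power u : u \in 'L_4(G) -> u != 1 -> exists k : nat, s = u ^+ k.
  by move=> Lu nu; apply: (prime_card_cover p_pr o4 Lu nu hb).
(* If t in [F] moved c, a power of t would supply s: [c, t^k b] = [c, b] s = g. *)
have FC t : t \in F -> t \in 'C('L_2(G)).
  move=> Ft; have Gt := subsetP (rad3_sub G) t Ft; have Lct := rad3_C2R Lc Ft.
  have ct : [~ c, t] = 1.
    apply/eqP; apply: contraT => nct; have [k es] := power _ Lct nct.
    case: (notK c (t ^+ k * b)); rewrite ?groupM ?groupX //.
    rewrite commgMJ commgX; last by apply: commute_sym; apply: comm1; apply: c4.
    by rewrite -es (conjg_fixP _) ?eg //; apply/eqP; apply: c4.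
  have : 'L_2(G) \subset 'C[t].
    apply: (prime_index_gen p_pr nL32 i2 Lc nc); last by apply: inC.
    by apply/subsetP=> l Ll; apply: inC; apply: rF.
  by rewrite -cent_set1 centsC sub1set.
have [t0 Ft0 nt0] : exists2 t, t \in F & t \notin 'L_2(G) by apply/subsetPn; rewrite -indexg_eq1 iFL neq_ltn prime_gt1 ?orbT.
have FR t x : t \in F -> x \in G -> [~ t, x] \in 'L_3(G) by apply: rad3R.
have TM t l x : t \in F -> l \in 'L_2(G) -> x \in G -> [~ t * l, x] = [~ t, x] * [~ l, x].
  by move=> Ft Ll Gx; rewrite commMgJ cJ //; apply: s32; apply: FR.
have TX t x i : t \in F -> x \in G -> [~ t ^+ i, x] = [~ t, x] ^+ i.
  by move=> Ft Gx; apply: commXg; apply: (centP (FC t Ft)); apply: s32; apply: FR.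
(* An element of [F] whose commutator with x is a nontrivial power of [c, b] modulo L_4 would give g
   as [t^i l, x], the factor l in L_3 adjusting the value inside L_4. *)
have hits t x (k : nat) : t \in F -> x \in G -> x \notin 'C('L_3(G)) -> [~ t, x] \notin 'L_4(G) ->
    ([~ c, b] ^+ k)^-1 * [~ t, x] \in 'L_4(G) -> False.
  move=> Ft Gx nx nt4 hk; have Gt := subsetP (rad3_sub G) t Ft; have Ltx := FR t x Ft Gx.
  have npk : ~~ (p %| k).
    apply: contra nt4 => /dvdnP[r er]; have Lk : [~ c, b] ^+ k \in 'L_4(G).
      by rewrite er mulnC expgM groupX // (lcn3_pow i2).
    by rewrite -(groupMl _ (groupVr Lk)).
  have [i hi] := prime_modinv 1 p_pr npk; rewrite expn1 in hi.
  have Gcb := groupR Gc Gb; have Gtx := groupR Gt Gx.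
  have e1 : coset 'L_4(G) [~ t ^+ i, x] = coset 'L_4(G) [~ c, b].
    rewrite TX // (cosetXG _ N4 Gtx) -[in LHS](_ : coset 'L_4(G) [~ c, b] ^+ k = coset 'L_4(G) [~ t, x]).
      rewrite -expgM (divn_eq (k * i) p) hi modn_small ?prime_gt1 // expgD [(_ * p)%N]mulnC expgM.
      rewrite -(cosetXG _ N4 Gcb) (_ : coset _ ([~ c, b] ^+ p) = 1) ?expg1n ?mul1g //.
      by apply/(coset1P N4 (groupX p Gcb)); apply: (lcn3_pow i2).
    by rewrite -(cosetXG _ N4 Gcb); apply/(coset_eqP N4 (groupX k Gcb) Gtx).
  have Gti := groupX i Gt; have h : [~ t ^+ i, x]^-1 * g \in 'L_4(G).
    apply/(coset_eqP N4 (groupR Gti Gx) (mem_lcn Lg)); rewrite e1 eg (cosetMG N4 Gcb Gs).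
    by rewrite (_ : coset _ s = 1) ?mulg1 //; apply/(coset1P N4 Gs).
  have [l Ll el] := covers x Gx nx _ h.
  case: (notK (t ^+ i * l) x); rewrite ?groupM ?(mem_lcn Ll) //.
  by rewrite TM ?groupX ?s32 // el mulKVg.
have [al [be hab]] := lcn3_coord p_pr pG i2 iF Ga Gb nab Lc nc (FR t0 a Ft0 Ga).
(* The factor c^-al removes the [c, a] part of [t0, a]; what remains is a power of [c, b] modulo
   L_4, which [hits] excludes unless it is trivial. *)
pose t1 := t0 * c ^- al; have Lcal : c ^- al \in 'L_2(G) by rewrite groupV groupX.
have Ft1 : t1 \in F by rewrite groupM // (subsetP (lcn2_rad3 G)).
have nt1 : t1 \notin 'L_2(G) by rewrite groupMr.
have Lt1a := FR t1 a Ft1 Ga.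
have t1a : ([~ c, b] ^+ be)^-1 * [~ t1, a] \in 'L_4(G).
  have Lc1 : [~ c, a] ^+ al \in 'L_2(G) by rewrite groupX // s32.
  have Lc2 : [~ c, b] ^+ be \in 'L_2(G) by rewrite groupX // s32.
  rewrite TM // (RV (groupX al Lc) Ga) (RX al Lc Ga) (cm (s32 (FR t0 a Ft0 Ga)) (groupVr Lc1)).
  by move: hab; rewrite invMg -(mulgA ([~ c, b] ^- be)).
have t1a4 : [~ t1, a] \in 'L_4(G) by apply: contraT => n4; case: (hits t1 a be).
have [l Ll el] := covers a Ga Ca _ (groupVr t1a4).
pose t2 := t1 * l; have Ft2 : t2 \in F by rewrite groupM // (subsetP (lcn2_rad3 G)) // s32.
have nt2 : t2 \notin 'L_2(G) by rewrite groupMr // s32.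
have t2a : [~ t2, a] = 1 by rewrite TM ?s32 // el mulgV.
have Gt2 := subsetP (rad3_sub G) t2 Ft2; have Lt2b := FR t2 b Ft2 Gb.
(* t2 is fixed by a and centralizes L_2, so [t2, b]^a = [t2, b [b, a]] = [t2, b]. *)
have t2ba : [~ [~ t2, b], a] = 1.
  apply/eqP/conjg_fixP; rewrite conjRg.
  have -> : t2 ^ a = t2 by apply/conjg_fixP/eqP.
  have Lba := mem_lcn2 Gb Ga; rewrite conjg_mulR commgMJ.
  have -> : [~ t2, [~ b, a]] = 1 by apply/eqP/commgP; apply: (centP (FC t2 Ft2)).
  by rewrite mul1g cJ // s32.
have [ga [de hgd]] := lcn3_coord p_pr pG i2 iF Ga Gb nab Lc nc Lt2b.
have Lga : [~ c, a] ^+ ga \in 'L_3(G) by apply: groupX.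
have Lde : [~ c, b] ^+ de \in 'L_3(G) by apply: groupX.
have caa : [~ c, a, a] != 1.
  apply: contra Ca => /eqP caa; apply: (cent_lcn3 Lc nc Ga).
  apply/setIP; split; first exact: mem_lcn Lca.
  have : G \subset 'C[ [~ c, a] ].
    apply: subset_trans (pair_gen p_pr pG iF Ga Gb nab) _; rewrite gen_subG; apply/subsetP=> f.
    case/setUP=> [/set2P[]->|Ff]; apply: inC' => //; last exact: rF.
    by apply/eqP/commgP/commute_sym; apply: (centP Cb).
  by rewrite -cent_set1 centsC sub1set.
have pga : p %| ga.
  have : [~ c, a, a] ^+ ga = 1.
    move: t2ba; rewrite -(mulKVg ([~ c, a] ^+ ga * [~ c, b] ^+ de) [~ t2, b]).
    rewrite (RM (s32 (groupM Lga Lde)) (s32 (s43 hgd)) Ga) (c4 hgd Ga) mulg1.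
    rewrite (RM (s32 Lga) (s32 Lde) Ga) (RX ga (s32 Lca) Ga) (RX de (s32 Lcb) Ga).
    rewrite (comm_sym12 Lc Gb Ga) (_ : [~ c, a, b] = 1) ?expg1n ?mulg1 //.
    by apply/eqP/commgP/commute_sym; apply: (centP Cb).
  move/eqP; rewrite -order_dvdn (_ : #[ [~ c, a, a] ] = p) //.
  apply: nt_prime_order => //; rewrite -o4; apply: expg_cardG; exact: R4.
have t2b : ([~ c, b] ^+ de)^-1 * [~ t2, b] \in 'L_4(G).
  have ga4 : [~ c, a] ^+ ga \in 'L_4(G) by case/dvdnP: pga => r ->; rewrite mulnC expgM groupX // (lcn3_pow i2).
  rewrite -(mulKVg ([~ c, a] ^+ ga * [~ c, b] ^+ de) [~ t2, b]) (mulgA _ _ (_ * [~ t2, b])).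
  by rewrite groupM // -conjgE mem_lcnJ //; exact: mem_lcn Lde.
have GR := pair_gen p_pr pG iF Ga Gb nab.
(* Since b centralizes L_3, [hits] is applied to a b instead, which gives the same commutator
   [t2, a b] = [t2, b]. *)
have t2b4 : [~ t2, b] \in 'L_4(G).
  apply: contraT => n4; have e : [~ t2, a * b] = [~ t2, b] by rewrite commgMJ t2a conj1g mulg1.
  case: (hits t2 (a * b) de Ft2 (groupM Ga Gb) Cab); by rewrite e.
(* If [t2, b] were nontrivial in L_4, some [c t2^k, b] would be g. *)
have t2b1 : [~ t2, b] = 1.
  apply/eqP; apply: contraT => nu; have [k es] := power _ t2b4 nu.
  case: (notK (c * t2 ^+ k) b); rewrite ?groupM ?groupX //.
  rewrite commMgJ TX // -es eg; congr (_ * _); apply/conjg_fixP/commgP.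
  by apply: commuteX; apply: commute_sym; apply: (centP (FC t2 Ft2)); apply: s32.
split; last by exists b => //; apply/setIP.
apply: (central_obs iFL (t := t2)) => //; apply/setIP; split=> //.
have : G \subset 'C[t2].
  apply: subset_trans GR _; rewrite gen_subG; apply/subsetP=> f; case/setUP=> [/set2P[]->|Ff].
  - exact: inC'.
  - exact: inC'.
  have nLF : 'L_2(G) <| F by rewrite /normal lcn2_rad3 (subset_trans (rad3_sub G) (lcn_norm 2 G)).
  have : F \subset 'C[t2].
    apply: (prime_index_gen p_pr nLF iFL Ft2 nt2); last exact: inC (commgg _).
    by apply/subsetP=> n Ln; apply: inC'; apply/eqP/commgP; apply: (centP (FC t2 Ft2)).
  by move/subsetP; apply.
by rewrite -cent_set1 centsC sub1set.
Qed.

End Last1.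
Section Powers.
Hypothesis sF : F \subset 'Z(G) * 'L_2(G).

(** x^p lies in [F] <= Z(G) L_2 and so acts like its L_2 part n; n commutes with x, which by
    [indep34] happens only inside L_3. *)
Lemma pow_value x y : x \in G -> x \notin F -> y \in G ->
  exists n, [/\ n \in 'L_3(G), [~ n, x] = 1 & [~ x ^+ p, y] = [~ n, y]].
Proof.
move=> Gx nx Gy; have /mulsgP[z n /setIP[Gz /centP cz] Ln exp] := subsetP sF _ (rad3_pow i2 Gx).
have e g : g \in G -> [~ x ^+ p, g] = [~ n, g].
  move=> Gg; rewrite exp commMgJ (_ : [~ z, g] = 1) ?conj1g ?mul1g //; exact/eqP/commgP/cz.
have nx1 : [~ n, x] = 1 by rewrite -e //; apply/eqP/commgP/commute_sym/commuteX.
exists n; split=> //; last exact: e.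
by apply: contraT => nn; case/negP: (indep34 p_pr pG i2 iF i3 Ln nn Gx nx); rewrite nx1.
Qed.

(** Modulo L_4 the relations from a^2 and b^2 give [c, a] = c^-2 = [c, b], so [c, a b] is the square
    [c, b]^2 and lies in L_4, against [indep34]. *)
Lemma no_obs121_2 b : p = 2 -> b \in G -> b \in 'C('L_3(G)) -> b \notin F -> False.
Proof.
move=> p2 Gb Cb nb; have [a Ga nab] := nrad3P Gb nb; have [na _] := nrad3 Ga Gb nab.
set c := [~ a, b] in nab; have Lc : c \in 'L_2(G) := mem_lcn2 Ga Gb.
have Lca := R3 Lc Ga; have Lcb := R3 Lc Gb.
have [n [Ln _]] := pow_value Ga na Gb; rewrite {1}p2 (comm_sq_abelian abL (nL2 Ga) Lc) -/c => e1.
have [m [Lm _]] := pow_value Gb nb Ga.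
have LcV : [~ b, a] \in 'L_2(G) := mem_lcn2 Gb Ga.
rewrite {1}p2 (comm_sq_abelian abL (nL2 Gb) LcV) -(invgR a b) -/c (RV Lc Gb) expgVn => e2.
have h1 : c ^+ 2 * [~ c, a] \in 'L_4(G) by rewrite e1 R4.
have h2 : [~ c, b] * c ^+ 2 \in 'L_4(G) by rewrite -groupV invMg e2 R4.
have Gab := groupM Ga Gb.
have nabF : a * b \notin F.
  apply: contra nab => h; have := rad3R h Gb.
  by rewrite commMgJ commgg mulg1 mem_lcnJ.
case/negP: (indep34 p_pr pG i2 iF i3 Lc nab Gab nabF).
have sq : [~ c, b] ^+ 2 \in 'L_4(G) by have := lcn3_pow i2 Lc Gb; rewrite p2.
rewrite commgMR groupMr; last exact: R4.
have -> : [~ c, b] * [~ c, a] = [~ c, b] ^+ 2 * ([~ c, b] * c ^+ 2)^-1 * (c ^+ 2 * [~ c, a]).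
  have alg (x y w : gT) : commute x w -> x * y = x ^+ 2 * (x * w)^-1 * (w * y).
    by move=> h; rewrite h invMg expg_sq !mulgA mulgK mulgKV.
  by apply: alg; apply: cm; [apply: s32 | apply: groupX].
by rewrite groupM // groupM // groupV.
Qed.

Section Cubes.
Hypothesis p3 : p = 3.

Lemma cube_value x y : x \in G -> x \notin F -> y \in G -> exists n, [/\ n \in 'L_3(G), [~ n, x] = 1 &
  [~ n, y] = [~ x, y] ^+ 3 * [~ [~ x, y], x] ^+ 3 * [~ [~ x, y], x, x] ].
Proof.
move=> Gx nx Gy; have [n [Ln nx1 e]] := pow_value Gx nx Gy; exists n; split=> //.
by rewrite -e {1}p3 (comm_cube_abelian abL (nL2 Gx)) //; apply: mem_lcn2.
Qed.

Let pow3 n x : n \in 'L_2(G) -> x \in G -> [~ n, x] ^+ 3 \in 'L_4(G).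
Proof. by move=> Ln Gx; have := lcn3_pow i2 Ln Gx; rewrite p3. Qed.

Lemma lcn2_cube4 n : n \in 'L_2(G) -> n ^+ 3 \in 'L_4(G).
Proof.
move=> Ln; have [a [b [Ga Gb nab]]] := exists_pair p_pr i2; have [na _] := nrad3 Ga Gb nab.
set c := [~ a, b] in nab; have Lc : c \in 'L_2(G) := mem_lcn2 Ga Gb.
have c3 : c ^+ 3 \in 'L_4(G).
  have [m [Lm _ e]] := cube_value Ga na Gb; have := R4 Lm Gb; rewrite e -/c groupMr; last by apply: R4 => //; apply: R3.
  by rewrite groupMr // pow3.
have l3 l : l \in 'L_3(G) -> l ^+ 3 \in 'L_4(G).
  move=> Ll; have [x Gx h] := lcn3_value p_pr pG i2 iF Lc nab Ll.
  rewrite -(mulKVg [~ c, x] l) expgMn; last by apply: cm; apply: s32; [apply: R3 | apply: s43].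
  by rewrite groupM ?pow3 // groupX.
have [k hk] := prime_index_cover p_pr nL32 i2 Lc nab Ln.
have Lk := groupX k Lc; rewrite -(mulKVg (c ^+ k) n) (expgMn _ (cm Lk (s32 hk))) -expgM mulnC expgM.
by rewrite groupM ?l3 // groupX.
Qed.

Lemma lcn4_cube1 l : l \in 'L_4(G) -> l ^+ 3 = 1.
Proof.
move=> Ll; apply/set1P; move: l Ll.
have ab4 : abelian 'L_4(G) by apply: abelianS (lcn_sub_leq G (isT : 2 <= 4)) abL.
apply: (expg_gen ab4 (T := 1%G) (S := [set [~ n, g] | n in 'L_3(G), g in G])).
- by apply/subsetP=> _ /imset2P[n g Ln Gg ->]; apply: R4.
- exact: subxx.
- move=> _ /imset2P[n g Ln Gg ->]; apply/set1P; rewrite -(RX 3 (s32 Ln) Gg).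
  by apply: c4 => //; apply: lcn2_cube4; apply: s32.
Qed.

Lemma lcn3_cube1 l : l \in 'L_3(G) -> l ^+ 3 = 1.
Proof.
move=> Ll; have [c Lc nc] : exists2 c, c \in 'L_2(G) & c \notin 'L_3(G) by apply/subsetPn; apply: (nlcn23 p_pr i2).
have [x Gx h] := lcn3_value p_pr pG i2 iF Lc nc Ll.
rewrite -(mulKVg [~ c, x] l) (expgMn _ (cm (s32 (R3 Lc Gx)) (s32 (s43 h)))) (lcn4_cube1 h) mulg1.
by rewrite -(RX 3 Lc Gx) c4 // lcn2_cube4.
Qed.

(** Cubes of L_3 are trivial and L_2 = <c> L_3 is abelian, so every cube in L_2 is a power of
    c^3. *)
Lemma Phi12 c : c \in 'L_2(G) -> c \notin 'L_3(G) -> 'Phi('L_2(G)) = <[c ^+ 3]>.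
Proof.
move=> Lc nc; have pL : 3.-group 'L_2(G) by have := pgroupS (lcn_sub 2 G) pG; rewrite p3.
apply/eqP; rewrite eqEsubset; apply/andP; split; rewrite (Phi_Mho pL abL); last first.
  by rewrite cycle_subG /= (Mho_p_elt 1 Lc (mem_p_elt pL Lc)).
rewrite (MhoE 1 pL) gen_subG; apply/subsetP=> _ /imsetP[n Ln ->].
have [k hk] := prime_index_cover p_pr nL32 i2 Lc nc Ln; have Lk := groupX k Lc.
rewrite -(mulKVg (c ^+ k) n) (expgMn _ (cm Lk (s32 hk))) (lcn3_cube1 hk) mulg1.
by rewrite -expgM mulnC expgM mem_cycle.
Qed.

Lemma card_Phi12 c : c \in 'L_2(G) -> c \notin 'L_3(G) -> c ^+ 3 != 1 -> #|'Phi('L_2(G))| = 3.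
Proof.
move=> Lc nc n1; rewrite (Phi12 Lc nc); apply: nt_prime_order => //.
by apply: lcn4_cube1; apply: lcn2_cube4.
Qed.

Lemma cube_rel x y : x \in G -> x \notin F -> y \in G -> exists n, [/\ n \in 'L_3(G), [~ n, x] = 1 &
  [~ n, y] = [~ x, y] ^+ 3 * [~ [~ x, y], x, x] ].
Proof.
move=> Gx nx Gy; have [n [Ln nx1 e]] := cube_value Gx nx Gy; exists n; split=> //.
by rewrite e (lcn3_cube1 (R3 (mem_lcn2 Gx Gy) Gx)) mulg1.
Qed.

(** If c^3 = 1 for c = [a, b], the cube relation for a gives [c, a, a] = 1, while b centralizes L_3;
    all triple commutators then vanish and L_4 = 1. *)
Lemma Phi121 b : 'L_4(G) != 1 -> b \in G -> b \in 'C('L_3(G)) -> b \notin F -> #|'Phi('L_2(G))| = 3.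
Proof.
move=> n4 Gb Cb nb; have [a Ga nab] := nrad3P Gb nb; have [na _] := nrad3 Ga Gb nab.
have Lc := mem_lcn2 Ga Gb; apply: (card_Phi12 Lc nab); apply: contra n4 => /eqP c1.
have cb l : l \in 'L_3(G) -> [~ l, b] = 1 by move=> Ll; apply/eqP/commgP/commute_sym; apply: (centP Cb).
have [n [Ln _]] := cube_rel Ga na Gb; rewrite cb // c1 mul1g => aa.
rewrite -subG1; apply: (@lcn4_gen a b [~ a, b] 1%G) => //.
- by rewrite -aa group1.
- by rewrite (cb _ (R3 Lc Ga)) group1.
- by rewrite (cb _ (R3 Lc Gb)) group1.
Qed.

Section Type122.
Hypothesis o4 : #|'L_4(G)| = 9.

Let nocyc w : w \in 'L_4(G) -> ~~ ('L_4(G) \subset <[w]>).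
Proof.
move=> Lw; apply/negP=> /subset_leq_card; rewrite o4; apply/negP; rewrite -ltnNge.
by apply: (@leq_ltn_trans 3) => //; rewrite -orderE dvdn_leq // order_dvdn lcn4_cube1.
Qed.

(** [A], [M], [D] generate L_4, of order 9 and exponent 3. If c^3 = 1, the cube relation for a
    forces A = 1, since otherwise M and D would be powers of A; then the relation for b puts D into
    <M>. Either way L_4 would be cyclic. *)
Lemma cube_nontrivial : exists2 c, c \in 'L_2(G) & c \notin 'L_3(G) /\ c ^+ 3 != 1.
Proof.
have [a [b [Ga Gb nab]]] := exists_pair p_pr i2; have [na nb] := nrad3 Ga Gb nab.
set c := [~ a, b] in nab; have Lc : c \in 'L_2(G) := mem_lcn2 Ga Gb.
exists c => //; split=> //; apply/eqP=> c31; have Lca := R3 Lc Ga; have Lcb := R3 Lc Gb.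
pose A := [~ c, a, a]; pose M := [~ c, a, b]; pose D := [~ c, b, b].
have LA : A \in 'L_4(G) := R4 Lca Ga; have LM : M \in 'L_4(G) := R4 Lca Gb; have LD : D \in 'L_4(G) := R4 Lcb Gb.
have gen (w : gT) : w \in 'L_4(G) -> A \in <[w]> -> M \in <[w]> -> D \in <[w]> -> False.
  by move=> Lw wA wM wD; case/negP: (nocyc Lw); apply: (@lcn4_gen a b c <[w]>%G).
have val n : n \in 'L_3(G) -> exists i j : nat, [~ n, a] = A ^+ i * M ^+ j /\ [~ n, b] = M ^+ i * D ^+ j.
  move=> Ln; have [i [j h]] := lcn3_coord p_pr pG i2 iF Ga Gb nab Lc nab Ln; exists i, j.
  have Li : [~ c, a] ^+ i \in 'L_3(G) by apply: groupX.
  have Lj : [~ c, b] ^+ j \in 'L_3(G) by apply: groupX.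
  have e g : g \in G -> [~ n, g] = [~ c, a, g] ^+ i * [~ c, b, g] ^+ j.
    move=> Gg; rewrite -(mulKVg ([~ c, a] ^+ i * [~ c, b] ^+ j) n).
    rewrite (RM (s32 (groupM Li Lj)) (s32 (s43 h)) Gg) (c4 h Gg) mulg1.
    by rewrite (RM (s32 Li) (s32 Lj) Gg) (RX i (s32 Lca) Gg) (RX j (s32 Lcb) Gg).
  by rewrite !e // (comm_sym12 Lc Gb Ga).
have tri (w : gT) (i : nat) : w \in 'L_4(G) -> 3 %| i -> w ^+ i = 1.
  by move=> Lw /dvdnP[r ->]; rewrite mulnC expgM lcn4_cube1 // expg1n.
have cop (w : gT) (i : nat) (B : {group gT}) : w \in 'L_4(G) -> ~~ (3 %| i) -> w ^+ i \in B -> w \in B.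
  by move=> Lw ni wi; apply: (mem_expg_coprime (p := 3) _ ni _ wi) => //; rewrite lcn4_cube1.
have A1 : A = 1.
  have [n [Ln na1 nb1]] := cube_rel Ga na Gb; have [i [j [ea eb]]] := val n Ln.
  move: na1 nb1; rewrite ea eb -/c c31 mul1g -/A => e1 e2.
  have [dj|nj] := boolP (3 %| j); last first.
    have MA : M \in <[A]>.
      apply: (cop M j <[A]>%G LM nj); rewrite -(groupMl _ (groupX i (cycle_id A))) e1; exact: group1.
    case: (gen A LA (cycle_id A) MA); apply: (cop D j <[A]>%G LD nj).
    by rewrite -(groupMl _ (groupX i MA)) e2 cycle_id.
  rewrite (tri M j LM dj) mulg1 in e1; rewrite (tri D j LD dj) mulg1 in e2.
  have [di|ni] := boolP (3 %| i); first by rewrite -e2 (tri M i).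
  by apply/set1P; apply: (cop A i 1%G LA ni); rewrite e1 group1.
have [n [Ln nb1]] := cube_rel Gb nb Ga; have [i [j [ea _]]] := val n Ln.
rewrite ea A1 expg1n mul1g -(invgR a b) -/c expgVn c31 invg1 mul1g (RV Lc Gb) (RV (s32 Lcb) Gb) -/D => e.
case: (gen M LM); rewrite ?A1 ?group1 ?cycle_id //.
by rewrite -groupV -e mem_cycle.
Qed.

Lemma card_Phi122 : #|'Phi('L_2(G))| = 3.
Proof. by have [c Lc [nc n1]] := cube_nontrivial; apply: card_Phi12 Lc nc n1. Qed.

Lemma exponent122 : exponent 'L_2(G) = 9.
Proof.
have [c Lc [nc n1]] := cube_nontrivial.
have d9 : exponent 'L_2(G) %| 3 ^ 2.
  apply/exponentP=> n Ln; rewrite (expgM n 3 3); apply: lcn4_cube1; exact: lcn2_cube4.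
have /(dvdn_pfactor _ _ (isT : prime 3))[k le2 e] := d9.
have n3 : ~~ (exponent 'L_2(G) %| 3) by apply: contra n1 => /exponentP/(_ c Lc)->.
by move: n3; rewrite e; case: k le2 e => [|[|[|//]]].
Qed.

(** If [L_3, x] = L_4 for all x outside [F], then L_4 is the centralizer of x in L_3, and the cube
    relation becomes c^3 [c, x, x] = 1 at x = a, b, a b, a b^2. A quadratic form over F_3 in two
    variables with equal values at the four points of the projective line is zero, so A = M = D =
    1. *)
Lemma exists_proper_value : exists b, [/\ b \in G, b \notin F & ~~ ('L_4(G) \subset cset 'L_3(G) b)].
Proof.
have [ex|none] := boolP [exists b in G, (b \notin F) && ~~ ('L_4(G) \subset cset 'L_3(G) b)].
  by have /exists_inP[b Gb /andP[nb h]] := ex; exists b.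
have o3 : #|'L_3(G)| = 81 by rewrite -(Lagrange (lcn_subS 3 G)) o4 i3 p3.
have full x : x \in G -> x \notin F -> 'L_4(G) \subset cset 'L_3(G) x.
  move=> Gx nx; apply: contraR none => h; apply/exists_inP; exists x => //; exact/andP.
have rel x y : x \in G -> x \notin F -> y \in G -> [~ x, y] ^+ 3 * [~ [~ x, y], x, x] = 1.
  move=> Gx nx Gy; have [n [Ln nx1 <-]] := cube_rel Gx nx Gy; apply: c4 => //.
  have s4 : 'L_4(G) \subset 'C_('L_3(G))[x].
    by apply/subsetP=> l Ll; apply/setIP; split; [apply: s43 | apply: inC; apply: c4].
  suff -> : 'L_4(G) = 'C_('L_3(G))[x] by apply/setIP; split=> //; apply: inC.
  apply/eqP; rewrite eqEcard s4 o4 /=; have i9 := subset_leq_card (full x Gx nx).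
  rewrite o4 card_cset in i9; have := Lagrange (subsetIl 'L_3(G) 'C[x]); rewrite o3.
  by move: i9; clear; move: #|_ : _| => q; move: #|_| => r; nia.
have [a [b [Ga Gb nab]]] := exists_pair p_pr i2; have [na nb] := nrad3 Ga Gb nab.
set c := [~ a, b] in nab; have Lc : c \in 'L_2(G) := mem_lcn2 Ga Gb.
have Lca := R3 Lc Ga; have Lcb := R3 Lc Gb.
pose A := [~ c, a, a]; pose M := [~ c, a, b]; pose D := [~ c, b, b].
have LA : A \in 'L_4(G) := R4 Lca Ga; have LM : M \in 'L_4(G) := R4 Lca Gb; have LD : D \in 'L_4(G) := R4 Lcb Gb.
have c44 u w : u \in 'L_4(G) -> w \in 'L_4(G) -> u * w = w * u.
  by move=> Lu Lw; apply: cm; apply: s32; apply: s43.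
have bil x y z : x \in G -> y \in G -> z \in G -> [~ c, x * y, z] = [~ c, y, z] * [~ c, x, z].
  move=> Gx Gy Gz; have [Lx Ly] := (R3 Lc Gx, R3 Lc Gy); have Lxy := R4 Lx Gy.
  by rewrite commgMR (RM (s32 (groupM Ly Lx)) (s32 (s43 Lxy)) Gz) (c4 Lxy Gz) mulg1 (RM (s32 Ly) (s32 Lx) Gz).
have quad x y : x \in G -> y \in G -> [~ c, x * y, x * y] = [~ c, y, y] * [~ c, x, y] * ([~ c, x, y] * [~ c, x, x]).
  move=> Gx Gy; have [Lx Ly] := (R3 Lc Gx, R3 Lc Gy); rewrite bil ?groupM // !R3r //.
  by rewrite (comm_sym12 Lc Gy Gx).
have conj x : x \in G -> x \notin F -> [~ x, b] ^+ 3 * [~ [~ x, b], x, x] = 1 ->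
    c^-1 * [~ x, b] \in 'L_3(G) -> c ^+ 3 * [~ c, x, x] = 1.
  move=> Gx nx e h; have Lh := s32 h; move: e; rewrite -(mulKVg c [~ x, b]).
  rewrite (expgMn _ (cm Lc Lh)) (lcn3_cube1 h) mulg1 (RM Lc Lh Gx).
  by rewrite (RM (s32 (R3 Lc Gx)) (s32 (R3 Lh Gx)) Gx) (c4 (R4 h Gx) Gx) mulg1.
have e1 : c ^+ 3 * A = 1 := rel a b Ga na Gb.
have Gab := groupM Ga Gb; have Gabb := groupM Gab Gb.
have cab : [~ a * b, b] = c ^ b by rewrite commMgJ commgg mulg1.
have cabb : [~ a * b * b, b] = (c ^ b) ^ b by rewrite commMgJ commgg mulg1 cab.
have LJ : c ^ b \in 'L_2(G) by rewrite mem_lcnJ.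
have nF x : x \in G -> [~ x, b] \notin 'L_3(G) -> x \notin F by move=> Gx; apply: contra => h; apply: rad3R.
have J1 : c^-1 * c ^ b \in 'L_3(G) by rewrite -commgEl.
have J2 : c^-1 * (c ^ b) ^ b \in 'L_3(G).
  by rewrite -(mulKVg (c ^ b) ((c ^ b) ^ b)) mulgA groupM // -commgEl R3.
have nab' : a * b \notin F by apply: nF; rewrite // cab mem_lcnJ.
have nabb' : a * b * b \notin F by apply: nF; rewrite // cabb !mem_lcnJ.
have e2 : c ^+ 3 * [~ c, a * b, a * b] = 1 by apply: conj => //; [apply: rel | rewrite cab].
have e3 : c ^+ 3 * [~ c, a * b * b, a * b * b] = 1 by apply: conj => //; [apply: rel | rewrite cabb].
have e0 : c ^+ 3 * D = 1.
  have := rel b a Gb nb Ga; rewrite -(invgR a b) -/c expgVn (RV Lc Gb) (RV (s32 Lcb) Gb) -/D -invMg.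
  by move/eqP; rewrite invg_eq1 (cm (s32 (s43 LD)) (groupX 3 Lc)) => /eqP.
have cA : c ^+ 3 = A^-1 by apply: (mulIg A); rewrite e1 mulVg.
have DA : D = A by apply: (mulgI (c ^+ 3)); rewrite e0 e1.
have x2 : [~ c, a * b, a * b] = A by apply: (mulgI (c ^+ 3)); rewrite e2 e1.
have x3 : [~ c, a * b * b, a * b * b] = A by apply: (mulgI (c ^+ 3)); rewrite e3 e1.
have DMM : D * M * M = 1.
  by move: x2; rewrite quad // -/D -/M -/A mulgA => h; apply: (mulIg A); rewrite h mul1g.
have A3 : A ^+ 3 = 1 by apply: lcn4_cube1.
have DM2 : D * (D * M) * (D * M) = 1.
  move: x3; rewrite quad // bil // -/D -/M x2 => h; apply: (mulIg A); rewrite mul1g -mulgA; exact: h.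
have alg (d m : gT) : d * m = m * d -> d ^+ 3 = 1 -> m ^+ 3 = 1 -> d * (d * m) * (d * m) = 1 -> m = 1.
  move=> dm d3 m3; have -> : d * (d * m) * (d * m) = d ^+ 3 * m ^+ 2.
    by rewrite expg_cube expg_sq !mulgA -(mulgA (d * d) m d) -dm !mulgA.
  by rewrite d3 mul1g => m2; move: m3; rewrite expgS m2 mulg1.
have M1 : M = 1 := alg D M (c44 D M LD LM) (lcn4_cube1 LD) (lcn4_cube1 LM) DM2.
have D1 : D = 1 by move: DMM; rewrite M1 !mulg1.
have : 'L_4(G) \subset 1%G by apply: (@lcn4_gen a b c 1%G); rewrite -/A -/M -/D -?DA ?D1 ?M1 ?inE.
by move/subset_leq_card; rewrite o4 cards1.
Qed.

End Type122.
End Cubes.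
End Powers.
End Rank12.

(** * Passing lower central data to a quotient *)

Section QuotientLcn.
Variables (gT : finGroupType) (G : {group gT}) (j : nat).
Implicit Types (x y g n : gT) (k i : nat).
Let M := 'L_j.+1(G)%G.
Let NM : G \subset 'N(M) := lcn_norm j.+1 G.

Lemma lcnq k : 'L_k.+1(G / M) = 'L_k.+1(G) / M.
Proof. exact: lcn_quo (lcn_normal j.+1 G). Qed.

Lemma lcnq_mem k x : k <= j -> x \in G -> (coset M x \in 'L_k.+1(G / M)) = (x \in 'L_k.+1(G)).
Proof.
move=> le Gx; rewrite lcnq; apply/idP/idP => [/morphimP[y Ny Ly e]|]; last exact: mem_quotient.
have Gy := mem_lcn Ly; have h : y^-1 * x \in M by apply/(coset_eqP NM Gy Gx).
by rewrite -(mulKVg y x) groupM //; apply: mem_lcn_leq h.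
Qed.

Lemma lcnq_index k : k < j -> #|'L_k.+1(G / M) : 'L_k.+2(G / M)| = #|'L_k.+1(G) : 'L_k.+2(G)|.
Proof.
move=> lt; rewrite !lcnq; apply: index_quotient_eq; last exact: subset_trans (lcn_sub k.+1 G) NM.
  by apply: subset_trans (subsetIr _ _) _; apply: lcn_sub_leq.
exact: lcn_subS.
Qed.

Lemma lcnq_index0 : 0 < j -> #|G / M : 'L_2(G / M)| = #|G : 'L_2(G)|.
Proof. by move=> lt; have := @lcnq_index 0 lt; rewrite !lcn1. Qed.

Lemma lcnq_last : 'L_j.+1(G / M) = 1. Proof. by rewrite lcnq trivg_quotient. Qed.

Lemma commutators_lcnq : commutators G = 'L_2(G) -> commutators (G / M) = 'L_2(G / M).
Proof.
move=> eK; apply: commutators_full => h; rewrite lcnq => /morphimP[g Ng Lg ->].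
have Gg := mem_lcn Lg; apply/(commutators_quo (lcn_normal j.+1 G) Gg).
have : g \in commutators G by rewrite eK.
by case/commutatorsP=> x [y [Gx Gy <-]]; exists x, y; rewrite mulVg group1.
Qed.

End QuotientLcn.

(** * Two generators: the radical is L_2 *)

Section TwoGenerators.
Variables (gT : finGroupType) (p : nat) (G : {group gT}).
Hypotheses (p_pr : prime p) (pG : p.-group G) (i2 : #|'L_2(G) : 'L_3(G)| = p)
  (iG : #|G : 'L_2(G)| = (p ^ 2)%N).

(** A radical element outside L_2 would leave the radical with index at most p, too small for a
    nonzero alternating form. *)
Lemma rad3_lcn2 : rad3 G \subset 'L_2(G).
Proof.
apply/subsetP=> f Ff; apply: contraT => nf; have Gf := subsetP (rad3_sub G) f Ff.
have [X [Y [GX GY nXY]]] := exists_pair p_pr i2; have [nX _] := nrad3 GX GY nXY.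
have i1 : #|G : 'L_2(G) <*> <[f]>| <= p ^ 1 by apply: (index_step p_pr pG (lcn_sub 2 G) Gf nf); rewrite iG.
have i1' : #|G : rad3 G| <= p ^ 1.
  by apply: leq_trans i1; rewrite dvdn_leq // indexgS // join_subG lcn2_rad3 cycle_subG.
have := index_le1 (index_step p_pr pG (rad3_sub G) GX nX i1').
by move/subsetP/(_ Y GY); rewrite (negbTE (not_cycle_rad3 GX GY nXY)).
Qed.

Lemma rad3_eq : rad3 G = 'L_2(G)%G.
Proof. by apply/eqP; rewrite -val_eqE eqEsubset rad3_lcn2 lcn2_rad3. Qed.

Lemma index_rad3_2 : #|G : rad3 G| <= p ^ 2.
Proof. by rewrite rad3_eq iG. Qed.

Lemma rad3_cmod k : rad3 G \subset cmod 'L_k.+2(G) 'L_k.+4(G).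
Proof.
apply: subset_trans rad3_lcn2 _; apply/subsetP=> n Ln; apply: (cmod_in (lcn_norm k.+4 G)).
  exact: mem_lcn Ln.
move=> m Lm; have : [~ m, n] \in [~: 'L_k.+2(G), 'L_2(G)] by apply: mem_commg.
by move/(subsetP (lcn_comm G k.+1 1)); rewrite addn1.
Qed.

Lemma lcn23_commutators_2 k : 'L_k.+4(G) = 1 -> {subset 'L_2(G) :\: 'L_3(G) <= commutators G}.
Proof.
move=> L1 g /setDP[Lg ng].
have [||X [Y [GX GY h]]] := lift_all (c := k) p_pr pG i2 index_rad3_2 _ Lg ng (k := k.+1) => //.
  by move=> k' _; apply: rad3_cmod.
apply/commutatorsP; exists X, Y; split=> //; apply/eqP; rewrite eq_mulVg1.
by move: h; rewrite L1 => /set1P->.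
Qed.

End TwoGenerators.

(** * Class 5 with lower central factors of orders p^2, p, p^2, p, p *)

Section Type1211.
Variables (gT : finGroupType) (p : nat) (G : {group gT}).
Hypotheses (p_pr : prime p) (pG : p.-group G) (i2 : #|'L_2(G) : 'L_3(G)| = p)
  (iG : #|G : 'L_2(G)| = (p ^ 2)%N).
Hypotheses (i3 : #|'L_3(G) : 'L_4(G)| = (p ^ 2)%N) (i4 : #|'L_4(G) : 'L_5(G)| = p) (o5 : #|'L_5(G)| = p)
  (L6 : 'L_6(G) = 1).
Implicit Types (x y z g n m t c d w r s a b u v l X Y : gT) (k i j : nat) (A B : {group gT}).
Let N5 : G \subset 'N('L_5(G)) := lcn_norm 5 G.
Let N4 : G \subset 'N('L_4(G)) := lcn_norm 4 G.
Let R3 n X : n \in 'L_2(G) -> X \in G -> [~ n, X] \in 'L_3(G). Proof. exact: mem_lcnR. Qed.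
Let R4 n X : n \in 'L_3(G) -> X \in G -> [~ n, X] \in 'L_4(G). Proof. exact: mem_lcnR. Qed.
Let R5 n X : n \in 'L_4(G) -> X \in G -> [~ n, X] \in 'L_5(G). Proof. exact: mem_lcnR. Qed.
Let c5 u v : u \in 'L_5(G) -> v \in G -> [~ u, v] = 1.
Proof. exact: (lcn_eq1 L6 (i := 4) (j := 0) isT). Qed.
Let c33 u v : u \in 'L_3(G) -> v \in 'L_3(G) -> [~ u, v] = 1.
Proof. exact: (lcn_eq1 L6 (i := 2) (j := 2) isT). Qed.
Let s32 := subsetP (lcn_subS 2 G).
Let s43 := subsetP (lcn_subS 3 G).
Let iF := index_rad3_2 p_pr pG i2 iG.
Let eF := rad3_eq p_pr pG i2 iG.
Let eFs : rad3 G = 'L_2(G) :> {set gT}. Proof. by rewrite eF. Qed.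
Let Q := (G / 'L_5(G))%G.
Let pQ : p.-group Q. Proof. exact: quotient_pgroup. Qed.
Let i2Q : #|'L_2(Q) : 'L_3(Q)| = p. Proof. by rewrite (lcnq_index (j := 4) G (k := 1)). Qed.
Let i3Q : #|'L_3(Q) : 'L_4(Q)| = (p ^ 2)%N. Proof. by rewrite (lcnq_index (j := 4) G (k := 2)). Qed.
Let L5Q : 'L_5(Q) = 1. Proof. exact: (lcnq_last G 4). Qed.
Let o4Q : #|'L_4(Q)| = p.
Proof. by have := lcnq_index (j := 4) G (k := 3) isT; rewrite L5Q indexg1 i4. Qed.
Let iGQ : #|Q : 'L_2(Q)| = (p ^ 2)%N. Proof. by rewrite (lcnq_index0 (j := 4) G). Qed.

(** This is [obs121] for G/L_5: the radical there is L_2, so only the second half of that condition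
    has content. *)
Definition proper_cmod35 := exists2 b, b \in G & b \notin 'L_2(G) /\ b \in cmod 'L_3(G) 'L_5(G).

Let eFQ : rad3 Q = 'L_2(Q)%G := rad3_eq p_pr pQ i2Q iGQ.
Let iFQ : #|Q : rad3 Q| <= p ^ 2 := index_rad3_2 p_pr pQ i2Q iGQ.
Let sFQ : rad3 Q \subset 'Z(Q) * 'L_2(Q). Proof. by rewrite eFQ mulG_subr. Qed.
Let obsQ b : b \in G -> b \notin 'L_2(G) -> b \in cmod 'L_3(G) 'L_5(G) ->
  [/\ coset 'L_5(G) b \in Q, coset 'L_5(G) b \notin 'L_2(Q) & coset 'L_5(G) b \in 'C('L_3(Q))].
Proof.
move=> Gb nb /cmodP[_ cb]; split; first exact: mem_quotient.
  by rewrite (lcnq_mem (j := 4)).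
apply/centP=> w; rewrite (lcnq G 4) => /morphimP[l Nl Ll ->]; have Gl := mem_lcn Ll.
apply: commute_sym; apply: comm1; rewrite -(coset_comm N5 Gl Gb).
by apply/(coset1P N5 (groupR Gl Gb)); apply: cb.
Qed.

Let obs : proper_cmod35 -> obs121 Q.
Proof.
case=> b Gb [nb cb]; split; first exact: sFQ.
have [Qb nQb Cb] := obsQ Gb nb cb; exists (coset 'L_5(G) b); first exact/setIP.
by rewrite eFQ.
Qed.

Let L4Q1 : 'L_4(Q) != 1.
Proof. by rewrite -cardG_gt1 o4Q prime_gt1. Qed.

Lemma not_full_1211 : proper_cmod35 -> commutators G <> 'L_2(G).
Proof.
move=> h eK; apply: (obs121_not_full p_pr pQ i2Q i3Q L5Q iFQ o4Q (obs h)).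
exact: (commutators_lcnq 4 eK).
Qed.

(** Modulo L_5 this is the computation for factors p, p^2, p; then L_4 <= Phi(L_2) L_5 gives L_4 <=
    Phi(L_2) by nilpotency. *)
Lemma Phi_1211 : p = 3 -> proper_cmod35 -> 'Phi('L_2(G)) = 'L_4(G).
Proof.
move=> p3 h; have [b Gb [nb cb]] := h; have [Qb nQb Cb] := obsQ Gb nb cb.
have nbF : coset 'L_5(G) b \notin rad3 Q by rewrite eFQ.
have oPhi := Phi121 p_pr pQ i2Q i3Q L5Q iFQ sFQ p3 L4Q1 Qb Cb nbF.
have pL : p.-group 'L_2(G) := pgroupS (lcn_sub 2 G) pG.
have nL5 : 'L_2(G) \subset 'N('L_5(G)) := subset_trans (lcn_sub 2 G) N5.
have ePhi : 'Phi('L_2(G)) / 'L_5(G) = 'L_4(G) / 'L_5(G).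
  rewrite (quotient_Phi pL nL5) -!(lcnq G 4).
  have [c Lc nc] : exists2 c, c \in 'L_2(Q) & c \notin 'L_3(Q) by apply/subsetPn; apply: (nlcn23 p_pr i2Q).
  apply/eqP; rewrite eqEcard oPhi o4Q p3 leqnn andbT (Phi12 p_pr pQ i2Q i3Q L5Q iFQ sFQ p3 Lc nc).
  by rewrite cycle_subG; apply: (lcn2_cube4 p_pr pQ i2Q i3Q L5Q iFQ sFQ p3).
have nPhi : 'Phi('L_2(G)) <| G by apply: char_normal_trans (Phi_char _) (lcn_normal 2 G).
have s4 : 'L_4(G) \subset 'Phi('L_2(G)).
  apply: (lcn_sub_nil (k := 3) (pgroup_nil pG) (normal_norm nPhi) (M := [group of 'Phi('L_2(G))])).
  have nPhi5 : 'Phi('L_2(G)) \subset 'N('L_5(G)) := subset_trans (normal_sub nPhi) N5.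
  rewrite /= (normC nPhi5) -quotientSK; last exact: subset_trans (lcn_sub 4 G) N5.
  by rewrite ePhi.
apply/eqP; rewrite eqEsubset s4 andbT -(quotientSGK _ (lcn_subS 4 G)) ?ePhi //.
exact: subset_trans (normal_sub nPhi) N5.
Qed.

(** The results for G/L_5 show that cubing maps L_2 into L_4 and L_3 into L_5, whence it kills L_4.
    Exponent 3 would make Phi(L_2) = L_4 trivial. *)
Lemma exponent_1211 : p = 3 -> abelian 'L_2(G) -> proper_cmod35 -> exponent 'L_2(G) = 9.
Proof.
move=> p3 abL h; have nL x : x \in G -> x \in 'N('L_2(G)) by apply: (subsetP (lcn_norm 2 G)).
have l5 l : l \in 'L_3(G) -> l ^+ 3 \in 'L_5(G).
  move=> Ll; have Gl := mem_lcn Ll; apply/(coset1P N5 (groupX 3 Gl)).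
  rewrite (cosetXG _ N5 Gl); apply: (lcn3_cube1 p_pr pQ i2Q i3Q L5Q iFQ sFQ p3).
  by rewrite (lcnq_mem (j := 4)).
have l4 : {in 'L_4(G), forall l, l ^+ 3 \in 1%G}.
  have ab4 : abelian 'L_4(G) by apply: abelianS (lcn_sub_leq G (isT : 2 <= 4)) abL.
  apply: (expg_gen ab4 (T := 1%G) (S := [set [~ n, g] | n in 'L_3(G), g in G])).
  - by apply/subsetP=> _ /imset2P[n g Ln Gg ->]; apply: R4.
  - exact: subxx.
  - move=> _ /imset2P[n g Ln Gg ->]; apply/set1P; rewrite -(commX_abelian _ abL (nL g Gg) (s32 Ln)).
    by apply: c5 => //; apply: l5.
have d9 : exponent 'L_2(G) %| 3 ^ 2.
  apply/exponentP=> n Ln; rewrite (expgM n 3 3); apply/set1P; apply: l4.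
  have Gn := mem_lcn Ln; rewrite -(lcnq_mem (j := 4) (G := G) (k := 3)) ?groupX // (cosetXG _ N5 Gn).
  by apply: (lcn2_cube4 p_pr pQ i2Q i3Q L5Q iFQ sFQ p3); rewrite (lcnq_mem (j := 4)).
have /(dvdn_pfactor _ _ (isT : prime 3))[k le2 e] := d9.
have n3 : ~~ (exponent 'L_2(G) %| 3).
  apply/negP=> d3; have pL : 3.-group 'L_2(G) by have := pgroupS (lcn_sub 2 G) pG; rewrite p3.
  have : 'Phi('L_2(G)) == 1 by rewrite (trivg_Phi pL) abelemE // abL d3.
  rewrite (Phi_1211 p3 h) => /eqP e1; have := i4; rewrite e1.
  have -> : 'L_5(G) = 1 by apply/eqP; rewrite -subG1 -e1 (lcn_subS 4).
  by rewrite indexgg p3.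
by move: n3; rewrite e; case: k le2 e => [|[|[|//]]].
Qed.

Let n5 : ~~ (G \subset 'C('L_4(G))).
Proof.
apply/negP=> cG; have o1 : 'L_5(G) = 1 by rewrite lcnSn commGC; apply/commG1P.
by move: o5 (prime_gt1 p_pr); rewrite o1 cards1 => <-.
Qed.

Let nL54 : 'L_5(G) <| 'L_4(G). Proof. by rewrite /normal (lcn_subS 4) (subset_trans (lcn_sub 4 G) N5). Qed.

Let center45 z : z \in 'Z(G) -> z \in 'L_4(G) -> z \in 'L_5(G).
Proof.
move=> Zz Lz; apply: contraT => nz; case/negP: n5; rewrite centsC.
apply: (prime_index_gen p_pr nL54 i4 Lz nz); last by case/setIP: Zz.
by apply/subsetP=> u Lu; apply/centP=> g Gg; apply: comm1; apply: c5.
Qed.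

(** For m in L_4 outside L_5 the centralizer of m has index at most p, so it contains some b outside
    L_2, and b centralizes L_4. The symmetry [l, b, g] = [l, g, b] = 1 makes [l, b] central for l in
    L_3, and Z(G) meets L_4 only in L_5. *)
Lemma abelian_1211 : abelian 'L_2(G) -> proper_cmod35.
Proof.
move=> abL; have [m Lm nm] : exists2 m, m \in 'L_4(G) & m \notin 'L_5(G).
  by apply/subsetPn; rewrite -indexg_gt1 i4 prime_gt1.
have [b Cb nb] : exists2 b, b \in 'C_G[m] & b \notin 'L_2(G).
  apply/subsetPn; apply/negP=> sC; have : #|G : 'C_G[m]| <= p.
    rewrite -card_cset -o5; apply: subset_leq_card; apply/subsetP=> _ /csetP[g Gg <-].
    by rewrite -groupV invgR R5.
  rewrite leqNgt => /negP[]; apply: (@leq_trans (p ^ 2)); first by rewrite -{1}(expn1 p) ltn_exp2l ?prime_gt1.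
  by rewrite -iG dvdn_leq ?indexg_gt0 // indexgS.
have [Gb cb] := setIP Cb; exists b => //; split=> //; apply: (cmod_in N5) => // l Ll.
have C4 : 'L_4(G) \subset 'C[b].
  apply: (prime_index_gen p_pr nL54 i4 Lm nm); last by rewrite cent1C.
  by apply/subsetP=> u Lu; apply/cent1P; first [exact: comm1 (c5 Lu Gb) | exact: commute_sym (comm1 (c5 Lu Gb))].
apply: center45; last exact: R4; apply/setIP; split; first by rewrite groupR // (mem_lcn Ll).
apply/centP=> g Gg; apply: comm1; rewrite (comm_sym_abelian abL (s32 Ll) Gb Gg).
by apply/eqP/commgP; have /(subsetP C4)/cent1P h := R4 Ll Gg; first [exact: h | exact: commute_sym h].
Qed.

(** Outside L_3 the lifting works, and inside L_4 one x outside two centralizers suffices. For t in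
    L_3 outside L_4 only the L_5 part is in doubt; L_2 is nonabelian by [abelian_1211], so some
    [c l, l0] with l0 in L_3 generates L_5 and absorbs it. *)
Lemma commutators_1211 : ~ proper_cmod35 -> commutators G = 'L_2(G).
Proof.
move=> none; have nE x : x \in G -> x \notin 'L_2(G) -> x \notin cmod 'L_3(G) 'L_5(G).
  by move=> Gx nx; apply/negP=> cx; apply: none; exists x.
have nab : ~~ abelian 'L_2(G) by apply/negP=> ab; apply: none; apply: abelian_1211.
have hitx x : x \in G -> x \notin cmod 'L_3(G) 'L_5(G) ->
    {in 'L_4(G), forall s, exists2 l, l \in 'L_3(G) & [~ l, x]^-1 * s \in 'L_5(G)}.
  move=> Gx nx; apply: (hit p_pr N5 nL54 i4 (lcn_sub 3 G) Gx).
  - by move=> l Ll; apply: R4.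
  - by move=> l Ll; apply: R5; [apply: R4 | apply: mem_lcn Ll].
  - exact: cmod_nP N5 Gx nx.
apply: commutators_full => t Lt.
have [Lt3|nt3] := boolP (t \in 'L_3(G)); last first.
  by apply: (lcn23_commutators_2 p_pr pG i2 iG (k := 2) L6); apply/setDP.
have [Lt4|nt4] := boolP (t \in 'L_4(G)).
  have n35 : ~~ (G \subset cmod 'L_3(G) 'L_5(G)).
    by apply: (cmod_proper (k := 2)); rewrite -indexg_eq1 i4 neq_ltn prime_gt1 ?orbT.
  have [x [Gx nx nC]] := avoid2 n35 n5; have [l Ll hl] := hitx x Gx nx t Lt4.
  have /csetP[m Lm em] := subsetP (cset_last (k := 2) p_pr L6 o5 Gx nC) _ hl.
  apply/commutatorsP; exists (l * m), x; split=> //; first by rewrite groupM ?(mem_lcn Ll) ?(mem_lcn Lm).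
  rewrite commMgJ em (conjg_fixP _) ?mulKVg //; apply/eqP.
  by apply: c33; [apply: s43; apply: R4 | apply: s43].
have [c Lc nc] : exists2 c, c \in 'L_2(G) & c \notin 'L_3(G) by apply/subsetPn; apply: (nlcn23 p_pr i2).
have [x Gx hx] := lcn3_value p_pr pG i2 iF Lc nc Lt3; have Lcx := R3 Lc Gx.
have nx : x \notin 'L_2(G).
  apply: contra nt4 => Lx; rewrite -(groupMl _ (groupVr (_ : [~ c, x] \in 'L_4(G)))) //.
  by apply: rad3_C2R => //; rewrite eF.
have [l Ll hl] := hitx x Gx (nE x Gx nx) _ hx.
have Lcl : c * l \in 'L_2(G) by rewrite groupM // s32.
have ncl : c * l \notin 'L_3(G) by rewrite groupMr.
have ecl : [~ c * l, x] = [~ c, x] * [~ l, x].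
  by rewrite commMgJ (conjg_fixP _) //; apply/eqP; apply: c33.
set u := _ * _ in hl; have et : t = [~ c * l, x] * u by rewrite ecl /u -(mulgA [~ c, x] [~ l, x]) mulKVg mulKVg.
have nL32 : 'L_3(G) <| 'L_2(G) by rewrite /normal (lcn_subS 2) (subset_trans (lcn_sub 2 G) (lcn_norm 3 G)).
have D5 n m : n \in 'L_2(G) -> m \in 'L_2(G) -> [~ n, m] \in 'L_5(G).
  by move=> Ln Lm; apply: (subsetP (lcn_der2 p_pr i2)); apply: mem_commg.
have [l0 Ll0 nl0] : exists2 l0, l0 \in 'L_3(G) & [~ c * l, l0] != 1.
  apply/exists_inP; rewrite -negb_forall_in; apply: contra nab => /forall_inP h.
  have cC : c * l \in 'C('L_3(G)) by apply/centP=> k Lk; apply/commgP; apply: h.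
  have s2C : 'L_2(G) \subset 'C('L_3(G)).
    by apply: (prime_index_gen p_pr nL32 i2 Lcl ncl) => //; apply/centsP=> k Lk k' Lk'; apply: comm1; apply: c33.
  have s2cl : 'L_2(G) \subset 'C[c * l].
    apply: (prime_index_gen p_pr nL32 i2 Lcl ncl); last by rewrite cent1id.
    by apply/subsetP=> k Lk; rewrite cent1C; apply/cent1P; first [exact: (centP cC) | exact: commute_sym (centP cC k Lk)].
  apply: (prime_index_gen p_pr nL32 i2 Lcl ncl); first by rewrite centsC.
  by move: s2cl; rewrite -cent_set1 centsC sub1set.
have [i eu] := prime_card_cover p_pr o5 (D5 _ _ Lcl (s32 Ll0)) nl0 hl.
apply/commutatorsP; exists (c * l), (x * l0 ^+ i); split.
- exact: mem_lcn Lcl.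
- by rewrite groupM // groupX // (mem_lcn Ll0).
have Ll0i : l0 ^+ i \in 'L_3(G) by apply: groupX.
have Lclx : [~ c * l, x] \in 'L_3(G) := R3 Lcl Gx.
rewrite commgMJ (conjg_fixP (x := [~ c * l, x]) (y := l0 ^+ i) _); last by apply/eqP; apply: c33.
rewrite commgX; last by apply: commute_sym; apply: comm1; apply: c5; [apply: D5 => //; apply: s32 | apply: mem_lcn Ll0].
rewrite -eu et; apply: comm1; exact: c5 hl (mem_lcn Lclx).
Qed.

(** Z(G) lies in L_3 and meets L_4 inside L_5, of order p. It does not cover L_3/L_4, since [L_3, G]
    is not contained in L_5, so its image there has order at most p. *)
Lemma center_1211 : #|'Z(G)| <= p ^ 2.
Proof.
have ZF : 'Z(G) \subset 'L_2(G) by rewrite -eFs; apply: center_rad3.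
have Z3 : 'Z(G) \subset 'L_3(G).
  apply/subsetP=> z Zz; have Lz := subsetP ZF z Zz; apply: contraT => nz.
  have [X [Y [GX GY nXY]]] := exists_pair p_pr i2; have [nX _] := nrad3 GX GY nXY.
  case/negP: (indep34 p_pr pG i2 iF i3 Lz nz GX nX); case/setIP: Zz => _ /centP cz.
  by rewrite (_ : [~ z, X] = 1) //; apply/eqP/commgP/cz.
have pZ := pgroupS (center_sub G) pG.
have small (A B : {group gT}) (k : nat) : p.-nat #|A : B| -> #|A : B| < p ^ 2 -> #|A : B| <= p.
  move=> /p_natP[[|[|k']] ->] //; first by rewrite prime_gt0.
  by rewrite ltn_exp2l ?prime_gt1.
have o4 : #|'L_4(G)| = (p ^ 2)%N by rewrite -(Lagrange (lcn_subS 4 G)) o5 i4.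
have le1 : #|'Z(G) :&: 'L_4(G)| <= p.
  by rewrite -o5; apply: subset_leq_card; apply/subsetP=> z /setIP[Zz Lz]; apply: center45.
have le2 : #|'Z(G) : 'L_4(G)| <= p.
  apply: (small _ _ 0%N); first exact: pnat_dvd (dvdn_indexg _ _) pZ.
  rewrite -i3 -!card_quotient ?(subset_trans (center_sub G) N4) ?(subset_trans (lcn_sub 3 G) N4) //.
  rewrite ltnNge; apply/negP=> le; have e : 'Z(G) / 'L_4(G) = 'L_3(G) / 'L_4(G).
    by apply/eqP; rewrite eqEcard quotientS.
  have s3 : 'L_3(G) \subset 'L_4(G) * 'Z(G).
    by rewrite -quotientSK ?e // (subset_trans (lcn_sub 3 G) N4).
  have : 'L_4(G) \subset 'L_5(G).
    rewrite [in X in X \subset _](lcnSn 2) gen_subG; apply/subsetP=> _ /imset2P[n g Ln Gg ->].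
    case/mulsgP: (subsetP s3 n Ln) => m z Lm /setIP[Gz /centP cz] ->.
    rewrite commMgJ (_ : [~ z, g] = 1) ?mulg1; last by apply/eqP/commgP/cz.
    by rewrite mem_lcnJ ?R5.
  by rewrite -indexg_eq1 i4 => /eqP e1; move: (prime_gt1 p_pr); rewrite e1.
by rewrite -(LagrangeI 'Z(G) 'L_4(G)) -mulnn leq_mul.
Qed.

(** This subgroup turns out to be Z_2(G). *)
Let Y := ('L_3(G) :&: cmod_group G 'L_5(G))%G.

Let YP n : reflect (n \in 'L_3(G) /\ {in G, forall g, [~ n, g] \in 'L_5(G)}) (n \in Y).
Proof.
apply: (iffP setIP) => [[Ln /cmodP[_ h]]|[Ln h]]; split=> //.
  by move=> g Gg; rewrite -groupV invgR h.
by apply: (cmod_in N5); [apply: mem_lcn Ln | move=> g Gg; rewrite -groupV invgR h].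
Qed.

Let sY4 : 'L_4(G) \subset Y.
Proof. by apply/subsetP=> m Lm; apply/YP; split=> [|g Gg]; [apply: s43 | apply: R5]. Qed.

Let nY3 : ~~ ('L_3(G) \subset Y).
Proof.
apply/negP=> s; have : 'L_4(G) \subset 'L_5(G).
  rewrite [in X in X \subset _](lcnSn 2) gen_subG; apply/subsetP=> _ /imset2P[n g Ln Gg ->].
  by case/YP: (subsetP s n Ln) => _; apply.
by rewrite -indexg_eq1 i4 => /eqP e1; move: (prime_gt1 p_pr); rewrite e1.
Qed.

Let eY : 'Z_2(G) = Y.
Proof.
have Z3 : 'Z(G) \subset Y.
  have ZF : 'Z(G) \subset 'L_2(G) by rewrite -eFs; apply: center_rad3.
  apply/subsetP=> z Zz; have Lz := subsetP ZF z Zz; case/setIP: (Zz) => _ /centP cz.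
  have z1 g : g \in G -> [~ z, g] = 1 by move=> Gg; apply/eqP/commgP/cz.
  apply/YP; split=> [|g Gg]; last by rewrite z1.
  apply: contraT => nz.
  have [X [X' [GX GX' nXY]]] := exists_pair p_pr i2; have [nX _] := nrad3 GX GX' nXY.
  by case/negP: (indep34 p_pr pG i2 iF i3 Lz nz GX nX); rewrite z1.
apply/eqP; rewrite eqEsubset; apply/andP; split; apply/subsetP=> z.
  case/ucn2P=> Gz hz; have zY g : g \in G -> [~ z, g] \in Y by move=> Gg; apply: (subsetP Z3); apply: hz.
  have Lz : z \in 'L_2(G).
    rewrite -eFs; apply/rad3P; split=> // g Gg; rewrite -groupV invgR.
    by case/YP: (zY g Gg).
  have Lz3 : z \in 'L_3(G).
    apply: contraT => nz; case/negP: nY3; have [X [X' [GX GX' nXY]]] := exists_pair p_pr i2.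
    by apply: (lcn3_gen p_pr pG i2 iF GX GX' nXY Lz nz sY4 (subsetIl _ _)); apply: zY.
  apply/YP; split=> // g Gg; apply: center45; [exact: hz | exact: R4].
case/YP=> Lz hz; rewrite ucnSnR ucn1; apply/setIdP; split; first exact: mem_lcn Lz.
rewrite gen_subG; apply/subsetP=> _ /imset2P[z' g /set1P-> Gg ->]; apply/setIP; split.
  by rewrite groupR // (mem_lcn Lz).
by apply/centP=> h Gh; apply: comm1; apply: c5 => //; apply: hz.
Qed.

(** An element of Z_2(G) outside L_4 is [c, x] modulo L_4 for some x outside L_2, and [c, x] is
    central modulo L_5 precisely when x centralizes L_3/L_5. The order is then p^3, being strictly
    between |L_4| = p^2 and |L_3| = p^4. *)
Lemma ucn2_1211 : #|'Z_2(G)| = (p ^ 3)%N <-> proper_cmod35.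
Proof.
have o4 : #|'L_4(G)| = (p ^ 2)%N by rewrite -(Lagrange (lcn_subS 4 G)) o5 i4.
have o3 : #|'L_3(G)| = (p ^ 4)%N by rewrite -(Lagrange (lcn_subS 3 G)) o4 i3 -expnD.
have [c Lc nc] : exists2 c, c \in 'L_2(G) & c \notin 'L_3(G) by apply/subsetPn; apply: (nlcn23 p_pr i2).
have Gc := mem_lcn Lc; have abQ : abelian 'L_2(Q) := abelian_lcn2_12 p_pr i2Q L5Q.
have LcQ : coset 'L_5(G) c \in 'L_2(Q) by rewrite (lcnq_mem (j := 4)).
have ncQ : coset 'L_5(G) c \notin 'L_3(Q) by rewrite (lcnq_mem (j := 4)).
rewrite eY; split=> [oY|[b Gb [nb /cmodP[_ cb]]]].
  have [n Yn nn] : exists2 n, n \in Y & n \notin 'L_4(G).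
    by apply/subsetPn; apply/negP=> /subset_leq_card; rewrite oY o4 leq_exp2l ?prime_gt1.
  case/YP: Yn => Ln hn; have [x Gx hx] := lcn3_value p_pr pG i2 iF Lc nc Ln.
  have Lcx := R3 Lc Gx.
  exists x => //; split.
    apply: contra nn => Lx; rewrite -(groupMl _ (groupVr (_ : [~ c, x] \in 'L_4(G)))) //.
    by apply: rad3_C2R => //; rewrite eF.
  have cx g : g \in G -> [~ [~ c, x], g] \in 'L_5(G).
    move=> Gg; have := hn g Gg; rewrite -{1}(mulKVg [~ c, x] n) commMgJ groupMr; last exact: R5.
    by rewrite memJ_norm // (subsetP N5) // (mem_lcn hx).
  have Qx : coset 'L_5(G) x \in Q by apply: mem_quotient.
  have Zx : [~ coset 'L_5(G) c, coset 'L_5(G) x] \in 'Z(Q).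
    apply/setIP; split; first by rewrite groupR // mem_quotient.
    apply/centP=> _ /morphimP[g Ng Gg ->]; apply: comm1.
    rewrite -(coset_comm N5 Gc Gx) -(coset_comm N5 (mem_lcn Lcx) Gg).
    by apply/(coset1P N5); [rewrite groupR // (mem_lcn Lcx) | apply: cx].
  have Cx := cent_lcn3 p_pr pQ i2Q L5Q iFQ LcQ ncQ Qx Zx.
  apply: (cmod_in N5) => // l Ll; have Gl := mem_lcn Ll.
  apply/(coset1P N5 (groupR Gl Gx)); rewrite (coset_comm N5 Gl Gx).
  by apply/eqP/commgP/commute_sym; apply: (centP Cx); rewrite (lcnq_mem (j := 4)).
have Lcb := R3 Lc Gb; have cbY : [~ c, b] \in Y.
  apply/YP; split=> // g Gg; have Gcb := mem_lcn Lcb; apply/(coset1P N5 (groupR Gcb Gg)).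
  rewrite (coset_comm N5 Gcb Gg) (coset_comm N5 Gc Gb) (comm_sym_abelian abQ LcQ) ?mem_quotient //.
  have Lcg := R3 Lc Gg; rewrite -(coset_comm N5 Gc Gg) -(coset_comm N5 (mem_lcn Lcg) Gb).
  by apply/(coset1P N5); [rewrite groupR // (mem_lcn Lcg) | apply: cb].
have ncb : [~ c, b] \notin 'L_4(G) by apply: (indep34 p_pr pG i2 iF i3) => //; rewrite eF.
have pY : p.-group Y by apply: pgroupS pG; apply: subset_trans (subsetIl _ _) (lcn_sub 3 G).
have [k ek] := p_natP pY.
have l1 : p ^ 2 < #|Y| by rewrite -o4 proper_card // properE sY4; apply: contra ncb => /subsetP; apply.
have l2 : #|Y| < p ^ 4 by rewrite -o3 proper_card // properE subsetIl.
move: l1 l2; rewrite ek !(ltn_exp2l _ _ (prime_gt1 p_pr)) => l1 l2; congr (_ ^ _)%N.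
by move: l1 l2; clear; lia.
Qed.

End Type1211.

(** * Class 5 with lower central factors of orders p^2, p, p, p, p^2 *)

Section Type1112.
Variables (gT : finGroupType) (p : nat) (G : {group gT}).
Hypotheses (p_pr : prime p) (pG : p.-group G) (i2 : #|'L_2(G) : 'L_3(G)| = p)
  (iG : #|G : 'L_2(G)| = (p ^ 2)%N).
Hypotheses (i3 : #|'L_3(G) : 'L_4(G)| = p) (i4 : #|'L_4(G) : 'L_5(G)| = p) (o5 : #|'L_5(G)| = (p ^ 2)%N)
  (L6 : 'L_6(G) = 1).
Implicit Types (x y z g n m t c d w r s a b u v l h X Y : gT) (i j : nat) (A B : {group gT}).
Let N5 : G \subset 'N('L_5(G)) := lcn_norm 5 G.
Let N4 : G \subset 'N('L_4(G)) := lcn_norm 4 G.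
Let R3 n X : n \in 'L_2(G) -> X \in G -> [~ n, X] \in 'L_3(G). Proof. exact: mem_lcnR. Qed.
Let R4 n X : n \in 'L_3(G) -> X \in G -> [~ n, X] \in 'L_4(G). Proof. exact: mem_lcnR. Qed.
Let R5 n X : n \in 'L_4(G) -> X \in G -> [~ n, X] \in 'L_5(G). Proof. exact: mem_lcnR. Qed.
Let c5 u v : u \in 'L_5(G) -> v \in G -> [~ u, v] = 1.
Proof. exact: (lcn_eq1 L6 (i := 4) (j := 0) isT). Qed.
Let c24 u v : u \in 'L_2(G) -> v \in 'L_4(G) -> [~ u, v] = 1.
Proof. exact: (lcn_eq1 L6 (i := 1) (j := 3) isT). Qed.
Let c42 u v : u \in 'L_4(G) -> v \in 'L_2(G) -> [~ u, v] = 1.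
Proof. exact: (lcn_eq1 L6 (i := 3) (j := 1) isT). Qed.
Let c33 u v : u \in 'L_3(G) -> v \in 'L_3(G) -> [~ u, v] = 1.
Proof. exact: (lcn_eq1 L6 (i := 2) (j := 2) isT). Qed.
Let s32 := subsetP (lcn_subS 2 G).
Let s54 := subsetP (lcn_subS 4 G).
Let nL (k : nat) : 'L_k.+2(G) <| 'L_k.+1(G).
Proof. by rewrite /normal lcn_subS (subset_trans (lcn_sub k.+1 G)) ?lcn_norm. Qed.
Let gt1 (k : nat) : #|'L_k.+1(G) : 'L_k.+2(G)| = p -> ~~ ('L_k.+1(G) \subset 'L_k.+2(G)).
Proof. by move=> i; rewrite -indexg_gt1 i prime_gt1. Qed.

Let E2 := cmod 'L_2(G) 'L_4(G).
Let sCC : E2 :&: G \subset cmod 'L_3(G) 'L_5(G) := lcn_C2_C3 p_pr i2.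

(* modulo [L_2, L_2] the action on L_2 is commutative, so L_5 = [L_4, a] for a outside the centralizers *)
Let last_gen a : a \in G -> a \notin cmod 'L_3(G) 'L_5(G) ->
  forall u, u \in 'L_5(G) -> exists d m, [/\ d \in [~: 'L_2(G), 'L_2(G)], m \in 'L_4(G) & u = d * [~ m, a]].
Proof.
move=> Ga na; have na2 : a \notin E2 by apply: contra na => h; apply: (subsetP sCC); apply/setIP.
pose D := [~: 'L_2(G), 'L_2(G)]%G; have sD5 : D \subset 'L_5(G) := lcn_der2 p_pr i2.
have nD : G \subset 'N(D) by apply: normsR; apply: lcn_norm.
have [l Ll nl] := cmod_nP N5 Ga na; set m := [~ l, a] in nl; have Lm : m \in 'L_4(G) := R4 Ll Ga.
have gr : group_set (cset 'L_4(G) a).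
  apply: cset_group_set => n n' Ln Ln'; apply/conjg_fixP/eqP; apply: c5; first exact: R5.
  exact: mem_lcn Ln'.
pose H := Group gr; have sH5 : H \subset 'L_5(G) := cset_sub_lcn 3 Ga.
pose B := (D <*> H)%G; have sB5 : B \subset 'L_5(G) by rewrite join_subG sD5.
have nB : G \subset 'N(B).
  apply/subsetP=> g Gg; rewrite inE; apply/subsetP=> _ /imsetP[u Bu ->].
  by rewrite (conjg_fixP _) //; apply/eqP; apply: c5 => //; apply: (subsetP sB5).
have abq : abelian ('L_2(G / D)) by rewrite lcn_quo ?/normal ?nD ?(subset_trans sD5 (lcn_sub 5 G)) // sub_der1_abelian.
have bB b : b \in G -> b \in E2 -> [~ m, b] \in D.
  move=> Gb Eb; have Gl := mem_lcn Ll; have Gm := mem_lcn Lm.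
  have lb5 : [~ l, b] \in 'L_5(G).
    by have /cmodP[_] := subsetP sCC b (introT setIP (conj Eb Gb)); apply.
  apply/(coset1P nD (groupR Gm Gb)); rewrite (coset_comm nD Gm Gb) /m (coset_comm nD Gl Ga).
  rewrite (comm_sym_abelian abq) ?mem_quotient //; last first.
    by rewrite (lcn_quo 1) ?mem_quotient ?s32 // /normal nD (subset_trans sD5 (lcn_sub 5 G)).
  rewrite -(coset_comm nD Gl Gb) -(coset_comm nD (mem_lcn lb5) Ga) c5 //; exact: morph1.
have aB : a \in cmod [set m] B.
  apply: (cmod_in nB) => // _ /set1P->; apply: (subsetP (joing_subr _ _)); apply/csetP; by exists m.
have mG : G \subset cmod [set m] B.
  apply/subsetP=> g Gg; have [n Ln nn] := cmod_nP N4 Ga na2; have Gn := mem_lcn Ln.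
  have n3 : n \notin 'L_3(G) by apply: contra nn => h; apply: R4.
  have [i hi] := prime_index_cover p_pr (nL 2) i3 (R3 Ln Ga) nn (R3 Ln Gg).
  pose e := (a ^+ i)^-1 * g; have Gai := groupX i Ga; have Ge : e \in G by rewrite groupM ?groupV.
  have ne : [~ n, e] \in 'L_4(G).
    have Gna := groupR Gn Ga; apply/(coset1P N4 (groupR Gn Ge)).
    apply: (mulIg (coset 'L_4(G) [~ n, a ^+ i])); rewrite mul1g -(coset_RMr N4 Gn Gai Ge); last first.
      by apply: R4 => //; apply: R3.
    rewrite mulKVg (coset_RXr _ N4) //; last by apply: R4 => //; apply: R3.
    by rewrite -(cosetXG _ N4 Gna); apply: esym; apply/(coset_eqP N4 (groupX i Gna) (groupR Gn Gg)).
  have eE : e \in E2.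
    apply: (cmod_in N4) => // n' Ln'; have : 'L_2(G) \subset cmod [set e] 'L_4(G).
      apply: (prime_index_gen p_pr (nL 1) i2 Ln n3).
        apply/subsetP=> k Lk; apply: (cmod_in N4); first exact: mem_lcn Lk.
        by move=> _ /set1P->; apply: (mem_lcnRl (k := 2)).
      by apply: (cmod_in N4) => // _ /set1P->; rewrite -groupV invgR.
    by move/subsetP/(_ n' Ln')/cmodP=> [_ h]; rewrite -groupV invgR h ?inE.
  rewrite -(mulKVg (a ^+ i) g) groupM ?groupX //; apply: (cmod_in nB) => // _ /set1P->.
  by apply: (subsetP (joing_subl _ _)); apply: bB.
have s5B : 'L_5(G) \subset B.
  have sL : 'L_4(G) \subset cmod G B.
    apply: (prime_index_gen p_pr (nL 3) i4 Lm nl).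
      apply/subsetP=> w Lw; apply: (cmod_in nB); first exact: mem_lcn Lw.
      by move=> g Gg; rewrite -groupV invgR c5.
    apply: (cmod_in nB); first exact: mem_lcn Lm.
    by move=> g Gg; rewrite -groupV invgR; have /cmodP[_] := subsetP mG g Gg; apply; rewrite inE.
  rewrite [in X in X \subset _](lcnSn 3) gen_subG; apply/subsetP=> _ /imset2P[w g Lw Gg ->].
  by rewrite -groupV invgR; have /cmodP[_] := subsetP sL w Lw; apply.
have eB : B = D * H :> {set gT}.
  apply: norm_joinEr; apply: subset_trans nD; exact: subset_trans sH5 (lcn_sub 5 G).
move=> u /(subsetP s5B); rewrite eB => /mulsgP[d _ Dd /csetP[w Lw <-] ->].
by exists d, w.
Qed.

(** For abelian L_2, [last_gen] reduces to L_5 = [L_4, a], generated by a single [m, a] of order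
    dividing p, while |L_5| = p^2. *)
Lemma nonabelian_1112 : ~~ abelian 'L_2(G).
Proof.
apply/negP=> abL; have n35 : ~~ (G \subset cmod 'L_3(G) 'L_5(G)) by apply: (cmod_proper (k := 2)); apply: gt1.
have [a Ga na] := avoid1 n35; have [l Ll nl] := cmod_nP N5 Ga na; set m := [~ l, a] in nl.
have Lm : m \in 'L_4(G) := R4 Ll Ga; have Lma := R5 Lm Ga.
have mp : m ^+ p \in 'L_5(G).
  have Gm := mem_lcn Lm; apply/(coset1P N5 (groupX p Gm)); rewrite (cosetXG _ N5 Gm).
  have : coset 'L_5(G) m \in 'L_4(G) / 'L_5(G) by apply: mem_quotient.
  by move/expg_cardG; rewrite card_quotient ?(subset_trans (lcn_sub 4 G) N5) // i4.
have s5 : 'L_5(G) \subset <[ [~ m, a] ]>.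
  apply/subsetP=> u /(last_gen Ga na)[d [w [+ Lw ->]]]; rewrite (commG1P abL) => /set1P->; rewrite mul1g.
  have [i hi] := prime_index_cover p_pr (nL 3) i4 Lm nl Lw.
  have s42 := subsetP (lcn_sub_leq G (isT : 2 <= 4)); have nLa := subsetP (lcn_norm 2 G) a Ga.
  have L2m : m \in 'L_2(G) := s42 _ Lm.
  rewrite -(mulKVg (m ^+ i) w) (commM_abelian abL nLa (groupX i L2m)) ?(s42 _ (s54 hi)) //.
  by rewrite (c5 hi Ga) mulg1 (commX_abelian _ abL nLa L2m) mem_cycle.
have := subset_leq_card s5; rewrite o5 leqNgt => /negP[].
apply: (@leq_ltn_trans p); last by rewrite -{1}(expn1 p) ltn_exp2l ?prime_gt1.
rewrite -orderE dvdn_leq ?prime_gt0 // order_dvdn -commXg; last first.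
  by apply: commute_sym; apply: comm1; apply: c5 => //; apply: mem_lcn Lm.
by apply/eqP; apply: c5.
Qed.

Let D5 n m : n \in 'L_2(G) -> m \in 'L_2(G) -> [~ n, m] \in 'L_5(G).
Proof. by move=> Ln Lm; apply: (subsetP (lcn_der2 p_pr i2)); apply: mem_commg. Qed.

Let comm_group h A : h \in 'L_2(G) -> A \subset 'L_2(G) -> exists P : {group gT},
  [/\ P \subset 'L_5(G), {in A, forall k, [~ h, k] \in P} & {in P, forall d, exists2 k, k \in A & d = [~ h, k]}].
Proof.
move=> Lh sA; have gr : group_set (cset A h).
  apply: cset_group_set => n n' An An'; apply/conjg_fixP/eqP; apply: c5; last exact: mem_lcn (subsetP sA _ An').
  by apply: D5 => //; apply: (subsetP sA).
exists (Group gr); split.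
- by apply/subsetP=> _ /csetP[n An <-]; apply: D5 => //; apply: (subsetP sA).
- by move=> k Ak; rewrite -groupV invgR; apply/csetP; exists k.
move=> d Pd; have : d^-1 \in Group gr by rewrite groupV.
by case/csetP=> n An e; exists n => //; rewrite -invgR e invgK.
Qed.

(** L_2 is generated by h and L_3, and [L_3, L_3] = 1; hence the commutators [h, k] with k in L_3
    account for all of [L_2, L_2]. *)
Let der_in (P : {group gT}) : P \subset 'L_5(G) -> forall h, h \in 'L_2(G) -> h \notin 'L_3(G) ->
  {in 'L_3(G), forall k, [~ h, k] \in P} -> [~: 'L_2(G), 'L_2(G)] \subset P.
Proof.
move=> sP h Lh nh hP; have nP : G \subset 'N(P).
  apply/subsetP=> g Gg; rewrite inE; apply/subsetP=> _ /imsetP[u Pu ->].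
  by rewrite (conjg_fixP _) //; apply/eqP; apply: c5 => //; apply: (subsetP sP).
have hC : 'L_2(G) \subset cmod [set h] P.
  apply: (prime_index_gen p_pr (nL 1) i2 Lh nh).
    by apply/subsetP=> k Lk; apply: (cmod_in nP); [apply: mem_lcn Lk | move=> _ /set1P->; apply: hP].
  by apply: (cmod_in nP); [apply: mem_lcn Lh | move=> _ /set1P->; rewrite commgg].
have kC : 'L_2(G) \subset cmod 'L_3(G) P.
  apply: (prime_index_gen p_pr (nL 1) i2 Lh nh).
    apply/subsetP=> k Lk; apply: (cmod_in nP); first exact: mem_lcn Lk.
    by move=> k' Lk'; rewrite c33.
  apply: (cmod_in nP); first exact: mem_lcn Lh.
  by move=> k Lk; rewrite -groupV invgR hP.
have LL : 'L_2(G) \subset cmod 'L_2(G) P.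
  apply: (prime_index_gen p_pr (nL 1) i2 Lh nh).
    apply/subsetP=> k Lk; apply: (cmod_in nP); first exact: mem_lcn Lk.
    by move=> n Ln; rewrite -groupV invgR; have /cmodP[_] := subsetP kC n Ln; apply.
  apply: (cmod_in nP); first exact: mem_lcn Lh.
  by move=> n Ln; rewrite -groupV invgR; have /cmodP[_] := subsetP hC n Ln; apply; rewrite inE.
rewrite gen_subG; apply/subsetP=> _ /imset2P[n m Ln Lm ->].
by have /cmodP[_] := subsetP LL m Lm; apply.
Qed.

(** An element of L_3 is [h, a] u with u in L_5, and u = d [m, a] with d in [L_2, L_2]. The pair (h
    m, a k) absorbs u once d = [h, k] with k commuting with [h, a]; where k can be found depends on
    the depth of h. *)
Lemma commutators_1112 : commutators G = 'L_2(G).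
Proof.
apply: commutators_full => t Lt.
have [Lt3|nt3] := boolP (t \in 'L_3(G)); last first.
  by apply: (lcn23_commutators_2 p_pr pG i2 iG (k := 2) L6); apply/setDP.
have n35 : ~~ (G \subset cmod 'L_3(G) 'L_5(G)) by apply: (cmod_proper (k := 2)); apply: gt1.
have [a Ga na] := avoid1 n35; have na2 : a \notin E2 by apply: contra na => h; apply: (subsetP sCC); apply/setIP.
have [h Lh hh] : exists2 h, h \in 'L_2(G) & [~ h, a]^-1 * t \in 'L_5(G).
  have [n1 Ln1 h1] : exists2 n, n \in 'L_2(G) & [~ n, a]^-1 * t \in 'L_4(G).
    apply: (hit p_pr N4 (nL 2) i3 (lcn_sub 2 G) Ga _ _ _ Lt3).
    - by move=> n Ln; apply: R3.
    - by move=> n Ln; apply: R4; [apply: R3 | apply: mem_lcn Ln].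
    - exact: cmod_nP N4 Ga na2.
  have [n2 Ln2 h2] : exists2 n, n \in 'L_3(G) & [~ n, a]^-1 * ([~ n1, a]^-1 * t) \in 'L_5(G).
    apply: (hit p_pr N5 (nL 3) i4 (lcn_sub 3 G) Ga _ _ _ h1).
    - by move=> n Ln; apply: R4.
    - by move=> n Ln; apply: R5; [apply: R4 | apply: mem_lcn Ln].
    - exact: cmod_nP N5 Ga na.
  exists (n1 * n2); first by rewrite groupM // s32.
  rewrite commMgJ (_ : [~ n1, a] ^ n2 = [~ n1, a]); first by rewrite invMg -(mulgA [~ n2, a]^-1).
  by apply/conjg_fixP/eqP; apply: c33 => //; apply: R3.
(* For h in L_4 the element t itself is in L_5, and L_5 consists of the commutators [g, m] for any m
   of L_4 outside L_5. *)
have [Lh4|nh4] := boolP (h \in 'L_4(G)).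
  have Lt5 : t \in 'L_5(G) by rewrite -(groupMl _ (groupVr (R5 Lh4 Ga))).
  have [m Lm nm] : exists2 m, m \in 'L_4(G) & m \notin 'L_5(G) by apply/subsetPn; apply: gt1.
  have Gm := mem_lcn Lm; have gr : group_set (cset G m).
    apply: cset_group_set => n n' Gn Gn'; apply/conjg_fixP/eqP; apply: c5 => //.
    by rewrite -groupV invgR R5.
  pose H := Group gr; have sH : H \subset 'L_5(G).
    by apply/subsetP=> _ /csetP[n Gn <-]; rewrite -groupV invgR R5.
  have nH : G \subset 'N(H).
    apply/subsetP=> g Gg; rewrite inE; apply/subsetP=> _ /imsetP[u Hu ->].
    by rewrite (conjg_fixP _) //; apply/eqP; apply: c5 => //; apply: (subsetP sH).
  have sL : 'L_4(G) \subset cmod G H.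
    apply: (prime_index_gen p_pr (nL 3) i4 Lm nm).
      apply/subsetP=> w Lw; apply: (cmod_in nH); first exact: mem_lcn Lw.
      by move=> g Gg; rewrite -groupV invgR c5.
    by apply: (cmod_in nH) => // g Gg; apply/csetP; exists g.
  have s5H : 'L_5(G) \subset H.
    rewrite [in X in X \subset _](lcnSn 3) gen_subG; apply/subsetP=> _ /imset2P[w g Lw Gg ->].
    by rewrite -groupV invgR; have /cmodP[_] := subsetP sL w Lw; apply.
  by have /csetP[g Gg <-] := subsetP s5H t Lt5; apply: mem_commutators.
have [d [m [Dd Lm eu]]] := last_gen Ga na hh; set u := _ * _ in eu hh.
have et : t = [~ h, a] * u by rewrite mulKVg.
have Gh := mem_lcn Lh; have Gm := mem_lcn Lm; have Ghm := groupM Gh Gm.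
have Lha := R3 Lh Ga; have Lma := R5 Lm Ga.
have L5d : d \in 'L_5(G) by apply: (subsetP (lcn_der2 p_pr i2)).
have ehm : [~ h * m, a] = [~ h, a] * [~ m, a].
  by rewrite commMgJ (conjg_fixP _) //; apply/eqP; apply: c24 => //; apply: s32.
have fin k : k \in 'L_2(G) -> d = [~ h, k] -> [~ [~ h, a], k] = 1 -> t \in commutators G.
  move=> Lk ed ck; have Gk := mem_lcn Lk; apply/commutatorsP; exists (h * m), (a * k); split; rewrite ?groupM //.
  have e1 : [~ h, a] ^ k = [~ h, a] by apply/conjg_fixP/eqP.
  have e2 : [~ m, a] ^ k = [~ m, a] by apply/conjg_fixP/eqP; apply: c5.
  have e3 : d ^ m = d by apply/conjg_fixP/eqP; apply: c5.
  rewrite commgMJ ehm conjMg e1 e2 commMgJ (c42 Lm Lk) mulg1 -ed e3.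
  by rewrite et eu (mulgA d) (comm1 (c5 L5d (mem_lcn Lha))) -(mulgA [~ h, a] d).
(* For h in L_3, any k of L_2 commutes with [h, a], which is in L_4; the [h, k] exhaust [L_2, L_2]
   because h generates L_3 modulo L_4 and [L_2, L_4] = 1. For h outside L_3, [der_in] provides k in
   L_3. *)
have [Lh3|nh3] := boolP (h \in 'L_3(G)).
  have [P [sP inP valP]] := comm_group Lh (subxx 'L_2(G)).
  have [c Lc nc] : exists2 c, c \in 'L_2(G) & c \notin 'L_3(G) by apply/subsetPn; apply: gt1.
  have nP : G \subset 'N(P).
    apply/subsetP=> g Gg; rewrite inE; apply/subsetP=> _ /imsetP[w Pw ->].
    by rewrite (conjg_fixP _) //; apply/eqP; apply: c5 => //; apply: (subsetP sP).
  have c3P : 'L_3(G) \subset cmod [set c] P.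
    apply: (prime_index_gen p_pr (nL 2) i3 Lh3 nh4).
      apply/subsetP=> k Lk; apply: (cmod_in nP); first exact: mem_lcn Lk.
      by move=> _ /set1P->; rewrite c24.
    by apply: (cmod_in nP) => // _ /set1P->; rewrite -groupV invgR inP.
  have inc : {in 'L_3(G), forall k, [~ c, k] \in P}.
    by move=> k Lk; have /cmodP[_] := subsetP c3P k Lk; apply; rewrite inE.
  have [k Lk ed] := valP d (subsetP (der_in sP Lc nc inc) d Dd).
  by apply: (fin k Lk ed); apply: c42 => //; apply: R4.
have [P [sP inP valP]] := comm_group Lh (lcn_subS 2 G).
have [k Lk ed] := valP d (subsetP (der_in sP Lh nh3 inP) d Dd).
by apply: (fin k (s32 Lk) ed); apply: c33.
Qed.

End Type1112.

(** * Minimal number of generators and the Frattini quotient *)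

Section MinGen.
Variables (gT : finGroupType) (p : nat) (X : {group gT}).
Hypotheses (p_pr : prime p) (pX : p.-group X).

(** Burnside basis theorem: X/Phi(X) is elementary abelian of rank d, and representatives of
    generators of the quotient generate X. *)
Lemma mingen_Phi d : #|X : 'Phi(X)| = (p ^ d)%N -> mingen X d.
Proof.
move=> iX; have nPhi : X \subset 'N('Phi(X)) := gFnorm _ _.
have ab := Phi_quotient_abelem pX.
have oQ : #|X / 'Phi(X)| = (p ^ d)%N by rewrite card_quotient.
have mQ : 'm(X / 'Phi(X)) = d.
  rewrite grank_abelian ?(abelem_abelian ab) // (rank_abelem ab) oQ pfactorK //.
split.
  have [B genB cB] := grank_witness (X / 'Phi(X)).
  exists [seq repr b | b : coset_of 'Phi(X) <- enum B].
  rewrite size_map -cardE cB; split; first exact: mQ.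
  set S := [set x in _]; have SX : S \subset X.
    apply/subsetP=> x; rewrite inE => /mapP[b]; rewrite mem_enum => Bb ->.
    suff : repr b \in coset 'Phi(X) @*^-1 (X / 'Phi(X)) by rewrite quotientGK ?Phi_normal.
    apply/morphpreP; split; first exact: repr_coset_norm.
    by rewrite /= coset_reprK -genB mem_gen.
  apply: Phi_nongen; apply/eqP; rewrite eqEsubset join_subG Phi_sub SX /=.
  have sPS : 'Phi(X) \subset 'Phi(X) <*> S := joing_subl _ _.
  rewrite -(quotientSGK nPhi (G := ('Phi(X) <*> S)%G) sPS) -genB gen_subG; apply/subsetP=> b Bb.
  rewrite -[b]coset_reprK; apply: mem_quotient; apply: (subsetP (joing_subr _ _)).
  by rewrite inE; apply/mapP; exists b; rewrite ?mem_enum.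
move=> s es; set S := [set x in s] in es; have nS : S \subset 'N('Phi(X)).
  by apply: subset_trans nPhi; rewrite -es subset_gen.
have eQ : <<S / 'Phi(X)>> = X / 'Phi(X).
  transitivity (<<S>> / 'Phi(X)); [by rewrite /quotient morphim_gen | by rewrite es].
apply: (@leq_trans #|S / 'Phi(X)|); first by rewrite -mQ -eQ grank_min.
apply: leq_trans (leq_morphim _ _) _; rewrite cardsE; exact: card_size.
Qed.

Lemma mingen_uniq k l : mingen X k -> mingen X l -> k = l.
Proof.
case=> [[s [es gs]] mk] [[t [et gt]] ml]; apply/eqP; rewrite eqn_leq.
by rewrite -{1}et mk // -es ml.
Qed.

Lemma mingen_Phi_index d : mingen X d -> #|X : 'Phi(X)| = (p ^ d)%N.
Proof.
move=> md; have pI : p.-nat #|X : 'Phi(X)| by apply: pnat_dvd (dvdn_indexg _ _) pX.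
by have [k ek] := p_natP pI; rewrite (mingen_uniq md (mingen_Phi ek)) ek.
Qed.

End MinGen.

(** * Commutator length two *)

Section CommLen.
Variables (gT : finGroupType) (G : {group gT}).

Lemma commlen_full : commutators G = 'L_2(G) -> commlen_le G 2.
Proof.
move=> eK x; rewrite -[[~: G, G]]/('L_2(G)) -eK => Kx; exists [:: x]; split=> //; split.
  by move=> y; rewrite inE => /eqP->.
by rewrite big_seq1.
Qed.

(* K(G) and x K(G) are subsets of L_2(G) of more than half its size, so they meet *)
Lemma commlen_half (B : {set gT}) : 'L_2(G) \subset commutators G :|: B -> 2 * #|B| < #|'L_2(G)| ->
  commlen_le G 2.
Proof.
move=> sKB lB x; rewrite -[[~: G, G]]/('L_2(G)) => Lx; set K := commutators G in sKB.
have sK : K \subset 'L_2(G) := commutators_sub G.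
have lK : #|'L_2(G)| <= #|K| + #|B| := leq_trans (subset_leq_card sKB) (leq_card_setU _ _).
have : K :&: (x *: K) != set0.
  apply/negP=> /eqP e0; have sU : K :|: x *: K \subset 'L_2(G).
    rewrite subUset sK; apply/subsetP=> _ /lcosetP[y Ky ->]; rewrite groupM //; exact: (subsetP sK).
  have := subset_leq_card sU; rewrite cardsU e0 cards0 subn0 card_lcoset.
  by move: lB lK; clear; lia.
case/set0Pn=> a /setIP[Ka /lcosetP[y Ky ea]]; exists [:: a; y^-1]; split=> //; split.
  by move=> w; rewrite !inE => /orP[]/eqP-> //; apply: commutatorsV.
by rewrite big_cons big_seq1 ea mulgK.
Qed.

End CommLen.

(** * Location of the missed elements in class 3 *)

Section Noncommutators.
Variables (gT : finGroupType) (p : nat) (G : {group gT}).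
Hypotheses (p_pr : prime p) (pG : p.-group G) (oG2 : #|G : 'L_2(G)| = (p ^ 3)%N) (L4 : 'L_4(G) = 1).

Let central3 l : l \in 'L_3(G) -> l \in 'Z(G).
Proof.
move=> Ll; apply/setIP; split; first exact: mem_lcn Ll.
by apply/centP=> g Gg; apply: comm1; apply: (lcn_eq1 L4 (i := 2) (j := 0) isT Ll Gg).
Qed.

(** A pair representing a missed g modulo L_3 consists of two elements centralizing L_2, and then
    Jacobi makes [x, y] central. *)
Lemma noncommutator_31 g : #|'L_3(G)| = p -> #|'L_2(G) : 'L_3(G)| = (p ^ 3)%N ->
  g \in 'L_2(G) -> g \notin commutators G -> g \in 'Z(G).
Proof.
move=> o3 i2 Lg nK; have Gg := mem_lcn Lg.
have nL3 := lcn_normal 3 G; have K3 : commutators (G / 'L_3(G)) = 'L_2(G / 'L_3(G)).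
  apply: (commutators_p3 p_pr (quotient_pgroup _ pG)).
  by rewrite lcn_quo // card_quotient ?(subset_trans (lcn_sub 2 G) (lcn_norm 3 G)) // i2.
have : coset 'L_3(G) g \in commutators (G / 'L_3(G)) by rewrite K3 lcn_quo ?mem_quotient.
case/(commutators_quo nL3 Gg)=> x [y [Gx Gy e]].
have e' : [~ x, y]^-1 * g \in 'L_3(G) by rewrite -groupV invMg invgK.
have Cx : x \in 'C('L_2(G)).
  by apply: contraR nK => nC; apply: (lift_prime (k := 0) p_pr L4 o3 Gx Gy e'); left.
have Cy : y \in 'C('L_2(G)).
  by apply: contraR nK => nC; apply: (lift_prime (k := 0) p_pr L4 o3 Gx Gy e'); right.
rewrite -(mulKVg [~ x, y] g); apply: groupM; last exact: central3.
apply/setIP; split; first exact: groupR.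
apply/centP=> z Gz; apply: comm1; have := jacobi3 L4 Gx Gy Gz.
have -> : [~ z, x, y] = 1 by apply/eqP/commgP/commute_sym/(centP Cy)/mem_lcn2.
have -> : [~ y, z, x] = 1 by apply/eqP/commgP/commute_sym/(centP Cx)/mem_lcn2.
by rewrite !mulg1.
Qed.

Lemma noncommutator_22 g : #|'L_3(G)| = (p ^ 2)%N -> #|'L_2(G) : 'L_3(G)| = (p ^ 2)%N ->
  g \in 'L_2(G) -> g \notin commutators G -> g \in 'Z(G).
Proof.
move=> o3 i2 Lg nK; have ng : g \notin 'L_3(G).
  by apply: contra nK; apply: (lcn3_commutators p_pr pG oG2 L4 o3 i2).
have [x [y [z fr0]]] := coords2 p_pr pG oG2 i2.
have [x' [y' [fr hg]]] := frame22_change p_pr pG oG2 i2 fr0 Lg ng.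
rewrite -(mulKVg [~ x', z] g); apply: groupM; last exact: central3.
by apply: (pair22 p_pr L4 o3 fr hg); rewrite mulKVg.
Qed.

End Noncommutators.

(** * The orders of the lower central factors *)

Section Types.
Variables (gT : finGroupType) (p : nat) (G : {group gT}).
Hypotheses (p_pr : prime p) (pG : p.-group G).

(** A generating triple has three commutators, each of order dividing p modulo L_3 as soon as the
    factor is larger than p. *)
Lemma index23_le3 : #|G : 'L_2(G)| = (p ^ 3)%N -> #|'L_2(G) : 'L_3(G)| <= p ^ 3.
Proof.
move=> oG; have [lt|le] := ltnP p #|'L_2(G) : 'L_3(G)|; last first.
  by apply: leq_trans le _; rewrite -{1}(expn1 p) leq_exp2l ?prime_gt1.
have [w Gw nw] : exists2 w, w \in G & w \notin 'L_2(G).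
  by apply/subsetPn; rewrite -indexg_gt1 oG -(exp1n 3) ltn_exp2r ?prime_gt1.
have [r [s [Gr Gs defG]]] := complete_triple p_pr pG oG Gw nw.
pose B1 := ('L_3(G) <*> <[ [~ w, r] ]>)%G; pose B2 := (B1 <*> <[ [~ w, s] ]>)%G.
pose B3 := (B2 <*> <[ [~ r, s] ]>)%G.
have s1 : B1 \subset 'L_2(G) by rewrite join_subG (lcn_subS 2) cycle_subG; apply: mem_lcn2.
have s2 : B2 \subset 'L_2(G) by rewrite join_subG s1 cycle_subG; apply: mem_lcn2.
have s3 : B3 \subset 'L_2(G) by rewrite join_subG s2 cycle_subG; apply: mem_lcn2.
have t1 : 'L_3(G) \subset B1 := joing_subl _ _.
have t2 : B1 \subset B2 := joing_subl _ _.
have t3 : B2 \subset B3 := joing_subl _ _.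
have sL : 'L_2(G) \subset B3.
  apply: (der_triple Gw Gr Gs defG) => //; first exact: subset_trans (subset_trans t1 t2) t3.
  - by apply: (subsetP t3); apply: (subsetP t2); rewrite (subsetP (joing_subr _ _)) ?cycle_id.
  - by apply: (subsetP t3); rewrite (subsetP (joing_subr _ _)) ?cycle_id.
  - by rewrite (subsetP (joing_subr _ _)) ?cycle_id.
have j1 := join_commR_le p_pr pG oG w w lt Gw Gr (subxx 'L_3(G)) (lcn_subS 2 G).
have j2 := join_commR_le p_pr pG oG w w lt Gw Gs t1 s1.
have j3 := join_commR_le p_pr pG oG w w lt Gr Gs (subset_trans t1 t2) s2.
apply: (@leq_trans #|B3 : 'L_3(G)|); first by rewrite dvdn_leq ?indexg_gt0 // indexSg ?(lcn_subS 2).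
apply: leq_trans j3 _; rewrite expnS leq_mul2l; apply/orP; right.
apply: leq_trans j2 _; rewrite expnS leq_mul2l; apply/orP; right.
by move: j1; rewrite indexgg expn1 muln1.
Qed.

Lemma der_noncyclic : 'L_2(G) != 1 -> ~~ cyclic (G / 'L_2(G)).
Proof.
apply: contra => cQ; have cG := cyclic_nilpotent_quo_der1_cyclic (pgroup_nil pG) cQ.
by apply/eqP; apply: (derG1P (cyclic_abelian cG)).
Qed.

Lemma index12_ge : 'L_2(G) != 1 -> p ^ 2 <= #|G : 'L_2(G)|.
Proof.
move=> /der_noncyclic nc; rewrite leqNgt; apply: contra nc => lt.
have pI : p.-nat #|G : 'L_2(G)| by apply: pnat_dvd (dvdn_indexg _ _) pG.
have [k ek] := p_natP pI; have oQ : #|G / 'L_2(G)| = (p ^ k)%N by rewrite card_quotient ?lcn_norm.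
move: lt; rewrite ek ltn_exp2l ?prime_gt1 //; case: k {ek} oQ => [|[|//]] oQ _.
  by rewrite (card1_trivg oQ) cyclic1.
by apply: prime_cyclic; rewrite oQ expn1.
Qed.

(** G/L_2 has order p^2 and is not cyclic, so p-th powers lie in L_2; two generators a, b give a
    single generator [a, b] of L_2/L_3, and [a, b]^p = [a^p, b] = 1 modulo L_3. *)
Lemma index23_p : #|G : 'L_2(G)| = (p ^ 2)%N -> 'L_2(G) != 1 -> #|'L_2(G) : 'L_3(G)| = p.
Proof.
move=> oG n1; have nc := der_noncyclic n1; have N2 := lcn_norm 2 G.
have oQ : #|G / 'L_2(G)| = (p ^ 2)%N by rewrite card_quotient.
have pow x : x \in G -> x ^+ p \in 'L_2(G).
  move=> Gx; apply: contraT => nx; case/negP: nc.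
  have nx1 : coset 'L_2(G) x ^+ p != 1.
    by apply: contra nx => /eqP e; apply/(coset1P N2 (groupX p Gx)); rewrite (cosetXG _ N2 Gx).
  have Qx : coset 'L_2(G) x \in G / 'L_2(G) by apply: mem_quotient.
  suff -> : G / 'L_2(G) = <[coset 'L_2(G) x]> by apply: cycle_cyclic.
  apply/eqP; rewrite eq_sym eqEcard cycle_subG Qx oQ -orderE /=.
  have /(dvdn_pfactor _ _ p_pr)[k le ek] : #[coset 'L_2(G) x] %| p ^ 2 by rewrite -oQ order_dvdG.
  move: nx1; rewrite -order_dvdn ek; case: k le {ek} => [|[|[|//]]] _; rewrite ?expn0 ?expn1 ?dvd1n ?dvdnn //.
have n23 : ~~ ('L_2(G) \subset 'L_3(G)).
  by have := lcn_nilp (k := 1) (pgroup_nil pG) n1; rewrite properE => /andP[].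
have [a [b [Ga Gb nab]]] : exists a b, [/\ a \in G, b \in G & [~ a, b] \notin 'L_3(G)].
  have [nF] : ~~ (G \subset rad3 G).
    apply: contra n23 => sF; rewrite (lcnSn 1) gen_subG; apply/subsetP=> _ /imset2P[x y Gx Gy ->].
    by apply: rad3R => //; apply: (subsetP sF).
  have [b Gb nb] := avoid1 nF; have [a Ga nab] := nrad3P Gb nb; by exists a, b.
have na : a \notin 'L_2(G) by apply: contra nab => La; apply: (mem_lcnR (k := 1)).
have nb : b \notin 'L_2(G) <*> <[a]>.
  apply: contra (not_cycle_rad3 Ga Gb nab); apply: subsetP; apply: genS; apply: setSU; exact: lcn2_rad3.
have i1 : #|G : 'L_2(G) <*> <[a]>| <= p ^ 1 by apply: (index_step p_pr pG (lcn_sub 2 G) Ga na); rewrite oG.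
have sH1 : 'L_2(G) <*> <[a]> \subset G by rewrite join_subG lcn_sub cycle_subG.
have dG := index_le1 (index_step p_pr pG sH1 Gb nb i1).
pose B := ('L_3(G) <*> <[ [~ a, b] ]>)%G; have abB : [~ a, b] \in B by rewrite (subsetP (joing_subr _ _)) ?cycle_id.
have sB : B \subset 'L_2(G) by rewrite join_subG (lcn_subS 2) cycle_subG; apply: mem_lcn2.
have s3B : 'L_3(G) \subset B := joing_subl _ _.
have nB : G \subset 'N(B) by apply: (norm_between (k := 1)).
have sLB : 'L_2(G) \subset B.
  apply: (@der_gen _ G ([set a; b] :|: 'L_2(G)) B) => //.
  - by rewrite subUset (lcn_sub 2) andbT; apply/subsetP=> w /set2P[]->.
  - apply: subset_trans dG _; rewrite (join_subG ('L_2(G) <*> <[a]>)%G <[b]>) (join_subG 'L_2(G)%G <[a]>) !cycle_subG.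
    by rewrite sub_gen ?subsetUr // !mem_gen // !inE eqxx ?orbT.
  have L3 n g : n \in 'L_2(G) -> g \in G -> [~ n, g] \in B by move=> Ln Gg; apply: (subsetP s3B); apply: mem_lcnR.
  have L3' n g : n \in 'L_2(G) -> g \in G -> [~ g, n] \in B by move=> Ln Gg; apply: (subsetP s3B); apply: (mem_lcnRl (k := 1)).
  move=> s t /setUP[/set2P[]->|Ls] /setUP[/set2P[]->|Lt]; rewrite ?commgg ?group1 //; try exact: L3; try exact: L3'.
    by rewrite -groupV invgR.
  by apply: L3 => //; apply: mem_lcn Lt.
have abp : [~ a, b] ^+ p \in 'L_3(G).
  rewrite cos3_1 ?groupX ?groupR // cos3X ?groupR // -cos3Xl // -cos3_R ?groupX //.
  by apply: (mem_lcnR (k := 1)) => //; apply: pow.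
have le : #|'L_2(G) : 'L_3(G)| <= p.
  apply: leq_trans (index_cycle_le p_pr (subsetP (lcn_norm 3 G) _ (groupR Ga Gb)) abp).
  by rewrite dvdn_leq ?indexg_gt0 // indexSg ?(lcn_subS 2).
have pI : p.-nat #|'L_2(G) : 'L_3(G)| by apply: pnat_dvd (dvdn_indexg _ _) (pgroupS (lcn_sub 2 G) pG).
have [k ek] := p_natP pI; move: le n23; rewrite -indexg_eq1 ek -{2}(expn1 p) leq_exp2l ?prime_gt1 //.
by case: k {ek} => [|[|]].
Qed.

Lemma index_rad3_lcn2 : #|'L_2(G) : 'L_3(G)| = p -> #|G : 'L_2(G)| = (p ^ 3)%N -> #|rad3 G : 'L_2(G)| = p.
Proof.
move=> i2 oG; have iF := index_rad3 p_pr pG i2 (eq_leq oG).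
have pI : p.-nat #|G : rad3 G| by apply: pnat_dvd (dvdn_indexg _ _) pG.
have [k ek] := p_natP pI; have k2 : k = 2.
  apply/eqP; rewrite eqn_leq; apply/andP; split; first by rewrite -(leq_exp2l _ _ (prime_gt1 p_pr)) -ek.
  rewrite ltnNge; apply/negP=> le1.
  have i1 : #|G : rad3 G| <= p ^ 1 by rewrite ek leq_exp2l ?prime_gt1.
  have [X [Y [GX GY nXY]]] := exists_pair p_pr i2; have [nX _] := nrad3 GX GY nXY.
  have := index_le1 (index_step p_pr pG (rad3_sub G) GX nX i1).
  by move/subsetP/(_ Y GY); rewrite (negbTE (not_cycle_rad3 GX GY nXY)).
have := Lagrange_index (rad3_sub G) (lcn2_rad3 G); rewrite ek k2 oG => e.
by apply/eqP; rewrite -(eqn_pmul2l (_ : 0 < p ^ 2)) ?expn_gt0 ?prime_gt0 // e -expnSr.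
Qed.

Local Notation l k := (logn p #|'L_k(G)|).
(* a_i is the exponent of p in the order of L_i(G) *)
Definition lcn_type a2 a3 a4 a5 a6 := [/\ l 2 = a2, l 3 = a3, l 4 = a4, l 5 = a5 & l 6 = a6].

(** For |L_2| > p^3 the exponent of |L_2| is 4 or 5. The first factor is at most p^3, or equal to p
    in the second case; after a factor p the next is at most p^2, and after two factors p the third
    is at most p. With strict decrease the rest is arithmetic. *)
Lemma lcn_types : #|G| = (p ^ 7)%N ->
  [\/ #|'L_2(G)| <= p ^ 3, lcn_type 4 1 0 0 0, lcn_type 4 2 0 0 0 | [\/ lcn_type 4 2 1 0 0,
     lcn_type 4 3 1 0 0, lcn_type 4 3 2 1 0 | [\/ lcn_type 5 4 3 2 1 /\ l 7 = 0%N, lcn_type 5 4 3 2 0,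
     lcn_type 5 4 2 0 0 | lcn_type 5 4 2 1 0]]].
Proof.
move=> oG; have p1 := prime_gt1 p_pr.
have [le3|gt3] := leqP (l 2) 3; first by constructor 1; rewrite (lcn_card pG 2) leq_exp2l.
have n2 : 'L_2(G) != 1 by rewrite -(lcn_log_eq1 p_pr pG 2) -lt0n; apply: leq_trans gt3.
have iG : #|G : 'L_2(G)| = (p ^ (7 - l 2))%N.
  have := lcn_index pG 1; rewrite lcn1 oG pfactorK //.
have le5 : l 2 <= 5.
  have := index12_ge n2; rewrite iG leq_exp2l //; clear; lia.
have lt k : l k.+1 = 0%N \/ l k.+2 < l k.+1.
  have [e|ne] := eqVneq 'L_k.+1(G) 1; last by right; apply: lcn_log_lt.
  by left; apply/eqP; rewrite (lcn_log_eq1 p_pr pG) e.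
have le k : l k.+1 <= l k by apply: dvdn_leq_log; rewrite ?cardG_gt0 ?cardSg ?lcn_subS.
have idx k e : #|'L_k(G) : 'L_k.+1(G)| <= p ^ e -> l k - l k.+1 <= e.
  by rewrite (lcn_index pG) leq_exp2l.
have i23 : l 2 = 4 -> l 2 - l 3 <= 3.
  by move=> e4; apply: idx; apply: index23_le3; rewrite iG e4.
have i23' : l 2 = 5 -> l 2 - l 3 = 1%N.
  move=> e5; have h : #|G : 'L_2(G)| = (p ^ 2)%N by rewrite iG e5.
  by have := index23_p h n2; rewrite (lcn_index pG) -[RHS](expn1 p) => /eqP; rewrite eqn_exp2l // => /eqP.
have i34 : l 2 - l 3 = 1%N -> l 3 - l 4 <= 2.
  move=> e1; have i2 : #|'L_2(G) : 'L_3(G)| = p by rewrite (lcn_index pG) e1 expn1.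
  apply: idx; apply: (index34_le p_pr pG i2); apply: (index_rad3 p_pr pG i2).
  by rewrite iG leq_exp2l //; move: gt3; clear; lia.
have i45 : l 2 - l 3 = 1%N -> l 3 - l 4 = 1%N -> l 4 - l 5 <= 1.
  move=> e1 e2; have i2 : #|'L_2(G) : 'L_3(G)| = p by rewrite (lcn_index pG) e1 expn1.
  apply: idx; rewrite expn1; apply: (index45_le p_pr i2).
  by rewrite (lcn_index pG) e2 expn1.
have := (lt 1%N, lt 2, lt 3, lt 4, lt 5, lt 6); have := (le 2, le 3, le 4, le 5, le 6).
move: gt3 le5 i23 i23' i34 i45; rewrite /lcn_type; clear.
move: (l 2) (l 3) (l 4) (l 5) (l 6) (l 7) => b c d e f g.
move=> h1 h2 h3 h4 h5 h6 [[[[q1 q2] q3] q4] q5] [[[[[w1 w2] w3] w4] w5] w6].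
have [E|E] : b = 4 \/ b = 5 by lia.
  have [?|[?|?]] : c = 1%N \/ c = 2 \/ c = 3 by lia.
  - by constructor 2; split; lia.
  - have [?|?] : d = 0%N \/ d = 1%N by lia.
      by constructor 3; split; lia.
    by constructor 4; constructor 1; split; lia.
  have [?|?] : d = 1%N \/ d = 2 by lia.
    by constructor 4; constructor 2; split; lia.
  by constructor 4; constructor 3; split; lia.
have ? : c = 4 by lia.
have [?|?] : d = 3 \/ d = 2 by lia.
  have [?|?] : f = 1%N \/ f = 0%N by lia.
    by constructor 4; constructor 4; constructor 1; split; [split; lia|lia].
  by constructor 4; constructor 4; constructor 2; split; lia.
have [?|?] : e = 0%N \/ e = 1%N by lia.
  by constructor 4; constructor 4; constructor 3; split; lia.
by constructor 4; constructor 4; constructor 4; split; lia.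
Qed.

End Types.

(** * Order p^7: types read off from class, orders and ranks *)

Section FrattiniRank.
Variables (gT : finGroupType) (p : nat) (X : {group gT}).
Hypotheses (p_pr : prime p) (pX : p.-group X).

Lemma mingen_card_Phi a b : #|X| = (p ^ (a + b))%N -> #|'Phi(X)| = (p ^ b)%N -> mingen X a.
Proof.
move=> oX oP; apply: (mingen_Phi p_pr pX).
by rewrite -divgS ?Phi_sub // oX oP expnD mulnK // expn_gt0 prime_gt0.
Qed.

Lemma card_mingen a : mingen X a -> #|X| = (#|'Phi(X)| * p ^ a)%N.
Proof. by move=> /(mingen_Phi_index p_pr pX) <-; rewrite Lagrange ?Phi_sub. Qed.

Lemma card_Phi_mingen a b : mingen X a -> #|X| = (p ^ (a + b))%N -> #|'Phi(X)| = (p ^ b)%N.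
Proof.
move=> /card_mingen -> /eqP; rewrite addnC expnD eqn_pmul2r ?expn_gt0 ?prime_gt0 //.
by move/eqP.
Qed.

End FrattiniRank.

Section LcnTypes.
Variables (gT : finGroupType) (p : nat) (G : {group gT}).
Hypotheses (p_pr : prime p) (pG : p.-group G) (oG : #|G| = (p ^ 7)%N).
Local Notation l k := (logn p #|'L_k(G)|).
Local Notation T := (lcn_type p G).

Lemma lcn_type_card a2 a3 a4 a5 a6 : T a2 a3 a4 a5 a6 ->
  [/\ #|G : 'L_2(G)| = (p ^ (7 - a2))%N, #|'L_2(G) : 'L_3(G)| = (p ^ (a2 - a3))%N,
      #|'L_3(G) : 'L_4(G)| = (p ^ (a3 - a4))%N, #|'L_4(G) : 'L_5(G)| = (p ^ (a4 - a5))%N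
    & #|'L_5(G) : 'L_6(G)| = (p ^ (a5 - a6))%N] /\
  [/\ #|'L_2(G)| = (p ^ a2)%N, #|'L_3(G)| = (p ^ a3)%N, #|'L_4(G)| = (p ^ a4)%N,
      #|'L_5(G)| = (p ^ a5)%N & #|'L_6(G)| = (p ^ a6)%N].
Proof.
case=> <- <- <- <- <-; split; last by split; apply: lcn_card.
have i1 := lcn_index pG 1; rewrite lcn1 oG pfactorK // in i1.
by split=> //; apply: lcn_index.
Qed.

Lemma nil_class_log k : nil_class G = k.+1 -> l k.+2 = 0%N /\ 0 < l k.+1.
Proof.
move=> e; have nG := pgroup_nil pG; split.
  apply/eqP; rewrite (lcn_log_eq1 p_pr pG); apply/eqP/(lcn_nil_classP _ nG).
  by rewrite e.
rewrite lt0n (lcn_log_eq1 p_pr pG); apply/negP=> /eqP/(lcn_nil_classP _ nG).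
by rewrite e ltnn.
Qed.

Lemma log_nil_class k a : l k.+2 = 0%N -> l k.+1 = a.+1 -> nil_class G = k.+1.
Proof.
move=> z n; have nG := pgroup_nil pG; apply/eqP; rewrite eqn_leq; apply/andP; split.
  by apply/(lcn_nil_classP _ nG)/eqP; rewrite -(lcn_log_eq1 p_pr pG) z.
rewrite ltnNge; apply/negP=> /(lcn_nil_classP _ nG)/eqP.
by rewrite -(lcn_log_eq1 p_pr pG) n.
Qed.

Lemma lcn_logE k a : #|'L_k(G)| = (p ^ a)%N -> l k = a.
Proof. by move=> /= ->; rewrite pfactorK. Qed.

Lemma lcn_types_gt3 : 3 < l 2 ->
  [\/ T 4 1 0 0 0, T 4 2 0 0 0 | [\/ T 4 2 1 0 0,
     T 4 3 1 0 0, T 4 3 2 1 0 | [\/ T 5 4 3 2 1, T 5 4 3 2 0,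
     T 5 4 2 0 0 | T 5 4 2 1 0]]].
Proof.
move=> gt; case: (lcn_types p_pr pG oG) => [le|t|t|[t|t|t|[[t _]|t|t|t]]].
- by move: gt; rewrite ltnNge; case/negP; rewrite -(leq_exp2l _ _ (prime_gt1 p_pr)) -(lcn_card pG 2).
- by constructor 1.
- by constructor 2.
- by constructor 3; constructor 1.
- by constructor 3; constructor 2.
- by constructor 3; constructor 3.
- by constructor 3; constructor 4; constructor 1.
- by constructor 3; constructor 4; constructor 2.
- by constructor 3; constructor 4; constructor 3.
- by constructor 3; constructor 4; constructor 4.
Qed.

Lemma type_class3 : nil_class G = 3 -> #|'L_2(G)| = (p ^ 4)%N -> T 4 1 0 0 0 \/ T 4 2 0 0 0.
Proof.
move=> /nil_class_log[z n] /lcn_logE e.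
have gt : 3 < l 2 by rewrite /= e.
case: (lcn_types_gt3 gt) => [t|t|[t|t|t|[t|t|t|t]]]; [by left|by right|..];
  by case: t => e2 e3 e4 e5 e6; exfalso; move: e z n e2 e3 e4 e5 e6; clear; lia.
Qed.

Lemma type_class4 : nil_class G = 4 -> 3 < l 2 -> [\/ T 4 2 1 0 0, T 4 3 1 0 0 | T 5 4 2 0 0].
Proof.
move=> /nil_class_log[z n] gt.
case: (lcn_types_gt3 gt) => [t|t|[t|t|t|[t|t|t|t]]];
  [ | |by constructor 1|by constructor 2| | | |by constructor 3|];
  by case: t => e2 e3 e4 e5 e6; exfalso; move: z n e2 e3 e4 e5 e6; clear; lia.
Qed.

Lemma type_class5 : nil_class G = 5 -> [\/ T 4 3 2 1 0, T 5 4 3 2 0 | T 5 4 2 1 0].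
Proof.
move=> /nil_class_log[z n].
have n5 : 'L_5(G) != 1 by rewrite -(lcn_log_eq1 p_pr pG) -lt0n.
have nt k : k <= 5 -> 'L_k(G) != 1.
  move=> le; apply: contra n5 => /eqP e; rewrite -subG1 -e -(subnK le).
  by elim: (5 - k) => [|m IH]; [exact: subxx | apply: subset_trans (lcn_subS _ _) IH].
have gt : 3 < l 2.
  have x2 := lcn_log_lt p_pr pG (nt 2 isT); have x3 := lcn_log_lt p_pr pG (nt 3 isT).
  by have x4 := lcn_log_lt p_pr pG (nt 4 isT); move: n x2 x3 x4; clear; lia.
case: (lcn_types_gt3 gt) => [t|t|[t|t|t|[t|t|t|t]]];
  [ | | | |by constructor 1| |by constructor 2| |by constructor 3];
  by case: t => e2 e3 e4 e5 e6; exfalso; move: z n e2 e3 e4 e5 e6; clear; lia.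
Qed.

Section Class3.
Hypothesis t : T 4 1 0 0 0 \/ T 4 2 0 0 0.

Lemma class3_lcn : [/\ nil_class G = 3, abelian 'L_2(G) & #|'L_2(G)| = (p ^ 4)%N].
Proof.
case: t => h; have [_ [o2 _ o4 _ _]] := lcn_type_card h; have abL := abelian_lcn2 (card1_trivg o4);
  by case: h => _ e3 e4 _ _; rewrite (log_nil_class e4 e3).
Qed.

Lemma class3_full : commutators G <> 'L_2(G) <-> #|'Z(G)| = (p ^ 3)%N.
Proof.
case: t => h; have [[iG i2 _ _ _] [_ o3 o4 _ _]] := lcn_type_card h; have L4 := card1_trivg o4.
  split=> [/(commutators_31 p_pr pG iG L4 o3 i2)|/(obstruct31_center p_pr pG iG L4 o3 i2)] [x [y [z ob]]].
    exact: (card_center_31 p_pr pG iG L4 o3 i2 ob).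
  exact: (ob_not_full p_pr pG iG L4 o3 i2 ob).
split=> [/(commutators_22 p_pr pG iG L4 o3 i2)|/(obstruct22_center p_pr pG iG L4 o3 i2)] [x [y [z ob]]].
  exact: (card_center_22 p_pr pG iG L4 o3 i2 ob).
exact: (obs22_not_full p_pr pG iG L4 o3 i2 ob).
Qed.

Lemma class3_abelem : p = 3 -> commutators G <> 'L_2(G) -> p.-abelem 'L_2(G).
Proof.
move=> p3; case: t => h; have [[iG i2 _ _ _] [_ o3 o4 _ _]] := lcn_type_card h; have L4 := card1_trivg o4.
  by case/(commutators_31 p_pr pG iG L4 o3 i2)=> x [y [z ob]]; apply: (ob_abelem p_pr pG iG L4 o3 i2 ob).
by case/(commutators_22 p_pr pG iG L4 o3 i2)=> x [y [z ob]]; apply: (obs22_abelem p_pr pG iG L4 o3 i2 ob).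
Qed.

Lemma class3_Phi2 : p = 2 -> commutators G <> 'L_2(G) -> #|'Phi('L_2(G))| = 2.
Proof.
move=> p2; case: t => h; have [[iG i2 _ _ _] [_ o3 o4 _ _]] := lcn_type_card h; have L4 := card1_trivg o4.
  by case/(commutators_31 p_pr pG iG L4 o3 i2)=> x [y [z ob]]; apply: (ob_Phi2 p_pr pG iG L4 o3 i2 ob).
by case/(commutators_22 p_pr pG iG L4 o3 i2)=> x [y [z ob]]; apply: (obs22_Phi2 p_pr pG iG L4 o3 i2 ob).
Qed.

Lemma class3_noncommutator g : g \in 'L_2(G) -> g \notin commutators G -> g \in 'Z(G).
Proof.
case: t => h; have [[iG i2 _ _ _] [_ o3 o4 _ _]] := lcn_type_card h; have L4 := card1_trivg o4.
  by move=> Lg nK; have := noncommutator_31 p_pr pG L4 o3 i2 Lg nK.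
by move=> Lg nK; have := noncommutator_22 p_pr pG iG L4 o3 i2 Lg nK.
Qed.

End Class3.

Lemma lcn_1111 : T 4 3 2 1 0 ->
  'L_6(G) = 1 /\ forall k, k <= 3 -> #|'L_k.+2(G) : 'L_k.+3(G)| = p.
Proof.
move=> h; have [[_ i2 i3 i4 i5] [_ _ _ _ o6]] := lcn_type_card h.
by split=> [|[|[|[|[|//]]]] _]; first exact: card1_trivg o6.
Qed.

Lemma proper_cmod35P : proper_cmod35 G \/ ~ proper_cmod35 G.
Proof.
case: (boolP [exists b in G, (b \notin 'L_2(G)) && (b \in cmod 'L_3(G) 'L_5(G))]).
  by case/exists_inP=> b Gb /andP[nb c]; left; exists b.
by move=> /exists_inP h; right=> -[b Gb [nb c]]; apply: h; exists b; rewrite ?nb.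
Qed.

Lemma commlen_lcn3 : {subset 'L_2(G) :\: 'L_3(G) <= commutators G} ->
  2 * #|'L_3(G)| < #|'L_2(G)| -> commlen_le G 2.
Proof.
move=> sK; apply: commlen_half; apply/subsetP=> x Lx; rewrite inE.
by have [L3|L3] := boolP (x \in 'L_3(G)); rewrite ?orbT // sK // inE L3.
Qed.

End LcnTypes.

(** * Groups of order 2^7 and 3^7 *)

Lemma commutators_order2_7 (gT : finGroupType) (G : {group gT}) : #|G| = (2 ^ 7)%N ->
  (commutators G <> 'L_2(G) <->
   [/\ nil_class G = 3%N, abelian 'L_2(G), #|'L_2(G)| = (2 ^ 4)%N,
       mingen 'L_2(G) 3 & #|'Z(G)| = (2 ^ 3)%N]).
Proof.
move=> oG; have p2 : prime 2 by []; have pG : 2.-group G by rewrite /pgroup oG pnatX.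
have pL := pgroupS (lcn_sub 2 G) pG.
split=> [nf|[c3 _ o2 _ oZ]]; last by apply/(class3_full p2 pG oG (type_class3 p2 pG oG c3 o2)).
have class3 t := let: And3 c ab o2 := class3_lcn p2 pG oG t in
  And5 c ab o2 (mingen_card_Phi (a := 3) (b := 1) p2 pL o2 (class3_Phi2 p2 pG oG t erefl nf))
    (iffLR (class3_full p2 pG oG t) nf).
(* For |L_2| = 2^5 the abelianization has order 4, so [commutators_maxclass2] applies once L_3
   differs from L_4. *)
have max t2 t3 t4 t5 t6 : lcn_type 2 G t2 t3 t4 t5 t6 -> t2 = 5 -> t3 = 4 -> t4 < 4 -> False.
  move=> h e2 e3 lt; have [[iG i2 i3 _ _] _] := lcn_type_card p2 pG oG h; move: iG i2 i3; rewrite e2 e3 => iG i2 i3.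
  case: nf; apply: (commutators_maxclass2 pG i2 iG); rewrite -indexg_eq1 i3.
  by case: t4 lt {h i3} => [|[|[|[|]]]].
case: (lcn_types p2 pG oG) => [le|t|t|[t|t|t|[[t _]|t|t|t]]].
- by case: nf; apply: (commutators_p3 p2 pG).
- by apply: class3; left.
- by apply: class3; right.
- have [[iG i2 i3 _ _] [_ _ o4 o5 _]] := lcn_type_card p2 pG oG t.
  by case: nf; apply: (commutators_211 p2 pG iG (card1_trivg o5) o4 i3 i2).
- have [[iG i2 i3 _ _] [_ _ o4 o5 _]] := lcn_type_card p2 pG oG t.
  have L5 := card1_trivg o5; have iF := index_rad3 p2 pG i2 (eq_leq iG).
  (* For p = 2 the square relations contradict the obstruction, so this type never fails. *)
  have [sF [b /setIP[Gb Cb] nb]] := obs121_commutators p2 pG i2 i3 L5 iF o4 (index_rad3_lcn2 p2 pG i2 iG) nf.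
  by case: (no_obs121_2 p2 pG i2 i3 L5 iF sF erefl Gb Cb nb).
- by have [L6 iL] := lcn_1111 p2 pG oG t; case: nf; apply: (commutators_1111 p2 L6 iL).
- by case: (max _ _ _ _ _ t).
- by case: (max _ _ _ _ _ t).
- by case: (max _ _ _ _ _ t).
- by case: (max _ _ _ _ _ t).
Qed.

Section Order3_7.
Variables (gT : finGroupType) (G : {group gT}).
Hypothesis oG : #|G| = (3 ^ 7)%N.
Local Notation T := (lcn_type 3 G).
Let p3 : prime 3. Proof. by []. Qed.
Let pG : 3.-group G. Proof. by rewrite /pgroup oG pnatX. Qed.
Let pL : 3.-group 'L_2(G) := pgroupS (lcn_sub 2 G) pG.

Lemma type_43100 : T 4 3 1 0 0 -> [/\ nil_class G = 4%N, abelian 'L_2(G) & #|'L_2(G)| = (3 ^ 4)%N] /\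
  [/\ commutators G <> 'L_2(G) <-> #|'Z(G)| = (3 ^ 3)%N,
      commutators G <> 'L_2(G) -> mingen 'L_2(G) 3 & commlen_le G 2].
Proof.
move=> t; have [[iG i2 i3 _ _] [o2 o3 o4 o5 _]] := lcn_type_card p3 pG oG t.
have L5 := card1_trivg o5; have iF := index_rad3 p3 pG i2 (eq_leq iG).
have iFL := index_rad3_lcn2 p3 pG i2 iG.
have obs nf := obs121_commutators p3 pG i2 i3 L5 iF o4 iFL nf.
split; split.
- by case: t => _ _ e4 e5 _; apply: (log_nil_class p3 pG e5 e4).
- exact: (abelian_lcn2_12 p3 i2 L5).
- exact: o2.
- split=> [/obs|/(obs121_center p3 pG i2 i3 L5 iF o4 iFL)] h.
    exact: (card_center_121 p3 pG i2 i3 L5 iF o4 iFL h).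
  exact: (obs121_not_full p3 pG i2 i3 L5 iF o4 h).
- move=> /obs[sF [b /setIP[Gb Cb] nb]]; apply: (mingen_card_Phi (a := 3) (b := 1) p3 pL o2).
  by apply: (Phi121 p3 pG i2 i3 L5 iF sF erefl _ Gb Cb nb); rewrite trivg_card1 o4.
- by apply: (commlen_lcn3 (lcn23_commutators p3 pG i2 L5 iF)); rewrite o2 o3.
Qed.

Lemma type_54200 : T 5 4 2 0 0 -> [/\ nil_class G = 4%N, abelian 'L_2(G), exponent 'L_2(G) = (3 ^ 2)%N
  & mingen 'L_2(G) 4] /\ (commutators G <> 'L_2(G) /\ commlen_le G 2).
Proof.
move=> t; have [[iG i2 i3 _ _] [o2 o3 o4 o5 _]] := lcn_type_card p3 pG oG t.
have L5 := card1_trivg o5; have iF := index_rad3_2 p3 pG i2 iG.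
have sF : rad3 G \subset 'Z(G) * 'L_2(G) by rewrite (rad3_eq p3 pG i2 iG) mulG_subr.
split; split.
- by case: t => _ _ e4 e5 _; apply: (log_nil_class p3 pG e5 e4).
- exact: (abelian_lcn2_12 p3 i2 L5).
- exact: (exponent122 p3 pG i2 i3 L5 iF sF erefl o4).
- by apply: (mingen_card_Phi (a := 4) (b := 1) p3 pL o2); apply: (card_Phi122 p3 pG i2 i3 L5 iF sF erefl o4).
- have [b [Gb nb /subsetPn[s Ls ns]]] := exists_proper_value p3 pG i2 i3 L5 iF sF erefl o4.
  have /subsetPn[c Lc nc] := nlcn23 p3 i2.
  move=> full; have /negP[] := not_commutator_12 p3 pG i2 i3 L5 iF sF Gb nb Lc nc Ls ns.
  rewrite full; apply: groupM; first by apply: mem_lcn2 => //; apply: mem_lcn Lc.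
  by apply: (subsetP (subset_trans (lcn_subS 3 G) (lcn_subS 2 G))).
- by apply: (commlen_lcn3 (lcn23_commutators p3 pG i2 L5 iF)); rewrite o2 o3.
Qed.

Lemma type_54210 : T 5 4 2 1 0 ->
  [/\ nil_class G = 5%N, #|'L_2(G)| = (3 ^ 5)%N, #|'L_5(G)| = 3%N & #|'Z(G)| <= 3 ^ 2] /\
  [/\ commutators G <> 'L_2(G) <-> #|'Z_2(G)| = (3 ^ 3)%N,
      abelian 'L_2(G) -> commutators G <> 'L_2(G), commutators G <> 'L_2(G) -> mingen 'L_2(G) 3,
      abelian 'L_2(G) -> exponent 'L_2(G) = (3 ^ 2)%N & commlen_le G 2].
Proof.
move=> t; have [[iG i2 i3 i4 _] [o2 o3 o4 o5 o6]] := lcn_type_card p3 pG oG t.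
have L6 := card1_trivg o6.
have fullP : commutators G <> 'L_2(G) <-> proper_cmod35 G.
  split; last exact: (not_full_1211 p3 pG i2 iG i3 i4).
  by move=> nf; have [//|h] := proper_cmod35P G; case: nf; apply: (commutators_1211 p3 pG i2 iG i4 o5 L6).
have abP := abelian_1211 p3 iG i4 o5 L6.
split; split.
- by case: t => _ _ _ e5 e6; apply: (log_nil_class p3 pG e6 e5).
- exact: o2.
- exact: o5.
- exact: (center_1211 p3 pG i2 iG i3 i4 o5 L6).
- by rewrite fullP; apply: iff_sym; apply: (ucn2_1211 p3 pG i2 iG i3 i4 o5 L6).
- by move=> /abP/fullP.
- move=> /fullP h; apply: (mingen_card_Phi (a := 3) (b := 2) p3 pL o2).
  by rewrite (Phi_1211 p3 pG i2 iG i3 i4 erefl h) o4.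
- by move=> ab; apply: (exponent_1211 p3 pG i2 iG i3 i4 L6 erefl ab (abP ab)).
- by apply: (commlen_lcn3 (lcn23_commutators_2 p3 pG i2 iG (k := 2) L6)); rewrite o2 o3.
Qed.

Lemma full_cases : commutators G <> 'L_2(G) ->
  [\/ T 4 1 0 0 0 \/ T 4 2 0 0 0, T 4 3 1 0 0, T 5 4 2 0 0 | T 5 4 2 1 0].
Proof.
move=> nf; case: (lcn_types p3 pG oG) => [le|t|t|[t|t|t|[[t e7]|t|t|t]]].
- by case: nf; apply: (commutators_p3 p3 pG).
- by constructor 1; left.
- by constructor 1; right.
- have [[iG i2 i3 _ _] [_ _ o4 o5 _]] := lcn_type_card p3 pG oG t.
  by case: nf; apply: (commutators_211 p3 pG iG (card1_trivg o5) o4 i3 i2).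
- by constructor 2.
- by have [L6 iL] := lcn_1111 p3 pG oG t; case: nf; apply: (commutators_1111 p3 L6 iL).
- have [[_ i2 i3 i4 i5] [_ _ _ _ o6]] := lcn_type_card p3 pG oG t.
  have L7 : 'L_7(G) = 1 by apply/eqP; rewrite -(lcn_log_eq1 p3 pG) e7.
  have i6 : #|'L_6(G) : 'L_7(G)| = 3 by rewrite L7 indexg1 o6.
  by case: nf; apply: (commutators_11111 p3 pG isT L7) => -[|[|[|[|[|//]]]]] _.
- have [[iG i2 i3 i4 i5] [_ _ _ _ o6]] := lcn_type_card p3 pG oG t.
  by case: nf; apply: (commutators_1112 p3 pG i2 iG i3 i4 (card1_trivg o6)).
- by constructor 3.
- by constructor 4.
Qed.

Lemma commutators_order3_7 : commutators G <> 'L_2(G) <->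
  [\/ [/\ nil_class G = 5%N, ~~ abelian 'L_2(G), mingen 'L_2(G) 3,
          #|'L_5(G)| = 3%N & #|'Z_2(G)| = (3 ^ 3)%N],
      [/\ nil_class G = 5%N, abelian 'L_2(G),
          #|'L_2(G)| = (3 ^ 5)%N /\ exponent 'L_2(G) = (3 ^ 2)%N,
          mingen 'L_2(G) 3 & (#|'Z(G)| <= 3 ^ 2)%N],
      [/\ nil_class G = 4%N, abelian 'L_2(G), #|'L_2(G)| = (3 ^ 4)%N,
          mingen 'L_2(G) 3 & #|'Z(G)| = (3 ^ 3)%N] |
      [/\ nil_class G = 4%N, abelian 'L_2(G),
          exponent 'L_2(G) = (3 ^ 2)%N & mingen 'L_2(G) 4] \/
      [/\ nil_class G = 3%N, 3.-abelem 'L_2(G), mingen 'L_2(G) 4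
          & #|'Z(G)| = (3 ^ 3)%N]].
Proof.
split=> [nf|].
  case: (full_cases nf) => t.
  - have [c _ o2] := class3_lcn p3 pG oG t.
    have abe : 3.-abelem 'L_2(G) := class3_abelem p3 pG oG t erefl nf.
    constructor 4; right; split=> //; last exact/(class3_full p3 pG oG t).
    apply: (mingen_card_Phi (a := 4) (b := 0) p3 pL o2).
    by apply/eqP; rewrite -trivg_card1 (trivg_Phi pL).
  - have [[c ab o2] [oZ mg _]] := type_43100 t.
    by constructor 3; split=> //; [exact: mg | exact/oZ].
  - by have [[c ab ex mg] _] := type_54200 t; constructor 4; left.
  have [[c o2 o5 oZ] [zP _ mg ex _]] := type_54210 t.
  have [ab|nab] := boolP (abelian 'L_2(G)).
    by constructor 2; split=> //; [split=> //; exact: ex | exact: mg].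
  by constructor 1; split=> //; [exact: mg | exact/zP].
case=> [[c nab mg o5 z2]|[c ab [o2 _] _ _]|[c ab o2 _ oZ]|[[c ab ex mg]|[c abe mg oZ]]].
(* Class 5 leaves three types. The last one is intended; 4 3 2 1 0 is ruled out by [exclude_1111],
   with |Phi(L_2)| = 3 coming from d = 3, and 5 4 3 2 0 has |L_5| = 9. *)
- case: (type_class5 p3 pG oG c) => t; last by have [_ [zP _ _ _ _]] := type_54210 t; apply/zP.
    have [[iG _ _ _ _] [o2 _ _ _ _]] := lcn_type_card p3 pG oG t; have [L6 iL] := lcn_1111 p3 pG oG t.
    case: (exclude_1111 pG L6 iL iG nab _ z2).
    exact: (card_Phi_mingen (a := 3) (b := 1) p3 pL mg o2).
  by have [_ [_ _ _ o5' _]] := lcn_type_card p3 pG oG t; rewrite o5' in o5.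
(* The order 3^5 excludes 4 3 2 1 0, and commutativity excludes 5 4 3 2 0 by [nonabelian_1112]. *)
- case: (type_class5 p3 pG oG c) => t; last by have [_ [_ nf _ _ _]] := type_54210 t; apply: nf.
    by have [_ [o2' _ _ _ _]] := lcn_type_card p3 pG oG t; rewrite o2' in o2.
  have [[_ i2 i3 i4 _] [_ _ _ o5 o6]] := lcn_type_card p3 pG oG t.
  by have := nonabelian_1112 p3 i2 i3 i4 o5 (card1_trivg o6); rewrite ab.
- have gt : 3 < logn 3 #|'L_2(G)| by rewrite o2 pfactorK.
  case: (type_class4 p3 pG oG c gt) => t.
  + have [[iG i2 i3 _ _] [_ _ o4 _ _]] := lcn_type_card p3 pG oG t.
    by have := center_211 p3 pG iG o4 i3 i2; rewrite oZ eqxx.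
  + by have [_ [zP _ _]] := type_43100 t; apply/zP.
  by have [_ [o2' _ _ _ _]] := lcn_type_card p3 pG oG t; rewrite o2' in o2.
(* With d = 4 and order 3^4 the Frattini subgroup would be trivial, against exponent 9; so only the
   type with |L_2| = 3^5 remains. *)
- have oL := card_mingen p3 pL mg.
  have small : #|'L_2(G)| <> (3 ^ 4)%N.
    move=> o2; have oP := card_Phi_mingen (a := 4) (b := 0) p3 pL mg o2.
    have : 3.-abelem 'L_2(G) by rewrite -(trivg_Phi pL) trivg_card1 oP.
    by rewrite (abelemE _ p3) ex => /andP[].
  have gt : 3 < logn 3 #|'L_2(G)|.
    have oPhi := part_pnat_id (pgroupS (Phi_sub _) pL).
    rewrite oL lognM ?cardG_gt0 ?expn_gt0 // pfactorK //; exact: leq_addl.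
  case: (type_class4 p3 pG oG c gt) => t; last by have [_ []] := type_54200 t.
    by have [_ [o2 _ _ _ _]] := lcn_type_card p3 pG oG t.
  by have [_ [o2 _ _ _ _]] := lcn_type_card p3 pG oG t.
have o2 : #|'L_2(G)| = (3 ^ 4)%N.
  rewrite (card_mingen p3 pL mg); move: abe; rewrite -(trivg_Phi pL) trivg_card1 => /eqP ->.
  by rewrite mul1n.
by apply/(class3_full p3 pG oG (type_class3 p3 pG oG c o2)).
Qed.

Lemma commlen_order3_7 : commlen_le G 2.
Proof.
have [full|/eqP nf] := eqVneq (commutators G) 'L_2(G); first exact: commlen_full.
case: (full_cases nf) => t.
- have [_ _ o2] := class3_lcn p3 pG oG t.
  (* Missed elements are central, and the center has 27 elements against 81 in L_2. *)
  apply: (@commlen_half _ G 'Z(G)); last by rewrite (iffLR (class3_full p3 pG oG t) nf) o2.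
  apply/subsetP=> x Lx; rewrite inE; case: (boolP (x \in commutators G)) => //= nx.
  exact: (class3_noncommutator p3 pG oG t Lx nx).
- by have [_ []] := type_43100 t.
- by have [_ []] := type_54200 t.
by have [_ []] := type_54210 t.
Qed.

End Order3_7.

Theorem theoremB :
  (forall (gT : finGroupType) (G : {group gT}), #|G| = (2 ^ 7)%N ->
     (commutators G <> 'L_2(G) <->
      [/\ nil_class G = 3%N, abelian 'L_2(G), #|'L_2(G)| = (2 ^ 4)%N,
          mingen 'L_2(G) 3 & #|'Z(G)| = (2 ^ 3)%N]))
  /\
  (forall (gT : finGroupType) (G : {group gT}), #|G| = (3 ^ 7)%N ->
     (commutators G <> 'L_2(G) <->
      [\/ [/\ nil_class G = 5%N, ~~ abelian 'L_2(G), mingen 'L_2(G) 3,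
              #|'L_5(G)| = 3%N & #|'Z_2(G)| = (3 ^ 3)%N],
          [/\ nil_class G = 5%N, abelian 'L_2(G),
              #|'L_2(G)| = (3 ^ 5)%N /\ exponent 'L_2(G) = (3 ^ 2)%N,
              mingen 'L_2(G) 3 & (#|'Z(G)| <= 3 ^ 2)%N],
          [/\ nil_class G = 4%N, abelian 'L_2(G), #|'L_2(G)| = (3 ^ 4)%N,
              mingen 'L_2(G) 3 & #|'Z(G)| = (3 ^ 3)%N] |
          [/\ nil_class G = 4%N, abelian 'L_2(G),
              exponent 'L_2(G) = (3 ^ 2)%N & mingen 'L_2(G) 4] \/
          [/\ nil_class G = 3%N, 3.-abelem 'L_2(G), mingen 'L_2(G) 4
              & #|'Z(G)| = (3 ^ 3)%N]])
     /\ commlen_le G 2).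
Proof.
split=> gT G oG; first exact: commutators_order2_7.
by split; [exact: commutators_order3_7 | exact: commlen_order3_7].
Qed.
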